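(* Let $(X,\mathcal{A},\mu,T,\xi)$ be a mixing probability preserving Gibbs-Markov system, and let $f:X\to\mathbb{R}$ be an observable in the domain of attraction of some $\alpha$-stable random variable with $\alpha\in(0,2)$, i.e. there are a slowly varying function $\ell$ and constants $c_+,c_-\geq0$ with $c_++c_->0$ such that, as $t\to\infty$, $$\mu(f>t)=(c_++o(1))t^{-\alpha}\ell(t)\quad\text{and}\quad\mu(f\leq-t)=(c_-+o(1))t^{-\alpha}\ell(t).$$ Assume also that $\mu(\vartheta_f>t)=O(\mu(|f|>t))$ as $t\to\infty$. Then, for the canonical normalizing sequence $(A_n,B_n)$ for $[\alpha,c_+,c_-]$, the partial sum processes $\mathsf{S}^{[n]}=(\mathsf{S}^{[n]}_t)_{t\geq0}:X\to\mathcal{D}([0,\infty),\mathbb{R})$ given by $$\mathsf{S}_t^{[n]}:=\frac1{B_n}\left(\mathbf{S}_{\lfloor tn\rfloor}(f)-\frac{\lfloor tn\rfloor}{n}A_n\right)$$ converge to the real-valued $\alpha$-stable L\'evy process $\mathsf{S}=(\mathsf{S}_t)_{t\geq0}$ with $\mathsf{S}_1\overset{d}{=}S$, where $S$ is the canonical limit for $[\alpha,c_+,c_-]$: for every probability measure $\nu\ll\mu$ on $(X,\mathcal{A})$ the laws of $\mathsf{S}^{[n]}$ under $\nu$ converge weakly to the law of $\mathsf{S}$ in $(\mathcal{D}([0,\infty),\mathbb{R}),\mathcal{J}_1)$.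
   Context: **Gibbs-Markov systems.** A piecewise invertible probability preserving system $(X,\mathcal{A},\mu,T,\xi)$ consists of a measure preserving map $T$ on a probability space $(X,\mathcal{A},\mu)$ and a countable partition (mod $\mu$) $\xi\subseteq\mathcal{A}$ of $X$ with $\mathcal{A}=\sigma(T^{-k}\xi:k\geq0)$ (mod $\mu$) such that for each $Z\in\xi$ the restriction $T|_Z:Z\to TZ$ is measurably invertible with inverse $v_Z:TZ\to Z$. It is Markov if each $TZ$, $Z\in\xi$, is measurable with respect to $\xi$ (mod $\mu$), and has the big image property if $\inf_{Z\in\xi}\mu(TZ)>0$. Put $\xi_n:=\bigvee_{k=0}^{n-1}T^{-k}\xi$, and let $\xi_n(x)$ be the element of $\xi_n$ containing $x$. The separation time is $s(x,y):=\inf\{n\geq1:\xi_n(x)\neq\xi_n(y)\}$; fix $\theta\in(0,1)$ and put $d_\theta(x,y):=\theta^{s(x,y)}$. For a map $g$ into a metric space $(\mathfrak{F},d_{\mathfrak F})$ and $W\subseteq X$ let $D_W(g):=\inf\{L>0:d_{\mathfrak F}(g(x),g(y))\leq L\,d_\theta(x,y)\text{ for }x,y\in W\}$. With $v_Z':=d(\mu\circ v_Z)/d\mu$, a Markov system with the big image property is Gibbs-Markov if $\sup_{Z\in\xi}D_{TZ}(\log v_Z')<\infty$ (for suitable versions of $v_Z'$). Mixing means that $T$ is mixing with respect to $\mu$. **Observables.** An observable is a measurable function $f$ on $X$. $\mathbf{S}_n(f):=\sum_{k=0}^{n-1}f\circ T^k$, and $\vartheta_f:=\sum_{Z\in\xi}D_Z(f)1_Z:X\to[0,\infty]$.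 **Canonical limit for $[\alpha,c_+,c_-]$.** The real random variable $S$ with $$\mathbb{E}[e^{itS}]=\exp\bigl(-c_\alpha\underline{\beta}\,|t|^\alpha(1-i\beta\,\mathrm{sgn}(t)\,\omega(\alpha,t))\bigr),\quad t\in\mathbb{R},$$ where $c_\alpha:=\Gamma(1-\alpha)\cos(\alpha\pi/2)$ if $\alpha\neq1$ and $c_1:=\pi/2$; $\underline{\beta}:=c_++c_-$, $\beta:=(c_+-c_-)/(c_++c_-)$; $\omega(\alpha,t):=\tan(\alpha\pi/2)$ if $\alpha\neq1$ and $\omega(1,t):=-(2/\pi)\log|t|$. **Canonical normalizing sequence for $[\alpha,c_+,c_-]$** (depending on the law of $f$ and on $\ell$). $(B_n)$ in $(0,\infty)$ satisfies $B_n\to\infty$ and $n\ell(B_n)=B_n^\alpha$ for $n\geq1$. $A_n:=0$ if $\alpha<1$; $A_n:=n\int f\,d\mu$ if $\alpha>1$; if $\alpha=1$, $(A_n)$ is a real sequence, determined by the law of $f$ up to $o(B_n)$, for which iid random variables $Z_k$ distributed like $f$ satisfy $B_n^{-1}(\sum_{k=0}^{n-1}Z_k-A_n)\Rightarrow S$, where $S$ is exactly the canonical limit for $[1,c_+,c_-]$, that is, $\mathbb{E}[e^{itS}]=\exp\bigl(-\frac{\pi}{2}(c_++c_-)|t|\,(1+i\beta\,\frac{2}{\pi}\,\mathrm{sgn}(t)\log|t|)\bigr)$ with $\beta=(c_+-c_-)/(c_++c_-)$ (for example $A_n=nB_n\int\sin(f/B_n)\,d\mu$). **Skorohod space.** $\mathcal{D}([0,\infty),\mathbb{R})$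 is the space of right-continuous functions $[0,\infty)\to\mathbb{R}$ with left limits. For $s>0$, $d_{\mathcal{J}_1,s}(\mathsf{x},\mathsf{y}):=\inf_\lambda\{\sup_{[0,s]}|\mathsf{x}\circ\lambda-\mathsf{y}|\vee\sup_{[0,s]}|\lambda-\mathrm{id}|\}$, the infimum being over increasing homeomorphisms $\lambda$ of $[0,s]$; the $\mathcal{J}_1$-topology on $\mathcal{D}([0,\infty),\mathbb{R})$ is induced by $d_{\mathcal{J}_1,\infty}:=\int_0^\infty e^{-s}(1\wedge d_{\mathcal{J}_1,s})\,ds$. *)

(* Defs.v *)
From HB Require Import structures.
From mathcomp Require Import all_boot all_order all_algebra.
From mathcomp Require Import all_classical all_reals all_analysis.
From mathcomp Require Import complex.

Set Implicit Arguments.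
Unset Strict Implicit.
Unset Printing Implicit Defensive.

Import Order.TTheory GRing.Theory Num.Theory.
Import numFieldNormedType.Exports.

Local Open Scope classical_set_scope.
Local Open Scope ring_scope.

Section GibbsMarkov.
Context {d : measure_display} {X : measurableType d} {R : realType}.
Variables (mu : probability X R) (T : X -> X) (xi : set (set X)) (theta : R).

Definition measure_preserving : Prop :=
  measurable_fun [set: X] T /\
  forall A : set X, measurable A -> mu (T @^-1` A) = mu A.

Definition mixing : Prop :=
  forall A B : set X, measurable A -> measurable B ->
    mu (A `&` (iter n T @^-1` B)) @[n --> \oo] --> (mu A * mu B)%E.

Definition measurable_mod (G : set (set X)) (A : set X) : Prop :=
  exists B : set X, <<s G >> B /\ mu (A `+` B) = 0%E.

Definition countable_partition_mod : Prop :=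
  [/\ countable xi,
      forall Z, xi Z -> measurable Z,
      forall Z Z', xi Z -> xi Z' -> Z <> Z' -> mu (Z `&` Z') = 0%E &
      mu (~` \bigcup_(Z in xi) Z) = 0%E].

Definition piecewise_invertible : Prop :=
  [/\ measure_preserving,
      countable_partition_mod,
      forall A : set X, measurable A ->
        measurable_mod [set C | exists k Z, xi Z /\ C = iter k T @^-1` Z] A,
      forall Z, xi Z -> set_inj Z T &
      (* measurability of the image [T Z] and of the inverse branch
         [v_Z : T Z -> Z] *)
      forall Z A, xi Z -> measurable A -> A `<=` Z -> measurable (T @` A)].

Definition markov_partition : Prop :=
  forall Z, xi Z -> measurable_mod xi (T @` Z).

Definition big_image_property : Prop :=
  (0 < ereal_inf [set mu (T @` Z) | Z in xi])%E.

(* xi_n *)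
Definition join_partition (n : nat) : set (set X) :=
  [set C | exists Z : nat -> set X, (forall k, (k < n)%N -> xi (Z k)) /\
     C = \bigcap_(k < n) (iter k T @^-1` Z k)].

(* As xi is a partition mod mu only, the element xi_n(x) of xi_n containing x
   is meaningful for all n exactly when every T^k x lies in a unique element
   of xi; this excludes a mu-null set of points. *)
Definition regular_point (x : X) : Prop :=
  forall k, exists! Z, xi Z /\ Z (iter k T x).

(* xi_n(x); for regular x the union is over a single element *)
Definition cell (n : nat) (x : X) : set X :=
  \bigcup_(C in [set C | join_partition n C /\ C x]) C.

Definition separation_time (x y : X) : \bar R :=
  ereal_inf [set n%:R%:E | n in [set n | (1 <= n)%N /\ cell n x <> cell n y]].

(* theta ^ s(x, y), with theta ^ oo = 0 *)
Definition theta_dist (x y : X) : R :=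
  if separation_time x y is r%:E then theta `^ r else 0.

(* D_W(g), the points of W being understood mod mu as above; +oo if there is
   no admissible L *)
Definition lipschitz_const (W : set X) (g : X -> R) : \bar R :=
  ereal_inf [set L%:E | L in [set L | 0 < L /\
    forall x y, W x -> W y -> regular_point x -> regular_point y ->
      `|g x - g y| <= L * theta_dist x y]].

(* [v Z] is a positive version of v_Z' = d(mu o v_Z) / d mu on T Z; note that
   v_Z(A) = Z `&` T @^-1` A for A included in T Z. Positivity is needed for
   [ln] to be the logarithm. *)
Definition branch_density (v : set X -> X -> R) : Prop :=
  forall Z, xi Z ->
    [/\ measurable_fun (T @` Z) (v Z),
        forall x, (T @` Z) x -> 0 < v Z x &
        forall A, measurable A -> A `<=` T @` Z ->
          mu (Z `&` (T @^-1` A)) = (\int[mu]_(x in A) (v Z x)%:E)%E].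

Definition gibbs_markov : Prop :=
  [/\ piecewise_invertible, markov_partition, big_image_property &
      exists v, branch_density v /\
        (ereal_sup [set lipschitz_const (T @` Z) (fun x => ln (v Z x)) | Z in xi]
           < +oo)%E].

Definition vartheta (f : X -> R) (x : X) : \bar R :=
  (\esum_(Z in xi) (lipschitz_const Z f * (\1_Z x)%:E))%E.

Definition ergodic_sum (f : X -> R) (n : nat) (x : X) : R :=
  \sum_(k < n) f (iter k T x).

End GibbsMarkov.

Section Stable.
Context {R : realType}.

(* positivity and measurability are required on a neighbourhood of +oo only *)
Definition slowly_varying (ell : R -> R) : Prop :=
  (exists a : R, measurable_fun `[a, +oo[ ell /\
     forall t, a <= t -> 0 < ell t) /\
  forall lambda : R, 0 < lambda ->
    ell (lambda * t) / ell t @[t --> +oo] --> (1 : R).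

Definition stable_tails {d : measure_display} {X : measurableType d}
    (mu : probability X R) (f : X -> R) (alpha cp cm : R) (ell : R -> R) :=
  exists ep em : R -> R,
    [/\ ep t @[t --> +oo] --> (0 : R),
        em t @[t --> +oo] --> (0 : R),
        \forall t \near +oo, mu [set x | t < f x] =
          ((cp + ep t) * t `^ (- alpha) * ell t)%:E &
        \forall t \near +oo, mu [set x | f x <= - t] =
          ((cm + em t) * t `^ (- alpha) * ell t)%:E].

(* Euler's integral on ]0, +oo[, extended by Gamma(x) = Gamma(x + 1) / x *)
Definition Gamma_pos (x : R) : R :=
  \int[@lebesgue_measure R]_(t in `]0, +oo[) (t `^ (x - 1) * expR (- t)).

Definition Gamma_fun (x : R) : R :=
  let m := if 0 < x then 0%N else (Num.truncn (- x)).+1 in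
  Gamma_pos (x + m%:R) / \prod_(i < m) (x + i%:R).

Definition cexp (z : R[i]) : R[i] :=
  ((expR (complex.Re z))%:C * (cos (complex.Im z) +i* sin (complex.Im z)))%C.

Definition charfun (S : probability (measurableTypeR R) R) (t : R) : R[i] :=
  ((\int[S]_x cos (t * x)) +i* (\int[S]_x sin (t * x)))%C.

Definition c_stable (alpha : R) : R :=
  if alpha == 1 then pi / 2 else Gamma_fun (1 - alpha) * cos (alpha * pi / 2).

Definition omega_stable (alpha t : R) : R :=
  if alpha == 1 then - (2 / pi) * ln `|t| else tan (alpha * pi / 2).

Definition canonical_limit (alpha cp cm : R)
    (S : probability (measurableTypeR R) R) : Prop :=
  let betabar := cp + cm in
  let beta := (cp - cm) / (cp + cm) in
  forall t : R, charfun S t =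
    cexp (- (c_stable alpha * betabar * `|t| `^ alpha)%:C *
          (1 - (0 +i* 1) * (beta * Num.sg t * omega_stable alpha t)%:C))%C.

End Stable.

Section Laws.
Context {R : realType}.

(* Weak convergence of the laws of [Y n] under [P] to the law of [Y'] under
   [P'], the integrals of test functions being taken on [W] and [W']. *)
Definition cvg_in_law {E : topologicalType}
    {d : measure_display} {W : measurableType d} (P : probability W R)
    (Y : nat -> W -> E)
    {d' : measure_display} {W' : measurableType d'} (P' : probability W' R)
    (Y' : W' -> E) : Prop :=
  forall h : E -> R, continuous h -> bounded_fun h ->
    'E_P[h \o Y n]%E @[n --> \oo] --> 'E_P'[h \o Y']%E.

(* mutual independence of Y 0, ..., Y n.-1 (sub-families are obtained by taking
   [V i = setT]) *)
Definition independent {d : measure_display} {W : measurableType d}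
    (P : probability W R) (n : nat) (Y : nat -> W -> R) : Prop :=
  forall V : nat -> set (measurableTypeR R), (forall i, measurable (V i)) ->
    P (\bigcap_(i < n) (Y i @^-1` V i)) = (\prod_(i < n) P (Y i @^-1` V i))%E.

Definition same_law {d : measure_display} {W : measurableType d}
    (P : probability W R) (Y : W -> R)
    {d' : measure_display} {W' : measurableType d'} (P' : probability W' R)
    (Y' : W' -> R) : Prop :=
  forall V : set (measurableTypeR R), measurable V ->
    P (Y @^-1` V) = P' (Y' @^-1` V).

(* [S] is meant to be the law of the canonical limit. For alpha = 1 the condition
   on [A] does not depend on the choice of the i.i.d. sequence. *)
Definition canonical_normalizing {d : measure_display} {X : measurableType d}
    (mu : probability X R) (f : X -> R) (alpha : R) (ell : R -> R)
    (S : probability (measurableTypeR R) R) (A B : nat -> R) : Prop :=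
  [/\ forall n, (1 <= n)%N -> 0 < B n,
      B n @[n --> \oo] --> +oo,
      forall n, (1 <= n)%N -> n%:R * ell (B n) = B n `^ alpha &
      [/\ alpha < 1 -> forall n, A n = 0,
          1 < alpha -> forall n, A n = n%:R * \int[mu]_x f x &
          alpha = 1 ->
            exists (d' : measure_display) (W : measurableType d')
              (P : probability W R) (Y : nat -> W -> R),
              [/\ forall k, measurable_fun [set: W] (Y k),
                  forall n, independent P n Y,
                  forall k, same_law P (Y k) mu f &
                  cvg_in_law P
                    (fun n w => (B n)^-1 * (\sum_(k < n) Y k w - A n) : R)
                    S (fun x => x : R)]]].

End Laws.

(* Elements are represented by their extension to the real line that is constant
   on ]-oo, 0], so that they are determined by their restriction to [0, oo). *)
Record skorohod (R : realType) := Skorohod {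
  cadlag_fun :> R -> R ;
  cadlag_right_cont : forall t : R, 0 <= t ->
    cadlag_fun s @[s --> t^'+] --> cadlag_fun t ;
  cadlag_left_lim : forall t : R, 0 < t -> cvg (cadlag_fun s @[s --> t^'-]) ;
  cadlag_neg : forall t : R, t < 0 -> cadlag_fun t = cadlag_fun 0 }.

Section Skorohod.
Context {R : realType}.
Implicit Types x y : skorohod R.

(* a continuous increasing bijection of a compact interval is a homeomorphism *)
Definition increasing_homeo (s : R) (lambda : R -> R) : Prop :=
  [/\ set_bij `[0, s] `[0, s] lambda,
      {in `[0, s] &, {homo lambda : a b / a < b}} &
      {within `[0, s], continuous lambda}].

Definition dist_on (s : R) (g h : R -> R) : \bar R :=
  ereal_sup [set `|g t - h t|%:E | t in `[0, s]].

Definition J1_dist_on (s : R) x y : \bar R :=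
  ereal_inf [set maxe (dist_on s (x \o lambda) y) (dist_on s lambda id)
            | lambda in increasing_homeo s].

Definition J1_dist x y : \bar R :=
  (\int[@lebesgue_measure R]_(s in `]0%R, +oo[)
     ((expR (- s))%:E * mine 1 (J1_dist_on s x y)))%E.

Definition J1_open (U : set (skorohod R)) : Prop :=
  forall x, U x -> exists e : R, 0 < e /\
    forall y, (J1_dist x y < e%:E)%E -> U y.

Lemma J1_openT : J1_open setT.
Proof. by move=> x _; exists 1; split. Qed.

Lemma J1_openI : setI_closed J1_open.
Proof.
move=> U V oU oV x [/oU[e [e0 eU]] /oV[e' [e'0 e'V]]].
exists (Num.min e e'); split; first by rewrite lt_min e0.
move=> y xy; split.
  by apply: eU; apply: (lt_le_trans xy); rewrite lee_fin ge_min lexx.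
by apply: e'V; apply: (lt_le_trans xy); rewrite lee_fin ge_min lexx orbT.
Qed.

Lemma J1_open_bigU (I : Type) (U : I -> set (skorohod R)) :
  (forall i, J1_open (U i)) -> J1_open (\bigcup_i U i).
Proof.
move=> oU x [i _ /oU[e [e0 eU]]]; exists e; split=> // y /eU Uy.
by exists i.
Qed.

HB.instance Definition _ := gen_eqMixin (skorohod R).
HB.instance Definition _ := gen_choiceMixin (skorohod R).
HB.instance Definition _ := isOpenTopological.Build (skorohod R)
  J1_openT J1_openI J1_open_bigU.

(* On t < 0, [Num.truncn] vanishes, in accordance with [cadlag_neg]. *)
Definition step_fun (a : nat -> R) (n : nat) (t : R) : R :=
  a (Num.truncn (t * n%:R)).

Lemma step_fun_right_cont a n t : 0 <= t ->
  step_fun a n s @[s --> t^'+] --> step_fun a n t.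
Proof.
move=> t0; have [->|n0] := eqVneq n 0%N.
  by rewrite /step_fun mulr0; apply: cvg_near_cst; near=> s; rewrite mulr0.
have n_gt0 : 0 < n%:R :> R by rewrite ltr0n lt0n.
have /truncn_itv/andP[mt tm] : 0 <= t * n%:R by rewrite mulr_ge0.
apply: cvg_near_cst; near=> s; rewrite /step_fun; congr a.
apply: truncn_def; apply/andP; split.
  by rewrite (le_trans mt)// ler_pM2r//; near: s; exact: nbhs_right_ge.
rewrite -ltr_pdivlMr//; near: s; apply: nbhs_right_lt.
by rewrite ltr_pdivlMr.
Unshelve. all: by end_near. Qed.

Lemma step_fun_left_lim a n t : 0 < t -> cvg (step_fun a n s @[s --> t^'-]).
Proof.
move=> t0; have [->|n0] := eqVneq n 0%N.
  apply/cvg_ex; exists (a 0%N); apply: cvg_near_cst; near=> s.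
  by rewrite /step_fun mulr0 truncn0.
have n_gt0 : 0 < n%:R :> R by rewrite ltr0n lt0n.
have tn0 : 0 < t * n%:R by rewrite mulr_gt0.
have [m [mt tm]] : exists m : nat, m%:R < t * n%:R /\ t * n%:R <= m.+1%:R.
  have /truncn_itv/andP[qt tq] := ltW tn0.
  have [eqt|neqt] := eqVneq (Num.truncn (t * n%:R))%:R (t * n%:R).
    move: eqt; case: (Num.truncn _) => [|q] eqt.
      by move: tn0; rewrite -eqt ltxx.
    by exists q; rewrite -eqt ltr_nat.
  by exists (Num.truncn (t * n%:R)); rewrite lt_neqAle neqt qt (ltW tq).
apply/cvg_ex; exists (a m); apply: cvg_near_cst; near=> s.
rewrite /step_fun; congr a; apply: truncn_def; apply/andP; split.
  rewrite -ler_pdivrMr//; near: s; apply: nbhs_left_ge.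
  by rewrite ltr_pdivrMr.
by rewrite (lt_le_trans _ tm)// ltr_pM2r//; near: s; exact: nbhs_left_lt.
Unshelve. all: by end_near. Qed.

Lemma step_fun_neg a n t : t < 0 -> step_fun a n t = step_fun a n 0.
Proof.
move=> t0; rewrite /step_fun mul0r truncn0; congr a.
apply/eqP; rewrite -leqn0 leqNgt truncn_gt0 -ltNge.
by rewrite (le_lt_trans _ ltr01)// mulr_le0_ge0// ltW.
Qed.

Definition step_path (a : nat -> R) (n : nat) : skorohod R :=
  Skorohod (@step_fun_right_cont a n) (@step_fun_left_lim a n) (@step_fun_neg a n).

Definition partial_sum_process {d : measure_display} {X : measurableType d}
    (T : X -> X) (f : X -> R) (A B : nat -> R) (n : nat) (x : X) : skorohod R :=
  step_path (fun m => (B n)^-1 * (ergodic_sum T f m x - m%:R / n%:R * A n)) n.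

Definition levy_process {d : measure_display} {W : measurableType d}
    (P : probability W R) (L : W -> skorohod R) : Prop :=
  [/\ forall t, 0 <= t -> measurable_fun [set: W] (fun w => L w t : R),
      {ae P, forall w, L w 0 = 0},
      forall (n : nat) (t : nat -> R), 0 <= t 0%N ->
        (forall i, (i < n)%N -> t i < t i.+1) ->
        independent P n (fun i w => L w (t i.+1) - L w (t i)) &
      forall s t : R, 0 <= s -> s <= t ->
        same_law P (fun w => L w t - L w s) P (fun w => L w (t - s))].

End Skorohod.

(* Main.v *)
Require Import Defs.
From HB Require Import structures.
From mathcomp Require Import all_boot all_order all_algebra.
From mathcomp Require Import all_classical all_reals all_analysis.
From mathcomp Require Import complex measurable_realfun ess_sup_inf.
From mathcomp Require Import ring lra zify.

Set Implicit Arguments.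
Unset Strict Implicit.
Unset Printing Implicit Defensive.

Import Order.TTheory GRing.Theory Num.Theory.
Import numFieldNormedType.Exports.

Local Open Scope classical_set_scope.
Local Open Scope ring_scope.

(** The cells of [xi] turn orbits into sequences of letters. Bounded distortion, big images and
    mixing make this process exponentially psi-mixing. The image under [T^k] of [mu] restricted to a
    cylinder of length k has a log-density that is Lipschitz with a uniform constant. After a fixed
    number of steps every such measure dominates a multiple of [mu], so the push-forward by [T]
    contracts the class towards [mu] ([minorization], [contraction], [cyl_mixing]). All correlation
    bounds are relative to L1 norms.

    Weighted orbit sums, with weights a_j of size at most U / B_n, have characteristic functions
    close to the product of those of the single terms a_j f ([char_product]). Here exp(i a_j f) - 1
    has L1 norm of order B_n^(-kap) with 2 kap > alpha, so a gap of logarithmic length between past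
    and present can be left out: the total error is of order n log n B_n^(-2 kap), which tends to 0
    ([gap_length], [char_near]). The tail condition on [vartheta] gives the Lipschitz constants of
    [f] the same truncated moments as [f], and so controls the replacement of [f] by functions of
    finitely many letters.

    Let phi_n be the characteristic function of f / B_n. The exponent rho_n(u) = n (phi_n(u) - 1) -
    i u A_n / B_n converges to the exponent psi of the canonical limit ([limit_data]). For alpha
    different from 1 this is a computation with Euler integrals, as n mu(f > t B_n) tends to c_+
    t^(-alpha) with Potter bounds as domination ([limit_data_ne1]). For alpha = 1 it is recovered
    from the iid convergence that defines [A] ([limit_data_iid]). Hence the increments over windows
    of length 1/q are asymptotically independent with exponent psi / q ([inc_cos]), which is the
    exponent of the Levy increments ([levy_inc_charfun]). Functions of these increments are
    asymptotically invariant under [T], and mixing carries their limits from [mu] to every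
    absolutely continuous [nu] ([strong_cvg]).

    For the paths, mixing at the first large value of the sum gives an inequality of Ottaviani type
    ([exceed_bound]). A second large value in a window of L steps then has probability of order
    (L/n)^2 ([split_bound]). Over the order of q windows up to a fixed time this adds up to order
    1/q, so with high probability each window contains at most one macroscopic jump ([path_splits]),
    and the path is J1-close to its discretisation ([window_close]).

    A bounded J1-continuous functional is a limit from below of functionals that are Lipschitz for
    closeness of paths ([low_cvg]). On discretised paths these are Lipschitz functions of finitely
    many increments, and their expectations converge by convergence of cosines, tightness and
    Bernstein smoothing ([lip_converges]). This bounds the lower limit of the expectations of h from
    below by the expectation at the Levy process; applied to h and to -h it gives weak
    convergence. *)

(* [side] discharges sign conditions, measurability, boundedness and elementary limits by following the syntax of the goal *)
Local Notation mfun X := (measurable_fun [set: X]).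

Ltac mset := fail.
Ltac extra := fail.
Ltac sgn := first [assumption | apply: ltW; assumption | lazymatch goal with
 | |- is_true (0 <= _ * _) => apply: mulr_ge0; sgn
 | |- is_true (0 < _ * _) => apply: mulr_gt0; sgn
 | |- is_true (0 <= _ + _) => apply: addr_ge0; sgn
 | |- is_true (0 < _ + _) => first [apply: ltr_wpDl; sgn | apply: ltr_wpDr; sgn]
 | |- is_true (0 <= _^-1) => rewrite invr_ge0; sgn
 | |- is_true (0 < _^-1) => rewrite invr_gt0; sgn
 | |- is_true (0 <= _ ^+ _) => apply: exprn_ge0; sgn
 | |- is_true (0 < _ ^+ _) => apply: exprn_gt0; sgn
 | |- is_true (0 < _ `^ _) => apply: powR_gt0; sgn
 | |- is_true (0 <= bigop _ _ _) => apply: sumr_ge0 => *; sgn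
 | |- is_true (_ != 0) => apply: lt0r_neq0; sgn
 | |- is_true (_ \in _) => first [rewrite posrE | rewrite nnegrE]; sgn
 | |- _ => first [apply: expR_gt0 | apply: pi_gt0 | apply: powR_ge0 | apply: sqr_ge0 | reflexivity | apply: normr_ge0 | apply: ler0n | apply: ler01 | apply: ltr01 | apply: ltr0Sn | rewrite ltr0n; assumption | apply: expR_ge0]
 end].
Ltac cvgt := first [assumption | lazymatch goal with
 | |- cvg_to _ (nbhs (_ * _)) => first [apply: cvgM; cvgt | apply: cvg_cst | apply: cvg_id]
 | |- cvg_to _ (nbhs (_ + - _)) => first [apply: cvgB; cvgt | apply: cvg_cst]
 | |- cvg_to _ (nbhs (_ + _)) => first [apply: cvgD; cvgt | apply: cvg_cst]
 | |- cvg_to _ (nbhs (- _)) => first [apply: cvgN; cvgt | apply: cvg_cst]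
 | |- cvg_to _ (nbhs (cos _)) => first [apply: continuous_cos | apply: continuous_cvg; [apply: continuous_cos|cvgt]]
 | |- cvg_to _ (nbhs (sin _)) => first [apply: continuous_sin | apply: continuous_cvg; [apply: continuous_sin|cvgt]]
 | |- cvg_to _ (nbhs (expR _)) => first [apply: continuous_expR | apply: continuous_cvg; [apply: continuous_expR|cvgt]]
 | |- _ => first [apply: cvg_cst | apply: cvg_id | match goal with H : context [@cvg_to] |- _ => solve [apply: H => *; assumption] end]
 end].
Ltac meas := lazymatch goal with
 | |- measurable_fun _ (fun x => @?f x + - @?g x) => apply: measurable_funB; meas
 | |- measurable_fun _ (fun x => @?f x + @?g x) => apply: measurable_funD; meas
 | |- measurable_fun _ (fun x => @?f x * @?g x) => apply: measurable_funM; meas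
 | |- measurable_fun _ (fun x => - @?f x) => apply: measurable_funN; meas
 | |- measurable_fun _ (fun x => `|@?f x|) => apply: measurableT_comp; [apply: normr_measurable|meas]
 | |- measurable_fun _ (fun x => (@?f x)%:E) => apply/measurable_EFinP; meas
 | |- measurable_fun _ (EFin \o _) => apply/measurable_EFinP; meas
 | |- measurable_fun _ (fun x => bigop _ _ _) => apply: measurable_sum => *; meas
 | |- measurable_fun _ (fun x => cos (@?f x)) => apply: measurableT_comp; [apply: continuous_measurable_fun; apply: continuous_cos|meas]
 | |- measurable_fun _ (fun x => sin (@?f x)) => apply: measurableT_comp; [apply: continuous_measurable_fun; apply: continuous_sin|meas]
 | |- measurable_fun _ (fun x => expR (@?f x)) => apply: measurableT_comp; [apply: continuous_measurable_fun; apply: continuous_expR|meas]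
 | |- measurable_fun _ _ => first [assumption | match goal with H : context [@measurable_fun] |- _ => solve [apply: H => *; assumption] end | solve [apply: measurable_cst | apply: measurable_id | apply: measurable_funPT] | apply: measurable_indic; meas | apply: measurable_fst | apply: measurable_snd
 | lazymatch goal with |- mfun _ _ => fail | _ => apply: measurable_funTS; meas end]
 | |- measurable (_ `&` _) => apply: measurableI; meas
 | |- measurable (_ `|` _) => apply: measurableU; meas
 | |- measurable (_ `\` _) => apply: measurableD; meas
 | |- measurable (~` _) => apply: measurableC; meas
 | |- measurable _ => first [assumption | match goal with H : context [@measurable] |- _ => solve [apply: H => *; assumption] end | solve [apply: measurableT | apply: measurable0 | apply: measurable_itv | apply: measurable_set1] | mset]
 end.
Ltac side := intros; lazymatch goal with
 | |- measurable_fun _ _ => meas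
 | |- measurable _ => meas
 | |- is_true (`|cos _| <= _) => rewrite ler_norml cos_geN1 cos_le1
 | |- is_true (`|sin _| <= _) => rewrite ler_norml sin_geN1 sin_le1
 | |- is_true _ => first [done | sgn | lra]
 | |- cvg_to _ _ => cvgt
 | |- _ => extra
 end.
Ltac noevar0 tac := match goal with |- ?g => tryif has_evar g then fail else tac end.
Ltac noevar tac := noevar0 tac.
#[local] Hint Extern 0 (is_true (0 <= _)) => noevar sgn : core.
#[local] Hint Extern 0 (is_true (0 < _)) => noevar sgn : core.
#[local] Hint Extern 0 (is_true (_ != 0)) => noevar sgn : core.
#[local] Hint Extern 0 (is_true (_ \in _)) => noevar sgn : core.
#[local] Hint Extern 0 (measurable_fun _ _) => noevar meas : core.
#[local] Hint Extern 0 (measurable _) => noevar meas : core.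

(** * Probabilities as real numbers *)

Section FiniteMeasure.
Context {d} {X : measurableType d} {R : realType}.
Variable mu : probability X R.

Definition pr (A : set X) : R := fine (mu A).

Lemma prE A : measurable A -> mu A = (pr A)%:E.
by move=> mA; rewrite /pr fineK// fin_num_measure. Qed.
Lemma pr_ge0 A : 0 <= pr A.
by rewrite /pr fine_ge0. Qed.
Lemma pr_le A B : measurable A -> measurable B -> A `<=` B -> pr A <= pr B.
move=> mA mB AB; rewrite -lee_fin -!prE//; apply: le_measure => //; rewrite inE//.
Qed.
Lemma pr_setT : pr setT = 1.
by rewrite /pr probability_setT. Qed.
Lemma pr_set0 : pr set0 = 0.
by rewrite /pr measure0. Qed.
Lemma pr_le1 A : measurable A -> pr A <= 1.
by move=> mA; rewrite -pr_setT pr_le. Qed.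
Lemma prU A B : measurable A -> measurable B -> A `&` B = set0 ->
 pr (A `|` B) = pr A+pr B.
move=> mA mB AB; apply: EFin_inj; rewrite -prE; last side.
by rewrite measureU// EFinD -!prE.
Qed.
Lemma pr_sigma (F : nat -> set X) : (forall i, measurable (F i)) ->
 trivIset setT F ->
 (\sum_(i < n) pr (F i)) @[n --> \oo] --> pr (\bigcup_i F i).
move=> mF tF.
have mU : measurable (\bigcup_i F i) by exact: bigcup_measurable.
have h := @measure_sigma_additive _ _ _ mu F mF tF.
rewrite [X in _ --> X](prE mU) in h; move/fine_cvg : h; apply: cvg_trans.
apply: near_eq_cvg; near=> n => /=.
rewrite big_mkord (eq_bigr (fun i : 'I_n => (pr (F i))%:E)) ?sumEFin//.
by move=> i _; rewrite prE.
Unshelve. all: by end_near. Qed.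

End FiniteMeasure.

(** * Exponential mixing of cylinders from distortion, big images and mixing *)

Section Decay.
Context {d} {X : measurableType d} {R : realType}.
Variables (mu : probability X R) (T : X -> X) (c : X -> nat) (theta D K1 : R).

Local Notation m := (pr mu).

Definition letter i : set X := [set x | c x = i].

Definition cyl (k : nat) (w : nat -> nat) : set X :=
 [set x | forall i, (i < k)%N -> c (iter i T x) = w i].

Definition same_word (k : nat) (x y : X) : Prop :=
 forall i, (i < k)%N -> c (iter i T x) = c (iter i T y).

Definition saturated (k : nat) (S : set X) : Prop :=
 forall x y, same_word k x y -> S x -> S y.

Hypotheses (mT : mfun X T) (presT : forall A, measurable A -> m (T @^-1` A) = m A)
 (mlet : forall i, measurable (letter i)).

(** Finite measures absolutely continuous with respect to [mu], kept as real set functions. The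
    transfer operator acts on them as push-forward by [T], so that no densities are handled. *)
Record is_mass (L : set X -> R) : Prop := IsMass {
 mass_ge0 : forall A, measurable A -> 0 <= L A ;
 massU : forall A B, measurable A -> measurable B -> A `&` B = set0 ->
 L (A `|` B) = L A+L B ;
 mass_sigma : forall F : nat -> set X, (forall i, measurable (F i)) ->
 trivIset setT F -> (\sum_(i < n) L (F i)) @[n --> \oo] --> L (\bigcup_i F i) ;
 mass_ac : forall A, measurable A -> m A = 0 -> L A = 0 }.

(** Says that the logarithm of the density of [L] varies by at most [a * theta ^+ k] over a cylinder
    of length [k]. The product form avoids densities and division by zero. *)
Definition regmass (a : R) (L : set X -> R) : Prop :=
 forall k w A1 A2, (0 < k)%N -> measurable A1 -> measurable A2 ->
 A1 `<=` cyl k w -> A2 `<=` cyl k w ->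
 L A1 * m A2 <= expR (a*theta ^+ k) * (L A2 * m A1).

Hypotheses (htheta : 0 < theta < 1) (D0 : 0 <= D) (K10 : 0 <= K1).

(** Bounded distortion of a branch: it is [regmass D] for the image under [T] of [mu] restricted to
    the letter [i]. *)
Hypothesis gibbs : forall i k w A1 A2, (0 < k)%N -> measurable A1 -> measurable A2 ->
 A1 `<=` cyl k w -> A2 `<=` cyl k w ->
 m (letter i `&` T @^-1` A1) * m A2 <=
 expR (D*theta ^+ k) * (m (letter i `&` T @^-1` A2) * m A1).

Hypothesis big : forall i A, measurable A ->
 m (letter i `&` T @^-1` A) <= K1 * (m (letter i) * m A).

Hypothesis mix : forall A B, measurable A -> measurable B ->
 m (A `&` (iter n T @^-1` B)) @[n --> \oo] --> m A * m B.

Let theta0 : 0 < theta. Proof. by lia. Qed.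
Let theta1 : theta < 1. Proof. by lia. Qed.
Lemma mpre A : measurable A -> measurable (T @^-1` A).
by move=> mA; rewrite -[X in measurable X]setTI; exact: mT. Qed.
Lemma mpren n A : measurable A -> measurable (iter n T @^-1` A).
elim: n A => [//|n IH] A mA.
have -> : iter n.+1 T @^-1` A = iter n T @^-1` (T @^-1` A) by [].
by apply: IH; exact: mpre.
Qed.
Lemma presTn n A : measurable A -> m (iter n T @^-1` A) = m A.
elim: n A => [//|n IH] A mA.
have -> : iter n.+1 T @^-1` A = iter n T @^-1` (T @^-1` A) by [].
by rewrite IH ?presT//; exact: mpre.
Qed.
Lemma cyl0 w : cyl 0 w = setT.
by apply/seteqP; split. Qed.
Lemma cylS k w : cyl k.+1 w = cyl k w `&` iter k T @^-1` letter (w k).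
apply/seteqP; split => x.
 by move=> h; split=> [i ik|]; [apply: h; rewrite ltnS ltnW|exact: h].
move=> [h1 h2] i; rewrite ltnS leq_eqVlt => /orP[/eqP->//|]; exact: h1.
Qed.
Lemma mcyl k w : measurable (cyl k w).
elim: k => [|k IH]; first by rewrite cyl0.
by rewrite cylS; apply: measurableI => //; exact: mpren.
Qed.
Lemma cyl1_letter w : cyl 1 w = letter (w 0%N).
by rewrite cylS cyl0 setTI. Qed.
Lemma cyl_cons i k w :
 letter i `&` T @^-1` cyl k w = cyl k.+1 (fun j => if j is j'.+1 then w j' else i).
apply/seteqP; split => x.
 by move=> [xi h] [//|j] jk; rewrite iterSr; exact: h.
by move=> h; split=> [|j jk]; [exact: (h 0%N)|rewrite -iterSr; exact: (h j.+1)].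
Qed.
Lemma cyl_letter k w : (0 < k)%N -> cyl k w `<=` letter (w 0%N).
by move=> k0 x /(_ 0%N k0). Qed.
Lemma trivIset_letter (A : set X) : trivIset setT (fun i => A `&` letter i).
by apply/trivIsetP => i j _ _ ij; apply/seteqP; split=> x//= [[_ xi] [_ xj]]; move: ij; rewrite -xi -xj eqxx. Qed.
Lemma bigcup_letter (A : set X) : \bigcup_i (A `&` letter i) = A.
by apply/seteqP; split=> x => [[i _ []//]|Ax]; exists (c x). Qed.

Section Mass.
Variable L : set X -> R.
Hypothesis hL : is_mass L.

Lemma mass0 : L set0 = 0.
by apply: (mass_ac hL) => //; rewrite pr_set0. Qed.
Lemma mass_le A B : measurable A -> measurable B -> A `<=` B -> L A <= L B.
move=> mA mB AB; have -> : B = A `|` (B `\` A).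
 by rewrite setDUK.
rewrite (massU hL)//; last by rewrite setDIK.
- by rewrite lerDl (mass_ge0 hL); side.
Qed.
Lemma mass_letters A : measurable A ->
 (\sum_(i < n) L (A `&` letter i)) @[n --> \oo] --> L A.
move=> mA; rewrite -[X in _ --> L X](bigcup_letter A); apply: (mass_sigma hL); try side. exact: trivIset_letter.
Qed.
Definition smalls q : set X := [set x | (c x < q)%N].

Lemma small_lettersS q : smalls q.+1 = smalls q `|` letter q.
apply/seteqP; split=> x; rewrite /smalls /letter /=.
 by lia.
by lia.
Qed.
Lemma small_letters0 : smalls 0 = set0.
by apply/seteqP; split. Qed.
Lemma msmall q : measurable (smalls q).
elim: q => [|q IH]; first by rewrite small_letters0.
by rewrite small_lettersS; side.
Qed.
Lemma mass_small A q : measurable A ->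
 L (A `&` smalls q) = \sum_(i < q) L (A `&` letter i).
move=> mA; elim: q => [|q IH].
 by rewrite big_ord0 small_letters0 setI0 mass0.
rewrite big_ord_recr -IH small_lettersS setIUr (massU hL)//.
- exact: measurableI (msmall _). apply/seteqP; split=> x //= -[[_]].
 by rewrite /smalls /letter /= => + [_ cx]; rewrite cx ltnn.
Qed.
Lemma push_mass n : is_mass (fun A => L (iter n T @^-1` A)).
split=> [A mA|A B mA mB AB|F mF tF|A mA A0].
- by apply: (mass_ge0 hL); exact: mpren.
- by rewrite preimage_setU (massU hL)//; [exact: mpren|exact: mpren|rewrite -preimage_setI AB preimage_set0].
- rewrite preimage_bigcup; apply: (mass_sigma hL) => [i|]; first exact: mpren.
 apply/trivIsetP => i j _ _ ij; rewrite -preimage_setI.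
 by move/trivIsetP : tF => /(_ i j I I ij) ->.
- by apply: (mass_ac hL); [exact: mpren|rewrite presTn].
Qed.
Lemma restr_mass B : measurable B -> is_mass (fun A => L (A `&` B)).
move=> mB; split=> [A mA|A A' mA mA' AA|F mF tF|A mA A0].
- by apply: (mass_ge0 hL); side.
- rewrite setIUl (massU hL)//.
 by rewrite setIACA AA set0I.
- rewrite setI_bigcupl; apply: (mass_sigma hL) => [i|]; first side.
 by apply: trivIset_setIr.
- apply: (mass_ac hL); first side.
 apply/eqP; rewrite eq_le pr_ge0 andbT -A0 pr_le//.
Qed.
Lemma scale_mass r : 0 <= r -> is_mass (fun A => r*L A).
move=> r0; split=> [A mA|A A' mA mA' AA|F mF tF|A mA A0].
- by rewrite mulr_ge0// (mass_ge0 hL).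
- by rewrite (massU hL)// mulrDr.
- under eq_fun do rewrite -mulr_sumr.
 by apply: cvgM; [side|exact: (mass_sigma hL)].
- by rewrite (mass_ac hL)// mulr0.
Qed.

End Mass.

Lemma pr_mass : is_mass m.
split=> [A mA|A B|F|//]; [exact: pr_ge0|exact: prU|exact: pr_sigma].
Qed.

(** Chains [l1/l2 <= e1 p1/p2] with [p1/p2 <= e2 u1/u2] in product form. When [p2] vanishes,
    absolute continuity takes the place of the division. *)
Lemma mass_reg_step (l1 l2 p1 p2 u1 u2 e1 e2 : R) :
 0 <= l1 -> 0 <= l2 -> 0 <= p1 -> 0 <= p2 -> 0 <= u1 -> 0 <= u2 ->
 0 <= e1 -> 0 <= e2 -> (p1 = 0 -> l1 = 0) ->
 l1 * p2 <= e1 * (l2 * p1) -> p1*u2 <= e2 * (p2*u1) ->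
 l1*u2 <= e1*e2 * (l2*u1).
move=> l10 l20 p10 p20 u10 u20 e10 e20 ac h1 h2.
have RHS0 : 0 <= e1*e2 * (l2*u1) by rewrite !mulr_ge0.
have [p2E|p2n] := eqVneq p2 0.
 move: h2; rewrite p2E mul0r mulr0 => h2.
 have /eqP : p1*u2 = 0 by apply/eqP; rewrite eq_le h2 mulr_ge0.
 by rewrite mulf_eq0 => /orP[/eqP/ac->|/eqP->]; rewrite ?mul0r ?mulr0.
have p2_gt0 : 0 < p2 by lra.
rewrite -(ler_pM2r p2_gt0).
have g1 : l1 * p2*u2 <= e1 * (l2 * p1)*u2 by rewrite ler_wpM2r.
have g2 : e1 * l2 * (p1*u2) <= e1 * l2 * (e2 * (p2*u1)) by rewrite ler_wpM2l.
lra.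
Qed.
(** A Lasota-Yorke inequality: inside a letter, a cylinder of length [k] pulls back to one of length
    [k + 1], which gains the factor [theta], and the branch adds its distortion [D]. The letters are
    summed by countable additivity. *)
Lemma push_regular a (L : set X -> R) : is_mass L -> regmass a L ->
 regmass (a*theta+D) (fun A => L (T @^-1` A)).
move=> hL rL k w A1 A2 k0 mA1 mA2 s1 s2.
have c1 := mass_letters hL (mpre mA1); have c2 := mass_letters hL (mpre mA2).
have step n : (\sum_(i < n) L (T @^-1` A1 `&` letter i)) * m A2 <=
 expR ((a*theta+D)*theta ^+ k) *
 ((\sum_(i < n) L (T @^-1` A2 `&` letter i)) * m A1).
 rewrite !mulr_suml mulr_sumr; apply: ler_sum => i _.
 have mI A : measurable A -> measurable (letter i `&` T @^-1` A).
 by move=> mA; apply: measurableI => //; exact: mpre.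
 rewrite !(setIC _ (letter i)).
 rewrite (_ : expR _ = expR (a*theta ^+ k.+1)*expR (D*theta ^+ k)); last first.
 by rewrite -expRD exprS mulrDl mulrA.
 apply: (@mass_reg_step _ _ (m (letter i `&` T @^-1` A1))
 (m (letter i `&` T @^-1` A2))); rewrite ?expR_ge0 ?pr_ge0 ?(mass_ge0 hL)//; try exact: mI.
 - by move=> /(mass_ac hL); apply; exact: mI.
 - apply: (rL k.+1 (fun j => if j is j'.+1 then w j' else i)) => //; try exact: mI.
 + by rewrite -cyl_cons => x [? ?]; split => //; exact: s1.
 + by rewrite -cyl_cons => x [? ?]; split => //; exact: s2.
 - exact: gibbs s1 s2.
have h1 : (\sum_(i < n) L (T @^-1` A1 `&` letter i)) * m A2 @[n --> \oo] -->
 L (T @^-1` A1) * m A2 by apply: cvgM => //; exact: cvg_cst.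
have h2 : expR ((a*theta+D)*theta ^+ k) *
 ((\sum_(i < n) L (T @^-1` A2 `&` letter i)) * m A1) @[n --> \oo] -->
 expR ((a*theta+D)*theta ^+ k) * (L (T @^-1` A2) * m A1) by apply: cvgM; [exact: cvg_cst|side].
by apply: (ler_cvg_to h1 h2); near=> n; side.
Unshelve. all: by end_near. Qed.
Lemma regular_le a b (L : set X -> R) : is_mass L -> a <= b ->
 regmass a L -> regmass b L.
move=> hL ab rL k w A1 A2 k0 mA1 mA2 s1 s2.
apply: (le_trans (rL k w A1 A2 k0 mA1 mA2 s1 s2)).
by rewrite ler_wpM2r ?mulr_ge0 ?pr_ge0 ?(mass_ge0 hL)// ler_expR ler_wpM2r.
Qed.
(** The fixed point of [a |-> a * theta + D], hence the regularity to which all masses are attracted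
    under push-forward. *)
Definition a0 : R := D / (1-theta).

Lemma a0_ge0 : 0 <= a0.
by rewrite divr_ge0// subr_ge0 ltW. Qed.
Lemma a0E : a0*theta+D = a0.
by rewrite /a0; field; rewrite subr_eq0 eq_sym lt_eqF. Qed.
Lemma pushn_regular n a (L : set X -> R) : is_mass L -> regmass a L ->
 regmass (a*theta ^+ n + a0) (fun A => L (iter n T @^-1` A)).
move=> hL rL; elim: n => [|n IH].
 by rewrite expr0 mulr1; apply: regular_le rL; rewrite // lerDl a0_ge0.
have := push_regular (push_mass hL n) IH.
rewrite mulrDl -mulrA -exprSr -addrA a0E => h k w A1 A2 k0 mA1 mA2 s1 s2.
exact: (h k w A1 A2).
Qed.
(** One step already bounds the density: within a letter a regular mass is comparable to [mu], and
    [big] bounds the branch. *)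
Lemma push_bound a (L : set X -> R) : is_mass L -> regmass a L ->
 forall A, measurable A ->
 L (T @^-1` A) <= expR (a*theta)*K1 * (L setT * m A).
move=> hL rL A mA.
have c1 := mass_letters hL (mpre mA); have c2 := mass_letters hL (@measurableT _ X).
have step n : \sum_(i < n) L (T @^-1` A `&` letter i) <=
 expR (a*theta)*K1 * ((\sum_(i < n) L (setT `&` letter i)) * m A).
 rewrite mulr_suml mulr_sumr; apply: ler_sum => i _.
 rewrite setIC setTI.
 have mI : measurable (letter i `&` T @^-1` A).
 by apply: measurableI => //; exact: mpre.
 rewrite -[L _]mulr1.
 apply: (@mass_reg_step _ _ (m (letter i `&` T @^-1` A)) (m (letter i))); rewrite ?expR_ge0 ?pr_ge0 ?(mass_ge0 hL)//.
 - exact: (mass_ac hL mI).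
 - rewrite -[theta]expr1; apply: (rL 1%N (fun=> i)) => //.
 + by rewrite cyl1_letter => x [].
 + by rewrite cyl1_letter.
 - by rewrite mulr1; exact: big.
have h2 : expR (a*theta)*K1 *
 ((\sum_(i < n) L (setT `&` letter i)) * m A) @[n --> \oo] -->
 expR (a*theta)*K1 * (L setT * m A) by apply: cvgM; [exact: cvg_cst|side].
by apply: (ler_cvg_to c1 h2); near=> n; side.
Unshelve. all: by end_near. Qed.
Lemma restr_regular a (L : set X -> R) i : is_mass L -> regmass a L ->
 regmass a (fun A => L (A `&` letter i)).
move=> hL rL k w A1 A2 k0 mA1 mA2 s1 s2.
have [wi|wi] := eqVneq (w 0%N) i.
 have cy A : A `<=` cyl k w -> A `&` letter i = A.
 move=> s; apply/seteqP; split=> x; first by case.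
 by move=> Ax; split=> //; rewrite -wi; exact: (cyl_letter k0 (s x Ax)).
 by rewrite !cy//; exact: (rL k w).
have cy A : A `<=` cyl k w -> A `&` letter i = set0.
 move=> s; apply/seteqP; split=> x //= [Ax xi].
 by move: wi; rewrite -xi (cyl_letter k0 (s x Ax)) eqxx.
by rewrite !cy// (mass0 hL) !mul0r mulr0.
Qed.
Lemma pr_regular : regmass 0 m.
move=> k w A1 A2 k0 mA1 mA2 s1 s2.
by rewrite mul0r expR0 mul1r mulrC.
Qed.
Lemma big_tail q A : measurable A ->
 m (T @^-1` A `\` smalls q) <= K1 * (m (~` smalls q) * m A).
move=> mA; rewrite setDE.
have mC := measurableC (msmall q).
have hL := restr_mass pr_mass mC.
have c1 := mass_letters hL (mpre mA).
have c2 := mass_letters hL (@measurableT _ X).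
rewrite setTI in c2.
have step n : \sum_(i < n) m (T @^-1` A `&` letter i `&` ~` smalls q) <=
 K1 * ((\sum_(i < n) m (setT `&` letter i `&` ~` smalls q)) * m A).
 rewrite mulr_suml mulr_sumr; apply: ler_sum => i _; rewrite setTI.
 have [iq|iq] := ltnP i q.
 rewrite (_ : _ `&` ~` _ = set0) ?pr_set0 ?mulr_ge0 ?pr_ge0//.
 by apply/seteqP; split=> x //= -[[_ xi]]; rewrite /smalls /= xi.
 rewrite [X in _ <= _ * (m X * _)](_ : _ = letter i); last first.
 apply/seteqP; split=> x; first by case.
 by move=> xi; split=> //; rewrite /smalls /= xi; apply/negP; rewrite -leqNgt.
 apply: le_trans (big i mA); apply: pr_le.
 - by apply: measurableI => //; apply: measurableI => //; exact: mpre.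
 - by apply: measurableI => //; exact: mpre.
 - by move=> x [[? ?] _].
have h2 : K1 * ((\sum_(i < n) m (setT `&` letter i `&` ~` smalls q)) * m A) @[n --> \oo] -->
 K1 * (m (~` smalls q) * m A) by side.
by apply: (ler_cvg_to c1 h2); near=> n; side.
Unshelve. all: by end_near. Qed.
Lemma small_tail (e : R) : 0 < e -> exists q, m (~` smalls q) < e.
move=> e0.
have c2 := mass_letters pr_mass (@measurableT _ X).
have {c2} c2 : m (smalls q) @[q --> \oo] --> (1 : R).
 rewrite -(pr_setT mu); move: c2; apply: cvg_trans; apply: near_eq_cvg.
 by near=> n; rewrite -(mass_small pr_mass)// setTI.
have /cvgr_lt : 1-m (smalls q) @[q --> \oo] --> (0 : R) by rewrite -(subrr 1); side.
move=> /(_ _ e0) [q _ h]; exists q; have := h q (leqnn q).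
have := prU mu (msmall q) (measurableC (msmall q)) (setICr _).
rewrite setUv pr_setT => ->; lra.
Unshelve. all: by end_near. Qed.

Lemma mass_cell_lb a (L : set X -> R) j B : is_mass L -> regmass a L ->
 measurable B ->
 expR (- (a*theta)) * (L (letter j) * m (B `&` letter j)) <=
 m (letter j)*L (B `&` letter j).
move=> hL rL mB.
have mI : measurable (B `&` letter j) by [].
have := rL 1%N (fun=> j) (letter j) (B `&` letter j) isT (mlet j) mI.
rewrite !cyl1_letter expr1 => /(_ (@subset_refl _ _) (@subIsetr _ _ _)).
move=> h; rewrite expRN mulrC ler_pdivrMr// (le_trans h)//.
by lra.
Qed.
Lemma bounded_witness (P : nat -> nat -> Prop) q :
 (forall i, exists N, forall n, (N <= n)%N -> P i n) ->
 exists N, forall i n, (i < q)%N -> (N <= n)%N -> P i n.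
move=> h; elim: q => [|q [N IH]]; first by exists 0%N.
have [N' hN'] := h q; exists (maxn N N') => i n.
rewrite ltnS leq_eqVlt geq_max => /orP[/eqP ->|iq] /andP[n1 n2]; first exact: hN'.
exact: IH.
Qed.
Lemma mix_letters q : exists N, forall i j n, (i < q)%N -> (j < q)%N -> (N <= n)%N ->
 2^-1 * (m (letter i) * m (letter j)) <= m (letter i `&` iter n T @^-1` letter j).
have key i j : exists N, forall n, (N <= n)%N ->
 2^-1 * (m (letter i) * m (letter j)) <= m (letter i `&` iter n T @^-1` letter j).
 have := mix (mlet i) (mlet j).
 have [->|ne] := eqVneq (m (letter i) * m (letter j)) 0.
 by move=> _; exists 0%N => n _; rewrite mulr0 pr_ge0.
 have gt0 : 0 < m (letter i) * m (letter j) by rewrite lt_neqAle eq_sym ne mulr_ge0 ?pr_ge0.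
 move/cvgr_ge => /(_ (2^-1 * (m (letter i) * m (letter j)))) [|N _ h]; first lra.
 by exists N => n /h.
have key2 i : exists N, forall n, (N <= n)%N -> forall j, (j < q)%N ->
 2^-1 * (m (letter i) * m (letter j)) <= m (letter i `&` iter n T @^-1` letter j).
 have [N hN] := bounded_witness q (key i).
 by exists N => n Nn j jq; exact: hN.
have [N hN] := bounded_witness q key2.
by exists N => i j n iq jq Nn; exact: hN.
Qed.
(** A Doeblin condition. After one step half of the mass sits on finitely many letters, so one
    letter receives a definite amount, spread regularly. Mixing carries this letter to all of these
    letters. A last step reaches every set, since at most half of [T^-1 A] lies outside these
    letters ([big_tail]). *)
Lemma minorization (a : R) : 0 <= a -> exists N0, forall N, (N0 <= N)%N ->
 exists2 eta : R, 0 < eta < 1 & forall L : set X -> R,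
 is_mass L -> regmass a L -> L setT = 1 ->
 forall A, measurable A -> eta * m A <= L (iter N T @^-1` A).
move=> a_ge0; have th0 := theta0; have [K KE] : exists K, K = expR (a*theta)*K1 by eexists.
have K_ge0 : 0 <= K by rewrite KE.
(* Small enough that the letters from [q] on carry at most half of [L1], by [K], and at most half of
   any [T^-1 A], by [K1]. *)
have [e eE] : exists e : R, e = (2 * (K+K1+1))^-1 by eexists.
have e_gt0 : 0 < e by rewrite eE.
have Ke : K*e <= 2^-1 by rewrite eE ler_pdivrMr//; have := K10; lra.
have K1e : K1*e <= 2^-1 by rewrite eE ler_pdivrMr//; have := K10; lra.
have [q hq] := small_tail e_gt0; have [N0 hN0] := mix_letters q.
(* One step before and one step after the [n] steps to which mixing is applied. *)
exists N0.+2 => -[//|[//|n]]; rewrite !ltnS => nN0.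
have [Q QE] : exists Q : R, Q = 2 * (q%:R+1) by eexists.
have Q_gt0 : 0 < Q by rewrite QE.
pose a1 := a*theta+D; pose c0 := expR (- (a1*theta))*Q^-1.
pose c1 := expR (- (a0*theta))*2^-1 * (Q * (K+1))^-1.
have c0_gt0 : 0 < c0 by apply: mulr_gt0.
have c1_gt0 : 0 < c1 by apply: mulr_gt0.
exists (Num.min (c0*c1*2^-1) 2^-1) => [|L hL rL LT A mA].
 rewrite lt_min gt_min; apply/andP; split; last by apply/orP; right; lra.
 by apply/andP.
pose L1 (B : set X) := L (T @^-1` B); have hL1 : is_mass L1 := push_mass hL 1.
have rL1 : regmass a1 L1 by exact: push_regular.
have L1K B : measurable B -> L1 B <= K * m B.
 by move=> mB; have := push_bound hL rL mB; rewrite LT mul1r -KE.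
have L1T : L1 setT = 1 by rewrite /L1 preimage_setT.
have L1q : 2^-1 <= \sum_(i < q) L1 (letter i).
 have := mass_small hL1 q (@measurableT _ X); rewrite setTI; under eq_bigr do rewrite setTI.
 move=> <-; have := massU hL1 (msmall q) (measurableC (msmall q)) (setICr _).
 rewrite setUv L1T; have := L1K _ (measurableC (msmall q)).
 by have := ler_wpM2l K_ge0 (ltW hq); lra.
have [i iq L1i] : exists2 i, (i < q)%N & Q^-1 <= L1 (letter i).
 apply/not_exists2P => h; have : \sum_(i < q) L1 (letter i) <= \sum_(i < q) Q^-1.
 apply: ler_sum => i _; rewrite leNgt; apply/negP => hi.
 by case: (h i) => [/(_ (ltn_ord i))//|]; apply; exact: ltW.
 have : (q%:R : R)*Q^-1 < 2^-1 by rewrite ltr_pdivrMr// QE; lra.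
 by rewrite sumr_const card_ord -mulr_natl; lra.
have mi_gt0 : (Q * (K+1))^-1 <= m (letter i).
 rewrite invfM ler_pdivrMr// (le_trans L1i)// (le_trans (L1K _ (mlet i)))// mulrC.
 by rewrite ler_wpM2l ?pr_ge0//; lra.
have lb1 B : measurable B -> c0 * m (B `&` letter i) <= L1 B.
 move=> mB; have mBi : measurable (B `&` letter i) by [].
 apply: (@le_trans _ _ (L1 (B `&` letter i))); last by apply: (mass_le hL1).
 apply: (@le_trans _ _ (expR (- (a1*theta)) * (L1 (letter i) * m (B `&` letter i)))).
 by rewrite -mulrA ler_wpM2l// ler_wpM2r// pr_ge0.
 apply: (le_trans (mass_cell_lb i hL1 rL1 mB)).
 by rewrite -[leRHS]mul1r ler_wpM2r ?(mass_ge0 hL1)// pr_le1.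
(* The restriction of [mu] to a letter has regularity 0, so its images have regularity [a0] whatever
   [n] is. *)
pose L2 (B : set X) := m (iter n T @^-1` B `&` letter i).
have hL2 : is_mass L2 by exact: (push_mass (restr_mass pr_mass (mlet i)) n).
have rL2 : regmass a0 L2.
 have := pushn_regular n (restr_mass pr_mass (mlet i)) (@restr_regular _ _ i pr_mass pr_regular).
 by rewrite mul0r add0r.
have lb2 B : measurable B -> c1 * m (B `&` smalls q) <= L2 B.
 move=> mB; apply: (@le_trans _ _ (L2 (B `&` smalls q))); last first.
 by apply: (mass_le hL2) => //; exact: measurableI (msmall q).
 rewrite (mass_small pr_mass)// (mass_small hL2)// mulr_sumr; apply: ler_sum => j _.
 have [mj0|mjn] := eqVneq (m (letter j)) 0.
 have -> : m (B `&` letter j) = 0 by apply/eqP; rewrite eq_le pr_ge0 andbT -mj0 pr_le.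
 by rewrite mulr0 (mass_ge0 hL2).
 have mj_gt0 : 0 < m (letter j) by rewrite lt_neqAle eq_sym mjn pr_ge0.
 rewrite -(ler_pM2l mj_gt0); apply: le_trans (mass_cell_lb j hL2 rL2 mB).
 have h3 : 2^-1 * ((Q * (K+1))^-1 * m (letter j)) <= L2 (letter j).
 apply: (@le_trans _ _ (2^-1 * (m (letter i) * m (letter j)))); last by rewrite /L2 setIC; exact: hN0.
 by rewrite ler_wpM2l// ler_wpM2r// pr_ge0.
 have := ler_wpM2l (expR_ge0 (- (a0*theta))) (ler_wpM2r (pr_ge0 mu (B `&` letter j)) h3).
 by apply: le_trans; rewrite /c1; lra.
have mTA := mpre mA; have lb3 : 2^-1 * m A <= m (T @^-1` A `&` smalls q).
 have := prU mu (measurableI _ _ mTA (msmall q)) (measurableD mTA (msmall q)).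
 rewrite setUIDK setDE setIACA setICr setI0 => /(_ erefl).
 have := big_tail q mA; rewrite setDE presT//; have mA0 := pr_ge0 mu A.
 have := ler_wpM2r mA0 (ler_wpM2l K10 (ltW hq)); have := ler_wpM2r mA0 K1e; lra.
have -> : L (iter n.+2 T @^-1` A) = L1 (iter n T @^-1` (T @^-1` A)).
 by rewrite /L1; congr L; apply/seteqP; split=> x; rewrite /= -iterSr.
apply: (@le_trans _ _ (c0*c1*2^-1 * m A)); first by rewrite ler_wpM2r ?pr_ge0// ge_min lexx.
apply: le_trans (lb1 _ (mpren n mTA)); rewrite (_ : c0*c1*2^-1 * m A = c0 * (c1 * (2^-1 * m A))); last by ring.
 rewrite ler_wpM2l ?(ltW c0_gt0)//.
by apply: le_trans (lb2 _ mTA); rewrite ler_wpM2l// ltW.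
Qed.

(** As [y >= eta * q], at least half of [y] remains after the subtraction, and the distortion is at
    most squared. *)
Lemma contraction_step (eta e1 x y p q : R) : 0 < eta < 1 -> 1 <= e1 ->
 0 <= p -> 0 <= q -> x*q <= e1 * (y * p) -> eta*q <= y ->
 (x-eta/2 * p)*q <= e1*e1 * ((y-eta/2*q) * p).
move=> /andP[eta0 eta1] e11 p0 q0 h yq.
have s1 : 0 <= (e1-1)*e1 * p * (y-eta*q).
 by rewrite !mulr_ge0//; lra.
have s2 : 0 <= eta/2 * p*q * (e1-1) ^+ 2.
 by rewrite !mulr_ge0//; lra.
lra.
Qed.
(** The part [eta / 2] of [mu] is split off and the rest is normalised. The class is stable: [N]
    steps bring the regularity from [4 * a0] below [2 * a0], since [theta ^+ N <= 1/4], and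
    [contraction_step] doubles it again. *)
Lemma contraction : exists N (r : R), [/\ (0 < N)%N, 0 < r < 1 &
 forall (L : set X -> R), is_mass L -> regmass (4*a0) L -> L setT = 1 ->
 exists L', [/\ is_mass L', regmass (4*a0) L', L' setT = 1 &
 forall A, measurable A -> L (iter N T @^-1` A) = (1-r) * m A+r*L' A]].
have th1 := theta1; have th0 := theta0; have A0 := a0_ge0.
have [N0 hN0] := @minorization (4*a0) (mulr_ge0 (ler0n R 4) A0).
have [N1 _ hN1] : \forall n \near \oo, theta ^+ n < 4^-1.
 by apply: (@cvgr_lt _ _ _ _ _ 0) => //; apply: cvg_expr; rewrite ger0_norm// ltW.
pose N := (maxn N0 N1).+1.
have [|eta heta hmin] := hN0 N.
 by rewrite /N (leq_trans (leq_maxl N0 N1)).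
have /andP[eta0 eta1] := heta.
have thN : theta ^+ N <= 4^-1.
 by apply/ltW/hN1; rewrite /N /= (leq_trans (leq_maxr N0 N1)).
exists N, (1-eta/2); split => [//||L hL rL LT]; first by apply/andP; split; lra.
have r0 : 1-eta/2 != 0 by rewrite gt_eqF//; lra.
pose M A := L (iter N T @^-1` A).
have hM : is_mass M := push_mass hL N.
have rM : regmass (2*a0) M.
 have := pushn_regular N hL rL; apply: regular_le => //.
 have : 4*a0*theta ^+ N <= 4*a0*4^-1 by rewrite ler_wpM2l// mulr_ge0.
 lra.
exists (fun A => (1-eta/2)^-1 * (M A-eta/2 * m A)); split.
- have ri : 0 <= (1-eta/2)^-1 by rewrite invr_ge0; lra.
 apply: (@scale_mass (fun A => M A-eta/2 * m A)) => //.
 split=> [A mA|A B mA mB AB|F mF tF|A mA Am0].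
 + have := hmin L hL rL LT A mA; rewrite -/(M A).
 have := pr_ge0 mu A => p0 h.
 by have : eta/2 * m A <= eta * m A; [rewrite ler_wpM2r//; lra|lra].
 + by rewrite (massU hM)// prU//; lra.
 + under eq_fun do rewrite sumrB -mulr_sumr.
 apply: cvgB; first exact: mass_sigma hM _ mF tF.
 by apply: cvgM; [side|exact: pr_sigma].
 + by rewrite (mass_ac hM)// Am0; lra.
- move=> k w A1 A2 k0 mA1 mA2 s1 s2.
 have -> : expR (4*a0*theta ^+ k) = expR (2*a0*theta ^+ k)*expR (2*a0*theta ^+ k) by rewrite -expRD; congr expR; lra.
 have := @contraction_step eta (expR (2*a0*theta ^+ k)) (M A1) (M A2) (m A1) (m A2) heta.
 rewrite !pr_ge0 => /(_ _ isT isT (rM k w A1 A2 k0 mA1 mA2 s1 s2) (hmin L hL rL LT A2 mA2)) h.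
 have h' : 1 <= expR (2*a0*theta ^+ k) by rewrite -expR0 ler_expR mulr_ge0// mulr_ge0.
 have ri : 0 <= (1-eta/2)^-1 by rewrite invr_ge0; lra.
 by have := ler_wpM2l ri (h h'); lra.
- by rewrite /M preimage_setT LT pr_setT mulr1 mulVf.
- move=> A mA; rewrite mulVKf /M; lra.
Qed.
Lemma contraction_iter : exists N (r : R), [/\ (0 < N)%N, 0 < r < 1 &
 forall (L : set X -> R), is_mass L -> regmass (4*a0) L -> L setT = 1 ->
 forall j, exists L', [/\ is_mass L', regmass (4*a0) L', L' setT = 1 &
 forall A, measurable A ->
 L (iter (j*N) T @^-1` A) = (1-r ^+ j) * m A+r ^+ j*L' A]].
have [N [r [N0 r01 h]]] := contraction; exists N, r; split => // L hL rL LT.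
elim=> [|j [L' [hL' rL' LT' IH]]].
 by exists L; split => // A mA; rewrite mul0n expr0 subrr mul0r add0r mul1r.
have [L2 [hL2 rL2 LT2 IH2]] := h L' hL' rL' LT'.
exists L2; split => // A mA.
have -> : iter (j.+1*N) T @^-1` A = iter (j*N) T @^-1` (iter N T @^-1` A) by apply/seteqP; split=> x; rewrite /= mulSn iterD.
by rewrite IH ?IH2 ?presTn//; [rewrite exprSr; ring|exact: mpren].
Qed.
(** The rate is the [N]-th root of the contraction factor. The time [n.+1] is written as
    [j * N + s + 1]; the last [s + 1] steps, never zero in number, go through [push_bound], which
    makes the error relative to the measure of [A]. *)
Lemma mass_decay : exists K g : R, [/\ 0 <= K, 0 < g < 1 &
 forall (L : set X -> R), is_mass L -> regmass (4*a0) L ->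
 forall n A, measurable A ->
 `|L (iter n.+1 T @^-1` A)-L setT * m A| <= K*g ^+ n * (L setT * m A)].
have K1_ge0 := K10; have th0 := theta0; have th1 := theta1.
have [N [r [N0 /andP[r0 r1] h]]] := contraction_iter.
have [Kb KbE] : exists Kb, Kb = expR (4*a0*theta)*K1 by eexists.
have Kb0 : 0 <= Kb by rewrite KbE mulr_ge0 ?expR_ge0.
pose g := r `^ (N%:R^-1).
have g0 : 0 < g by exact: powR_gt0.
have gN : g ^+ N = r.
 rewrite -powR_mulrn ?powR_ge0// /g -powRrM mulVf ?powRr1 ?(ltW r0)//.
have g1 : g < 1.
 rewrite ltNge; apply/negP => g1; move: r1; rewrite -gN ltNge => /negP; apply.
 exact: exprn_ege1.
exists ((Kb+1) * (g ^+ N)^-1), g; split.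
- by [].
- by lra.
move=> L hL rL n A mA.
have [LT0|LTn] := eqVneq (L setT) 0.
 have LE B : measurable B -> L B = 0.
 move=> mB; apply/eqP; rewrite eq_le (mass_ge0 hL)// andbT -LT0.
 exact: mass_le.
 by rewrite LT0 LE ?mul0r ?subrr ?normr0 ?mulr0//; exact: mpren.
have LT_gt0 : 0 < L setT by rewrite lt_neqAle eq_sym LTn (mass_ge0 hL).
pose L1 B := (L setT)^-1*L B.
have hL1 : is_mass L1 by apply: scale_mass => //; side.
have rL1 : regmass (4*a0) L1.
 move=> k w A1 A2 k0 mA1 mA2 s1 s2; rewrite /L1.
 have ri : 0 <= (L setT)^-1 by [].
 by have := ler_wpM2l ri (rL k w A1 A2 k0 mA1 mA2 s1 s2); lra.
have L1T : L1 setT = 1 by rewrite /L1 mulVf.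
have LL1 B : L B = L setT*L1 B by rewrite /L1 mulVKf.
rewrite LL1 -mulrBr normrM gtr0_norm// mulrCA ler_wpM2l//.
rewrite (divn_eq n N); set j := (n %/ N)%N; set s := (n %% N)%N.
have [L' [hL' rL' LT' IH]] := h L1 hL1 rL1 L1T j.
have -> : iter (j*N+s).+1 T @^-1` A =
 iter (j*N) T @^-1` (T @^-1` (iter s T @^-1` A)).
 rewrite (_ : (_+s).+1 = (s + (1+j*N))%N); last by rewrite add1n addnS addnC.
 by apply/seteqP; split=> x; rewrite /preimage /= iterD iterS.
rewrite IH; last by apply: mpre; exact: mpren.
have ub := push_bound hL' rL' (mpren s mA); rewrite LT' mul1r -KbE presTn// in ub.
rewrite presT ?presTn//; last exact: mpren.
have -> : (1-r ^+ j) * m A+r ^+ j*L' (T @^-1` (iter s T @^-1` A))-m A =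
 r ^+ j * (L' (T @^-1` (iter s T @^-1` A))-m A) by lra.
rewrite normrM ger0_norm//.
have l0 : 0 <= L' (T @^-1` (iter s T @^-1` A)) by apply: (mass_ge0 hL'); apply: mpre; exact: mpren.
have p0 := pr_ge0 mu A.
have b1 : `|L' (T @^-1` (iter s T @^-1` A))-m A| <= (Kb+1) * m A.
 have : 0 <= Kb * m A by rewrite mulr_ge0.
 by rewrite ler_norml => ?; lra.
have b2 : r ^+ j <= (g ^+ N)^-1*g ^+ (j*N+s).
 rewrite exprD mulnC exprM gN mulrCA ler_peMr//.
 rewrite mulrC -gN ler_pdivlMr// mul1r ler_wiXn2l ?(ltW g1)//.
 by rewrite ltnW// ltn_mod.
apply: (le_trans (ler_pM _ _ b2 b1)) => //.
lra.
Qed.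
(** Restricting to a letter preserves regularity and one push maps [a0] to [a0], so the constant
    does not depend on the length of the cylinder. *)
Lemma cyl_mass k w : is_mass (fun A => m (cyl k w `&` iter k T @^-1` A)) /\
 regmass a0 (fun A => m (cyl k w `&` iter k T @^-1` A)).
elim: k => [|k [hL rL]].
 rewrite cyl0; under eq_fun do rewrite setTI.
 split; first exact: pr_mass.
 by apply: (regular_le pr_mass a0_ge0 pr_regular).
set L := (fun A => m (cyl k w `&` iter k T @^-1` A)) in hL rL.
have E : (fun A => m (cyl k.+1 w `&` iter k.+1 T @^-1` A)) =
 (fun A => L ((T @^-1` A) `&` letter (w k))).
 apply/funext => A; rewrite /L cylS; congr (m _).
 by apply/seteqP; split=> x []  => [[? ?] ?|? []].
rewrite E; split; first exact: (push_mass (restr_mass hL (mlet (w k))) 1).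
rewrite -a0E; apply: (@push_regular _ (fun A => L (A `&` letter (w k)))).
- exact: restr_mass.
- exact: restr_regular.
Qed.

(** Psi-mixing with exponential rate. The last letter of the cylinder is imposed as a restriction
    before [mass_decay] is applied, so that its [n.+1] steps lead exactly to time [k.+1 + n]. *)
Theorem cyl_mixing : exists K g : R, [/\ 0 <= K, 0 < g < 1 &
 forall k n w A, measurable A ->
 `|m (cyl k w `&` iter (k+n) T @^-1` A)-m (cyl k w) * m A|
 <= K*g ^+ n * (m (cyl k w) * m A)].
have [K [g [K0 g01 h]]] := mass_decay; exists K, g; split => // k n w A mA.
have /andP[g0 g1] := g01.
case: k => [|k].
 rewrite cyl0 setTI add0n presTn// pr_setT mul1r subrr normr0.
 by rewrite !mulr_ge0 ?pr_ge0// exprn_ge0// ltW.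
have [hL rL] := cyl_mass k w.
have hL' := restr_mass hL (mlet (w k)).
have rL' : regmass (4*a0) (fun B => m (cyl k w `&` iter k T @^-1` (B `&` letter (w k)))).
 apply: (@regular_le a0) => //; last exact: (@restr_regular _ (fun A => m (cyl k w `&` iter k T @^-1` A)) (w k) hL rL).
 by have := a0_ge0; lra.
have := h _ hL' rL' n A mA; rewrite setTI -cylS.
suff -> : cyl k w `&` iter k T @^-1` (iter n.+1 T @^-1` A `&` letter (w k)) =
 cyl k.+1 w `&` iter (k.+1+n) T @^-1` A by [].
rewrite cylS; have E x : iter n.+1 T (iter k T x) = iter (k.+1+n) T x.
 by rewrite -iterD addSnnS addnC.
by apply/seteqP; split=> x /= [] => [? []|[? ?]]; rewrite -!iterS E; split.
Qed.

End Decay.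

(** * Null sets, level sets and generated sigma-algebras *)

Section NullSets.
Context {d} {X : measurableType d} {R : realType}.
Variable mu : probability X R.
Local Notation m := (pr mu).

Lemma prM A : measurable A -> (mu : {measure set X -> \bar R}) A = (m A)%:E.
exact: prE. Qed.
Lemma pr_null_le A B : measurable A -> measurable B -> A `<=` B -> m B = 0 -> m A = 0.
by move=> mA mB AB B0; apply/eqP; rewrite eq_le pr_ge0 andbT -B0 pr_le. Qed.
Lemma pr_subU A B : measurable A -> measurable B -> m (A `|` B) <= m A+m B.
move=> mA mB; rewrite -(setDUK (@subsetUl _ A B)) prU//; first last.
 by rewrite setDIK.
by rewrite lerD2l pr_le// => x [[]].
Qed.
Lemma pr_nullU A B : measurable A -> measurable B -> m A = 0 -> m B = 0 -> m (A `|` B) = 0.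
move=> mA mB A0 B0; apply/eqP; rewrite eq_le pr_ge0 andbT.
by rewrite (le_trans (pr_subU mA mB))// A0 B0 addr0.
Qed.
Lemma pr_null_bigcup (F : nat -> set X) : (forall i, measurable (F i)) ->
 (forall i, m (F i) = 0) -> m (\bigcup_i F i) = 0.
move=> mF F0; have mU : measurable (\bigcup_i F i) by exact: bigcup_measurable.
suff : mu (\bigcup_i F i) = 0%E by rewrite prE// => -[].
apply/negligibleP => //; apply: negligible_bigcup => k.
by exists (F k); split => //; apply: etrans (prE mu (mF k)) _; rewrite F0.
Qed.
Lemma pr_mod_null A A' : measurable A -> measurable A' ->
 A' `<=` A -> m (A `\` A') = 0 -> m A = m A'.
move=> mA mA' s n0; rewrite -(setDUK s) prU//; [|by rewrite setDIK].
by lra.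
Qed.
Lemma pr_full_inter A G : measurable A -> measurable G -> m (~` G) = 0 -> m (A `&` G) = m A.
move=> mA mG G0; apply/esym/pr_mod_null => //.
by apply: pr_null_le G0; [| |move=> x [Ax]; rewrite setIC => h Gx; apply: h].
Qed.

End NullSets.

Section MeasurableLevelSets.
Context {d} {X : measurableType d} {R : realType}.
Implicit Types (f : X -> R) (t : R).

Lemma mset_gt f t : mfun X f -> measurable [set x | t < f x].
move=> mf; rewrite (_ : [set _ | _] = setT `&` f @^-1` `]t, +oo[%classic).
 by apply: mf => //; side.
by rewrite setTI; apply/seteqP; split=> x; rewrite /= in_itv/= andbT.
Qed.
Lemma mset_ge f t : mfun X f -> measurable [set x | t <= f x].
move=> mf; rewrite (_ : [set _ | _] = setT `&` f @^-1` `[t, +oo[%classic).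
 by apply: mf => //; side.
by rewrite setTI; apply/seteqP; split=> x; rewrite /= in_itv/= andbT.
Qed.
Lemma mset_le f t : mfun X f -> measurable [set x | f x <= t].
move=> mf; rewrite (_ : [set _ | _] = setT `&` f @^-1` `]-oo, t]%classic).
 by apply: mf => //; side.
by rewrite setTI.
Qed.
(** The integer part of [|f|] is a code with countably many letters, so [small_tail] applies to
    it. *)
Lemma pr_abs_tail0 (mu : probability X R) f : mfun X f ->
 forall e : R, 0 < e -> exists t0, forall t, t0 <= t -> pr mu [set x | t < `|f x|] < e.
move=> mf e e0; pose c x := Num.truncn `|f x|.
have mnf : mfun X (fun x => `|f x|) by exact: measurableT_comp.
have cE i x : (c x == i) = (i%:R <= `|f x| < i.+1%:R) by rewrite /c truncn_eq.
have mc i : measurable (letter c i).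
 rewrite (_ : letter c i = [set x | i%:R <= `|f x|] `\` [set x | i.+1%:R <= `|f x|]).
 by apply: measurableD; exact: mset_ge.
 apply/seteqP; split=> x; rewrite /letter /=.
 by move/eqP; rewrite cE => /andP[h1 h2]; split => //; apply/negP; rewrite -ltNge.
 by move=> [h1 /negP]; rewrite -ltNge => h2; apply/eqP; rewrite cE h1.
have h2 : ((0 : R) < 2^-1) && ((2^-1 : R) < 1).
 by rewrite invr_gt0 ltr0n invf_lt1 ?ltr0n ?ltr1n.
have [q hq] := small_tail mu mc h2 (lexx (0 : R)) (lexx (0 : R)) e0.
exists q%:R => t qt; apply: le_lt_trans hq; apply: pr_le.
- exact: mset_gt.
- by apply: measurableC; exact: (msmall mc h2).
- move=> x /= tf; rewrite /smalls /=; apply/negP; rewrite -leqNgt.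
 by rewrite /c truncn_ge_nat// ltW// (le_lt_trans qt).
Qed.

End MeasurableLevelSets.

Section SigmaInduction.
Context {T : Type}.

Lemma generated_ind (G P : set (set T)) : P set0 -> (forall A, P A -> P (~` A)) ->
 (forall F : nat -> set T, (forall n, P (F n)) -> P (\bigcup_n F n)) ->
 G `<=` P -> <<s G >> `<=` P.
move=> P0 PC PU GP; apply: smallest_sub => //; split => // A PA.
by rewrite setTD; exact: PC.
Qed.

End SigmaInduction.

(** * Gibbs-Markov systems: coding, distortion, approximation by cylinders *)

Section Coding.
Context {d} {X : measurableType d} {R : realType}.
Variables (mu : probability X R) (T : X -> X) (xi : set (set X)) (theta : R).
Local Notation m := (pr mu).

Hypotheses (htheta : 0 < theta < 1) (hGM : gibbs_markov mu T xi theta).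

Let hpi : piecewise_invertible mu T xi. Proof. by case: hGM. Qed.
Let mT : mfun X T. Proof. by case: hpi => -[]. Qed.
Let presT A : measurable A -> m (T @^-1` A) = m A.
by case: hpi => -[_ h] _ _ _ _ mA; rewrite /pr h. Qed.
Let mxi Z : xi Z -> measurable Z.
by case: hpi => _ [_ h _ _] _ _ _; exact: h. Qed.
Let disjxi Z Z' : xi Z -> xi Z' -> Z <> Z' -> m (Z `&` Z') = 0.
by case: hpi => _ [_ _ h _] _ _ _ xZ xZ' ZZ'; rewrite /pr h. Qed.
Let coverxi : m (~` \bigcup_(Z in xi) Z) = 0.
by case: hpi => _ [_ _ _ h] _ _ _; rewrite /pr h. Qed.
Let mTZ Z : xi Z -> measurable (T @` Z).
by case: hpi => _ _ _ _ h xZ; apply: (h Z Z) => //; side. Qed.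
Lemma enum_xi : exists e : set X -> nat, {in xi &, injective e}.
by case: hpi => _ [/countable_injP]. Qed.
Definition enumx : set X -> nat := projT1 (cid enum_xi).

Lemma enumx_inj Z Z' : xi Z -> xi Z' -> enumx Z = enumx Z' -> Z = Z'.
by move=> xZ xZ'; apply: (projT2 (cid enum_xi)); rewrite inE.
Qed.
(** The union selects the cell with number [i] and yields the empty set when there is none. *)
Definition zeta i : set X := \bigcup_(Z in [set Z | xi Z /\ enumx Z = i]) Z.

Lemma zetaE Z : xi Z -> zeta (enumx Z) = Z.
move=> xZ; apply/seteqP; split=> x; last by move=> Zx; exists Z.
by case=> Z' [xZ' /enumx_inj E] Z'x; rewrite -(E xZ' xZ).
Qed.
Lemma zeta_cases i : zeta i = set0 \/ xi (zeta i) /\ enumx (zeta i) = i.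
have [[Z [xZ eZ]]|h] := pselect (exists Z, xi Z /\ enumx Z = i).
 by right; rewrite -eZ zetaE.
by left; apply/seteqP; split=> x // -[Z [xZ eZ] _]; apply: h; exists Z.
Qed.
Lemma zeta_xi i x : zeta i x -> xi (zeta i) /\ enumx (zeta i) = i.
by case: (zeta_cases i) => // ->. Qed.
Lemma mzeta i : measurable (zeta i).
by case: (zeta_cases i) => [->|[/mxi]]. Qed.
(** The smallest number of a cell containing [x], and 0 outside all cells, so that the function is
    total with measurable letters. *)
Definition code (x : X) : nat :=
 if pselect (exists i, `[< zeta i x >]) is left h then ex_minn h else 0%N.

Definition overlap : set X :=
 ~` (\bigcup_i zeta i) `|` \bigcup_i \bigcup_j (if i == j then set0 else zeta i `&` zeta j).

Lemma moverlap : measurable overlap.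
apply: measurableU.
 by apply: measurableC; apply: bigcup_measurable => i _; exact: mzeta.
apply: bigcup_measurable => i _; apply: bigcup_measurable => j _.
by case: ifP => // _; apply: measurableI; exact: mzeta.
Qed.
Lemma overlap0 : m overlap = 0.
apply: pr_nullU.
- by apply: measurableC; apply: bigcup_measurable => i _; exact: mzeta.
- apply: bigcup_measurable => i _; apply: bigcup_measurable => j _.
 by case: ifP => // _; apply: measurableI; exact: mzeta.
- rewrite -coverxi; congr (m (~` _)).
 apply/seteqP; split=> x.
 by move=> [i _ /[dup] zx /zeta_xi[xZ _]]; exists (zeta i).
 by move=> [Z xZ Zx]; exists (enumx Z) => //; rewrite zetaE.
have mij i j : measurable (if i == j then set0 else zeta i `&` zeta j) by case: ifP => // _; apply: measurableI; exact: mzeta.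
apply: pr_null_bigcup => i; first by apply: bigcup_measurable => j _; side.
apply: pr_null_bigcup => j; first side.
have [_|ij] := eqVneq i j; first exact: pr_set0.
case: (zeta_cases i) => [->|[xi1 e1]]; first by rewrite set0I pr_set0.
case: (zeta_cases j) => [->|[xi2 e2]]; first by rewrite setI0 pr_set0.
by apply: disjxi => // E; move: ij; rewrite -e1 -e2 E eqxx.
Qed.
(** Points whose iterates all lie in exactly one cell. The set has full measure and is forward
    invariant, and on it letters and cells determine each other. *)
Definition good : set X := \bigcap_k (iter k T @^-1` (~` overlap)).

Lemma mgood : measurable good.
apply: bigcap_measurable; first by exists 0%N.
move=> k _; apply: mpren => //; exact: measurableC moverlap.
Qed.
Lemma good0 : m (~` good) = 0.
rewrite /good setC_bigcap; apply: pr_null_bigcup => k.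
 by apply: measurableC; apply: mpren => //; exact: measurableC moverlap.
rewrite -preimage_setC setCK presTn//; [exact: overlap0|exact: moverlap].
Qed.
Lemma goodT k x : good x -> good (iter k T x).
by move=> gx j _; rewrite /= -iterD; exact: gx. Qed.
Lemma nonoverlap_code x : ~ overlap x -> zeta (code x) x.
move=> ov; rewrite /code; case: pselect => [h|h]; first by case: ex_minnP => i /asboolP.
exfalso; apply: ov; left => -[i _ zi]; apply: h.
by exists i; apply/asboolP.
Qed.
Lemma nonoverlap_uniq x i j : ~ overlap x -> zeta i x -> zeta j x -> i = j.
move=> ov zi zj; apply/eqP/negP => /negP ij; apply: ov; right.
by exists i => //; exists j => //; rewrite (negbTE ij).
Qed.
Lemma good_nov k x : good x -> ~ overlap (iter k T x).
by move=> gx; exact: gx k I. Qed.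
Lemma good_code x : good x -> zeta (code x) x.
by move/(@good_nov 0%N); exact: nonoverlap_code. Qed.
Lemma good_xi x : good x -> xi (zeta (code x)).
by move/good_code/zeta_xi => -[]. Qed.
Lemma good_codeE x i : good x -> zeta i x -> code x = i.
move=> /[dup] gx /(@good_nov 0%N) ov; apply: nonoverlap_uniq => //; exact: good_code.
Qed.
Lemma good_zetaE x Z : good x -> xi Z -> Z x -> Z = zeta (code x).
by move=> gx xZ Zx; rewrite (good_codeE (i := enumx Z) gx) zetaE.
Qed.
Lemma good_regular x : good x -> regular_point T xi x.
move=> gx k; have gk := @goodT k _ gx.
exists (zeta (code (iter k T x))); split.
 by split; [exact: good_xi|exact: good_code].
by move=> Z [xZ Zx]; apply/esym; exact: good_zetaE.
Qed.
Lemma mcode i : measurable (letter code i).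
have -> : letter code i = (zeta i `\` \bigcup_(j in [set j | (j < i)%N]) zeta j) `|`
 (if i == 0%N then ~` (\bigcup_i zeta i) else set0).
 apply/seteqP; split=> x; rewrite /letter /= /code.
 case: pselect => [h|h].
 case: ex_minnP => j /asboolP zj jmin ji; left; rewrite -ji; split => // -[k kj].
 by move=> /asboolP /jmin; rewrite leqNgt kj.
 move=> <-; right; rewrite eqxx => -[j _ zj]; apply: h; exists j; exact/asboolP.
 case=> [[zi hi]|].
 case: pselect => [h|[]]; last by exists i; apply/asboolP.
 case: ex_minnP => j /asboolP zj jmin; apply/eqP; rewrite eqn_leq.
 rewrite jmin/=; last exact/asboolP.
 by rewrite leqNgt; apply/negP => ji; apply: hi; exists j.
 case: eqVneq => [->|]//= hx; case: pselect => [h|//].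
 by exfalso; case: h => j /asboolP zj; apply: hx; exists j.
apply: measurableU; last first.
 by case: ifP => // _; apply: measurableC; apply: bigcup_measurable => j _; exact: mzeta.
by apply: measurableD; [exact: mzeta|apply: bigcup_measurable => j _; exact: mzeta].
Qed.
Lemma letter_good i : letter code i `&` good = zeta i `&` good.
apply/seteqP; split=> x [h gx]; split=> //; first by rewrite -h; exact: good_code.
exact: good_codeE.
Qed.
Lemma pr_letterI i B : measurable B -> m (letter code i `&` B) = m (zeta i `&` B).
move=> mB; rewrite -(pr_full_inter _ mgood good0); last exact: measurableI (mcode _) _.
rewrite -[RHS](pr_full_inter _ mgood good0); last exact: measurableI (mzeta _) _.
by rewrite setIAC letter_good setIAC.
Qed.

Local Notation same := (same_word T code).
Local Notation saturated := (saturated T code).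

Lemma same_cell_sub k n x y : good x -> good y -> same k x y -> (n <= k)%N ->
 cell T xi n x `<=` cell T xi n y.
move=> gx gy s nk z [C [[Z [xZ ->]] Cx] Cz].
exists (\bigcap_(j < n) (iter j T @^-1` Z j)) => //; split; first by exists Z.
move=> j jn; have := Cx j jn; rewrite /=.
move=> /(good_zetaE (@goodT j _ gx) (xZ j jn)) ->.
rewrite s; last exact: leq_trans nk.
exact: good_code (@goodT j _ gy).
Qed.
Lemma same_cell k n x y : good x -> good y -> same k x y -> (n <= k)%N ->
 cell T xi n x = cell T xi n y.
move=> gx gy s nk; apply/seteqP; split; apply: (@same_cell_sub k) => //.
by move=> i ik; rewrite s.
Qed.
(** The cells of order up to [k] coincide, so the points separate at time [k.+1] at the earliest. *)
Lemma same_theta_dist k x y : good x -> good y -> same k x y ->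
 theta_dist T xi theta x y <= theta ^+ k.+1.
move=> gx gy s; have /andP[th0 th1] := htheta.
rewrite /theta_dist; have : ((k.+1%:R%:E : \bar R) <= separation_time T xi x y)%E.
 apply: le_ereal_inf_tmp => _ [n [n1 nE] <-].
 rewrite lee_fin ler_nat ltnNge; apply/negP => nk; apply: nE.
 exact: (same_cell gx gy s).
case: separation_time => [r||]; last side.
- rewrite lee_fin => kr; rewrite -powR_mulrn//.
 by apply: ger_powR; side.
- by [].
Qed.
Lemma lipschitz_lt W (g : X -> R) (a : R) x y :
 (lipschitz_const T xi theta W g < a%:E)%E -> W x -> W y -> good x -> good y ->
 `|g x-g y| <= a*theta_dist T xi theta x y.
move=> /ereal_inf_lt[_ [b [b0 hb] <-]]; rewrite lte_fin => ba Wx Wy gx gy.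
apply: (le_trans (hb x y Wx Wy (good_regular gx) (good_regular gy))).
rewrite ler_wpM2r ?(ltW ba)// /theta_dist; case: separation_time => // r.
Qed.

Lemma density_regular : exists (v : set X -> X -> R) (D : R),
 [/\ branch_density mu T xi v, 0 <= D &
 forall Z k x y, xi Z -> (T @` Z) x -> (T @` Z) y -> good x -> good y ->
 same k x y -> v Z x <= expR (D*theta ^+ k.+1)*v Z y].
case: hGM => _ _ _ [v [hv]].
set s := ereal_sup _ => slt.
have [D [D0 hD]] : exists D : R, 0 <= D /\ (s < D%:E)%E.
 case: s slt => [r||] // _; last by exists 0; rewrite ltNyr.
 by exists (Num.max 0 (r+1)); rewrite le_max lexx lte_fin lt_max ltrDl ltr01 orbT.
exists v, D; split => // Z k x y xZ TZx TZy gx gy sxy.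
have lt1 : (lipschitz_const T xi theta (T @` Z) (fun x => ln (v Z x)) < D%:E)%E by apply: le_lt_trans hD; apply: ereal_sup_ubound; exists Z.
have [_ vpos _] := hv Z xZ.
have h := lipschitz_lt lt1 TZx TZy gx gy.
have {}h : ln (v Z x)-ln (v Z y) <= D*theta ^+ k.+1.
 apply: (le_trans (ler_norm _)); apply: (le_trans h).
 by rewrite ler_wpM2l//; exact: same_theta_dist.
rewrite -[v Z x]lnK ?posrE ?vpos// -[v Z y]lnK ?posrE ?vpos// -expRD ler_expR.
lra.
Qed.
(** The pointwise comparison of [v Z x] with [v Z y] is integrated in [x] over [A1], then in [y]
    over [A2]. *)
Lemma gibbs_xi : exists D, 0 <= D /\ forall Z k A1 A2, xi Z -> measurable A1 -> measurable A2 ->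
 A1 `<=` T @` Z -> A2 `<=` T @` Z -> A1 `<=` good -> A2 `<=` good ->
 (forall x y, A1 x -> A2 y -> same k x y) ->
 m (Z `&` T @^-1` A1) * m A2 <= expR (D*theta ^+ k.+1) * (m (Z `&` T @^-1` A2) * m A1).
have [v [D [hv D0 hD]]] := density_regular; exists D; split => // Z k A1 A2 xZ mA1 mA2 A1Z A2Z g1 g2 sA.
have [mv vpos vint] := hv Z xZ.
have mI A : measurable A -> measurable (Z `&` T @^-1` A) by move=> mA; apply: measurableI; [side|exact: mpre].
have mvA A : measurable A -> A `<=` T @` Z -> measurable_fun A (v Z).
 move=> mA AZ; apply: measurable_funS mv => //; side.
set E := expR _.
have e1 y : A2 y -> m (Z `&` T @^-1` A1) <= E * m A1*v Z y.
 move=> A2y; rewrite -lee_fin -prE; last exact: mI.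
 rewrite vint//.
 apply: (@le_trans _ _ (\int[mu]_(x in A1) cst (E*v Z y)%:E x)%E).
 apply: ge0_le_integral => //=.
 - by move=> x A1x; rewrite lee_fin ltW// vpos//; exact: A1Z. move=> x A1x; rewrite lee_fin; apply: (hD Z k x y) => //.
 + exact: A1Z. + exact: A2Z. + exact: g1. + exact: g2. + exact: sA.
 by rewrite integral_cst// (prM mu)// -EFinM lee_fin mulrAC.
rewrite -lee_fin EFinM -(prM mu mA2) -(integral_cst mu mA2).
rewrite (mulrC (m (Z `&` _))) mulrA EFinM -(prE mu (mI _ mA2)).
rewrite vint// -ge0_integralZl//; first last.
- by rewrite lee_fin mulr_ge0 ?pr_ge0.
- by move=> x A2x; rewrite lee_fin ltW// vpos//; exact: A2Z.
apply: ge0_le_integral => //=.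
- by move=> x _; rewrite lee_fin pr_ge0.
- by apply: emeasurable_funM => //; side.
Qed.
Lemma sigma_xi_measurable : <<s xi >> `<=` @measurable _ X.
apply: generated_ind => [|A mA|F mF|Z /mxi//]; first side.
- side.
- exact: bigcup_measurable.
Qed.
(** The property passes to complements and countable unions, and cells have it because they are
    disjoint mod [mu]. *)
Lemma sigma_xi_dichotomy B : <<s xi >> B -> forall Z, xi Z ->
 m (Z `\` B) = 0 \/ m (Z `&` B) = 0.
have P : <<s xi >> `<=` [set B | measurable B /\ forall Z, xi Z -> m (Z `\` B) = 0 \/ m (Z `&` B) = 0].
 apply: generated_ind => [|A [mA hA]|F hF|Z xZ].
 - by split => // Z xZ; right; rewrite setI0 pr_set0.
 - split; first side.
 move=> Z xZ; case: (hA Z xZ); rewrite setDE ?setCK; by [right|left].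
 - split; first by apply: bigcup_measurable => i _; case: (hF i).
 move=> Z xZ; have [[n Fn]|h] := pselect (exists n, m (Z `\` F n) = 0).
 left; apply: pr_null_le Fn; last by move=> x [Zx h]; split => // Fx; apply: h; exists n.
 by apply: measurableD; [side|apply: bigcup_measurable => i _; case: (hF i)].
 by apply: measurableD; [side|case: (hF n)].
 right; rewrite setI_bigcupr; apply: pr_null_bigcup => n.
 by apply: measurableI; [side|case: (hF n)].
 by case: (hF n) => _ /(_ Z xZ) [] // Zn; exfalso; apply: h; exists n.
 - split; first side.
 move=> Z' xZ'; have [->|ZZ'] := pselect (Z' = Z); first by left; rewrite setDv pr_set0.
 by right; exact: disjxi.
by move=> /P [].
Qed.
(** This is the content of the Markov property: the image of a cell agrees mod [mu] with a set in
    the sigma-algebra generated by [xi]. *)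
Lemma image_dichotomy Z Z' : xi Z -> xi Z' ->
 m (Z' `\` T @` Z) = 0 \/ m (Z' `&` T @` Z) = 0.
move=> xZ xZ'; case: hGM => _ /(_ Z xZ) [B [sB B0]] _ _.
have mB := sigma_xi_measurable sB; have mTZZ := mTZ xZ; have mZ' := mxi xZ'.
have mS : measurable (T @` Z `+` B) by rewrite setYE; apply: measurableD; [exact: measurableU|exact: measurableI].
have {}B0 : m (T @` Z `+` B) = 0 by rewrite /pr B0.
have key A1 A2 : measurable A1 -> measurable A2 -> A1 `<=` A2 `|` (T @` Z `+` B) ->
 m A2 = 0 -> m A1 = 0.
 move=> mA1 mA2 s A20; apply: (@pr_null_le _ _ _ _ _ (A2 `|` (T @` Z `+` B))) => //.
 exact: pr_nullU.
case: (sigma_xi_dichotomy sB xZ') => [h|h]; [left|right]; apply: key h => //; try exact: measurableD; try exact: measurableI.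
- move=> x [Z'x nTZ]; have [Bx|nBx] := pselect (B x); [right; right|left]; by split.
- move=> x [Z'x TZx]; have [Bx|nBx] := pselect (B x); [left|right; left]; by split.
Qed.
Lemma pr_pre_null Z A A' : measurable Z -> measurable A -> measurable A' -> A' `<=` A ->
 m (A `\` A') = 0 -> m (Z `&` T @^-1` A) = m (Z `&` T @^-1` A').
move=> mZ mA mA' s A0.
have m1 := mpre mT mA; have m2 := mpre mT mA'.
apply: pr_mod_null; [side|side|by move=> x [? ?]; split => //; exact: s|].
apply: (@pr_null_le _ _ _ _ _ (T @^-1` (A `\` A'))).
- by [].
- by apply: mpre => //; side.
- by move=> x [[Zx Ax] h]; split => // A'x; apply: h; split.
- by rewrite presT//; side.
Qed.
(** The cylinder starts in the single cell [zeta (w 0)], which by the Markov property lies in the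
    image of [zeta i] or misses it, mod [mu]. In the first case [gibbs_xi] applies after removing
    null sets; in the second the left side vanishes. *)
Lemma code_gibbs : exists D : R, 0 <= D /\
 (forall i k w A1 A2, (0 < k)%N -> measurable A1 -> measurable A2 ->
 A1 `<=` cyl T code k w -> A2 `<=` cyl T code k w ->
 m (letter code i `&` T @^-1` A1) * m A2 <=
 expR (D*theta ^+ k) * (m (letter code i `&` T @^-1` A2) * m A1)).
have [D [D0 hD]] := gibbs_xi; exists D; split => // i k w A1 A2 k0 mA1 mA2 s1 s2.
have /andP[th0 th1] := htheta.
have mP1 := mpre mT mA1; have mP2 := mpre mT mA2; have mg := mgood.
rewrite !pr_letterI//.
have [z0|[xZ _]] := zeta_cases i.
 by rewrite z0 !set0I pr_set0 !mul0r mulr0.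
have mZ := mxi xZ; have mTZZ := mTZ xZ; have mzw := mzeta (w 0%N).
have [w0|[xW _]] := zeta_cases (w 0%N).
 have m0 A : measurable A -> A `<=` cyl T code k w -> m A = 0.
 move=> mA s; rewrite -(pr_full_inter mA mgood good0).
 rewrite (_ : A `&` good = set0) ?pr_set0//; apply/seteqP; split=> x //= [Ax gx].
 by have := good_code gx; rewrite (cyl_letter k0 (s x Ax)) w0.
 by rewrite (m0 A1)// (m0 A2)// !mulr0.
have [h|h] := image_dichotomy xZ xW.
 pose B A := A `&` (T @` zeta i) `&` good.
 have mBB A : measurable A -> measurable (B A).
 by move=> mA; apply: measurableI => //; exact: measurableI.
 have sB A : B A `<=` A by move=> x [[]].
 have B0 A : measurable A -> A `<=` cyl T code k w -> m (A `\` B A) = 0.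
 move=> mA s; apply: (@pr_null_le _ _ _ _ _ ((zeta (w 0%N) `\` T @` zeta i) `|` ~` good)).
 - by apply: measurableD => //; exact: mBB.
 - by apply: measurableU; [exact: measurableD|exact: measurableC].
 - move=> x [Ax hx]; have [gx|] := pselect (good x); last by right.
 left; split; first by rewrite -(cyl_letter k0 (s x Ax)); exact: good_code.
 by move=> Tx; apply: hx.
 - by apply: pr_nullU => //; exact: good0.
 rewrite (pr_pre_null mZ mA1 (mBB _ mA1) (@sB _) (B0 _ mA1 s1)).
 rewrite (pr_pre_null mZ mA2 (mBB _ mA2) (@sB _) (B0 _ mA2 s2)).
 rewrite (pr_mod_null mA1 (mBB _ mA1) (@sB _) (B0 _ mA1 s1)).
 rewrite (pr_mod_null mA2 (mBB _ mA2) (@sB _) (B0 _ mA2 s2)).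
 have := hD (zeta i) k (B A1) (B A2) xZ (mBB _ mA1) (mBB _ mA2).
 move/(_ ltac:(by move=> x [[]]) ltac:(by move=> x [[]]) ltac:(by move=> x []) ltac:(by move=> x [])).
 move=> h1; apply: (le_trans (h1 _)).
 by move=> x y [[/s1 c1 _] _] [[/s2 c2 _] _] j jk; rewrite c1// c2.
 rewrite ler_wpM2r ?mulr_ge0 ?pr_ge0// ler_expR ler_wpM2l//.
 by rewrite exprS ler_piMl ?exprn_ge0// ltW.
have -> : m (zeta i `&` T @^-1` A1) = 0.
 apply: (@pr_null_le _ _ _ _ _ (T @^-1` ((zeta (w 0%N) `&` T @` zeta i) `|` ~` good))).
 - exact: measurableI.
 - by apply: mpre => //; apply: measurableU.
 - move=> x [zx Ax]; have [gx|] := pselect (good (T x)); last by right.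
 left; split; first by rewrite -(cyl_letter k0 (s1 _ Ax)); exact: good_code.
 by exists x.
 - rewrite presT; last by apply: measurableU; [exact: measurableI|exact: measurableC].
 by apply: pr_nullU => //; exact: good0.
by rewrite mul0r mulr_ge0 ?expR_ge0// mulr_ge0 ?pr_ge0.
Qed.
(** Distortion with the empty word compares [A] inside the image of the branch with the whole image,
    whose measure is bounded below by the big image property. *)
Lemma code_big : exists K1 : R, 0 <= K1 /\ forall i A, measurable A ->
 m (letter code i `&` T @^-1` A) <= K1 * (m (letter code i) * m A).
have [D [D0 hD]] := gibbs_xi.
have [b [b0 hb]] : exists b : R, 0 < b /\ forall Z, xi Z -> b <= m (T @` Z).
 case: hGM => _ _ + _; rewrite /big_image_property; set s := ereal_inf _ => s0.
 have [b [b0 bs]] : exists b : R, 0 < b /\ (b%:E <= s)%E.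
 case: s s0 => [r||]//; first by rewrite lte_fin => r0; exists r.
 by move=> _; exists 1; rewrite leey.
 exists b; split => // Z xZ; rewrite -lee_fin -prE; last exact: mTZ.
 by apply: (le_trans bs); apply: ereal_inf_lbound; exists Z.
exists (expR (D*theta)/b); split; first by rewrite divr_ge0 ?expR_ge0// ltW.
move=> i A mA; have mTA := mpre mT mA; rewrite pr_letterI//.
rewrite (_ : m (letter code i) = m (zeta i)); last first.
 by rewrite -[letter code i]setIT pr_letterI// setIT.
have [z0|[xZ _]] := zeta_cases i; first by rewrite z0 set0I pr_set0 mul0r mulr0.
have mZ := mxi xZ; have mTZZ := mTZ xZ; have mg := mgood.
pose B := A `&` T @` zeta i `&` good; pose C := T @` zeta i `&` good.
have mB : measurable B by apply: measurableI => //; exact: measurableI.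
have mC : measurable C by exact: measurableI.
have mCE : m C = m (T @` zeta i) by rewrite pr_full_inter//; exact: good0.
have -> : m (zeta i `&` T @^-1` A) = m (zeta i `&` T @^-1` B).
 rewrite (_ : zeta i `&` T @^-1` A = zeta i `&` T @^-1` (A `&` T @` zeta i)); last first.
 by apply/seteqP; split=> x [zx] /=; [move=> Ax; split => //; split => //; exists x|by case].
 apply: pr_pre_null => //; try by move=> x [].
 apply: pr_null_le good0; try by side.
 by move=> x [Ax h] gx; apply: h.
have h := hD (zeta i) 0%N B C xZ mB mC _ _ _ _ _.
have {}h : m (zeta i `&` T @^-1` B) * m C <= expR (D*theta ^+ 1) * (m (zeta i `&` T @^-1` C) * m B).
 by apply: h => // x; [move=> [[]]|move=> []|move=> []|move=> []].
rewrite mulrAC ler_pdivlMr//.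
have p0 := pr_ge0 mu (zeta i `&` T @^-1` B).
apply: (@le_trans _ _ (m (zeta i `&` T @^-1` B) * m C)).
 by rewrite ler_wpM2l// mCE hb.
apply: (le_trans h); rewrite expr1 ler_wpM2l ?expR_ge0// ler_pM ?pr_ge0//.
- by apply: pr_le => //; apply: measurableI => //; exact: mpre.
- by apply: pr_le => // x [[]].
Qed.

Lemma saturated_le k k' S : (k <= k')%N -> saturated k S -> saturated k' S.
by move=> kk' sS x y sxy; apply: sS => i ik; rewrite sxy// (leq_trans ik). Qed.
Definition apprble (A : set X) : Prop := measurable A /\
 forall e : R, 0 < e -> exists k S, [/\ measurable S, saturated k S & m (A `+` S) < e].

Let msym (A B : set X) : measurable A -> measurable B -> measurable (A `+` B).
by move=> mA mB; rewrite setYE; side.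
Qed.
Lemma approximable_null A B : measurable A -> apprble B -> m (A `+` B) = 0 -> apprble A.
move=> mA [mB hB] AB0; split => // e /hB[k [S [mS sS h]]]; exists k, S; split => //.
apply: le_lt_trans h; rewrite -[leRHS]add0r -AB0.
apply: le_trans (pr_subU mu (msym mA mB) (msym mB mS)); apply: pr_le.
- exact: msym.
- by [].
- rewrite /setY => x; have [Bx|Bx] := pselect (B x).
 by case=> [[Ax Sx]|[Sx Ax]]; [right; left|left; right].
 by case=> [[Ax Sx]|[Sx Ax]]; [left; left|right; right].
Qed.
Lemma approximableU A B : apprble A -> apprble B -> apprble (A `|` B).
move=> [mA hA] [mB hB]; split => [|e e0]; first side.
have e20 : 0 < e/2 by [].
have [k [S [mS sS h]]] := hA _ e20; have [k' [S' [mS' sS' h']]] := hB _ e20.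
exists (maxn k k'), (S `|` S'); split; first side.
 by move=> x y sxy [Sx|Sx]; [left|right];
 [apply: (saturated_le (leq_maxl k k') sS sxy)|apply: (saturated_le (leq_maxr k k') sS' sxy)].
rewrite (splitr e); apply: le_lt_trans (ltrD h h').
apply: le_trans (pr_subU mu (msym mA mS) (msym mB mS')); apply: pr_le => //; try side.
- by apply: msym; side.
- rewrite /setY => x [[[Ax|Bx] nS]|[[Sx|S'x] nA]].
 + by left; left; split => // Sx; apply: nS; left.
 + by right; left; split => // Sx; apply: nS; right.
 + by left; right; split => // Ax; apply: nA; left.
 + by right; right; split => // Bx; apply: nA; right.
Qed.
Lemma approximable0 : apprble set0.
split => // e e0; exists 0%N, set0; split => //.
by rewrite /setY setD0 setU0 pr_set0.
Qed.
Lemma approximable_bigcup (F : nat -> set X) : (forall n, apprble (F n)) ->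
 apprble (\bigcup_n F n).
move=> hF; have mF n : measurable (F n) by case: (hF n).
have mU : measurable (\bigcup_n F n) by exact: bigcup_measurable.
split => // e e0; pose G n := \big[setU/set0]_(i < n) F i.
have aG n : apprble (G n).
 elim: n => [|n IH]; rewrite /G ?big_ord0 ?big_ord_recr/=; first exact: approximable0.
 exact: approximableU.
have mG n : measurable (G n) by case: (aG n).
have GU : \bigcup_n G n = \bigcup_n F n.
 apply/seteqP; split=> x [n _].
 by rewrite /G -bigcup_mkord => -[i _ Fx]; exists i.
 by move=> Fx; exists n.+1 => //; rewrite /G -bigcup_mkord; exists n => /=.
have cG : m (G n) @[n --> \oo] --> m (\bigcup_n F n).
 have := @nondecreasing_cvg_mu _ _ _ mu G mG; rewrite GU => /(_ mU).
 have nd : {homo G : n m / (n <= m)%N >-> (n <= m)%O}.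
 move=> n p np; apply/subsetPset; rewrite /G -!bigcup_mkord => x [i ik Fx].
 by exists i => //=; exact: leq_trans np.
 by move=> /(_ nd); rewrite (prM mu mU) => /fine_cvg.
have e20 : 0 < e/2 by [].
have [N _ hN] := @cvgr_gt _ _ _ _ _ _ cG (m (\bigcup_n F n)-e/2) ltac:(by rewrite ltrBlDr ltrDl).
have {hN} := hN N (leqnn N) => hN.
have sG : G N `<=` \bigcup_n F n by rewrite -GU; exact: bigcup_sup.
have hD : m (\bigcup_n F n `\` G N) < e/2.
 have := prU mu (mG N) (measurableD mU (mG N)) (setDIK _ _).
 by rewrite setDUK//; lra.
have [_ /(_ _ e20) [k [S [mS sS hS]]]] := aG N.
exists k, S; split => //; rewrite (splitr e); apply: le_lt_trans (ltrD hD hS).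
apply: le_trans (pr_subU mu (measurableD mU (mG N)) (msym (mG N) mS)); apply: pr_le => //; try side.
- by apply: measurableU; [side|exact: msym].
- rewrite /setY => x [[Ux nS]|[Sx nU]].
 by have [Gx|Gx] := pselect (G N x); [right; left|left].
 by right; right; split => // Gx; apply: nU; exact: sG.
Qed.
Lemma approximableC A : apprble A -> apprble (~` A).
move=> [mA hA]; split => [|e /hA[k [S [mS sS h]]]]; first side.
exists k, (~` S); split; first side.
 move=> x y sxy nS Sy; apply: nS; apply: sS Sy => i ik; exact/esym/sxy.
by rewrite /setY !setDE !setCK setUC setIC [X in _ `|` X]setIC.
Qed.

(** The approximable sets are stable under complements, countable unions and null modifications, and
    contain the sets [T^-k Z], which generate the sigma-algebra mod [mu]. *)
Theorem measurable_approximable A : measurable A -> apprble A.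
move=> mA; case: hpi => _ _ /(_ A mA) [B [sB B0]] _ _.
suff aB : apprble B.
 by apply: approximable_null aB _ => //; rewrite /pr B0.
move: sB; apply: generated_ind => [|? ?|F hF|C [k [Z [xZ ->]]]].
- exact: approximable0.
- exact: approximableC.
- exact: approximable_bigcup.
have mZ := mxi xZ; have ml := mcode (enumx Z); have mg := mgood.
have mkZ := mpren mT k mZ; have mkl := mpren mT k ml.
apply: (@approximable_null _ (iter k T @^-1` letter code (enumx Z))) => //.
 split => // e e0; exists k.+1, (iter k T @^-1` letter code (enumx Z)); split => //.
 by move=> x y sxy; rewrite /letter => <-; exact/esym/sxy.
 by rewrite /setY setDv setU0 pr_set0.
apply: (@pr_null_le _ _ _ _ _ (iter k T @^-1` (~` good))).
- exact: msym.
- by apply: mpren => //; side.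
- rewrite /setY => x h gx; have := letter_good (enumx Z); rewrite zetaE// => E.
 case: h => [[h1 h2]|[h1 h2]]; apply: h2.
 suff : (letter code (enumx Z) `&` good) (iter k T x) by case.
 by rewrite E; split.
 suff : (Z `&` good) (iter k T x) by case.
 by rewrite -E; split.
- by rewrite presTn//; exact: good0.
Qed.
(** If [Z] were null, the positive density [v Z] would have integral zero over [T Z], whose measure
    is positive by the big image property. *)
Lemma xi_pos Z : xi Z -> 0 < m Z.
move=> xZ; rewrite lt_neqAle pr_ge0 andbT; apply/eqP => Z0.
have [v [D [hv _ _]]] := density_regular; have [mv vpos vint] := hv Z xZ.
have mZ := mxi xZ; have mTZZ := mTZ xZ; have mpZ := mpre mT mTZZ.
have b0 : (0 < mu (T @` Z))%E.
 case: hGM => _ _ b _; apply: (lt_le_trans b).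
 by apply: ereal_inf_lbound; exists Z.
suff : mu (T @` Z) = 0%E by move=> E; rewrite E ltxx in b0.
have i0 : (\int[mu]_(x in T @` Z) `|(v Z x)%:E|)%E = 0%E.
 transitivity (\int[mu]_(x in T @` Z) (v Z x)%:E)%E.
 by apply: eq_integral => x; rewrite inE => TZx; rewrite gee0_abs// lee_fin ltW// vpos.
 rewrite -vint// (prE mu); last exact: measurableI.
 by congr (_%:E); apply: (pr_null_le _ mZ _ (esym Z0)) => //; exact: measurableI.
have /ae_eq_integral_abs := i0; case=> // N [mN N0 hN].
apply/eqP; rewrite eq_le measure_ge0 andbT -N0; apply: le_measure; rewrite ?inE// => x TZx.
apply: hN => h; have := vpos x TZx; have := h TZx => -[->]; rewrite ltxx//.
Qed.

Section Observable.
Variable f : X -> R.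
Hypothesis mf : mfun X f.
Hypothesis hvartheta : exists C : R, \forall t \near +oo,
 (mu [set x | (t%:E < vartheta T xi theta f x)%E] <=
 C%:E * mu [set x | (t < `|f x|)%R])%E.

Local Notation lip Z := (lipschitz_const T xi theta Z f).

Lemma lip_ge0 Z : (0 <= lip Z)%E.
by apply: le_ereal_inf_tmp => _ [L [L0 _] <-]; side. Qed.
(** Written as a series over the numbers of the cells, [vartheta] is seen to be measurable. Cells
    are nonempty by [xi_pos], so [zeta] is injective on their numbers. *)
Lemma vartheta_sum x : vartheta T xi theta f x =
 \big[+%E/0%E]_(0 <= i <oo | i \in [pred i | `[< xi (zeta i) >]])
 (lip (zeta i) * (\1_(zeta i) x)%:E)%E.
rewrite nneseries_esum; last by move=> n _; rewrite mule_ge0 ?lip_ge0// lee_fin.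
rewrite /vartheta; apply: (@reindex_esum _ _ _ _ _ zeta).
split.
- by move=> i /=; rewrite unfold_in => /asboolP.
- move=> i j; rewrite !in_setE /= !unfold_in => /asboolP xi_ /asboolP xj E.
 have [z0|[_ <-]] := zeta_cases i.
 have := xi_pos xi_; rewrite z0 pr_set0 ltxx//.
 have [z0|[_ <-]] := zeta_cases j; last by rewrite E.
 have := xi_pos xj; rewrite z0 pr_set0 ltxx//.
- move=> Z xZ; exists (enumx Z); last by rewrite zetaE.
 by rewrite /= unfold_in; apply/asboolP; rewrite zetaE.
Qed.
Lemma measurable_vartheta : mfun X (vartheta T xi theta f).
rewrite (_ : vartheta T xi theta f = fun x =>
 \big[+%E/0%E]_(0 <= i <oo | i \in [pred i | `[< xi (zeta i) >]])
 (lip (zeta i) * (\1_(zeta i) x)%:E)%E); last by apply/funext => x; exact: vartheta_sum.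
apply: ge0_emeasurable_sum => [i x _ _|i _]; first by rewrite mule_ge0 ?lip_ge0// lee_fin.
apply: emeasurable_funM => //; apply/measurable_EFinP.
by apply: measurable_indic; exact: mzeta.
Qed.
Lemma vartheta_good x : good x -> vartheta T xi theta f x = lip (zeta (code x)).
move=> gx; rewrite /vartheta (esumID [set zeta (code x)]); last first.
 by move=> Z _; rewrite mule_ge0 ?lip_ge0// lee_fin.
rewrite [X in (_+X)%E]esum1; last first.
 move=> Z [xZ nZ]; rewrite indicE memNset ?mule0// => Zx; apply: nZ.
 exact: good_zetaE.
rewrite adde0 (_ : xi `&` _ = [set zeta (code x)]); last first.
 by apply/seteqP; split=> Z; [case|move=> ->; split => //; exact: good_xi].
rewrite esum_set1 ?mule_ge0 ?lip_ge0//.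
by rewrite indicE mem_set ?mule1//; exact: good_code.
Qed.
Definition osc i : R := fine (lip (zeta i)).

Lemma osc_ge0 i : 0 <= osc i.
by rewrite /osc fine_ge0// lip_ge0. Qed.
(** An infinite constant on [Z] would make [vartheta] infinite on a set of fixed positive measure,
    whereas its tail is bounded by that of [|f|], which tends to 0. *)
Lemma lip_fin Z : xi Z -> lip Z \is a fin_num.
move=> xZ; rewrite ge0_fin_numE ?lip_ge0// ltey; apply/eqP => E.
have Z0 := xi_pos xZ; case: hvartheta => C [t1 [_ ht1]].
have C1 : 0 < Num.max C 1 by rewrite lt_max ltr01 orbT.
have [t0 ht0] := pr_abs_tail0 mu mf (divr_gt0 Z0 C1).
pose t := Num.max t0 (t1+1).
have := ht1 t; have t1t : t1 < t by rewrite /t lt_max ltrDl ltr01 orbT.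
have mset : measurable [set x | (t%:E < vartheta T xi theta f x)%E] by rewrite -[X in measurable X]setTI; exact: emeasurable_fun_o_infty measurable_vartheta _.
have mft : measurable [set x | t < `|f x|] by apply: mset_gt; side.
rewrite !(prE mu)// -EFinM lee_fin => h.
have h2 : m Z <= m [set x | (t%:E < vartheta T xi theta f x)%E].
 rewrite -(pr_full_inter (mxi xZ) mgood good0); apply: pr_le => //.
 by apply: measurableI; [side|exact: mgood].
 move=> x [Zx gx] /=; rewrite vartheta_good// -(good_zetaE gx xZ Zx) E.
 by rewrite ltey.
have h3 : C * m [set x | t < `|f x|] <= Num.max C 1 * m [set x | t < `|f x|] by rewrite ler_wpM2r ?pr_ge0// le_max lexx.
have := ht0 t; rewrite /t le_max lexx => /(_ isT); rewrite -/t => h4.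
rewrite ltr_pdivlMr// mulrC in h4; clear E; lra.
Qed.
Lemma osc_lip k x y : (0 < k)%N -> good x -> good y -> same k x y ->
 `|f x-f y| <= osc (code x)*theta ^+ k.
move=> k0 gx gy sxy; have /andP[th0 th1] := htheta.
have h : `|f x-f y| <= osc (code x)*theta ^+ k.+1.
 apply/ler_addgt0Pr => e e0.
 have lt1 : (lip (zeta (code x)) < (osc (code x)+e)%:E)%E.
 rewrite EFinD /osc fineK; last exact: lip_fin (good_xi gx).
 by rewrite lteDl// lip_fin//; exact: good_xi.
 have zy : zeta (code x) y by have := good_code gy; rewrite -(sxy 0%N k0).
 apply: (le_trans (lipschitz_lt lt1 (good_code gx) zy gx gy)).
 apply: (@le_trans _ _ ((osc (code x)+e)*theta ^+ k.+1)).
 by rewrite ler_wpM2l ?addr_ge0 ?osc_ge0 ?(ltW e0)//; exact: same_theta_dist.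
 rewrite mulrDl lerD2l ler_piMr// exprn_ile1// ltW//.
apply: (le_trans h); rewrite ler_wpM2l ?osc_ge0// exprS ler_piMl// ltW//.
Qed.
Lemma osc_tail : exists C t0 : R, 0 <= C /\ forall t, t0 <= t ->
 m [set x | t < osc (code x)] <= C * m [set x | t < `|f x|].
case: hvartheta => C [t1 [_ ht1]]; exists (Num.max C 0), (t1+1); split.
 by rewrite le_max lexx orbT.
move=> t tt; have /ht1 h : t1 < t by rewrite (lt_le_trans _ tt)// ltrDl.
have mset : measurable [set x | (t%:E < vartheta T xi theta f x)%E] by rewrite -[X in measurable X]setTI; exact: emeasurable_fun_o_infty measurable_vartheta _.
have mft : measurable [set x | t < `|f x|] by apply: mset_gt; side.
move: h; rewrite !(prE mu)// -EFinM lee_fin => h.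
apply: (@le_trans _ _ (C * m [set x | t < `|f x|])); last first.
 by rewrite ler_wpM2r ?pr_ge0// le_max lexx.
apply: le_trans h; have mo : measurable [set x | t < osc (code x)].
 rewrite (_ : [set _ | _] = \bigcup_(i in [set i | t < osc i]) letter code i).
 by apply: bigcup_measurable => i _; exact: mcode.
 apply/seteqP; split=> x /=; first by exists (code x).
 by case=> i ti; rewrite /letter => ->.
rewrite -(pr_full_inter mo mgood good0); apply: pr_le => //.
 by apply: measurableI => //; exact: mgood.
move=> x [/= tx gx]; rewrite vartheta_good// -[lip _]fineK//.
by apply: lip_fin; exact: good_xi.
Qed.

End Observable.

End Coding.

(** * Bounded measurable functions and their expectations *)

Section BoundedMeasurable.
Context {d} {X : measurableType d} {R : realType}.
Variable mu : probability X R.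
Local Notation m := (pr mu).

Definition bmf (H : X -> R) : Prop :=
 mfun X H /\ exists M : R, forall x, `|H x| <= M.

Definition ex (H : X -> R) : R := \int[mu]_x H x.

Lemma bmf_measurable H : bmf H -> mfun X H.
by case. Qed.
Lemma bmf_int H : bmf H -> mu.-integrable setT (EFin \o H).
move=> [mH [M hM]]; apply: measurable_bounded_integrable => //.
 by rewrite (prM mu)// ltry.
exists M; split; first exact: num_real.
by move=> N MN x _; apply: (le_trans (hM x)); side.
Qed.
Lemma bmf_cst (r : R) : bmf (fun=> r).
by split => //; exists `|r|. Qed.
Lemma bmfD H G : bmf H -> bmf G -> bmf (fun x => H x+G x).
move=> [mH [M hM]] [mG [N hN]]; split; first side.
by exists (M+N) => x; rewrite (le_trans (ler_normD _ _))// lerD.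
Qed.
Lemma bmfM H G : bmf H -> bmf G -> bmf (fun x => H x*G x).
move=> [mH [M hM]] [mG [N hN]]; split; first side.
by exists (M*N) => x; rewrite normrM ler_pM.
Qed.
Lemma bmfZ r H : bmf H -> bmf (fun x => r*H x).
exact: bmfM (bmf_cst r). Qed.
Lemma bmfN H : bmf H -> bmf (fun x => - H x).
move=> [mH [M hM]]; split; first side.
by exists M => x; rewrite normrN.
Qed.
Lemma bmfB H G : bmf H -> bmf G -> bmf (fun x => H x-G x).
by move=> h g; apply: bmfD => //; exact: bmfN. Qed.
Lemma bmf_norm H : bmf H -> bmf (fun x => `|H x|).
move=> [mH [M hM]]; split; first side.
by exists M => x; rewrite normr_id.
Qed.
Lemma bmf_indic A : measurable A -> bmf (\1_A).
move=> mA; split; first side.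
by exists 1 => x; rewrite indicE; case: (_ \in _); rewrite ?normr1 ?normr0.
Qed.
Lemma bmf_sum I (s : seq I) (H : I -> X -> R) : (forall i, bmf (H i)) ->
 bmf (fun x => \sum_(i <- s) H i x).
move=> hH; elim: s => [|i s IH].
 by under [X in bmf X]funext do rewrite big_nil; exact: bmf_cst.
by under [X in bmf X]funext do rewrite big_cons; exact: bmfD.
Qed.
Lemma bmf_cos H : mfun X H -> bmf (fun x => cos (H x)).
move=> mH; split; first by apply: measurableT_comp => //; apply: continuous_measurable_fun; exact: continuous_cos.
by exists 1 => x; side.
Qed.
Lemma bmf_sin H : mfun X H -> bmf (fun x => sin (H x)).
move=> mH; split; first by apply: measurableT_comp => //; apply: continuous_measurable_fun; exact: continuous_sin.
by exists 1 => x; side.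
Qed.
Lemma bmf_min (H : X -> R) (r : R) : mfun X H -> (forall x, 0 <= H x) -> 0 <= r ->
 bmf (fun x => Num.min r (H x)).
move=> mH H0 r0; split; first exact: measurable_minr.
exists r => x; rewrite ger0_norm ?ge_min ?lexx//.
by rewrite le_min r0 H0.
Qed.
Lemma bmf_maxr H (r : R) : bmf H -> bmf (fun x => Num.max (H x) r).
move=> [mH [M hM]]; split; first exact: measurable_maxr.
exists (M + `|r|) => x; have := hM x; rewrite ler_norml => /andP[h1 h2].
have := ler_norm r; have := normr_ge0 r; have := ler_norm (- r); rewrite normrN => h3 h4 h5.
by rewrite maxEle; case: ifP => _; rewrite ler_norml; lra.
Qed.
Lemma exD H G : bmf H -> bmf G -> ex (fun x => H x+G x) = ex H+ex G.
by move=> h g; rewrite /ex RintegralD//; exact: bmf_int. Qed.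
Lemma exB H G : bmf H -> bmf G -> ex (fun x => H x-G x) = ex H-ex G.
by move=> h g; rewrite /ex RintegralB//; exact: bmf_int. Qed.
Lemma exZ r H : bmf H -> ex (fun x => r*H x) = r*ex H.
by move=> h; rewrite /ex RintegralZl//; exact: bmf_int. Qed.
Lemma exZr r H : bmf H -> ex (fun x => H x*r) = ex H*r.
by move=> h; rewrite /ex RintegralZr//; exact: bmf_int. Qed.
Lemma ex_cst r : ex (fun=> r) = r.
by rewrite /ex Rintegral_cst//= -/(pr mu setT) pr_setT mulr1. Qed.
Lemma ex_le H G : bmf H -> bmf G -> (forall x, H x <= G x) -> ex H <= ex G.
by move=> h g hg; apply: le_Rintegral => //; exact: bmf_int. Qed.
Lemma ex_ge0 H : (forall x, 0 <= H x) -> 0 <= ex H.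
by move=> h; apply: Rintegral_ge0. Qed.
Lemma ex_abs H : bmf H -> `|ex H| <= ex (fun x => `|H x|).
by move=> h; apply: le_normr_Rintegral => //; exact: bmf_int. Qed.
Lemma ex_eq H G : (forall x, H x = G x) -> ex H = ex G.
by move=> h; congr ex; apply/funext. Qed.
Lemma ex_indic A : measurable A -> ex (\1_A) = m A.
by move=> mA; rewrite /ex /Rintegral integral_indic// setIT.
Qed.
Lemma ex_abs_le H G : bmf H -> bmf G -> (forall x, `|H x| <= G x) -> `|ex H| <= ex G.
by move=> h g hg; rewrite (le_trans (ex_abs h))// ex_le//; exact: bmf_norm. Qed.
Lemma ex_sum I (s : seq I) (H : I -> X -> R) : (forall i, bmf (H i)) ->
 ex (fun x => \sum_(i <- s) H i x) = \sum_(i <- s) ex (H i).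
move=> hH; elim: s => [|i s IH].
 by rewrite big_nil -[RHS](ex_cst 0); apply: ex_eq => x; rewrite big_nil.
rewrite big_cons -IH -exD//; last exact: bmf_sum.
by apply: ex_eq => x; rewrite big_cons.
Qed.
Lemma ex_bound H M : bmf H -> (forall x, `|H x| <= M) -> `|ex H| <= M.
move=> h hM; apply: (le_trans (ex_abs_le h (bmf_cst M) hM)); by rewrite ex_cst.
Qed.
Definition lvset (H : X -> R) (a e : R) : set X := [set x | a <= H x < a+e].

Lemma mlevel H a e : mfun X H -> measurable (lvset H a e).
move=> mH; rewrite (_ : lvset _ _ _ = [set x | a <= H x] `\` [set x | a+e <= H x]).
 by apply: measurableD; exact: mset_ge.
apply/seteqP; split=> x; rewrite /lvset /=.
 by lra.
by lra.
Qed.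
(** Rounds [H] down to the grid of mesh [e] started at [b]: a finite combination of indicators of
    level sets, through which statements on sets pass to functions. *)
Definition quant (H : X -> R) (b e : R) (N : nat) (x : X) : R :=
 \sum_(i < N) (b + i%:R*e) * \1_(lvset H (b + i%:R*e) e) x.

Lemma quant_near H b M e : 0 < e -> (forall x, b <= H x) -> (forall x, H x <= M) ->
 exists N, forall x, `|H x-quant H b e N x| <= e.
move=> e0 hb hM; pose N := (Num.truncn ((M-b)/e)).+1; exists N => x.
have h1 := hb x; have h2 := hM x.
pose k := Num.truncn ((H x-b)/e).
have k0 : 0 <= (H x-b)/e by rewrite divr_ge0; lra.
have kN : (k < N)%N by rewrite /N ltnS /k; apply: le_truncn; rewrite ler_pM2r//; lra.
have /andP[k1 k2] := truncn_itv k0; rewrite -/k in k1 k2.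
rewrite ler_pdivlMr in k1; rewrite ltr_pdivrMr// -natr1 in k2.
have inl i : (x \in lvset H (b + i%:R*e) e) = (i == k).
 apply/idP/eqP => [|->].
 rewrite inE /lvset => /andP[h3 h4]; rewrite /k; apply/esym/truncn_def.
 by rewrite ler_pdivlMr// ltr_pdivrMr// -natr1; lra.
 by rewrite inE /lvset /=; lra.
rewrite /quant (bigD1 (Ordinal kN))//= big1.
 by rewrite indicE inl eqxx mulr1 ler_norml; lra.
move=> i ik; rewrite indicE inl (_ : (_ == _) = false) ?mulr0//.
by apply/negbTE; side.
Qed.
Lemma bmf_quant H b e N : mfun X H -> bmf (quant H b e N).
move=> mH; apply: bmf_sum => i; apply: bmfZ; apply: bmf_indic; exact: mlevel.
Qed.
Lemma ex_quant_mul H b e N G : mfun X H -> bmf G ->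
 ex (fun x => quant H b e N x*G x) =
 \sum_(i < N) (b + i%:R*e)*ex (fun x => \1_(lvset H (b + i%:R*e) e) x*G x).
move=> mH bG.
have bI (i : 'I_N) : bmf (fun x => \1_(lvset H (b + i%:R*e) e) x*G x) by apply: bmfM => //; apply: bmf_indic; exact: mlevel.
transitivity (\sum_(i < N) ex (fun x => (b + i%:R*e) * (\1_(lvset H (b + i%:R*e) e) x*G x))).
 rewrite -ex_sum; last by move=> i; exact: bmfZ.
 by apply: ex_eq => x; rewrite /quant mulr_suml; apply: eq_bigr => i _; rewrite mulrA.
by apply: eq_bigr => i _; rewrite exZ.
Qed.
Lemma ex_quant_near H b e N G C : bmf H -> bmf G -> (forall x, `|H x-quant H b e N x| <= e) ->
 (forall x, `|G x| <= C) ->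
 `|ex (fun x => H x*G x)-ex (fun x => quant H b e N x*G x)| <= e*C.
move=> bH bG hq hG; have bq : bmf (quant H b e N) by apply: bmf_quant; case: bH.
rewrite -exB; [|exact: bmfM|exact: bmfM]; apply: ex_bound.
 by apply: bmfB; exact: bmfM.
by move=> x; rewrite -mulrBl normrM ler_pM.
Qed.

(* An inequality between weighted expectations may be tested on level sets. *)
Lemma level_le H K1 K2 : bmf H -> bmf K1 -> bmf K2 -> (forall x, 0 <= H x) ->
 (forall a e, ex (fun x => \1_(lvset H a e) x*K1 x) <=
 ex (fun x => \1_(lvset H a e) x*K2 x)) ->
 ex (fun x => H x*K1 x) <= ex (fun x => H x*K2 x).
move=> bH bK1 bK2 H0 hlev; have [mH [M hM]] := bH.
have [C1 hC1] := bK1.2; have [C2 hC2] := bK2.2.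
apply/ler_addgt0Pr => e e0.
pose e' := e / (`|C1| + `|C2| + 1).
have e'0 : 0 < e' by rewrite divr_gt0.
have hM' x : H x <= M by apply: le_trans (hM x); exact: ler_norm.
have [N hN] := quant_near e'0 H0 hM'.
have q1 := ex_quant_near bH bK1 hN hC1; have q2 := ex_quant_near bH bK2 hN hC2.
have qq : ex (fun x => quant H 0 e' N x*K1 x) <= ex (fun x => quant H 0 e' N x*K2 x).
 rewrite !ex_quant_mul//; apply: ler_sum => i _.
 by rewrite ler_wpM2l// add0r.
have ee : e'*C1+e'*C2 <= e.
 have eE : e = e' * `|C1| + e' * `|C2| + e' by rewrite /e' -!mulrDr; field; side.
 have := ler_norm C1; have := ler_norm C2.
 move=> /(ler_wpM2l (ltW e'0)) a1 /(ler_wpM2l (ltW e'0)) a2; lra.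
move: q1 q2; rewrite !ler_norml => /andP[a1 a2] /andP[a3 a4]; lra.
Qed.
(** The counterpart of [level_le] for identities, where [H] may change sign. *)
Lemma level_eq H K1 K2 : bmf H -> bmf K1 -> bmf K2 ->
 (forall a e, ex (fun x => \1_(lvset H a e) x*K1 x) =
 ex (fun x => \1_(lvset H a e) x*K2 x)) ->
 ex (fun x => H x*K1 x) = ex (fun x => H x*K2 x).
move=> bH bK1 bK2 hlev; have [mH [M hM]] := bH.
have [C1 hC1] := bK1.2; have [C2 hC2] := bK2.2.
apply/eqP; rewrite -subr_eq0 -normr_le0; apply/ler_addgt0Pr => e e0; rewrite add0r.
pose e' := e / (`|C1| + `|C2| + 1).
have e'0 : 0 < e' by rewrite divr_gt0.
have hM' x : H x <= M by apply: le_trans (hM x); exact: ler_norm.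
have hm x : - M <= H x by have := hM x; rewrite ler_norml => /andP[].
have [N hN] := quant_near e'0 hm hM'.
have q1 := ex_quant_near bH bK1 hN hC1; have q2 := ex_quant_near bH bK2 hN hC2.
have qq : ex (fun x => quant H (- M) e' N x*K1 x) = ex (fun x => quant H (- M) e' N x*K2 x) by rewrite !ex_quant_mul//; apply: eq_bigr => i _; rewrite hlev.
have ee : e'*C1+e'*C2 <= e.
 have eE : e = e' * `|C1| + e' * `|C2| + e' by rewrite /e' -!mulrDr; field; side.
 have := ler_norm C1; have := ler_norm C2.
 move=> /(ler_wpM2l (ltW e'0)) a1 /(ler_wpM2l (ltW e'0)) a2; lra.
move: q1 q2; rewrite !ler_norml => /andP[a1 a2] /andP[a3 a4]; lra.
Qed.
Lemma bmf_comp (T : X -> X) H : mfun X T -> bmf H -> bmf (fun x => H (T x)).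
move=> mT [mH [M hM]]; split; first exact: measurableT_comp.
by exists M.
Qed.
Lemma ex_indicM A B : measurable A -> measurable B ->
 ex (fun x => \1_A x * \1_B x) = m (A `&` B).
move=> mA mB; rewrite -ex_indic; last side.
by apply: ex_eq => x; rewrite !indicE in_setI; case: (x \in A); case: (x \in B); rewrite ?mulr1 ?mulr0.
Qed.

End BoundedMeasurable.

(** * Expectations under measure preserving maps and equal laws *)

Section MeasurePreserving.
Context {d} {X : measurableType d} {R : realType}.
Variables (mu : probability X R) (T : X -> X).
Local Notation m := (pr mu).
Hypotheses (mT : mfun X T) (presT : forall A, measurable A -> m (T @^-1` A) = m A).

Lemma iter_measurable n : mfun X (iter n T).
elim: n => [|n IH]; first side.
rewrite (_ : iter n.+1 T = T \o iter n T)//; exact: measurableT_comp.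
Qed.
Lemma bmf_iter n (H : X -> R) : bmf H -> bmf (fun x => H (iter n T x)).
by apply: bmf_comp; exact: iter_measurable. Qed.

End MeasurePreserving.

Section SameLaw.
Context {R : realType} {d1 d2 d3 : measure_display}.
Context {X1 : measurableType d1} {X2 : measurableType d2} {S : measurableType d3}.
Variables (m1 : probability X1 R) (m2 : probability X2 R).
Variables (Y1 : X1 -> S) (Y2 : X2 -> S).

Lemma ex_same_law (h : S -> R) : mfun X1 Y1 -> mfun X2 Y2 ->
 (forall V, measurable V -> m1 (Y1 @^-1` V) = m2 (Y2 @^-1` V)) -> bmf h ->
 ex m1 (h \o Y1) = ex m2 (h \o Y2).
move=> mY1 mY2 E bh.
have b1 : bmf (h \o Y1).
 by case: bh => mh [M hM]; split; [exact: measurableT_comp|exists M => x; exact: hM].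
have b2 : bmf (h \o Y2).
 by case: bh => mh [M hM]; split; [exact: measurableT_comp|exists M => x; exact: hM].
have mh : mfun S (EFin \o h) by apply/measurable_EFinP; case: bh.
rewrite /ex /Rintegral; congr fine.
rewrite -[LHS](@integral_pushforward _ _ _ _ _ _ mY1 m1 setT (EFin \o h))//; last exact: bmf_int.
rewrite -[RHS](@integral_pushforward _ _ _ _ _ _ mY2 m2 setT (EFin \o h))//; last exact: bmf_int.
by apply: eq_measure_integral => A mA _; exact: E.
Qed.

End SameLaw.

Section Invariance.
Context {d} {X : measurableType d} {R : realType}.
Variables (mu : probability X R) (T : X -> X).
Hypotheses (mT : mfun X T) (presT : forall A, measurable A -> pr mu (T @^-1` A) = pr mu A).

Lemma ex_iter n (H : X -> R) : bmf H -> ex mu (fun x => H (iter n T x)) = ex mu H.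
move=> bH; apply: (@ex_same_law _ _ _ _ _ _ _ mu mu (iter n T) idfun) => //; [exact: iter_measurable|move=> A mA].
by rewrite !prE//; [rewrite presTn|exact: mpren].
Qed.

End Invariance.

Ltac bmft := lazymatch goal with
 | |- bmf (fun x => @?f x + - @?g x) => apply: bmfB; bmft
 | |- bmf (fun x => @?f x + @?g x) => apply: bmfD; bmft
 | |- bmf (fun x => @?f x * @?g x) => first [apply: bmfZ; bmft | apply: bmfM; bmft]
 | |- bmf (fun x => - @?f x) => apply: bmfN; bmft
 | |- bmf (fun x => `|@?f x|) => apply: bmf_norm; bmft
 | |- bmf (fun x => cos (@?f x)) => apply: bmf_cos; meas
 | |- bmf (fun x => sin (@?f x)) => apply: bmf_sin; meas
 | |- bmf (fun x => bigop _ _ _) => apply: bmf_sum => *; bmft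
 | |- bmf _ => first [assumption | match goal with H : context [@bmf] |- _ => solve [apply: H => *; assumption] end | apply: bmf_cst | apply: bmf_indic; meas]
 end.
Ltac mset ::= apply: mset_gt; meas.
Ltac extra ::= bmft.
#[local] Hint Extern 0 (bmf _) => noevar bmft : core.

(** The form in which the decay of correlations is handed to the probabilistic part: psi-mixing of
    cylinders with constant [K] and rate [g]. *)
Record mixing_code {d} {X : measurableType d} {R : realType}
 (mu : probability X R) (T : X -> X) (c : X -> nat) (K g : R) : Prop := MixingCode {
 code_map : mfun X T ;
 code_pres : forall A, measurable A -> pr mu (T @^-1` A) = pr mu A ;
 code_letter : forall i, measurable (letter c i) ;
 code_K : 0 <= K ;
 code_g : 0 < g < 1 ;
 code_mix : forall k n w A, measurable A ->
 `|pr mu (cyl T c k w `&` iter (k+n) T @^-1` A)-pr mu (cyl T c k w) * pr mu A|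
 <= K*g ^+ n * (pr mu (cyl T c k w) * pr mu A) }.

(** * Mixing inequalities for functions of finitely many letters *)

Section Mixing.
Context {d} {X : measurableType d} {R : realType}.
Variables (mu : probability X R) (T : X -> X) (c : X -> nat) (K g : R).
Hypothesis hc : mixing_code mu T c K g.
Local Notation m := (pr mu).
Local Notation E := (ex mu).
Let mT := code_map hc.
Let presT := code_pres hc.

(** Words are numbered by [pickle], so that a saturated set becomes a countable disjoint union of
    cylinders. *)
Lemma saturated_cyl k S x : saturated T c k S -> S x ->
 S `&` [set y | pickle (mkseq (fun i => c (iter i T y)) k) =
 pickle (mkseq (fun i => c (iter i T x)) k)] =
 cyl T c k (fun i => c (iter i T x)).
move=> sS Sx; apply/seteqP; split=> y.
 move=> [_ /(pcan_inj pickleK) E] i ik.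
 by have := congr1 (fun s => nth 0%N s i) E; rewrite !nth_mkseq.
move=> h; split; first by apply: sS Sx => i ik; exact/esym/h.
congr pickle; apply: (@eq_from_nth _ 0%N); rewrite !size_mkseq// => i ik.
by rewrite !nth_mkseq// h.
Qed.

Let wordset k S i := S `&` [set y | pickle (mkseq (fun i => c (iter i T y)) k) = i].

Lemma wordset_cases k S i : saturated T c k S ->
 wordset k S i = set0 \/ exists w, wordset k S i = cyl T c k w.
move=> sS; have [[x [Sx xi]]|h] := pselect (exists x, S x /\
 pickle (mkseq (fun i => c (iter i T x)) k) = i).
 by right; eexists; rewrite /wordset -xi; exact: saturated_cyl sS Sx.
by left; apply/seteqP; split=> x // [Sx xi]; apply: h; exists x.
Qed.
Lemma msat k S : saturated T c k S -> measurable S.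
move=> sS; have -> : S = \bigcup_i wordset k S i.
 by apply/seteqP; split=> x; [move=> Sx; eexists => //; split|case=> i _ []].
apply: bigcup_measurable => i _; case: (wordset_cases i sS) => [->//|[w ->]].
by apply: mcyl => //; exact: code_letter hc.
Qed.
Lemma saturated_mix k n S B : saturated T c k S -> measurable B ->
 `|m (S `&` iter (k+n) T @^-1` B)-m S * m B| <= K*g ^+ n * (m S * m B).
move=> sS mB; have mS := msat sS.
have mcy w : measurable (cyl T c k w) by apply: mcyl => //; exact: code_letter hc.
have mW i : measurable (wordset k S i) by case: (wordset_cases i sS) => [->|[w ->]].
have mkB := mpren mT (k+n) mB.
have tW A : trivIset setT (fun i => wordset k S i `&` A).
 apply/trivIsetP => i j _ _ ij; apply/seteqP; split=> x //= -[[[_ xi] _] [[_ xj] _]].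
 by move: ij; rewrite -xi -xj eqxx.
have UW A : \bigcup_i (wordset k S i `&` A) = S `&` A by apply/seteqP; split=> x; [move=> [i _ [[Sx _] Ax]]; split|move=> [Sx Ax]; eexists => //; split => //; split].
have c1 := @pr_sigma _ _ _ mu _ (fun i => measurableI _ _ (mW i) mkB) (tW _).
rewrite UW in c1.
have c2 := @pr_sigma _ _ _ mu _ (fun i => measurableI _ _ (mW i) measurableT) (tW _).
rewrite UW setIT in c2.
have step N : `|(\sum_(i < N) m (wordset k S i `&` iter (k+n) T @^-1` B)) -
 (\sum_(i < N) m (wordset k S i `&` setT)) * m B|
 <= K*g ^+ n * ((\sum_(i < N) m (wordset k S i `&` setT)) * m B).
 rewrite !mulr_suml mulr_sumr -sumrB (le_trans (ler_norm_sum _ _ _))//.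
 apply: ler_sum => i _; rewrite setIT.
 case: (wordset_cases i sS) => [->|[w ->]]; last exact: (code_mix hc).
 by rewrite set0I pr_set0 mul0r subrr normr0 mulr0.
have c4 : K*g ^+ n * ((\sum_(i < N) m (wordset k S i `&` setT)) * m B) @[N --> \oo] -->
 K*g ^+ n * (m S * m B) by side.
have c5 : `|(\sum_(i < N) m (wordset k S i `&` iter (k+n) T @^-1` B)) -
 (\sum_(i < N) m (wordset k S i `&` setT)) * m B| @[N --> \oo] -->
 `|m (S `&` iter (k+n) T @^-1` B)-m S * m B| by apply: cvg_norm; side.
apply: (ler_cvg_to c5 c4).
by near=> N; side.
Unshelve. all: by end_near. Qed.
Definition word_fun k (H : X -> R) : Prop := forall x y, same_word T c k x y -> H x = H y.

Lemma word_fun_level k H a e : word_fun k H -> saturated T c k (lvset H a e).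
by move=> wH x y sxy; rewrite /lvset /= (wH _ _ sxy). Qed.
Lemma word_fun_measurable k H : word_fun k H -> mfun X H.
move=> wH _ B mB; rewrite setTI; apply: (@msat k) => x y sxy.
by rewrite /preimage /= (wH _ _ sxy).
Qed.

Section Bilinear.
Variables (k n : nat) (H G : X -> R).
Hypotheses (wH : word_fun k H) (bH : bmf H) (bG : bmf G).
Hypotheses (H0 : forall x, 0 <= H x) (G0 : forall x, 0 <= G x).
Let GT x := G (iter (k+n) T x).
Let bGT : bmf GT. Proof. exact: bmf_iter. Qed.
Let GT0 x : 0 <= GT x. Proof. exact: G0. Qed.
Lemma level_iter a e : lvset GT a e = iter (k+n) T @^-1` lvset G a e.
by []. Qed.
Lemma mix_set S : saturated T c k S ->
 `|E (fun x => GT x * \1_S x)-m S*E G| <= K*g ^+ n * (m S*E G).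
move=> sS; have mS := msat sS; have bS := @bmf_indic _ _ R _ mS.
have key a e : `|m (lvset GT a e `&` S)-m S * m (lvset GT a e)|
 <= K*g ^+ n * (m S * m (lvset GT a e)).
 have mL : measurable (lvset G a e) by apply: mlevel; case: bG.
 by rewrite level_iter presTn// setIC; exact: saturated_mix.
have mLT a e : measurable (lvset GT a e) by apply: mlevel; case: bGT.
have e1 r : E (fun x => GT x*r) = r*E G.
 by rewrite exZr// mulrC /GT ex_iter.
rewrite ler_norml; apply/andP; split.
 suff : E (fun x => GT x * ((1-K*g ^+ n) * m S)) <= E (fun x => GT x * \1_S x).
 by rewrite e1; lra.
 apply: level_le => // a e.
 rewrite exZr ?ex_indic ?ex_indicM//.
 by have := key a e; rewrite ler_norml => /andP[]; lra.
suff : E (fun x => GT x * \1_S x) <= E (fun x => GT x * ((1+K*g ^+ n) * m S)).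
 by rewrite e1; lra.
apply: level_le => // a e.
rewrite exZr ?ex_indic ?ex_indicM//.
by have := key a e; rewrite ler_norml => /andP[]; lra.
Qed.
(** A second passage to level sets: [mix_set] has treated those of the late factor [G], here those
    of [H] are used, which are saturated. *)
Lemma mix_ge0 : `|E (fun x => H x*GT x)-E H*E G| <= K*g ^+ n * (E H*E G).
have mL a e : measurable (lvset H a e) by apply: mlevel; case: bH.
have e1 r : E (fun x => H x*r) = r*E H by rewrite exZr// mulrC.
have key a e := mix_set (@word_fun_level k H a e wH).
have comm a e : E (fun x => GT x * \1_(lvset H a e) x) = E (fun x => \1_(lvset H a e) x*GT x).
 by apply: ex_eq => x; rewrite mulrC.
rewrite ler_norml; apply/andP; split.
 suff : E (fun x => H x * ((1-K*g ^+ n)*E G)) <= E (fun x => H x*GT x).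
 by rewrite e1; lra.
 apply: level_le => // a e.
 rewrite exZr ?ex_indic//.
 by have := key a e; rewrite comm ler_norml => /andP[]; lra.
suff : E (fun x => H x*GT x) <= E (fun x => H x * ((1+K*g ^+ n)*E G)).
 by rewrite e1; lra.
apply: level_le => // a e.
rewrite exZr ?ex_indic//.
by have := key a e; rewrite comm ler_norml => /andP[]; lra.
Qed.

End Bilinear.

(** Without a gap, independence survives as an upper bound up to the factor [1 + K]. This controls
    all error terms and the events after a first entrance. *)
Lemma mix_ub k H G : word_fun k H -> bmf H -> bmf G ->
 (forall x, 0 <= H x) -> (forall x, 0 <= G x) ->
 E (fun x => H x*G (iter k T x)) <= (1+K) * (E H*E G).
move=> wH bH bG H0 G0; have := @mix_ge0 k 0 H G wH bH bG H0 G0.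
by rewrite addn0 expr0 mulr1 ler_norml => /andP[]; lra.
Qed.

Let pos (H : X -> R) x := Num.max (H x) 0.

Lemma pos_split (r : R) : r = Num.max r 0-Num.max (- r) 0.
by case: (lerP r 0) => [r0|r0]; [rewrite max_l|rewrite max_r]; lra. Qed.
Lemma abs_split (r : R) : `|r| = Num.max r 0+Num.max (- r) 0.
case: (lerP r 0) => [r0|r0]; first by rewrite max_l ?oppr_ge0// ler0_norm// add0r.
by rewrite max_r ?oppr_le0// gtr0_norm// addr0.
Qed.
(** Positive and negative parts reduce the claim to [mix_ge0]. The error stays relative to both L1
    norms, which matters when [G] is small in mean. *)
Lemma mix_bound k n H G : word_fun k H -> bmf H -> bmf G ->
 `|E (fun x => H x*G (iter (k+n) T x))-E H*E G|
 <= K*g ^+ n * (E (fun x => `|H x|)*E (fun x => `|G x|)).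
move=> wH bH bG.
pose Hp x := Num.max (H x) 0; pose Hn x := Num.max (- H x) 0.
pose Gp x := Num.max (G x) 0; pose Gn x := Num.max (- G x) 0.
have bHp : bmf Hp by exact: bmf_maxr. have bHn : bmf Hn by apply: bmf_maxr; exact: bmfN.
have bGp : bmf Gp by exact: bmf_maxr. have bGn : bmf Gn by apply: bmf_maxr; exact: bmfN.
have Hp0 x : 0 <= Hp x by rewrite le_max lexx orbT.
have Hn0 x : 0 <= Hn x by rewrite le_max lexx orbT.
have Gp0 x : 0 <= Gp x by rewrite le_max lexx orbT.
have Gn0 x : 0 <= Gn x by rewrite le_max lexx orbT.
have wHp : word_fun k Hp by move=> x y sxy; rewrite /Hp (wH _ _ sxy).
have wHn : word_fun k Hn by move=> x y sxy; rewrite /Hn (wH _ _ sxy).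
have bi F : bmf F -> bmf (fun x => F (iter (k+n) T x)) by exact: bmf_iter.
have pp := mix_ge0 n wHp bHp bGp Hp0 Gp0; have pn := mix_ge0 n wHp bHp bGn Hp0 Gn0.
have np := mix_ge0 n wHn bHn bGp Hn0 Gp0; have nn := mix_ge0 n wHn bHn bGn Hn0 Gn0.
have EH : E H = E Hp-E Hn by rewrite -exB//; apply: ex_eq => x; exact: pos_split.
have EG : E G = E Gp-E Gn by rewrite -exB//; apply: ex_eq => x; exact: pos_split.
have EaH : E (fun x => `|H x|) = E Hp+E Hn by rewrite -exD//; apply: ex_eq => x; exact: abs_split.
have EaG : E (fun x => `|G x|) = E Gp+E Gn by rewrite -exD//; apply: ex_eq => x; exact: abs_split.
have EHG : E (fun x => H x*G (iter (k+n) T x)) =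
 (E (fun x => Hp x*Gp (iter (k+n) T x))-E (fun x => Hp x*Gn (iter (k+n) T x))) -
 (E (fun x => Hn x*Gp (iter (k+n) T x))-E (fun x => Hn x*Gn (iter (k+n) T x))).
 have bb F F' : bmf F -> bmf F' -> bmf (fun x => F x*F' (iter (k+n) T x)) by move=> bF bF'; apply: bmfM => //; exact: bi.
 rewrite -!exB; try by [exact: bb|apply: bmfB; exact: bb].
 apply: ex_eq => x; rewrite {1}(pos_split (H x)) {1}(pos_split (G (iter (k+n) T x))).
 by rewrite -/(Hp x) -/(Hn x) -/(Gp _) -/(Gn _); ring.
rewrite EH EG EaH EaG EHG; move: pp pn np nn.
set a1 := E (fun x => Hp x*Gp (iter (k+n) T x)); set a2 := E (fun x => Hp x*Gn (iter (k+n) T x)).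
set a3 := E (fun x => Hn x*Gp (iter (k+n) T x)); set a4 := E (fun x => Hn x*Gn (iter (k+n) T x)).
clearbody a1 a2 a3 a4; move: (E Hp) (E Hn) (E Gp) (E Gn) (K*g ^+ n) => p q r s t.
clear; rewrite !ler_norml => /andP[? ?] /andP[? ?] /andP[? ?] /andP[? ?]; lra.
Qed.

End Mixing.

(** * A real-valued modulus on complex numbers *)

Section ComplexNorm.
Context {R : realType}.
Implicit Types z w : R[i].
Local Notation Re := complex.Re.
Local Notation Im := complex.Im.

Lemma sqabs (r : R) : `|r| ^+ 2 = r ^+ 2.
by rewrite -normrX ger0_norm// sqr_ge0. Qed.
(** The modulus with values in [R]; the norm of [R[i]] takes its values in [R[i]]. *)
Definition cn z : R := Num.sqrt (Re z ^+ 2+Im z ^+ 2).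

Lemma cn_ge0 z : 0 <= cn z. Proof. exact: sqrtr_ge0. Qed.
Lemma cn_sqr z : cn z ^+ 2 = Re z ^+ 2+Im z ^+ 2.
by rewrite sqr_sqrtr// addr_ge0// sqr_ge0. Qed.
Lemma cnM z w : cn (z*w) = cn z*cn w.
rewrite /cn -sqrtrM ?addr_ge0 ?sqr_ge0//; congr Num.sqrt.
by case: z => a b; case: w => c e /=; ring.
Qed.
Lemma cn_Re z : `|Re z| <= cn z.
by rewrite /cn -sqrtr_sqr ler_wsqrtr// lerDl sqr_ge0. Qed.
Lemma cn_Im z : `|Im z| <= cn z.
by rewrite /cn -[`|_|]sqrtr_sqr ler_wsqrtr// lerDr sqr_ge0. Qed.
Lemma cn_le z : cn z <= `|Re z| + `|Im z|.
rewrite -(@ler_pXn2r _ 2) ?nnegrE ?cn_ge0//.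
rewrite cn_sqr sqrrD !sqabs; have := mulr_ge0 (normr_ge0 (Re z)) (normr_ge0 (Im z)); lra.
Qed.
Lemma cnD z w : cn (z+w) <= cn z+cn w.
rewrite -(@ler_pXn2r _ 2) ?nnegrE ?addr_ge0 ?cn_ge0//.
rewrite sqrrD !cn_sqr.
have h : Re z*Re w+Im z*Im w <= cn z*cn w.
 apply: (le_trans (ler_norm _)).
 rewrite -(@ler_pXn2r _ 2) ?nnegrE ?mulr_ge0 ?cn_ge0//.
 rewrite exprMn !cn_sqr sqabs; have := sqr_ge0 (Re z*Im w-Im z*Re w); lra.
case: z w h => a b [c e]; lra.
Qed.
Lemma cn0 : cn 0 = 0.
by rewrite /cn expr0n addr0 sqrtr0. Qed.
Lemma cn1 : cn 1 = 1.
by rewrite /cn expr0n expr1n addr0 sqrtr1. Qed.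
Lemma cnN z : cn (- z) = cn z.
by case: z => a b; rewrite /cn !sqrrN. Qed.
Lemma cnB z w : cn (z-w) <= cn z+cn w.
by rewrite (le_trans (cnD _ _))// cnN. Qed.
Lemma cnBC z w : cn (z-w) = cn (w-z).
by rewrite -cnN opprB. Qed.
Lemma cn_prod (I : Type) (s : seq I) (F : I -> R[i]) : (forall i, cn (F i) <= 1) ->
 cn (\prod_(i <- s) F i) <= 1.
move=> h; elim: s => [|i s IH]; first by rewrite big_nil cn1.
by rewrite big_cons cnM mulr_ile1 ?cn_ge0.
Qed.
Lemma cn_real (r : R) : cn (r%:C)%C = `|r|.
by rewrite /cn expr0n addr0 sqrtr_sqr. Qed.
Definition cis (t : R) : R[i] := (cos t +i* sin t)%C.

Lemma cisD s t : cis (s+t) = cis s*cis t.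
by rewrite /cis cosD sinD; apply/eqP; rewrite eq_complex /=; apply/andP; split; apply/eqP; ring. Qed.
Lemma cn_cis t : cn (cis t) = 1.
by rewrite /cn cos2Dsin2 sqrtr1. Qed.
Lemma cis0 : cis 0 = 1.
by rewrite /cis cos0 sin0. Qed.
(** The factors have modulus at most 1, so the errors of the single steps merely add up. *)
Lemma telescope_prod (a p : nat -> R[i]) (e : R) : a 0%N = 1 ->
 (forall k, cn (p k) <= 1) -> (forall k, cn (a k.+1-p k*a k) <= e) ->
 forall k, cn (a k - \prod_(j < k) p j) <= k%:R*e.
move=> a0 p1 h; elim=> [|k IH]; first by rewrite big_ord0 a0 subrr cn0 mul0r.
rewrite big_ord_recr /= -natr1 mulrDl mul1r [leRHS]addrC.
rewrite (_ : a k.+1 - _ = (a k.+1-p k*a k)+p k * (a k - \prod_(j < k) p j)); last by ring.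
apply: (le_trans (cnD _ _)); apply: lerD => //.
rewrite cnM (le_trans _ IH)// ler_piMl ?cn_ge0//.
Qed.

End ComplexNorm.

(** * Trigonometric inequalities, truncation at 2, sets of full measure *)

Section Lip1.
Context {R : realType}.

Lemma abs_sin_le (y : R) : `|sin y| <= `|y|.
have pos (x : R) : 0 <= x -> `|sin x| <= x.
 move=> x0; have [x1|x1] := leP x 1; last first.
 by apply: le_trans (ltW x1); side.
 move: x0; rewrite le_eqVlt => /orP[/eqP<-|x0]; first by rewrite sin0 normr0.
 have [c _ ] := @MVT R sin cos 0 x x0 (fun z _ => is_derive_sin z) (continuous_subspaceT (@continuous_sin R)).
 rewrite sin0 !subr0 => ->; rewrite normrM (gtr0_norm x0) ler_piMl//.
 by side.
have [y0|y0] := leP 0 y; first by rewrite (ger0_norm y0) pos.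
by rewrite -normrN -sinN (ltr0_norm y0) pos// oppr_ge0 ltW.
Qed.
Lemma cos_diff_le (u v : R) : `|cos u-cos v| <= `|u-v|.
have E : cos u-cos v = - 2*sin ((u+v)/2)*sin ((u-v)/2).
 have -> : cos u = cos ((u+v)/2 + (u-v)/2) by congr cos; lra.
 have -> : cos v = cos ((u+v)/2 - (u-v)/2) by congr cos; lra.
 by rewrite cosD cosB; ring.
have h1 : `|sin ((u+v)/2)| <= 1 by side.
have h2 := abs_sin_le ((u-v)/2).
rewrite E -mulrA normrM normrN (ger0_norm (ler0n R 2)) normrM.
have h3 : `|(u-v)/2| = `|u-v| / 2 by rewrite normrM [`|2^-1|]ger0_norm.
have h4 : `|sin ((u+v)/2)| * `|sin ((u-v)/2)| <= `|sin ((u-v)/2)| by rewrite ler_piMl.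
lra.
Qed.
Lemma sin_diff_le (u v : R) : `|sin u-sin v| <= `|u-v|.
rewrite -!cosBpihalf (le_trans (cos_diff_le _ _))//.
by rewrite (_ : u-pi/2 - _ = u-v); last by lra.
Qed.
Lemma cos_diff_min (u v : R) : `|cos u-cos v| <= Num.min 2 `|u-v|.
rewrite le_min cos_diff_le andbT.
have := cos_geN1 u; have := cos_le1 u; have := cos_geN1 v; have := cos_le1 v.
by move=> ? ? ? ?; rewrite ler_norml; lra.
Qed.
Lemma sin_diff_min (u v : R) : `|sin u-sin v| <= Num.min 2 `|u-v|.
rewrite le_min sin_diff_le andbT.
have := sin_geN1 u; have := sin_le1 u; have := sin_geN1 v; have := sin_le1 v.
by move=> ? ? ? ?; rewrite ler_norml; lra.
Qed.
Lemma min2D (u v : R) : 0 <= u -> 0 <= v -> Num.min 2 (u+v) <= Num.min 2 u+Num.min 2 v.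
by move=> u0 v0; rewrite !minEle; do ! case: ifPn => ?; lra. Qed.
Lemma min2_sum (I : Type) (s : seq I) (F : I -> R) : (forall i, 0 <= F i) ->
 Num.min 2 (\sum_(i <- s) F i) <= \sum_(i <- s) Num.min 2 (F i).
move=> F0; elim: s => [|i s IH]; first by rewrite !big_nil ge_min lexx orbT.
rewrite !big_cons (le_trans (min2D _ _)) ?sumr_ge0//.
by lra.
Qed.
Lemma min2_le (u v : R) : u <= v -> Num.min 2 u <= Num.min 2 v.
by move=> uv; rewrite le_min !ge_min lexx uv orbT. Qed.
Lemma min2_ge0 (u : R) : 0 <= u -> 0 <= Num.min 2 u.
by move=> u0; rewrite le_min u0 andbT. Qed.
Lemma powR_exprn (x a : R) n : 0 <= x -> (x ^+ n) `^ a = (x `^ a) ^+ n.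
move=> x0; elim: n => [|n IH]; first by rewrite !expr0 powR1.
by rewrite !exprS powRM// IH.
Qed.
Lemma geom_bound (r : R) k : 0 <= r < 1 -> \sum_(j < k) r ^+ (k-j) <= (1-r)^-1.
move=> /andP[r0 r1]; have q0 : 0 < 1-r by lra.
elim: k => [|k IH]; first by rewrite big_ord0 invr_ge0 ltW.
rewrite big_ord_recr /= subSn// subnn expr1.
rewrite (eq_bigr (fun j : 'I_k => r*r ^+ (k-j))); last first.
 by move=> j _; rewrite subSn ?exprS// ltnW.
rewrite -mulr_sumr.
have h1 : r * \sum_(i < k) r ^+ (k - i) <= r * (1-r)^-1 by rewrite ler_wpM2l.
have h2 : (1-r)^-1 = 1+r * (1-r)^-1 by field; side.
lra.
Qed.

End Lip1.

Section FullMeasure.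
Context {d} {X : measurableType d} {R : realType}.
Variables (mu : probability X R) (G : set X).
Hypotheses (mG : measurable G) (G0 : pr mu (~` G) = 0).

Lemma ex_full (H : X -> R) : bmf H -> ex mu H = ex mu (fun x => H x * \1_G x).
move=> bH; have bG : bmf (\1_G : X -> R) by exact: bmf_indic.
have [mH [M hM]] := bH.
apply/eqP; rewrite -subr_eq0 -exB//.
rewrite -normr_le0 (@le_trans _ _ (ex mu (fun x => M * \1_(~` G) x)))//; last first.
 by rewrite exZ// ex_indic ?G0; side.
apply: ex_abs_le; [side|side|move=> x].
rewrite !indicE in_setC; case: (x \in G) => /=; rewrite ?mulr1 ?mulr0 ?subrr ?normr0 ?subr0//.
Qed.
Lemma ex_le_full (H H' : X -> R) : bmf H -> bmf H' ->
 (forall x, G x -> H x <= H' x) -> ex mu H <= ex mu H'.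
move=> bH bH' h; rewrite ex_full// [leRHS]ex_full//.
apply: ex_le; [side|side|move=> x].
rewrite indicE; case: (boolP (x \in G)) => [|_]; last by rewrite !mulr0.
by rewrite inE !mulr1; exact: h.
Qed.

End FullMeasure.

(** The two moment bounds play the part of moments of order [kap]. The truncation at 2 matches the
    bound [|cos u - cos v| <= min(2, |u - v|)]. The bound on the Lipschitz constants [osc] serves to
    replace [f] by functions of finitely many letters. *)
Record tame_obs {d} {X : measurableType d} {R : realType}
 (mu : probability X R) (T : X -> X) (c : X -> nat) (f : X -> R)
 (G : set X) (osc : nat -> R) (theta kap M : R) : Prop := TameObs {
 obs_meas : mfun X f ;
 obs_mgood : measurable G ;
 obs_good0 : pr mu (~` G) = 0 ;
 obs_goodT : forall x, G x -> G (T x) ;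
 obs_theta : 0 < theta < 1 ;
 obs_osc0 : forall i, 0 <= osc i ;
 obs_osc : forall k x y, (0 < k)%N -> G x -> G y -> same_word T c k x y ->
 `|f x-f y| <= osc (c x)*theta ^+ k ;
 obs_kap : 0 < kap <= 1 ;
 obs_M : 0 <= M ;
 obs_mom : forall t, 0 <= t -> ex mu (fun x => Num.min 2 (t * `|f x|)) <= M*t `^ kap ;
 obs_mom_osc : forall t, 0 <= t ->
 ex mu (fun x => Num.min 2 (t*osc (c x))) <= M*t `^ kap }.

(** * Characteristic functions of weighted orbit sums nearly factorise *)

Section CharProduct.
Context {d} {X : measurableType d} {R : realType}.
Variables (mu : probability X R) (T : X -> X) (c : X -> nat) (K g : R).
Variables (f : X -> R) (G : set X) (osc : nat -> R) (theta kap M : R).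
Hypotheses (hc : mixing_code mu T c K g) (hf : tame_obs mu T c f G osc theta kap M).
Local Notation m := (pr mu).
Local Notation E := (ex mu).
Local Notation same := (same_word T c).
Let mT := code_map hc.
Let presT := code_pres hc.
Let mf := obs_meas hf.
Let mG := obs_mgood hf.
Let G0 := obs_good0 hf.

Lemma good_iter k x : G x -> G (iter k T x).
by move=> Gx; elim: k => //= k IH; exact: (obs_goodT hf). Qed.
Definition pick_val (P : set X) (h : X -> R) : R :=
 if pselect (exists y, P y) is left e then h (projT1 (cid e)) else 0.

(** Evaluates [h] at one good point chosen for the word of [x]. The choice depends on the word
    alone, so the result is a function of the first [k] letters. *)
Definition repv k (h : X -> R) x := pick_val [set y | G y /\ same k x y] h.

Lemma repv_word k h : word_fun T c k (repv k h).
move=> x y sxy; rewrite /repv; congr pick_val; apply/seteqP; split=> z [Gz s]; split=> // i ik.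
 by rewrite -sxy// s.
by rewrite sxy// s.
Qed.
Lemma repvP k h x : G x -> exists y, [/\ G y, same k x y & repv k h x = h y].
move=> Gx; rewrite /repv /pick_val; case: pselect => [e|[]]; last by exists x.
by case: (cid e) => y [Gy s]; exists y.
Qed.
Lemma repv_bound k h C x : 0 <= C -> (forall y, `|h y| <= C) -> `|repv k h x| <= C.
by move=> C0 hC; rewrite /repv /pick_val; case: pselect => // _; rewrite normr0. Qed.
Lemma repv_ge0 k h x : (forall y, 0 <= h y) -> 0 <= repv k h x.
by move=> h0; rewrite /repv /pick_val; case: pselect. Qed.
Lemma word_fun_le k k' (h : X -> R) : (k <= k')%N -> word_fun T c k h -> word_fun T c k' h.
by move=> kk' wh x y sxy; apply: wh => i ik; apply: sxy; exact: leq_trans kk'. Qed.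
Lemma word1_osc (h : nat -> R) : word_fun T c 1 (fun x => h (c x)).
by move=> x y /(_ 0%N isT) ->. Qed.
Lemma osc_measurable : mfun X (fun x => osc (c x)).
exact: (word_fun_measurable hc (word1_osc osc)). Qed.

Section Frequencies.
Variables (t : R) (a : nat -> R).
Hypotheses (t0 : 0 <= t) (hat : forall j, `|a j| <= t).

Definition psum k x : R := \sum_(j < k) a j*f (iter j T x).

Lemma psum_measurable k : mfun X (psum k).
apply: measurable_sum => j; apply: measurable_funM => //.
by apply: measurableT_comp => //; exact: iter_measurable.
Qed.
Lemma psum_split k n x :
 psum (k+n) x = psum k x + \sum_(j < n) a (k+j)*f (iter (k+j) T x).
by rewrite /psum big_split_ord. Qed.
Lemma psumS k x : psum k.+1 x = psum k x + a k*f (iter k T x).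
by rewrite /psum big_ord_recr. Qed.
(** On good points a majorant of [min(2, t |f|)]; it depends on the first letter only, so that
    mixing applies to it. *)
Definition fmaj x : R := Num.min 2 (t * (repv 1 (fun y => `|f y|) x + osc (c x))).

Lemma fmaj_word : word_fun T c 1 fmaj.
by move=> x y s; rewrite /fmaj (repv_word _ s); have := s 0%N isT => ->.
Qed.
Lemma fmaj_ge0 x : 0 <= fmaj x.
by rewrite min2_ge0// mulr_ge0// addr_ge0 ?(obs_osc0 hf)// repv_ge0. Qed.
Lemma bmf_word k (h : X -> R) C : word_fun T c k h -> (forall x, `|h x| <= C) -> bmf h.
by move=> wh hC; split; [exact: (word_fun_measurable hc wh)|exists C]. Qed.
Lemma bmf_min2 (h : X -> R) : mfun X h -> (forall x, 0 <= h x) ->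
 bmf (fun x => Num.min 2 (h x)).
by move=> mh h0; exact: bmf_min. Qed.
Lemma fmaj_bmf : bmf fmaj.
apply: (@bmf_word 1 _ 2); first exact: fmaj_word.
by move=> x; rewrite ger0_norm ?fmaj_ge0// ge_min lexx.
Qed.
Lemma fmaj_ub x : G x -> Num.min 2 (t * `|f x|) <= fmaj x.
move=> Gx; apply: min2_le; rewrite ler_wpM2l//.
have [y [Gy s ->]] := repvP 1 (fun y => `|f y|) Gx.
have := (obs_osc hf) 1%N x y isT Gx Gy s; rewrite expr1 => h.
have /andP[th0 th1] := obs_theta hf.
have : osc (c x)*theta <= osc (c x) by rewrite ler_piMr ?(obs_osc0 hf)// ltW.
have := ler_normB (f x) (f y); have := ler_normD (f x-f y) (f y).
rewrite subrK; lra.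
Qed.
Lemma fmaj_mean : E fmaj <= 3*M*t `^ kap.
have b1 : bmf (fun x => Num.min 2 (t * `|f x|)).
 apply: bmf_min2; last by move=> x; rewrite mulr_ge0.
 by [].
have b2 : bmf (fun x => Num.min 2 (t*osc (c x))).
 apply: bmf_min2; last by move=> x; rewrite mulr_ge0 ?(obs_osc0 hf).
 by apply: measurable_funM => //; exact: osc_measurable.
apply: (@le_trans _ _ (E (fun x => Num.min 2 (t * `|f x|)+2*Num.min 2 (t*osc (c x))))).
 apply: (ex_le_full mG G0) => [||x Gx]; [exact: fmaj_bmf|side|].
 have [y [Gy s E1]] := repvP 1 (fun y => `|f y|) Gx.
 rewrite /fmaj E1.
 have := (obs_osc hf) 1%N x y isT Gx Gy s; rewrite expr1 => h.
 have /andP[th0 th1] := obs_theta hf; have o0 := obs_osc0 hf (c x).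
 have h2 : osc (c x)*theta <= osc (c x) by rewrite ler_piMr// ltW.
 have h3 : `|f y| <= `|f x| + osc (c x) by have := ler_normD (f y-f x) (f x); rewrite subrK distrC; lra.
 apply: (@le_trans _ _ (Num.min 2 (t * `|f x| + (t*osc (c x)+t*osc (c x))))).
 by apply: min2_le; have := ler_wpM2l t0 h3; lra.
 have to0 : 0 <= t*osc (c x) by [].
 apply: (le_trans (min2D _ _)); rewrite//.
 by have := min2D to0 to0; lra.
rewrite exD//.
rewrite exZ//; have := obs_mom hf t0; have := obs_mom_osc hf t0; lra.
Qed.
Lemma correlate_word1 V H j k : word_fun T c 1 V -> bmf V -> (forall x, 0 <= V x) ->
 bmf H -> (j < k)%N ->
 E (fun x => V (iter j T x) * `|H (iter k T x)|) <= (1+K) * (E V*E (fun x => `|H x|)).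
move=> wV bV V0 bH jk; have bnH := bmf_norm bH.
have kj : (0 < k-j)%N by lia.
have -> : E (fun x => V (iter j T x) * `|H (iter k T x)|) = E (fun x => V x * `|H (iter (k-j) T x)|).
 have := ex_iter mT presT j (bmfM bV (bmf_norm (bmf_iter mT (k-j) bH))) => <-.
 by apply: ex_eq => x; rewrite -iterD subnK// ltnW.
apply: (mix_ub hc) => //; exact: word_fun_le wV.
Qed.

Section Phase.
Variable h : R -> R.
Hypotheses (mh : mfun R h) (h1 : forall u, `|h u| <= 1).
Hypothesis hmin : forall u v, `|h u-h v| <= Num.min 2 `|u-v|.

Lemma phase_bmf k : bmf (fun x => h (psum k x)).
split; first by apply: measurableT_comp => //; exact: psum_measurable.
by exists 1.
Qed.
(** The truncated uncertainty of a summand when [i] letters of its orbit are known. *)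
Definition oterm i x : R := Num.min 2 (t*theta ^+ i*osc (c x)).

Lemma oterm_ge0 i x : 0 <= oterm i x.
have /andP[th0 th1] := obs_theta hf.
by rewrite min2_ge0// !mulr_ge0 ?(obs_osc0 hf)// ltW.
Qed.
Lemma oterm_bmf i : bmf (oterm i).
apply: (@bmf_word 1 _ 2); first exact: (word1_osc (fun j => Num.min 2 (t*theta ^+ i*osc j))).
by move=> x; rewrite ger0_norm ?oterm_ge0// ge_min lexx.
Qed.
Lemma oterm_mean i : E (oterm i) <= M*t `^ kap * (theta `^ kap) ^+ i.
have /andP[th0 th1] := obs_theta hf.
apply: (le_trans (obs_mom_osc hf _)); first side.
by rewrite -mulrA ler_wpM2l ?(obs_M hf)// powRM ?powR_exprn.
Qed.
(** The price of replacing the phase of the sum up to [k] by a representative for the sum up to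
    [k']. Summands before [k'] cost their oscillation given the remaining letters, those in the gap
    their full size. *)
Definition werr k' k x : R :=
 \sum_(j < k') oterm (k'-j) (iter j T x) +
 \sum_(j < k-k') fmaj (iter (k'+j) T x).

Lemma werr_bmf k' k : bmf (werr k' k).
apply: bmfD; apply: bmf_sum => j; first exact: bmf_iter mT _ _ (oterm_bmf _).
exact: bmf_iter mT _ _ fmaj_bmf.
Qed.
Lemma psum_osc k x y : G x -> G y -> same k x y ->
 `|psum k x-psum k y| <= \sum_(j < k) t*theta ^+ (k-j)*osc (c (iter j T x)).
move=> Gx Gy s; rewrite /psum -sumrB (le_trans (ler_norm_sum _ _ _))//.
apply: ler_sum => j _; rewrite -mulrBr normrM -mulrA ler_pM//.
rewrite mulrC; apply: (obs_osc hf); [by rewrite subn_gt0|exact: good_iter|exact: good_iter|].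
by move=> i ik; rewrite -!iterD; apply: s; rewrite addnC -ltn_subRL.
Qed.
Lemma phase_werr k' k x : (k' <= k)%N -> G x ->
 `|h (psum k x)-repv k' (fun y => h (psum k' y)) x| <= werr k' k x.
move=> k'k Gx; have /andP[th0 th1] := obs_theta hf.
have [y [Gy s ->]] := repvP k' (fun y => h (psum k' y)) Gx.
apply: (le_trans (hmin _ _)).
have -> : psum k x = psum k' x + \sum_(j < k-k') a (k'+j)*f (iter (k'+j) T x) by rewrite -psum_split subnKC.
rewrite addrAC.
apply: (@le_trans _ _ (Num.min 2 (\sum_(j < k') t*theta ^+ (k'-j)*osc (c (iter j T x)) +
 \sum_(j < k-k') t * `|f (iter (k'+j) T x)|))).
 apply: min2_le; rewrite (le_trans (ler_normD _ _))// lerD ?psum_osc//.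
 rewrite (le_trans (ler_norm_sum _ _ _))// ler_sum// => j _.
 by rewrite normrM ler_wpM2r.
have n1 (j : 'I_k') : 0 <= t*theta ^+ (k'-j)*osc (c (iter j T x)) by rewrite !mulr_ge0 ?(obs_osc0 hf)// ltW.
apply: (le_trans (min2D _ _)); rewrite ?sumr_ge0//.
apply: lerD; first exact: min2_sum.
apply: (le_trans (min2_sum _ _)) => //; apply: ler_sum => j _.
by apply: fmaj_ub; exact: good_iter.
Qed.

Let r := theta `^ kap.
Let r01 : 0 <= r < 1.
have /andP[th0 th1] := obs_theta hf; have /andP[k0 k1] := obs_kap hf.
rewrite powR_ge0 /r.
by have := @gt0_ltr_powR _ kap k0 theta 1; rewrite !nnegrE powR1 (ltW th0) ler01; apply.
Qed.
Lemma werr_mean_aux k' k H : bmf H -> (k' <= k)%N ->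
 E (fun x => werr k' k x * `|H (iter k T x)|) <=
 (1+K) * (M * (1-r)^-1+3*M * (k-k')%:R)*t `^ kap*E (fun x => `|H x|).
move=> bH k'k; have bnH := bmf_norm (bmf_iter mT k bH).
have EH0 : 0 <= E (fun x => `|H x|) by apply: ex_ge0.
have K0 := code_K hc; have M0 := obs_M hf; have tk := powR_ge0 t kap.
have b1 (j : 'I_k') : bmf (fun x => oterm (k'-j) (iter j T x) * `|H (iter k T x)|) by apply: bmfM => //; exact: bmf_iter mT _ _ (oterm_bmf _).
have b2 (j : 'I_(k-k')) : bmf (fun x => fmaj (iter (k'+j) T x) * `|H (iter k T x)|) by apply: bmfM => //; exact: bmf_iter mT _ _ fmaj_bmf.
have -> : E (fun x => werr k' k x * `|H (iter k T x)|) =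
 \sum_(j < k') E (fun x => oterm (k'-j) (iter j T x) * `|H (iter k T x)|) +
 \sum_(j < k-k') E (fun x => fmaj (iter (k'+j) T x) * `|H (iter k T x)|).
 rewrite -!ex_sum// -exD; [|exact: bmf_sum|exact: bmf_sum].
 by apply: ex_eq => x; rewrite /werr mulrDl !mulr_suml.
have s1 : \sum_(j < k') E (fun x => oterm (k'-j) (iter j T x) * `|H (iter k T x)|) <=
 (1+K) * (M*t `^ kap*E (fun x => `|H x|)) * (1-r)^-1.
 apply: (@le_trans _ _ (\sum_(j < k') (1+K) * (M*t `^ kap*E (fun x => `|H x|))*r ^+ (k'-j))).
 apply: ler_sum => j _.
 have jk : (j < k)%N by rewrite (leq_trans _ k'k).
 apply: (le_trans (correlate_word1 _ _ _ bH jk)).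
 - exact: (word1_osc (fun i => Num.min 2 (t*theta ^+ (k'-j)*osc i))).
 - exact: oterm_bmf.
 - by move=> x; exact: oterm_ge0.
 - rewrite -mulrA ler_wpM2l// mulrAC ler_wpM2r//.
 exact: oterm_mean.
 by rewrite -mulr_sumr ler_wpM2l// geom_bound.
have s2 : \sum_(j < k-k') E (fun x => fmaj (iter (k'+j) T x) * `|H (iter k T x)|) <=
 (1+K) * (3*M*t `^ kap*E (fun x => `|H x|)) * (k-k')%:R.
 rewrite mulr_natr -[X in _ *+ X](card_ord (k-k')) -sumr_const.
 apply: ler_sum => j _.
 have jk : (k'+j < k)%N by rewrite -ltn_subRL.
 apply: (le_trans (correlate_word1 fmaj_word fmaj_bmf fmaj_ge0 bH jk)).
 by rewrite ler_wpM2l// ler_wpM2r// fmaj_mean.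
lra.
Qed.
(** Twice the cost of replacing the past by a word function, plus the mixing constant. *)
Definition dconst : R := 2 * (1+K) * (M * (1-r)^-1+3*M)+K.

Lemma dconst_aux : 0 <= M * (1-r)^-1+3*M.
have M0 := obs_M hf; have /andP[r0 r1] := r01.
by rewrite addr_ge0 ?mulr_ge0// invr_ge0; lra.
Qed.
Lemma dconst_ge0 : 0 <= dconst.
have K0 := code_K hc; have q := dconst_aux; apply: addr_ge0 => //; side.
Qed.

(** The past phase is replaced by a function of the first [k - n] letters, at a cost of order
    [(n + 1) t^kap], and mixing across the gap of [n] steps costs [g^n]. Both errors are relative to
    the mean of [|H|]. *)
Lemma decorrelate k n H : bmf H ->
 `|E (fun x => h (psum k x)*H (iter k T x))-E (fun x => h (psum k x))*E H|
 <= dconst * ((n%:R+1)*t `^ kap+g ^+ n)*E (fun x => `|H x|).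
move=> bH; pose k' := (k-n)%N; have k'k : (k' <= k)%N by rewrite leq_subr.
have /andP[g0 g1] := code_g hc; pose A := repv k' (fun y => h (psum k' y)).
have wA : word_fun T c k' A by exact: repv_word.
have A1 x : `|A x| <= 1 by exact: repv_bound.
have bA : bmf A by exact: bmf_word wA A1.
have bh := phase_bmf k; have K0 := code_K hc; have M0 := obs_M hf; have bW := werr_bmf k' k.
have q0 := dconst_aux; pose V := (n%:R+1)*t `^ kap; pose Q := (M * (1-r)^-1+3*M)*V.
have V0 : 0 <= V by apply: mulr_ge0.
have wk : (M * (1-r)^-1+3*M * (k-k')%:R)*t `^ kap <= Q.
 rewrite /Q mulrA ler_wpM2r//.
 have kn : ((k-k')%N%:R : R) <= n%:R by rewrite ler_nat /k' leq_subLR addnC -leq_subLR.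
 have /andP[r0 r1] := r01; have i0 : 0 <= (1-r)^-1 by rewrite invr_ge0; lra.
 have := ler_wpM2l M0 kn; have := mulr_ge0 (mulr_ge0 M0 i0) (ler0n R n); lra.
have err H' : bmf H' -> `|E (fun x => h (psum k x)*H' (iter k T x))-E (fun x => A x*H' (iter k T x))|
 <= (1+K)*Q*E (fun x => `|H' x|).
 move=> bH'; have bHk := bmf_iter mT k bH'; have bnHk := bmf_norm bHk.
 rewrite -exB//; apply: (le_trans (ex_abs mu _)) => //.
 apply: (@le_trans _ _ (E (fun x => werr k' k x * `|H' (iter k T x)|))).
 apply: (ex_le_full mG G0) => // x Gx.
 by rewrite -mulrBl normrM ler_wpM2r// phase_werr.
 apply: (le_trans (werr_mean_aux bH' k'k)); rewrite ler_wpM2r ?ex_ge0// -mulrA ler_wpM2l//.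
have e2 : `|E (fun x => h (psum k x))-E A| <= (1+K)*Q.
 have z (F : X -> R) : E (fun x => F x*1) = E F by apply: ex_eq => x; rewrite mulr1.
 by have := err (fun=> 1) (bmf_cst 1); rewrite !z normr1 ex_cst mulr1.
have e3 : `|E (fun x => A x*H (iter k T x))-E A*E H| <= K*g ^+ n*E (fun x => `|H x|).
 have [nk|kn] := leqP n k.
 have := mix_bound hc n wA bA bH; rewrite subnK// => e; apply: (le_trans e).
 rewrite ler_wpM2l// ler_piMl ?ex_ge0// -[leRHS](ex_cst mu 1); exact: ex_le.
 (* For [k < n] no letter of the past is kept, so [A] is constant and there is nothing to
    decorrelate. *)
 have k'0 : k' = 0%N by apply/eqP; rewrite subn_eq0 ltnW.
 have [s As] : exists s, forall x, A x = s.
 have [[x _]|nx] := pselect (exists x : X, True).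
 by exists (A x) => y; apply: wA; rewrite k'0.
 by exists 0 => x; exfalso; apply: nx; exists x.
 have -> : E (fun x => A x*H (iter k T x)) = s*E H.
 by rewrite -(ex_iter mT presT k bH) -exZ//; [apply: ex_eq => x; rewrite As|exact: bmf_iter].
 have -> : E A = s by rewrite -[RHS](ex_cst mu); exact: ex_eq.
 by rewrite subrr normr0 !mulr_ge0// ex_ge0.
rewrite (_ : E (fun x => h (psum k x)*H (iter k T x))-E (fun x => h (psum k x))*E H =
 (E (fun x => h (psum k x)*H (iter k T x))-E (fun x => A x*H (iter k T x))) +
 (E (fun x => A x*H (iter k T x))-E A*E H) - (E (fun x => h (psum k x))-E A)*E H); last by ring.
have EH0 : 0 <= E (fun x => `|H x|) by apply: ex_ge0.
have e4 : `|E (fun x => h (psum k x))-E A| * `|E H| <= (1+K)*Q*E (fun x => `|H x|).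
 by apply: ler_pM => //; exact: ex_abs.
rewrite (le_trans (ler_normB _ _))// normrM (le_trans (lerD (ler_normD _ _) e4))//.
have gn : 0 <= g ^+ n by [].
have := mulr_ge0 (mulr_ge0 (mulr_ge0 (addr_ge0 ler01 K0) q0) gn) EH0.
have := mulr_ge0 (mulr_ge0 K0 V0) EH0; have := err H bH; move: e3; rewrite /dconst -/V /Q; lra.
Qed.

End Phase.

Let mcos : mfun R (@cos R).
by apply: continuous_measurable_fun; exact: continuous_cos. Qed.
Let msin : mfun R (@sin R).
by apply: continuous_measurable_fun; exact: continuous_sin. Qed.
Let cos1 (u : R) : `|cos u| <= 1. Proof. by side. Qed.
Let sin1 (u : R) : `|sin u| <= 1. Proof. by side. Qed.
Definition echar (H : X -> R) : R[i] := (E (fun x => cos (H x)) +i* E (fun x => sin (H x)))%C.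

(** [decorrelate] is applied to [cos (a f) - 1] and [sin (a f)], whose absolute means are of order
    [t^kap]. This second small factor makes the errors summable over all steps. *)
Lemma char_step k n :
 cn (echar (psum k.+1)-echar (fun x => a k*f x)*echar (psum k)) <=
 4 * (dconst * ((n%:R+1)*t `^ kap+g ^+ n)) * (M*t `^ kap).
pose Gc x := cos (a k*f x)-1; pose Gs x := sin (a k*f x).
have maf : mfun X (fun x => a k*f x) by [].
have bGc : bmf Gc by apply: bmfB => //; exact: bmf_cos.
have bGs : bmf Gs by exact: bmf_sin.
have bt : bmf (fun x => Num.min 2 (t * `|f x|)) by apply: bmf_min2.
have M0 := obs_M hf; have /andP[g0 g1] := code_g hc.
have af x : `|a k*f x-0| <= t * `|f x| by rewrite subr0 normrM ler_wpM2r.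
have pc := phase_bmf mcos cos1 k; have ps := phase_bmf msin sin1 k.
have iGc := bmf_iter mT k bGc; have iGs := bmf_iter mT k bGs.
set e := dconst * _.
have e0 : 0 <= e by rewrite mulr_ge0 ?dconst_ge0// addr_ge0 ?exprn_ge0// mulr_ge0.
have dd (h1 : R -> R) H : mfun R h1 -> (forall u, `|h1 u| <= 1) ->
 (forall u v, `|h1 u-h1 v| <= Num.min 2 `|u-v|) -> bmf H -> (forall x, `|H x| <= Num.min 2 `|a k*f x-0|) ->
 `|E (fun x => h1 (psum k x)*H (iter k T x))-E (fun x => h1 (psum k x))*E H| <= e * (M*t `^ kap).
 move=> h2 h3 h4 bH HH; apply: (le_trans (@decorrelate h1 h2 h3 h4 k n H bH)); rewrite ler_wpM2l//.
 apply: le_trans (obs_mom hf t0); apply: ex_le => // x.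
 by apply: (le_trans (HH x)); exact: min2_le.
have hGc x : `|Gc x| <= Num.min 2 `|a k*f x-0| by rewrite /Gc -[X in _-X]cos0 cos_diff_min.
have hGs x : `|Gs x| <= Num.min 2 `|a k*f x-0| by rewrite /Gs -[sin _]subr0 -[X in _-X]sin0 sin_diff_min.
have EcE : E (fun x => cos (a k*f x)) = E Gc+1.
 by rewrite -[X in _+X](ex_cst mu) -exD//; apply: ex_eq => x; rewrite /Gc subrK.
have Ecc : E (fun x => cos (psum k.+1 x)) = E (fun x => cos (psum k x)*Gc (iter k T x)) +
 E (fun x => cos (psum k x))-E (fun x => sin (psum k x)*Gs (iter k T x)).
 have bX := bmfM pc iGc; rewrite -exD// -exB//; [|exact: bmfD|exact: bmfM].
 by apply: ex_eq => x; rewrite psumS cosD /Gc /Gs; ring.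
have Ess : E (fun x => sin (psum k.+1 x)) = E (fun x => sin (psum k x)*Gc (iter k T x)) +
 E (fun x => sin (psum k x))+E (fun x => cos (psum k x)*Gs (iter k T x)).
 have bX := bmfM ps iGc; rewrite -exD// -exD//; [|exact: bmfD|exact: bmfM].
 by apply: ex_eq => x; rewrite psumS sinD /Gc /Gs; ring.
apply: (le_trans (cn_le _)); rewrite /echar /= EcE Ecc Ess -/Gs.
have := dd cos Gc mcos cos1 cos_diff_min bGc hGc; have := dd cos Gs mcos cos1 cos_diff_min bGs hGs.
have := dd sin Gc msin sin1 sin_diff_min bGc hGc; have := dd sin Gs msin sin1 sin_diff_min bGs hGs.
rewrite !ler_norml => /andP[a1 a2] /andP[a3 a4] /andP[a5 a6] /andP[a7 a8].
rewrite (_ : 4*e * (M*t `^ kap) = 2*e * (M*t `^ kap)+2*e * (M*t `^ kap)); last by ring.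
by apply: lerD; rewrite ler_norml; lra.
Qed.
Lemma ex_sqr_le (H : X -> R) : bmf H -> E H ^+ 2 <= E (fun x => H x ^+ 2).
move=> bH; have bH2 : bmf (fun x => H x ^+ 2) by under [X in bmf X]funext do rewrite expr2; side.
have : 0 <= E (fun x => (H x-E H) ^+ 2) by apply: ex_ge0 => x; exact: sqr_ge0.
have -> : E (fun x => (H x-E H) ^+ 2) = E (fun x => H x ^+ 2)-2*E H*E H+E H ^+ 2.
 rewrite -exZ// -exB// -[X in _+X](ex_cst mu) -exD//.
 by apply: ex_eq => x; ring.
lra.
Qed.
Lemma echar_le1 (H : X -> R) : mfun X H -> cn (echar H) <= 1.
move=> mH; have bc := bmf_cos mH; have bs := bmf_sin mH.
rewrite -(@ler_pXn2r _ 2) ?nnegrE ?cn_ge0// cn_sqr expr1n /=.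
have h1 := ex_sqr_le bc; have h2 := ex_sqr_le bs.
have b2 (F : X -> R) : bmf F -> bmf (fun x => F x ^+ 2) by move=> bF; under [X in bmf X]funext do rewrite expr2; side.
have : E (fun x => cos (H x) ^+ 2)+E (fun x => sin (H x) ^+ 2) = 1.
 rewrite -exD; [|exact: b2|exact: b2].
 by rewrite -[RHS](ex_cst mu); apply: ex_eq => x; exact: cos2Dsin2.
lra.
Qed.

Theorem char_product k n :
 cn (echar (psum k) - \prod_(j < k) echar (fun x => a j*f x)) <=
 k%:R * (4 * (dconst * ((n%:R+1)*t `^ kap+g ^+ n)) * (M*t `^ kap)).
apply: (@telescope_prod _ (fun k => echar (psum k)) (fun j => echar (fun x => a j*f x))).
- rewrite /echar /psum; apply/eqP; rewrite eq_complex; apply/andP; split; apply/eqP.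
 by rewrite -[RHS](ex_cst mu); apply: ex_eq => x; rewrite big_ord0 cos0.
 by rewrite -[RHS](ex_cst mu); apply: ex_eq => x; rewrite big_ord0 sin0.
- by move=> j; apply: echar_le1; side.
- by move=> j; exact: char_step.
Qed.

End Frequencies.
End CharProduct.

Lemma exprn_powR {R : realType} (x a : R) j : 0 <= x -> (x ^+ j) `^ a = (x `^ a) ^+ j.
move=> x0; rewrite -(powR_mulrn j x0) -(powR_mulrn j (powR_ge0 x a)).
by rewrite -powRrM mulrC powRrM.
Qed.
Lemma powR_inv {R : realType} (x a : R) : 0 <= x -> x^-1 `^ a = x `^ (- a).
by move=> x0; rewrite -(powR_inv1 x0) -powRrM mulN1r. Qed.

(** * Truncated moments from tail bounds *)

Section MomentFromTail.
Context {d} {X : measurableType d} {R : realType}.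
Variable mu : probability X R.
Local Notation m := (pr mu).
Local Notation E := (ex mu).

Lemma min2_dyadic (z : R) J :
 Num.min 2 z <= \sum_(j < J) 2*2^-1 ^+ j * (2^-1 ^+ j < z)%R%:R+2*2^-1 ^+ J.
elim: J => [|J IH]; first by rewrite big_ord0 add0r expr0 mulr1 ge_min lexx.
rewrite big_ord_recr /= exprS mulrA mulfV// mul1r.
have p0 : 0 <= 2^-1 ^+ J :> R by [].
have s0 : 0 <= \sum_(j < J) 2*2^-1 ^+ j * (2^-1 ^+ j < z)%R%:R :> R by [].
case: ltP => h; first by rewrite mulr1; lra.
have : Num.min 2 z <= z by rewrite ge_min lexx orbT.
by rewrite mulr0; lra.
Qed.
(** The truncation is cut at the dyadic levels [2^-j]; the tails at these levels form a geometric
    series of ratio [2^(kap - 1)], convergent because [kap < 1]. *)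
Lemma moment_from_tail (Y : X -> R) (C kap : R) : mfun X Y ->
 (forall x, 0 <= Y x) -> 0 < kap < 1 -> 0 <= C ->
 (forall y, 0 < y -> m [set x | y < Y x] <= C*y `^ (- kap)) ->
 forall t, 0 <= t -> E (fun x => Num.min 2 (t*Y x)) <= 2*C / (1-2^-1 `^ (1-kap))*t `^ kap.
move=> mY Y0 /andP[k0 k1] C0 htail t; rewrite le_eqVlt => /orP[/eqP<-|t0].
 rewrite powR0 ?gt_eqF// mulr0 -[leRHS](ex_cst mu) le_eqVlt; apply/orP; left; apply/eqP.
 by apply: ex_eq => x; rewrite mul0r min_r.
pose r : R := 2^-1 `^ (1-kap); have r0 : 0 < r by apply: powR_gt0.
have r1 : r < 1.
 have := @gt0_ltr_powR _ (1-kap) _ (2^-1 : R) 1; rewrite !nnegrE powR1 ler01; apply; lra.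
have bmin : bmf (fun x => Num.min 2 (t*Y x)) by apply: bmf_min => // x; rewrite mulr_ge0// ltW.
have tailj j : m [set x | 2^-1 ^+ j < t*Y x] * (2*2^-1 ^+ j) <= 2*C*t `^ kap*r ^+ j.
 have -> : [set x | 2^-1 ^+ j < t*Y x] = [set x | 2^-1 ^+ j/t < Y x].
 by apply/seteqP; split=> x /=; rewrite ltr_pdivrMr// mulrC.
 have p0 : 0 < 2^-1 ^+ j :> R by []; have h2 : (0:R) < 2^-1 by [].
 have -> : 2*C*t `^ kap*r ^+ j = C * (2^-1 ^+ j/t) `^ (- kap) * (2*2^-1 ^+ j).
 rewrite powRM// -(powR_inv1 (ltW t0)) -powRrM mulN1r opprK.
 rewrite (_ : r ^+ j = (2^-1 ^+ j) `^ (- kap)*2^-1 ^+ j); first by ring.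
 rewrite (exprn_powR _ _ (ltW h2)) /r addrC powRD; last by rewrite (gt_eqF h2) implybT.
 by rewrite (powRr1 (ltW h2)) exprMn.
 by rewrite ler_wpM2r// htail// divr_gt0.
have key J : E (fun x => Num.min 2 (t*Y x)) <= 2*C*t `^ kap * (1-r)^-1+2*2^-1 ^+ J.
 pose H j x : R := 2*2^-1 ^+ j * \1_[set x | 2^-1 ^+ j < t*Y x] x.
 have bH j : bmf (H j) by apply: bmfZ.
 have bS : bmf (fun x => \sum_(j < J) H j x) by [].
 apply: (@le_trans _ _ (E (fun x => \sum_(j < J) H j x+2*2^-1 ^+ J))).
 apply: ex_le => // x.
 apply: (le_trans (min2_dyadic _ J)); rewrite lerD2r ler_sum// => j _.
 by rewrite /H indicE mem_setE.
 rewrite exD// ex_cst lerD2r ex_sum//.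
 apply: (@le_trans _ _ (\sum_(j < J) 2*C*t `^ kap*r ^+ j)).
 by apply: ler_sum => j _; rewrite /H exZ ?ex_indic// mulrC; exact: tailj.
 rewrite -mulr_sumr ler_wpM2l// -[leLHS](mulfK (x := 1-r)); last by rewrite gt_eqF//; lra.
 rewrite -[leRHS]mul1r ler_wpM2r ?invr_ge0; try lra.
 have := subrX1 r J; have := exprn_ge0 J (ltW r0).
 by move: (\sum_(i < J) r ^+ i) (r ^+ J) => u v; clear -r1; nra.
apply/ler_addgt0Pr => e e0; have [J _ hJ] : \forall J \near \oo, 2*2^-1 ^+ J < e.
 apply: (@cvgr_lt _ _ _ _ _ (0 : R)) => //; rewrite -[X in _ --> X](mulr0 2).
 by apply: cvgM; [exact: cvg_cst|apply: cvg_expr; rewrite ger0_norm//; lra].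
have := hJ J (leqnn J); have := key J; rewrite -/r /= => a1 a2; lra.
Qed.

End MomentFromTail.

(** * Potter bounds from doubling inequalities *)

Section RegularVariation.
Context {R : realType}.

Lemma dyadic_scale (x : R) : 1 <= x -> exists j : nat, 2 ^+ j <= x < 2 ^+ j.+1.
move=> x1; have [n hn] : exists n : nat, x < 2 ^+ n.
 exists (Num.truncn x).+1; have /andP[_ h] := truncn_itv (le_trans ler01 x1).
 apply: (lt_le_trans h); rewrite -natrX ler_nat; exact/ltnW/ltn_expl.
elim: n hn => [|n IH] hn; first by move: hn; rewrite expr0; lra.
by have [/IH//|h] := ltP x (2 ^+ n); exists n; side.
Qed.

Variables (V : R -> R) (al : R).
Hypotheses (Vdec : forall s t, 0 < s -> s <= t -> V t <= V s) (V0 : forall t, 0 <= V t).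

(** Doubling is iterated up to the dyadic scale just below [x]; monotonicity covers the remaining
    factor, at the cost of the constant [2 ^ kap]. *)
Lemma potter_upper kap t0 : 0 < t0 -> 0 <= kap ->
 (forall t, t0 <= t -> V (2*t) <= 2 `^ (- kap)*V t) ->
 forall t x, t0 <= t -> 1 <= x -> V (x*t) <= 2 `^ kap*x `^ (- kap)*V t.
move=> t00 k0 h t x tt x1; have [j /andP[j1 j2]] := dyadic_scale x1.
have tp : 0 < t by exact: lt_le_trans tt.
have it i : V (2 ^+ i*t) <= (2 `^ (- kap)) ^+ i*V t.
 elim: i => [|i IH]; first by rewrite !expr0 !mul1r.
 rewrite !exprS -!mulrA (le_trans (h _ _))//.
 by rewrite (le_trans tt)// ler_peMl ?(ltW tp)// exprn_ege1//; lra.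
 by rewrite ler_wpM2l ?powR_ge0.
have p2 : 0 < 2 ^+ j :> R by rewrite exprn_gt0.
apply: (@le_trans _ _ (V (2 ^+ j*t))).
 by apply: Vdec; [side|rewrite ler_wpM2r// ltW].
apply: (le_trans (it j)); rewrite ler_wpM2r// -exprn_powR// !powRN ler_pdivlMr ?powR_gt0//; last lra.
rewrite mulrC ler_pdivrMr// -powRM//.
by rewrite ge0_ler_powR ?nnegrE//; [lra|rewrite -exprS ltW].
Qed.
Lemma potter_lower kap t0 : 0 < t0 -> 0 <= kap ->
 (forall t, t0 <= t -> V t <= 2 `^ kap*V (2*t)) ->
 forall t x, t0 <= t -> 1 <= x -> V t <= 2 `^ kap*x `^ kap*V (x*t).
move=> t00 k0 h t x tt x1; have [j /andP[j1 j2]] := dyadic_scale x1.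
have tp : 0 < t by exact: lt_le_trans tt.
have it i : V t <= (2 `^ kap) ^+ i*V (2 ^+ i*t).
 elim: i => [|i IH]; first by rewrite !expr0 !mul1r.
 apply: (le_trans IH); rewrite exprSr -mulrA ler_wpM2l ?exprn_ge0 ?powR_ge0//.
 rewrite exprS -mulrA; apply: h.
 by rewrite (le_trans tt)// ler_peMl ?(ltW tp)// exprn_ege1//; lra.
have xp : 0 < x by lra.
apply: (le_trans (it j.+1)); apply: ler_pM => //.
- rewrite -(exprn_powR _ _ (ler0n _ 2)) -(powRM _ (ler0n _ 2) (ltW xp)) exprS.
 by rewrite ge0_ler_powR// ler_wpM2l.
- by apply: Vdec; [side|rewrite ler_wpM2r// ltW].
Qed.

End RegularVariation.

(** * Euler integrals with complex parameter on the half line *)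

Section HalfLine.
Context {R : realType}.
Local Notation leb := (@lebesgue_measure R).
Local Notation D := (`]0%R, +oo[%classic : set R).
Implicit Types (p q : R -> R).

Definition hint p : R := \int[leb]_(t in D) p t.
Definition hints p : Prop := leb.-integrable D (EFin \o p).

Lemma hintable_le p q : measurable_fun D p -> hints q ->
 (forall t : R, 0 < t -> `|p t| <= q t) -> hints p.
move=> mp iq pq; have := @le_integrable _ _ R leb D.
move=> /(_ (measurable_itv _) (EFin \o p) (EFin \o q)); apply.
- exact/measurable_EFinP.
- move=> t /=; rewrite in_itv andbT => t0; rewrite lee_fin.
 by rewrite (le_trans (pq t t0))// ler_norm.
- exact: iq.
Qed.
Lemma hint_eq p q : (forall t : R, 0 < t -> p t = q t) -> hint p = hint q.
by move=> h; apply: eq_Rintegral => t; rewrite inE /= in_itv andbT => /h. Qed.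
Lemma hintable_eq p q : (forall t : R, 0 < t -> p t = q t) -> hints p -> hints q.
move=> h; have := @eq_integrable _ _ R leb D (measurable_itv _) (EFin \o p) (EFin \o q); apply.
by move=> t; rewrite inE /= in_itv andbT => /h ->.
Qed.
Lemma hintableD p q : hints p -> hints q -> hints (fun t => p t+q t).
move=> ip iq; have := integrableD _ ip iq; move=> /(_ (measurable_itv _)); apply.
Qed.
Lemma hintsZ c p : hints p -> hints (fun t => c * p t).
by move=> ip; have := integrableZl _ c ip; move=> /(_ (measurable_itv _)); apply. Qed.
Lemma hintD p q : hints p -> hints q -> hint (fun t => p t+q t) = hint p+hint q.
by move=> ip iq; have := RintegralD _ ip iq; move=> /(_ (measurable_itv _)); apply. Qed.
Lemma hintZ c p : hints p -> hint (fun t => c * p t) = c*hint p.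
by move=> ip; have := RintegralZl c _ ip; move=> /(_ (measurable_itv _)); apply. Qed.
Lemma hintable_meas p : hints p -> measurable_fun D p.
by move=> /integrableP[/measurable_EFinP]. Qed.
Lemma hint_le_abs p q : hints p -> hints q ->
 (forall t : R, 0 < t -> `|p t| <= q t) -> `|hint p| <= hint q.
move=> ip iq h; have mD : measurable D by exact: measurable_itv.
have := le_normr_Rintegral _ ip; move=> /(_ (measurable_itv _)) h1; apply: (le_trans h1).
apply: le_Rintegral => //; last by move=> t /=; rewrite in_itv andbT => /h.
have := integrable_abse ip; by apply.
Qed.
Lemma hint_dominated (p : nat -> R -> R) q g :
 (forall n, measurable_fun D (p n)) -> measurable_fun D q -> hints g ->
 (forall n (t : R), 0 < t -> `|p n t| <= g t) ->
 (forall t : R, 0 < t -> p n t @[n --> \oo] --> q t) ->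
 hints q /\ hint (p n) @[n --> \oo] --> hint q.
move=> mp mq ig pg pq.
have mD : measurable D by [].
have [iq _ h] : [/\ leb.-integrable D (EFin \o q), True &
 (\int[leb]_(x in D) (p n x)%:E)%E @[n --> \oo] --> (\int[leb]_(x in D) (q x)%:E)%E].
 have [||||iq _ h] := @dominated_convergence _ _ R leb D mD
 (fun n => EFin \o p n) (EFin \o q) (EFin \o g) _ _ _ ig.
 - by [].
 - exact/measurable_EFinP.
 - apply: aeW => t /=; rewrite in_itv andbT => t0.
 by apply: cvg_EFin; [exact: nearW|side].
 - by apply: aeW => t n /=; rewrite in_itv andbT => t0; rewrite lee_fin pg.
 - by split.
split=> //; rewrite /hint /Rintegral; apply: fine_cvg; rewrite fineK//.
by have := integrable_fin_num _ iq; move=> /(_ (measurable_itv _)); apply.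
Qed.
Lemma FTC_itv (H h : R -> R) (x y : R) : x < y ->
 (forall t : R, x <= t <= y -> is_derive t 1 H (h t)) ->
 (forall t : R, x <= t <= y -> {for t, continuous h}) ->
 (\int[leb]_(t in `[x, y]) (h t)%:E)%E = (H y-H x)%:E.
move=> xy dH ch; have Hc t : x <= t <= y -> {for t, continuous H}.
 move=> /dH dt; apply: differentiable_continuous; apply/derivable1_diffP.
 exact: @ex_derive _ _ _ _ _ _ _ dt.
rewrite (@continuous_FTC2 R h H x y xy)//.
- by apply: continuous_in_subspaceT => t; rewrite inE /= in_itv => /ch.
- split.
 + move=> t; rewrite in_itv /= => /andP[xt ty].
 have dt : is_derive t 1 H (h t) by apply: dH; side.
 exact: @ex_derive _ _ _ _ _ _ _ dt.
 + by apply: cvg_at_right_filter; apply: Hc; side.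
 + by apply: cvg_at_left_filter; apply: Hc; side.
- move=> t; rewrite in_itv /= => /andP[xt ty].
 have dt : is_derive t 1 H (h t) by apply: dH; side.
 by rewrite derive1E (@derive_val _ _ _ _ _ _ _ dt).
Qed.
(** A model majorant with one power at 0 and another at infinity, integrable when [-1 < a] and
    [1 < b]. *)
Definition pdom (a b t : R) : R := if t <= 1 then t `^ a else t `^ (- b).

Lemma measurable_pdom a b : mfun R (pdom a b).
apply: measurable_fun_ifT; [|exact: measurable_powR|exact: measurable_powR].
by apply: measurable_fun_ler.
Qed.
Lemma pdom_ge0 a b t : 0 <= pdom a b t.
by rewrite /pdom; case: ifP => _; side. Qed.
Lemma powR_primitive (s x : R) : 0 < x -> s+1 != 0 ->
 is_derive x 1 (fun t => (s+1)^-1*t `^ (s+1)) (x `^ s).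
move=> x0 s1; have h := @is_derive1_powR R (s+1) x x0.
have := @is_deriveZ _ _ _ _ (s+1)^-1 _ _ _ h.
by rewrite addrK /GRing.scale /= mulrA mulVf// mul1r.
Qed.
Lemma powR_cts (s x : R) : 0 < x -> {for x, continuous (fun t : R => t `^ s)}.
move=> x0; apply: differentiable_continuous; apply/derivable1_diffP.
by have dt := @is_derive1_powR R s x x0.
Qed.
(** Exhausts the half line by compact intervals; starting at 2 keeps their end points distinct. *)
Lemma inv_cover (t : R) : 0 < t -> exists n : nat, n.+2%:R^-1 <= t <= n.+2%:R.
move=> t0; exists (maxn (Num.truncn t^-1) (Num.truncn t)).
apply/andP; split.
 rewrite -[leRHS]invrK lef_pV2//.
 have /andP[_ /ltW h] := truncn_itv (ltW (etrans (invr_gt0 t) t0)).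
 by rewrite (le_trans h)// ler_nat !ltnS leqW// leq_maxl.
have /andP[_ /ltW h] := truncn_itv (ltW t0).
by rewrite (le_trans h)// ler_nat !ltnS leqW// leq_maxr.
Qed.
Lemma integral_bigcup_le (F : nat -> set R) (h : R -> R) (M : R) :
 nondecreasing_seq F -> (forall i, measurable (F i)) ->
 mfun R h -> (forall t, 0 <= h t) ->
 (forall i, (\int[leb]_(t in F i) (h t)%:E <= M%:E)%E) ->
 (\int[leb]_(t in \bigcup_i F i) (h t)%:E <= M%:E)%E.
move=> nF mF mh h0 hM.
have c : (\int[leb]_(t in F n) (h t)%:E)%E @[n --> \oo] --> (\int[leb]_(t in \bigcup_i F i) (h t)%:E)%E.
 apply: ge0_nondecreasing_set_cvg_integral => //.
 by move=> i t _; rewrite lee_fin.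
rewrite -(cvg_lim _ c)//; apply: lime_le; first by apply/cvg_ex; eexists; exact: c.
by apply: nearW => i; side.
Qed.
Lemma hint_pdom a b : -1 < a -> 1 < b -> hints (pdom a b).
move=> a1 b1; have mpd := measurable_pdom a b.
have mD : measurable D by exact: measurable_itv.
have inv1 n : n.+2%:R^-1 < 1 :> R by rewrite invf_lt1// ltr1n.
have inv0 n : 0 < n.+2%:R^-1 :> R by rewrite invr_gt0 ltr0n.
have le1 n : 1 < n.+2%:R :> R by rewrite ltr1n.
have I1 : (\int[leb]_(t in `]0%R, 1%R]) (pdom a b t)%:E <= ((a+1)^-1)%:E)%E.
 have -> : `]0%R, 1%R]%classic = \bigcup_n `[(n.+2%:R^-1 : R), 1]%classic.
 apply/seteqP; split=> t /=.
 rewrite in_itv /= => /andP[t0 t1]; have [n /andP[n1 _]] := inv_cover t0.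
 by exists n => //=; rewrite in_itv /= n1.
 by move=> [n _ /=]; rewrite !in_itv /= => /andP[n1 ->]; rewrite (lt_le_trans _ n1).
 apply: integral_bigcup_le => //; [|by move=> t; exact: pdom_ge0|].
 move=> m n mn; apply/subsetPset => t /=; rewrite !in_itv /= => /andP[h ->]; rewrite andbT.
 by apply: le_trans h; rewrite lef_pV2 ?posrE// ler_nat !ltnS.
 move=> n; have -> : (\int[leb]_(t in `[n.+2%:R^-1%R, 1%R]) (pdom a b t)%:E = \int[leb]_(t in `[n.+2%:R^-1%R, 1%R]) (t `^ a)%:E)%E.
 by apply: eq_integral => t; rewrite inE /= in_itv /= => /andP[_ t1]; rewrite /pdom t1.
 have -> : (\int[leb]_(t in `[n.+2%:R^-1%R, 1%R]) (t `^ a)%:E =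
 ((a+1)^-1*1 `^ (a+1) - (a+1)^-1*n.+2%:R^-1 `^ (a+1))%:E)%E.
 apply: (@FTC_itv (fun t => (a+1)^-1*t `^ (a+1)) _ _ _ (inv1 n)) => t /andP[h _].
 + by apply: powR_primitive; [exact: lt_le_trans h|side].
 + by apply: powR_cts; exact: lt_le_trans h.
 rewrite lee_fin powR1 mulr1 lerBlDr lerDl mulr_ge0// invr_ge0; lra.
have I2 : (\int[leb]_(t in `[1%R, +oo[) (pdom a b t)%:E <= ((b-1)^-1)%:E)%E.
 have -> : `[1%R, +oo[%classic = \bigcup_n `[(1 : R), n.+2%:R]%classic.
 apply/seteqP; split=> t /=.
 rewrite in_itv /= andbT => t1; have [n /andP[_ n1]] := inv_cover (lt_le_trans ltr01 t1).
 by exists n => //=; rewrite in_itv /= n1 t1.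
 by move=> [n _ /=]; rewrite !in_itv => /andP[->].
 apply: integral_bigcup_le => //; [|by move=> t; exact: pdom_ge0|].
 move=> m n mn; apply/subsetPset => t /=; rewrite !in_itv => /andP[-> h].
 by apply: (le_trans h); rewrite ler_nat !ltnS.
 move=> n; have -> : (\int[leb]_(t in `[1%R, n.+2%:R]) (pdom a b t)%:E = \int[leb]_(t in `[1%R, n.+2%:R]) (t `^ (- b))%:E)%E.
 apply: eq_integral => t; rewrite inE /= in_itv /= => /andP[t1 _]; rewrite /pdom.
 by case: leP => // t1'; have -> : t = 1 by [apply/le_anti; rewrite t1 t1']; rewrite !powR1.
 have -> : (\int[leb]_(t in `[1%R, n.+2%:R]) (t `^ (- b))%:E =
 ((- b+1)^-1*n.+2%:R `^ (- b+1) - (- b+1)^-1*1 `^ (- b+1))%:E)%E.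
 apply: (@FTC_itv (fun t => (- b+1)^-1*t `^ (- b+1)) _ _ _ (le1 n)) => t /andP[h _].
 + by apply: powR_primitive; side.
 + by apply: powR_cts; side.
 have -> : (- b+1)^-1 = - (b-1)^-1 by rewrite -invrN opprB addrC.
 rewrite lee_fin powR1 mulr1 !mulNr opprK addrC lerBlDr lerDl mulr_ge0// invr_ge0; lra.
apply/integrableP; split; first side.
have -> : D = `]0%R, 1%R]%classic `|` `]1%R, +oo[%classic.
 apply/seteqP; split=> t /=; rewrite !in_itv /= !andbT.
 by lra.
 by lra.
under eq_integral do rewrite /= ger0_norm ?pdom_ge0//.
rewrite ge0_integral_setU//=; first last.
- apply/disj_setPS => t /=; rewrite !in_itv /= andbT => -[/andP[_ h1] h2].
 by lra.
- by move=> t _; rewrite lee_fin pdom_ge0.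
apply: lte_add_pinfty; first exact: le_lt_trans I1 (ltry _).
apply: le_lt_trans (ltry (b-1)^-1); apply: le_trans I2.
apply: ge0_subset_integral => //.
- by move=> t _; rewrite lee_fin pdom_ge0.
- by move=> t /=; rewrite !in_itv !andbT => /ltW.
Qed.
Lemma hint_ftc (H h : R -> R) : (forall t : R, 0 < t -> is_derive t (1 : R) H (h t)) ->
 (forall t : R, 0 < t -> {for t, continuous h}) -> hints h ->
 H n.+2%:R^-1 @[n --> \oo] --> (0 : R) -> H n.+2%:R @[n --> \oo] --> (0 : R) ->
 hint h = 0.
move=> dH ch ih H0 Hoo.
pose F n := `[(n.+2%:R^-1 : R), n.+2%:R]%classic.
have mh := hintable_meas ih.
have [_ c] : hints h /\ hint (h \_ (F n)) @[n --> \oo] --> hint h.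
 apply: (hint_dominated (g := fun t => `|h t|)) => //.
 - move=> n; rewrite patch_indic; apply: measurable_funM => //.
 - by have := integrable_abse ih; apply.
 - by move=> n t _; rewrite patchE; case: ifP => // _; rewrite normr0.
 - move=> t t0; apply: cvg_near_cst; have [N /andP[h1 h2]] := inv_cover t0.
 exists N => // n Nn; rewrite patchE ifT// inE /F /= in_itv; apply/andP; split.
 by apply: le_trans h1; rewrite lef_pV2// ler_nat !ltnS.
 by apply: (le_trans h2); rewrite ler_nat !ltnS.
have e n : hint (h \_ (F n)) = H n.+2%:R-H n.+2%:R^-1.
 rewrite /hint -Rintegral_mkcondr.
 have -> : D `&` F n = F n.
 apply/seteqP; split=> t; first by case.
 by rewrite /F /= !in_itv /= => /andP[h1 h2]; rewrite h1 h2 (lt_le_trans _ h1).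
 have xy : n.+2%:R^-1 < n.+2%:R :> R by rewrite (@lt_trans _ _ 1) ?ltr1n// invf_lt1// ltr1n.
 rewrite /Rintegral; have -> : (\int[leb]_(t in F n) (h t)%:E = (H n.+2%:R-H n.+2%:R^-1)%:E)%E.
 apply: (FTC_itv xy) => t /andP[h1 _].
 + by apply: dH; exact: lt_le_trans h1.
 + by apply: ch; exact: lt_le_trans h1.
 by [].
have c0 : hint (h \_ (F n)) @[n --> \oo] --> (0 : R).
 under eq_fun do rewrite e.
 have c1 : H n.+2%:R-H n.+2%:R^-1 @[n --> \oo] --> 0 - (0 : R) by exact: cvgB.
 by rewrite subr0 in c1.
by apply/esym; exact: cvg_unique _ c0 c.
Qed.
Lemma powR_le_exp (s c : R) : 0 < s -> 0 < c -> exists C : R, 0 < C /\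
 forall t : R, 0 < t -> t `^ s <= C*expR (c*t).
move=> s0 c0; exists ((s/c) `^ s); split; first side.
move=> t t0; have ct : 0 < c*t/s by rewrite divr_gt0.
have -> : t `^ s = (s/c) `^ s * (c*t/s) `^ s.
 rewrite -powRM//; congr (_ `^ _); field.
 by lra.
rewrite ler_pM2l//.
apply: (@le_trans _ _ (expR (c*t/s) `^ s)).
 apply: ge0_ler_powR; rewrite//.
 by have := expR_ge1Dx (c*t/s); lra.
by rewrite {1}/powR gt_eqF// expRK mulrC divfK.
Qed.
Lemma exp_pdom (b c : R) : 0 < b -> 0 < c -> exists C : R, 0 < C /\
 forall t : R, 0 < t -> t `^ (b-1)*expR (- c*t) <= C * pdom (b-1) 2 t.
move=> b0 c0; have b1 : 0 < b+1 by lra.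
have [C [C0 hC]] := powR_le_exp b1 c0.
exists (C+1); split; first lra; move=> t t0.
rewrite /pdom; case: (leP t 1) => t1.
 rewrite mulrC ler_wpM2r//.
 by apply: (@le_trans _ _ 1); [rewrite -expR0 ler_expR mulNr oppr_le0 mulr_ge0|lra].
apply: (@le_trans _ _ (C*t `^ (- 2))); last by rewrite ler_wpM2r//; lra.
have -> : b-1 = b+1 + (- 2) by ring.
rewrite powRD ?(gt_eqF t0) ?implybT// mulrAC ler_wpM2r//.
by rewrite mulNr expRN ler_pdivrMr// hC.
Qed.

(* [osc_int b c s th] is the real part of exp(i th) times the integral of t^(b-1) exp(-(c - i s)t). *)
Definition osc_ker (b c s th t : R) : R := t `^ (b-1) * (expR (- c*t)*cos (s*t+th)).
Definition osc_int b c s th : R := hint (osc_ker b c s th).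

Lemma is_derive_exp_cos (u w : R -> R) (x du dw : R) :
 is_derive x (1 : R) u du -> is_derive x (1 : R) w dw ->
 is_derive x (1 : R) (fun p : R => expR (u p)*cos (w p)) (expR (u x) * (du*cos (w x)-dw*sin (w x))).
move=> hu hw.
have h1 : is_derive x 1 (expR \o u) (expR (u x)*du).
 have := @is_derive1_comp _ expR u x (expR (u x)) du (is_derive_expR (u x)) hu.
 by [].
have h2 : is_derive x 1 (cos \o w) (- sin (w x)*dw).
 have := @is_derive1_comp _ cos w x (- sin (w x)) dw (is_derive_cos (w x)) hw.
 by [].
have := is_deriveM h1 h2; rewrite /GRing.scale /= => h.
apply: (is_derive_eq h); ring.
Qed.
Lemma der_lin (c e x : R) : is_derive x 1 (fun t => c*t+e) c.
have h1 : is_derive x 1 (fun t : R => c *: t) (c *: 1) by exact: is_deriveZ.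
have := is_deriveD h1 (is_derive_cst e x 1); rewrite addr0 /GRing.scale /= mulr1.
by [].
Qed.
Lemma continuous_exp_cos (c s th x : R) : {for x, continuous (fun t => expR (- c*t)*cos (s*t+th))}.
apply: differentiable_continuous; apply/derivable1_diffP.
have h1 := der_lin (- c) 0 x; have h2 := der_lin s th x.
have := is_derive_exp_cos h1 h2.
have -> : (fun p : R => expR (- c * p+0)*cos (s * p+th)) = (fun t => expR (- c*t)*cos (s*t+th)) by apply/funext => t; rewrite addr0.
by [].
Qed.
Lemma measurable_osc_ker b c s th : mfun R (osc_ker b c s th).
apply: measurable_funM; first exact: measurable_powR.
apply: continuous_measurable_fun => x; exact: continuous_exp_cos.
Qed.
Lemma ok_cts b c s th (t : R) : 0 < t -> {for t, continuous (osc_ker b c s th)}.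
by move=> t0; apply: continuousM; [exact: powR_cts|exact: continuous_exp_cos]. Qed.
Lemma osc_ker_le (b c s th t : R) : `|osc_ker b c s th t| <= t `^ (b-1)*expR (- c*t).
rewrite /osc_ker !normrM (ger0_norm (powR_ge0 _ _)) (ger0_norm (expR_ge0 _)) mulrA.
rewrite -[leRHS]mulr1 ler_wpM2l//.
by side.
Qed.
Lemma ok_hint b c s th : 0 < b -> 0 < c -> hints (osc_ker b c s th).
move=> b0 c0; have [C [C0 hC]] := exp_pdom b0 c0.
have i1 : hints (pdom (b-1) 2) by apply: hint_pdom; lra.
apply: (hintable_le _ (hintsZ C i1)).
- by apply: measurable_funTS; exact: measurable_osc_ker.
- by move=> t t0; rewrite (le_trans (osc_ker_le _ _ _ _ _))// hC.
Qed.
Lemma osc_int_pi b c s th : 0 < b -> 0 < c -> osc_int b c s (th-pi) = - osc_int b c s th.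
move=> b0 c0; rewrite -[RHS]mulN1r /osc_int -hintZ; last exact: ok_hint.
apply: hint_eq => t _; rewrite /osc_ker.
have -> : cos (s*t+th) = - cos (s*t + (th-pi)) by rewrite -cosDpi -addrA subrK.
by ring.
Qed.
Lemma cvg_powR0 (b : R) : 0 < b -> (n.+2%:R^-1 : R) `^ b @[n --> \oo] --> (0 : R).
move=> b0; apply/cvgrPdist_lt => e e0; near=> n.
rewrite sub0r normrN ger0_norm ?powR_ge0//.
have n0 : (0:R) < n.+2%:R by rewrite ltr0n.
have -> : e = (e `^ b^-1) `^ b by rewrite -powRrM mulVf ?gt_eqF// powRr1// ltW.
rewrite gt0_ltr_powR ?(ltW n0)//.
rewrite -[ltRHS]invrK ltf_pV2.
have p0 : 0 <= (e `^ b^-1)^-1 by [].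
have /andP[_ h] := truncn_itv p0; apply: (lt_le_trans h); rewrite ler_nat.
have : (Num.truncn ((e `^ b^-1)^-1) <= n)%N by near: n; exact: nbhs_infty_ge.
by lia.
Unshelve. all: by end_near. Qed.
Lemma cvg_powR_exp (b c : R) : 0 < b -> 0 < c ->
 (n.+2%:R : R) `^ b*expR (- c*n.+2%:R) @[n --> \oo] --> (0 : R).
move=> b0 c0; have b1 : 0 < b+1 by lra.
have [C [C0 hC]] := powR_le_exp b1 c0.
have cz : C * (n.+2%:R^-1 `^ 1) @[n --> \oo] --> (0 : R) by rewrite -[X in _ --> X](mulr0 C); apply: cvgM; [side|exact: cvg_powR0].
apply: (squeeze_cvgr _ (cvg_cst 0) cz); apply: nearW => n.
have n0 : (0:R) < n.+2%:R by [].
rewrite mulr_ge0//= powRr1//.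
rewrite mulNr expRN ler_pdivrMr// mulrAC ler_pdivlMr//.
by have := hC _ n0; rewrite powRD ?(gt_eqF n0) ?implybT// powRr1 // ltW.
Qed.

(* Integration by parts: b E_b(z) = z E_(b+1)(z). *)
Lemma osc_int_parts b c s th : 0 < b -> 0 < c ->
 b*osc_int b c s th = c*osc_int (b+1) c s th+s*osc_int (b+1) c s (th-pi/2).
move=> b0 c0; have b10 : 0 < b+1 by lra.
pose H t : R := t `^ b * (expR (- c*t)*cos (s*t+th)).
pose h t := b*osc_ker b c s th t + ((- c)*osc_ker (b+1) c s th t + (- s)*osc_ker (b+1) c s (th-pi/2) t).
have i1 := ok_hint s th b0 c0.
have i2 := ok_hint s th b10 c0.
have i3 := ok_hint s (th-pi/2) b10 c0.
have i4 := hintableD (hintsZ (- c) i2) (hintsZ (- s) i3).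
have h0 : hint h = 0.
 apply: (@hint_ftc H).
 - move=> t t0; have d1 := @is_derive1_powR R b t t0.
 have d2 := is_derive_exp_cos (der_lin (- c) 0 t) (der_lin s th t).
 have d3 := is_deriveM d1 d2.
 have -> : H = (fun t : R => t `^ b) * (fun p : R => expR (- c * p+0)*cos (s * p+th)) by apply/funext => p; rewrite /H [RHS]/(_ * _) addr0.
 have cE : cos (s*t + (th-pi/2)) = sin (s*t+th) by rewrite addrA cosBpihalf.
 apply: (is_derive_eq d3); rewrite /h /osc_ker /GRing.scale /= addr0 addrK cE.
 by lra.
 - move=> t t0; apply: continuousD; last apply: continuousD.
 + by apply: continuousM; [exact: cst_continuous|exact: ok_cts].
 + by apply: continuousM; [exact: cst_continuous|exact: ok_cts].
 + by apply: continuousM; [exact: cst_continuous|exact: ok_cts].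
 - exact: (hintableD (hintsZ b i1) i4).
 - have cz := cvg_powR0 b0; apply: (norm_cvg0 _); apply: (squeeze_cvgr _ (cvg_cst 0) cz).
 apply: nearW => n; have n0 : (0:R) < n.+2%:R by rewrite ltr0n.
 rewrite normr_ge0 /H; have := osc_ker_le (b+1) c s th (n.+2%:R^-1).
 rewrite /osc_ker addrK => /le_trans; apply; rewrite -[leRHS]mulr1 ler_wpM2l//.
 by rewrite -expR0 ler_expR mulNr oppr_le0 mulr_ge0.
 - have cz := cvg_powR_exp b0 c0; apply: (norm_cvg0 _); apply: (squeeze_cvgr _ (cvg_cst 0) cz).
 apply: nearW => n; rewrite normr_ge0 /H.
 by have := osc_ker_le (b+1) c s th (n.+2%:R); rewrite /osc_ker addrK.
move: h0; rewrite /h (hintD (hintsZ b i1) i4) (hintD (hintsZ _ i2) (hintsZ _ i3)) !hintZ// => h0.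
by rewrite /osc_int; lra.
Qed.
Lemma hint_derive (f df : R -> R -> R) (a u v : R) (g : R -> R) : a \in `]u, v[ ->
 (forall x, x \in `]u, v[ -> hints (f x)) ->
 (forall x t : R, x \in `]u, v[ -> 0 < t -> is_derive x (1 : R) (f ^~ t) (df x t)) ->
 hints g -> (forall t, 0 <= g t) ->
 (forall x t : R, x \in `]u, v[ -> 0 < t -> `|df x t| <= g t) ->
 is_derive a (1 : R) (fun x => hint (f x)) (hint (df a)).
move=> auv fi fd gi g0 dg.
have mD : measurable D by [].
have inD t : D t -> 0 < t by rewrite /= in_itv andbT.
have der x t : (`]u, v[%classic : set R) x -> D t -> derivable (f ^~ t) x 1 by move=> xuv /inD t0; have dt := fd x t xuv t0.
have dE x t : (`]u, v[%classic : set R) x -> D t -> partial1of2 f x t = df x t.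
 move=> xuv /inD t0; have dt := fd x t xuv t0.
 by rewrite partial1of2E (@derive_val _ _ _ _ _ _ _ dt).
have bnd x t : (`]u, v[%classic : set R) x -> D t -> `|partial1of2 f x t| <= g t by move=> xuv Dt; rewrite dE// dg//; exact: inD.
have h1 := @derivable_under_integral R _ _ leb f D mD a u v auv fi der g g0 gi bnd.
have h2 := @differentiation_under_integral R _ _ leb f D mD a u v auv fi der g g0 gi bnd.
apply: DeriveDef; first exact: h1.
rewrite -derive1E [LHS]h2; apply: eq_Rintegral => t; rewrite inE => Dt.
exact: dE.
Qed.

Lemma is_derive_curve_ker (cc ss : R -> R) (b th x t dc ds : R) : 0 < t ->
 is_derive x (1 : R) cc dc -> is_derive x (1 : R) ss ds ->
 is_derive x (1 : R) (fun y => osc_ker b (cc y) (ss y) th t)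
 (- dc*osc_ker (b+1) (cc x) (ss x) th t + (- ds)*osc_ker (b+1) (cc x) (ss x) (th-pi/2) t).
move=> t0 hc hs.
have h1 : is_derive x (1 : R) (fun y => - cc y*t) (- dc*t).
 have h := is_deriveM (is_deriveN hc) (is_derive_cst t x (1 : R)).
 by apply: (is_derive_eq h); rewrite /GRing.scale /= mulr0 add0r mulrC.
have h2 : is_derive x (1 : R) (fun y => ss y*t+th) (ds*t).
 have h := is_deriveD (is_deriveM hs (is_derive_cst t x (1 : R))) (is_derive_cst th x (1 : R)).
 by apply: (is_derive_eq h); rewrite /GRing.scale /= mulr0 add0r addr0 mulrC.
have h3 := is_derive_exp_cos h1 h2; have h4 := is_deriveZ (t `^ (b-1)) h3.
apply: (is_derive_eq h4); rewrite /osc_ker /GRing.scale /= addrK addrA cosBpihalf.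
have -> : t `^ b = t `^ (b-1)*t by rewrite -{3}(powRr1 (ltW t0)) -powRD ?subrK// (gt_eqF t0) implybT.
by ring.
Qed.
(** Differentiation under the integral along a curve of parameters with real part bounded below. A
    factor [t] comes down, which raises [b] by one. *)
Lemma osc_int_derive (cc ss dc ds : R -> R) (b th a u v c0 M : R) : 0 < b -> a \in `]u, v[ -> 0 < c0 ->
 (forall x, x \in `]u, v[ -> is_derive x (1 : R) cc (dc x) /\ is_derive x (1 : R) ss (ds x)) ->
 (forall x, x \in `]u, v[ -> [/\ c0 <= cc x, `|dc x| <= M & `|ds x| <= M]) ->
 is_derive a (1 : R) (fun x => osc_int b (cc x) (ss x) th)
 (- dc a*osc_int (b+1) (cc a) (ss a) th + (- ds a)*osc_int (b+1) (cc a) (ss a) (th-pi/2)).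
move=> b0 auv c00 hd hb; have b1 : 0 < b+1 by lra.
have [ca Ma _] := hb _ auv; have M0 : 0 <= M by exact: le_trans Ma.
have [C [C0 hC]] := exp_pdom b1 c00.
have i1 : hints (pdom (b+1-1) 2) by apply: hint_pdom; lra.
pose df x t := - dc x*osc_ker (b+1) (cc x) (ss x) th t + (- ds x)*osc_ker (b+1) (cc x) (ss x) (th-pi/2) t.
have cpos x : x \in `]u, v[ -> 0 < cc x by move=> /hb[h _ _]; exact: lt_le_trans h.
have := @hint_derive (fun x => osc_ker b (cc x) (ss x) th) df a u v
 (fun t => 2*M*C * pdom (b+1-1) 2 t) auv.
have -> : hint (df a) = - dc a*osc_int (b+1) (cc a) (ss a) th + (- ds a)*osc_int (b+1) (cc a) (ss a) (th-pi/2) by rewrite /df hintD ?hintZ//; try apply: hintsZ; apply: ok_hint => //; exact: cpos.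
apply.
- by move=> x /cpos h; exact: ok_hint.
- by move=> x t /hd[h1 h2] t0; exact: is_derive_curve_ker.
- exact: hintsZ.
- by move=> t; rewrite !mulr_ge0 ?pdom_ge0// ltW.
- move=> x t xuv t0; have [h1 h2 h3] := hb _ xuv.
 have kb th' : `|osc_ker (b+1) (cc x) (ss x) th' t| <= C * pdom (b+1-1) 2 t.
 apply: (le_trans (osc_ker_le _ _ _ _ _)); apply: le_trans (hC _ t0).
 by rewrite ler_wpM2l// ler_expR !mulNr lerN2 ler_wpM2r// ltW.
 apply: (le_trans (ler_normD _ _)); rewrite (normrM (- dc x)) (normrM (- ds x)) !normrN.
 have -> : 2*M*C * pdom (b+1-1) 2 t = M * (C * pdom (b+1-1) 2 t)+M * (C * pdom (b+1-1) 2 t) by ring.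
 by apply: lerD; apply: ler_pM.
Qed.
Lemma derive0_eq (F : R -> R) (x y : R) : x < y ->
 (forall z : R, x <= z <= y -> is_derive z (1 : R) F 0) -> F x = F y.
move=> xy dF; have [||z _ h] := @MVT R F (fun _ => 0) x y xy.
- by move=> z; rewrite in_itv /= => /andP[h1 h2]; apply: dF; rewrite !ltW.
- apply: derivable_within_continuous => z; rewrite in_itv /= => h.
 have dz := dF z h; exact: (@ex_derive _ _ _ _ _ _ _ dz).
- by apply/esym/eqP; rewrite -subr_eq0 h mul0r.
Qed.
(** Integration by parts shows that [x ^ b] times the integral has derivative zero in [x]. *)
Lemma radial_osc_int b r : 0 < b -> 0 < r ->
 osc_int b r 0 0 = r `^ (- b)*osc_int b 1 0 0.
move=> b0 r0.
pose F x := x `^ b*osc_int b x 0 0.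
have dF (x : R) : 0 < x -> is_derive x (1 : R) F 0.
 move=> x0.
 have d1 := @is_derive1_powR R b x x0.
 have xin : x \in `](x/2), (x+1)[ by rewrite in_itv /=; apply/andP; split; lra.
 have x20 : 0 < x/2 by lra.
 have d2 := @osc_int_derive id (cst 0) (cst 1) (cst 0) b 0 x (x/2) (x+1) (x/2) 1 b0 xin x20.
 have {}d2 := d2 (fun y _ => conj (is_derive_id y 1) (is_derive_cst 0 y 1)).
 have d3 : is_derive x (1 : R) (fun y => osc_int b y 0 0) (- osc_int (b+1) x 0 0).
 have := d2 _; rewrite /= oppr0 mul0r addr0 mulN1r; apply.
 by move=> y; rewrite in_itv /= => /andP[h1 h2]; rewrite normr1 normr0; split=> //; lra.
 have d4 := is_deriveM d1 d3; apply: (is_derive_eq d4); rewrite /GRing.scale /=.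
 have := @osc_int_parts b x 0 0 b0 x0; rewrite mul0r addr0 => h.
 have -> : x `^ b = x `^ (b-1)*x.
 by rewrite -{3}(powRr1 (ltW x0)) -powRD ?subrK// (gt_eqF x0) implybT.
 have -> : osc_int b x 0 0 * (b*x `^ (b-1)) = x `^ (b-1) * (b*osc_int b x 0 0) by ring.
 by rewrite h; ring.
have FE x y : 0 < x -> x < y -> F x = F y by move=> x0 xy; apply: (derive0_eq xy) => z /andP[h _]; apply: dF; side.
have Fr : F r = F 1.
 have [h|h|->//] := ltgtP r 1; first exact: FE.
 by apply/esym; exact: FE.
move: Fr; rewrite /F powR1 mul1r => <-; rewrite mulrA -powRD ?(gt_eqF r0) ?implybT//.
by rewrite addNr powRr0 mul1r.
Qed.
Lemma cos_gt0_nbhs (a : R) : 0 < cos a -> exists u v c0 : R, [/\ 0 < c0, a \in `]u, v[ &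
 forall x, x \in `]u, v[ -> c0 <= cos x].
move=> ca; have c2 : 0 < cos a/2 by lra.
have := @continuous_cos R a; move=> /cvgrPdist_lt/(_ _ c2)[e /= e0 he].
exists (a-e), (a+e), (cos a/2); split=> //.
 by rewrite in_itv /=; lra.
move=> x; rewrite in_itv /= => /andP[h1 h2].
have /he : ball a e x by rewrite /ball /= ltr_distlC; lra.
by rewrite ltr_norml => /andP[_]; lra.
Qed.
Lemma solve_rotation (x y p q w : R) : p ^+ 2+q ^+ 2 = 1 ->
 x * p+y*q = w -> x*q-y * p = 0 -> x = w * p /\ y = w*q.
move=> pq <- h0; split; apply/eqP; rewrite -subr_eq0; apply/eqP.
- have -> : x - (x * p+y*q) * p = x * (1 - (p ^+ 2+q ^+ 2))+q * (x*q-y * p) by ring.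
 by rewrite pq h0 subrr !mulr0 addr0.
- have -> : y - (x * p+y*q)*q = y * (1 - (p ^+ 2+q ^+ 2))-p * (x*q-y * p) by ring.
 by rewrite pq h0 subrr !mulr0 subr0.
Qed.
(** Along an arc of radius [r], integration by parts gives [Ci' = - b Si] and [Si' = b Ci], so the
    pair rotates with speed [b]. This is the formula [Gamma(b) z^(-b)] at a complex [z], without
    complex powers. *)
Lemma polar_osc_int b r phi : 0 < b -> 0 < r -> 0 <= phi < pi/2 ->
 osc_int b (r*cos phi) (r*sin phi) 0 = r `^ (- b)*osc_int b 1 0 0*cos (b * phi) /\
 osc_int b (r*cos phi) (r*sin phi) (- (pi/2)) = r `^ (- b)*osc_int b 1 0 0*sin (b * phi).
move=> b0 r0 /andP[p0 p1].
pose Ci x := osc_int b (r*cos x) (r*sin x) 0.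
pose Si x := osc_int b (r*cos x) (r*sin x) (- (pi/2)).
have cpos x : 0 <= x <= phi -> 0 < cos x.
 by move=> /andP[h1 h2]; apply: cos_gt0_pihalf; apply/andP; split; have := pi_gt0 R; lra.
have dth th (x : R) : 0 <= x <= phi -> is_derive x (1 : R) (fun y => osc_int b (r*cos y) (r*sin y) th)
 (- b*osc_int b (r*cos x) (r*sin x) (th-pi/2)).
 move=> hx; have cx := cpos _ hx; have [u [v [c0 [c00 xuv hc]]]] := cos_gt0_nbhs cx.
 have rc0 : 0 < r*c0 by rewrite mulr_gt0.
 have dc y : is_derive y (1 : R) (fun y => r*cos y) (- (r*sin y)).
 have := is_deriveZ r (is_derive_cos y); rewrite /GRing.scale /= mulrN; by [].
 have ds y : is_derive y (1 : R) (fun y => r*sin y) (r*cos y).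
 exact: (is_deriveZ r (is_derive_sin y)).
 have bd (w : R) : -1 <= w <= 1 -> `|r*w| <= r by move=> hw; rewrite normrM gtr0_norm// -[leRHS]mulr1 ler_pM2l// ler_norml.
 have := @osc_int_derive (fun y => r*cos y) (fun y => r*sin y) (fun y => - (r*sin y)) (fun y => r*cos y)
 b th x u v (r*c0) r b0 xuv rc0 (fun y _ => conj (dc y) (ds y)).
 have xc0 : 0 < r*cos x by [].
 have e1 := @osc_int_parts b (r*cos x) (r*sin x) (th-pi/2) b0 xc0.
 have e2 : th-pi/2-pi/2 = th-pi by field.
 rewrite e2 osc_int_pi// in e1.
 have -> : - - (r*sin x)*osc_int (b+1) (r*cos x) (r*sin x) th +
 - (r*cos x)*osc_int (b+1) (r*cos x) (r*sin x) (th-pi/2) =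
 - b*osc_int b (r*cos x) (r*sin x) (th-pi/2) by rewrite [RHS]mulNr e1; ring.
 apply; move=> y /hc h; split; first by rewrite ler_pM2l.
 by rewrite normrN bd// sin_geN1 sin_le1.
 by rewrite bd// cos_geN1 cos_le1.
have dC (x : R) : 0 <= x <= phi -> is_derive x (1 : R) Ci (- b*Si x) by move=> hx; have := dth 0 x hx; rewrite sub0r.
have dS (x : R) : 0 <= x <= phi -> is_derive x (1 : R) Si (b*Ci x).
 move=> hx; have cx := cpos _ hx; have := dth (- (pi/2)) x hx.
 have -> : - (pi/2)-pi/2 = 0-pi :> R by field.
 by rewrite osc_int_pi// mulrNN.
(* The pair rotated back and projected; it is constant for each [th], and the two values [0] and
   [- pi / 2] of [th] determine the pair. *)
pose G th x := Ci x*cos (b*x+th)+Si x*sin (b*x+th).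
have dG th (x : R) : 0 <= x <= phi -> is_derive x (1 : R) (G th) 0.
 move=> hx; have l := der_lin b th x.
 have hco : is_derive x (1 : R) (fun y => cos (b*y+th)) (- sin (b*x+th)*b).
 exact: (@is_derive1_comp _ cos _ x _ b (is_derive_cos (b*x+th)) l).
 have hsi : is_derive x (1 : R) (fun y => sin (b*y+th)) (cos (b*x+th)*b).
 exact: (@is_derive1_comp _ sin _ x _ b (is_derive_sin (b*x+th)) l).
 have h := is_deriveD (is_deriveM (dC x hx) hco) (is_deriveM (dS x hx) hsi).
 by apply: (is_derive_eq h); rewrite /GRing.scale /=; ring.
have GE th : G th phi = G th 0.
 move: p0; rewrite le_eqVlt => /orP[/eqP<-//|p0].
 by apply/esym; apply: (derive0_eq p0) => z; side.
have C0 : Ci 0 = r `^ (- b)*osc_int b 1 0 0 by have <- := radial_osc_int b0 r0; rewrite /Ci cos0 sin0 mulr0 mulr1.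
have S0 : Si 0 = 0.
 rewrite /Si cos0 sin0 mulr0 mulr1 /osc_int -[RHS](mul0r (hint (osc_ker b r 0 0))) -hintZ.
 by apply: hint_eq => t _; rewrite /osc_ker !mul0r add0r cosN cos_pihalf !mulr0.
 exact: ok_hint.
have g0 := GE 0; have g1 := GE (- (pi/2)).
move: g0 g1; rewrite /G C0 S0 !mulr0 !addr0 !add0r cos0 cosN cos_pihalf mulr0 mul0r addr0 add0r mulr1.
have -> : cos (b * phi-pi/2) = sin (b * phi) by rewrite cosBpihalf.
have -> : sin (b * phi-pi/2) = - cos (b * phi) by rewrite sinBpihalf.
rewrite -/(Ci phi) -/(Si phi) => g0 g1.
rewrite mul0r mulrN in g1.
exact: (solve_rotation (cos2Dsin2 (b * phi)) g0 g1).
Qed.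

(* The real part of exp(i th) z E_b(z) for z = r exp(-i phi). *)
Lemma osc_int_polar b r phi th : 0 < b -> 0 < r -> 0 <= phi < pi/2 ->
 r*cos phi*osc_int b (r*cos phi) (r*sin phi) th +
 r*sin phi*osc_int b (r*cos phi) (r*sin phi) (th-pi/2) =
 r `^ (1-b)*osc_int b 1 0 0*cos (th - (1-b) * phi).
move=> b0 r0 hp; have /andP[p0 p1] := hp.
have c0 : 0 < r*cos phi by rewrite mulr_gt0//; apply: cos_gt0_pihalf; side.
have [eC eS] := polar_osc_int b0 r0 hp.
have split_th th' : osc_int b (r*cos phi) (r*sin phi) th' =
 cos th'*osc_int b (r*cos phi) (r*sin phi) 0-sin th'*osc_int b (r*cos phi) (r*sin phi) (- (pi/2)).
 have i1 := ok_hint (r*sin phi) 0 b0 c0.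
 have i2 := ok_hint (r*sin phi) (- (pi/2)) b0 c0.
 rewrite -mulNr /osc_int -!hintZ// -hintD; [|exact: hintsZ|exact: hintsZ].
 apply: hint_eq => t _; rewrite /osc_ker addr0 cosBpihalf cosD; ring.
rewrite (split_th th) (split_th (th-pi/2)) eC eS cosBpihalf sinBpihalf.
have -> : r `^ (1-b) = r*r `^ (- b) by rewrite powRD ?(gt_eqF r0) ?implybT// powRr1// ltW.
have -> : th - (1-b) * phi = th-phi+b * phi by ring.
by rewrite cosD cosB sinB; ring.
Qed.

End HalfLine.

(** * Expectations as integrals of tails *)

Section TailIntegral.
Context {d} {X : measurableType d} {R : realType}.
Variable mu : probability X R.
Local Notation leb := (@lebesgue_measure R).
Local Notation m := (pr mu).
Local Notation E := (ex mu).

Definition tail_test (Phi p : R -> R) : Prop :=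
 [/\ forall t : R, is_derive t (1 : R) Phi (p t), continuous p & Phi 0 = 0].

Lemma mtail_test Phi p : tail_test Phi p ->
 mfun R p /\ mfun R Phi.
move=> [dP cp _]; split; apply: continuous_measurable_fun; first exact: cp.
move=> t; apply: differentiable_continuous; apply/derivable1_diffP.
by [].
Qed.
Lemma tail_test_integral Phi p (y : R) : tail_test Phi p -> 0 <= y ->
 (\int[leb]_(t in `]0%R, y[) (p t)%:E = (Phi y)%:E)%E.
move=> hp; have [mp _] := mtail_test hp; have [dP cp P0] := hp.
rewrite le_eqVlt => /orP[/eqP<-|y0].
 by rewrite set_itvoo0 integral_set0 P0.
have -> : (Phi y)%:E = (Phi y-Phi 0)%:E by rewrite P0 subr0.
rewrite -(@FTC_itv R Phi p 0 y y0); last by move=> t _; exact: cp.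
rewrite (@integral_itv_bndo_bndc _ (BRight 0) y (EFin \o p)); last first.
 by [].
rewrite (@integral_itv_obnd_cbnd _ 0 (BRight y) (EFin \o p))//.
Qed.

Variable Y : X -> R.
Hypotheses (mY : mfun X Y) (Y0 : forall x, 0 <= Y x).

Lemma measurable_undergraph :
 measurable [set z : X * measurableTypeR R | 0 < (z.2 : R) /\ (z.2 : R) < Y z.1].
have mg : measurable_fun [set: X * measurableTypeR R] (fun z => Y z.1 - (z.2 : R)) by apply: measurable_funB => //; apply: measurableT_comp => //; side.
rewrite (_ : [set _ | _] = [set z | 0 < (z.2 : R)] `&` [set z | 0 < Y z.1 - (z.2 : R)]).
 by apply: measurableI; exact: mset_gt.
by apply/seteqP; split=> z /=; rewrite subr_gt0.
Qed.
(** Fubini on the region under the graph of [Y]; integrability on the product follows from that of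
    the tail integral. *)
Lemma tail_integral Phi p : tail_test Phi p ->
 hints (fun t => p t * m [set x | t < Y x]) ->
 mu.-integrable setT (EFin \o (Phi \o Y)) /\
 E (Phi \o Y) = hint (fun t => p t * m [set x | t < Y x]).
move=> hp hi; have [mp mPhi] := mtail_test hp.
pose A : set (X * measurableTypeR R) := [set z | 0 < (z.2 : R) /\ (z.2 : R) < Y z.1].
have mA : measurable A := measurable_undergraph.
pose F (z : X * measurableTypeR R) : \bar R := (p z.2 * \1_A z)%:E.
have mF : measurable_fun setT F.
 apply/measurable_EFinP; apply: measurable_funM; last side.
 by apply: measurableT_comp => //; side.
have inner_x (x : X) : (\int[leb]_t F (x, t) = (Phi (Y x))%:E)%E.
 rewrite -(tail_test_integral hp (Y0 x)) [RHS]integral_mkcond.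
 apply: eq_integral => t _; rewrite /F patchE indicE.
 case: ifPn => h.
 by rewrite mem_set ?mulr1; move: h; rewrite inE /= in_itv => /andP[].
 rewrite memNset ?mulr0// => -[/= h1 h2]; case/negP: h.
 by rewrite inE /= in_itv /= h1 h2.
have inner_t (g : R -> R) (t : R) :
 (\int[mu]_x (g t * \1_A (x, t))%:E = ((fun t => (g t * m [set x | t < Y x])%:E) \_ `]0%R, +oo[) t)%E.
 rewrite patchE; case: ifPn => h.
 have t0 : 0 < t by move: h; rewrite inE /= in_itv andbT.
 have -> : (fun x => (g t * \1_A (x, t))%:E) = EFin \o (fun x => g t * \1_[set x | t < Y x] x).
 apply/funext => x; congr (_ * _)%:E; rewrite !indicE; congr (nat_of_bool _)%:R.
 by apply/idP/idP; rewrite !inE /A; [case|split].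
 rewrite -[LHS]fineK; last by apply: integrable_fin_num => //; exact: bmf_int.
 have <- : E (fun x => g t * \1_[set x | t < Y x] x) = g t * m [set x | t < Y x] by rewrite exZ ?ex_indic//; side.
 by [].
 apply: integral0_eq => x _; rewrite indicE memNset ?mulr0// => -[/= h1 _].
 by case/negP: h; rewrite inE /= in_itv /= h1.
have iF : (mu \x leb)%E.-integrable setT F.
 apply: (proj2 (@integrable21ltyP _ _ _ _ _ mu leb F mF)).
 have -> : (fun t => \int[mu]_x `|F (x, t)|)%E =
 ((fun t => (`|p t * m [set x | t < Y x]|)%:E) \_ `]0%R, +oo[).
 apply/funext => t.
 have -> : (fun x => `|F (x, t)|)%E = (fun x => (`|p t| * \1_A (x, t))%:E) by apply/funext => x; rewrite /F /= normrM (ger0_norm (_ : 0 <= \1_A (x, t))) indicE.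
 rewrite (inner_t (fun t => `|p t|)); rewrite !patchE; case: ifP => // _.
 by rewrite normrM (ger0_norm (pr_ge0 _ _)).
 rewrite -integral_mkcond.
 by have /integrableP[_] := hi.
have := integral12_prod_meas1 iF; have := integral21_prod_meas1 iF; rewrite /fubini_F /fubini_G => e2 e1.
have iPhi : mu.-integrable setT (EFin \o (Phi \o Y)).
 have := integrable_fubini_F iF; rewrite /fubini_F.
 apply: eq_integrable => // x _; side.
split=> //; rewrite /ex /Rintegral; congr fine.
have -> : (\int[mu]_x ((Phi \o Y) x)%:E = \int[mu]_x \int[leb]_t F (x, t))%E by apply: eq_integral => x _.
rewrite [LHS]e1 -e2 /hint [RHS]integral_mkcond.
by apply: eq_integral => t _; rewrite -inner_t.
Qed.

End TailIntegral.

(** * Limits of scaled expectations for regularly varying tails *)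

Section TailLimit.
Context {d} {X : measurableType d} {R : realType}.
Variable mu : probability X R.
Local Notation m := (pr mu).
Local Notation E := (ex mu).
Variables (Y : nat -> X -> R) (al c kap kap' C : R).
Hypotheses (mY : forall n, mfun X (Y n)) (Y0 : forall n x, 0 <= Y n x) (hk : kap <= kap') (C0 : 0 <= C)
 (htail : forall t : R, 0 < t -> n%:R * m [set x | t < Y n x] @[n --> \oo] --> c*t `^ (- al)).
Hypothesis hbound : \forall n \near \oo, forall t : R, 0 < t ->
 n%:R * m [set x | t < Y n x] <= C*Num.max (t `^ (- kap)) (t `^ (- kap')).

Lemma max_pdom (a b t : R) : 0 < t ->
 Num.max (t `^ (- kap)) (t `^ (- kap')) * pdom a b t = pdom (a-kap') (b+kap) t.
move=> t0; rewrite /pdom; case: (leP t 1) => t1.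
 have -> : Num.max (t `^ (- kap)) (t `^ (- kap')) = t `^ (- kap') by apply/max_idPr; rewrite ger_powR ?t0// lerN2.
 by rewrite mulrC -powRD// (gt_eqF t0) implybT.
have -> : Num.max (t `^ (- kap)) (t `^ (- kap')) = t `^ (- kap) by apply/max_idPl; rewrite ler_powR ?lerN2// ltW.
by rewrite opprD -powRD ?(gt_eqF t0) ?implybT// addrC.
Qed.
Lemma measurable_tail n : mfun R (fun t : R => m [set x | t < Y n x]).
rewrite (_ : (fun _ => _) = (fun t : R => fine (\int[mu]_x (\1_[set z : R*X | z.1 < Y n z.2] (t, x))%:E)%E)).
 apply: measurableT_comp => //.
 have mA : measurable [set z : R*X | z.1 < Y n z.2].
 rewrite (_ : [set _ | _] = [set z : R*X | 0 < Y n z.2-z.1]).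
 apply: mset_gt; apply: measurable_funB; last side.
 by apply: measurableT_comp => //; side.
 by apply/seteqP; split=> z /=; side.
 apply: (@measurable_fun_fubini_tonelli_F _ _ _ _ R mu (fun z => (\1_[set z : R*X | z.1 < Y n z.2] z)%:E)).
 by [].
 by [].
apply/funext => t; rewrite -ex_indic; last side.
rewrite /ex /Rintegral; congr fine; apply: eq_integral => x _; congr EFin.
Qed.
(** The threshold [N] is chosen before the test function, so the bounds hold uniformly over families
    of tests with a common [Cp]. *)
Lemma tail_bounded : exists N : nat, forall n, (N <= n)%N ->
 forall (Phi p : R -> R) (a b Cp : R), tail_test Phi p -> 0 <= Cp ->
 (forall t : R, 0 < t -> `|p t| <= Cp * pdom a b t) -> kap' < 1 + a -> 1 < b+kap ->
 [/\ hints (fun t => p t * (n%:R * m [set x | t < Y n x])),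
 mu.-integrable setT (EFin \o (Phi \o Y n)),
 n%:R*E (Phi \o Y n) = hint (fun t => p t * (n%:R * m [set x | t < Y n x])) &
 `|n%:R*E (Phi \o Y n)| <= Cp*C*hint (pdom (a-kap') (b+kap))].
have [N _ hN] := hbound; exists N.+1 => n Nn Phi p a b Cp hp Cp0 pb ha hb.
have n0 : 0 < n%:R :> R by rewrite ltr0n (leq_trans _ Nn).
have [mp _] := mtail_test hp.
have ipd : hints (pdom (a-kap') (b+kap)) by apply: hint_pdom; lra.
have bnd (t : R) : 0 < t -> `|p t * (n%:R * m [set x | t < Y n x])| <= Cp*C * pdom (a-kap') (b+kap) t.
 move=> t0; rewrite normrM (ger0_norm (mulr_ge0 (ltW n0) (pr_ge0 _ _))).
 rewrite -(max_pdom _ _ t0).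
 have -> : Cp*C * (Num.max (t `^ (- kap)) (t `^ (- kap')) * pdom a b t) =
 Cp * pdom a b t * (C*Num.max (t `^ (- kap)) (t `^ (- kap'))) by ring.
 apply: ler_pM => //; first by rewrite mulr_ge0 ?pr_ge0// ltW.
 exact: pb.
 by apply: hN => //=; exact: ltnW.
have i1 : hints (fun t => p t * (n%:R * m [set x | t < Y n x])).
 apply: (hintable_le _ (hintsZ (Cp*C) ipd)) => //.
 apply: measurable_funTS; apply: measurable_funM => //; apply: measurable_funM => //.
 exact: measurable_tail.
have i2 : hints (fun t => p t * m [set x | t < Y n x]).
 have := hintsZ n%:R^-1 i1; apply: hintable_eq => t _.
 by rewrite mulrCA mulKf// gt_eqF.
have [i3 e3] := tail_integral (mY n) (Y0 n) hp i2.
have e4 : n%:R*E (Phi \o Y n) = hint (fun t => p t * (n%:R * m [set x | t < Y n x])) by rewrite e3 -hintZ//; apply: hint_eq => t _; rewrite mulrCA.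
split=> //; rewrite e4 -hintZ//; apply: hint_le_abs => //; exact: hintsZ.
Qed.
(** Dominated convergence: the Potter-type bound times the bound on [p] is integrable at 0 because
    [kap' < 1 + a] and at infinity because [1 < b + kap]. The sequence is shifted to the indices
    where the bound holds. *)
Lemma tail_limit (Phi p : R -> R) (a b Cp : R) : tail_test Phi p -> 0 <= Cp ->
 (forall t : R, 0 < t -> `|p t| <= Cp * pdom a b t) -> kap' < 1 + a -> 1 < b+kap ->
 n%:R*E (Phi \o Y n) @[n --> \oo] --> c*hint (fun t => p t*t `^ (- al)).
move=> hp Cp0 pb ha hb; have [mp _] := mtail_test hp.
have [N hN] := tail_bounded; have [N' _ hN'] := hbound.
have ipd : hints (pdom (a-kap') (b+kap)) by apply: hint_pdom; lra.
pose M := maxn N N'.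
have NM k : (N <= k+M)%N by rewrite (leq_trans (leq_maxl N N'))// leq_addl.
have N'M k : (N' <= k+M)%N by rewrite (leq_trans (leq_maxr N N'))// leq_addl.
have [i1 c1] : hints (fun t => p t * (c*t `^ (- al))) /\
 hint (fun t => p t * ((k+M)%:R * m [set x | t < Y (k+M)%N x])) @[k --> \oo] --> hint (fun t => p t * (c*t `^ (- al))).
 apply: (@hint_dominated R _ _ (fun t => Cp*C * pdom (a-kap') (b+kap) t)).
 - by move=> k; have [h _ _ _] := hN _ (NM k) Phi p a b Cp hp Cp0 pb ha hb; exact: hintable_meas.
 - apply: measurable_funTS; apply: measurable_funM => //; apply: measurable_funM => //.
 - exact: hintsZ.
 - move=> k t t0; rewrite normrM (ger0_norm (mulr_ge0 _ (pr_ge0 _ _)))//.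
 rewrite -(max_pdom _ _ t0).
 have -> : Cp*C * (Num.max (t `^ (- kap)) (t `^ (- kap')) * pdom a b t) =
 Cp * pdom a b t * (C*Num.max (t `^ (- kap)) (t `^ (- kap'))) by ring.
 by apply: ler_pM => //; [rewrite mulr_ge0 ?pr_ge0|exact: pb|apply: (hN' _ (N'M k))].
 - move=> t t0; apply: cvgM; first side.
 have := htail t0; rewrite -(cvg_shiftn M); apply.
rewrite -(cvg_shiftn M).
have -> : c*hint (fun t => p t*t `^ (- al)) = hint (fun t => p t * (c*t `^ (- al))).
 have [c00|cn0] := eqVneq c 0.
 rewrite c00 mul0r /hint /Rintegral integral0_eq//= => t _.
 by rewrite mul0r mulr0.
 rewrite -hintZ; first by apply: hint_eq => t _; ring.
 have := hintsZ c^-1 i1; apply: hintable_eq => t _.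
 by rewrite mulrCA mulKf.
apply: cvg_trans c1; apply: near_eq_cvg; apply: nearW => k /=.
by have [_ _ -> _] := hN _ (NM k) Phi p a b Cp hp Cp0 pb ha hb.
Qed.

(** For [al < 1] the derivative of [cos th - cos (w y + th)] is not absolutely integrable against
    [t^(-al)]. The damping factor makes it so, and is removed afterwards by turning the parameter
    towards the imaginary axis. *)
Definition damped (c0 s th y : R) : R := cos th-expR (- c0*y)*cos (s*y+th).
Definition damped_p (c0 s th t : R) : R :=
 c0 * (expR (- c0*t)*cos (s*t+th))+s * (expR (- c0*t)*cos (s*t + (th-pi/2))).

Lemma damped_test c0 s th : tail_test (damped c0 s th) (damped_p c0 s th).
split.
- move=> t; have h := is_derive_exp_cos (der_lin (- c0) 0 t) (der_lin s th t).
 have h2 := is_deriveB (is_derive_cst (cos th) t (1 : R)) h.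
 have -> : damped c0 s th = cst (cos th) - (fun p : R => expR (- c0 * p+0)*cos (s * p+th)) by apply/funext => y; rewrite /damped -[in LHS](addr0 (- c0*y)).
 apply: (is_derive_eq h2); rewrite /damped_p !addr0 addrA cosBpihalf; ring.
- by move=> t; apply: cvgD; (apply: cvgM; [side|exact: continuous_exp_cos]).
- by rewrite /damped !mulr0 expR0 mul1r add0r subrr.
Qed.
Lemma damped_p_bound c0 s : 0 < c0 -> exists Cp : R, 0 <= Cp /\
 forall th t : R, 0 < t -> `|damped_p c0 s th t| <= Cp * pdom 0 2 t.
move=> c00; have [C' [C'0 hC]] := exp_pdom ltr01 c00.
exists ((c0 + `|s|)*C'); split; first side.
move=> th t t0; have := hC t t0; rewrite subrr powRr0 mul1r => h.
have k th' : `|expR (- c0*t)*cos (s*t+th')| <= C' * pdom 0 2 t.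
 apply: le_trans h; rewrite normrM (ger0_norm (expR_ge0 _)) -[leRHS]mulr1.
 by rewrite ler_wpM2l// ler_norml cos_geN1 cos_le1.
have -> : (c0 + `|s|)*C' * pdom 0 2 t = c0 * (C' * pdom 0 2 t) + `|s| * (C' * pdom 0 2 t) by ring.
apply: (le_trans (ler_normD _ _)); apply: lerD.
 by rewrite normrM gtr0_norm// ler_wpM2l// ltW.
by rewrite normrM ler_wpM2l.
Qed.
Lemma damped_le2 c0 s th y : 0 <= c0 -> 0 <= y -> `|damped c0 s th y| <= 2.
move=> c00 y0; apply: (le_trans (ler_normB _ _)); rewrite (_ : 2 = 1+1)//; apply: lerD.
 by side.
rewrite normrM (ger0_norm (expR_ge0 _)) -[leRHS]mul1r; apply: ler_pM => //.
 by rewrite -expR0 ler_expR mulNr oppr_le0.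
by side.
Qed.
Lemma damped_lin c0 s th y : 0 <= c0 -> 0 <= y -> `|damped c0 s th y| <= (c0 + `|s|)*y.
move=> c00 y0; rewrite /damped.
have -> : cos th-expR (- c0*y)*cos (s*y+th) =
 (cos th-cos (s*y+th)) + (1-expR (- c0*y))*cos (s*y+th) by ring.
have -> : (c0 + `|s|)*y = `|s| * y+c0*y by ring.
apply: (le_trans (ler_normD _ _)); apply: lerD; last first.
 rewrite normrM -[leRHS]mulr1; apply: ler_pM => //; last by rewrite ler_norml cos_geN1 cos_le1.
 have h : expR (- c0*y) <= 1 by rewrite -expR0 ler_expR mulNr oppr_le0.
 by rewrite ger0_norm; have := expR_ge1Dx (- c0*y); lra.
apply: (le_trans (cos_diff_le _ _)); rewrite opprD addrCA subrr addr0 normrN normrM.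
by rewrite (ger0_norm y0).
Qed.
Lemma one_minus_exp (y : R) : 0 <= y -> Num.min 2 y <= 4 * (1-expR (- y)).
move=> y0; have h : expR (- y) <= (1+y)^-1.
 by rewrite expRN lef_pV2//; exact: expR_ge1Dx.
apply: (@le_trans _ _ (4 * (1 - (1+y)^-1))); last by lra.
have -> : 1 - (1+y)^-1 = y / (1+y) by field; side.
rewrite mulrA ler_pdivlMr; case: (leP 2 y) => y2; nra.
Qed.
(** The error made by damping is bounded by another damped test, of phase 0 and small parameter,
    whose scaled expectation has a small limit. *)
Lemma undamped_diff (w c0 s th y : R) : 0 <= c0 -> s <= w -> 0 <= y ->
 `|(cos th-cos (w*y+th))-damped c0 s th y| <= 5*damped (c0 + (w-s)) 0 0 y.
move=> c00 sw y0; rewrite /damped mul0r addr0 cos0 mulr1.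
have -> : cos th-cos (w*y+th) - (cos th-expR (- c0*y)*cos (s*y+th)) =
 (cos (s*y+th)-cos (w*y+th)) + (expR (- c0*y)-1)*cos (s*y+th) by ring.
have d0 : 0 <= (c0 + (w-s))*y by rewrite mulr_ge0 // addr_ge0// subr_ge0.
have h1 : `|cos (s*y+th)-cos (w*y+th)| <= 4 * (1-expR (- (c0 + (w-s))*y)).
 rewrite mulNr; apply: le_trans (one_minus_exp d0).
 have := cos_diff_min (s*y+th) (w*y+th); have -> : s*y+th - (w*y+th) = - ((w-s)*y) by ring.
 rewrite normrN (ger0_norm (mulr_ge0 _ y0)) ?subr_ge0// => /le_trans; apply.
 rewrite le_min !ge_min lexx; apply/orP; right.
 by rewrite [leRHS]mulrDl lerDr.
have h2 : `|(expR (- c0*y)-1)*cos (s*y+th)| <= 1-expR (- (c0 + (w-s))*y).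
 have e1 : expR (- c0*y) <= 1 by rewrite -expR0 ler_expR mulNr oppr_le0.
 have e2 : expR (- (c0 + (w-s))*y) <= expR (- c0*y) by rewrite ler_expR !mulNr lerN2 mulrDl lerDl mulr_ge0// subr_ge0.
 rewrite normrM -[leRHS]mulr1; apply: ler_pM => //; last by rewrite ler_norml cos_geN1 cos_le1.
 by rewrite ler0_norm; lra.
by apply: (le_trans (ler_normD _ _)); lra.
Qed.
Lemma bmf_damped n c0 s th : 0 <= c0 -> bmf (damped c0 s th \o Y n).
move=> c00; split; last by exists 2 => x; exact: damped_le2.
apply: measurableT_comp => //; exact: (mtail_test (damped_test c0 s th)).2.
Qed.
Lemma damped_limit_lt1 r phi th : 0 < al < 1 -> 0 < kap -> kap' < 1 -> 0 < r -> 0 <= phi < pi/2 ->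
 n%:R*E (damped (r*cos phi) (r*sin phi) th \o Y n) @[n --> \oo] -->
 c * (r `^ al*osc_int (1 - al) 1 0 0*cos (th - al * phi)).
move=> /andP[a0 a1] k0 k1 r0 hphi; have /andP[p0 p1] := hphi.
have c0 : 0 < r*cos phi by rewrite mulr_gt0//; apply: cos_gt0_pihalf; side.
have [Cp [Cp0 hCp]] := damped_p_bound (r*sin phi) c0.
have h := @tail_limit _ _ 0 2 Cp (damped_test (r*cos phi) (r*sin phi) th) Cp0 (hCp th).
have e : hint (fun t => damped_p (r*cos phi) (r*sin phi) th t*t `^ (- al)) =
 r `^ al*osc_int (1 - al) 1 0 0*cos (th - al * phi).
 have b0 : 0 < 1 - al by lra.
 have := osc_int_polar th b0 r0 hphi; rewrite opprB addrCA subrr addr0 => <-.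
 have i1 := ok_hint (r*sin phi) th b0 c0.
 have i2 := ok_hint (r*sin phi) (th-pi/2) b0 c0.
 rewrite /osc_int -!hintZ// -hintD; [|exact: hintsZ|exact: hintsZ].
 apply: hint_eq => t t0; rewrite /damped_p /osc_ker.
 have -> : 1 - al-1 = - al by ring.
 by ring.
by rewrite -e; apply: h; lra.
Qed.
Lemma abs_three (x y u v a b c1 e : R) : `|x-y| < a -> `|y-u| < b -> `|v-u| <= c1 ->
 a+b+c1 <= e -> `|x-v| < e.
rewrite !ltr_norml !ler_norml => /andP[? ?] /andP[? ?] /andP[? ?] ?.
by lra.
Qed.
(** The angle [phi] is fixed close to [pi / 2] before [n] tends to infinity: the damped limit is
    continuous in the angle, and the limit of the damping error is of order [de ^ al]. *)
Lemma undamped_limit_lt1 w th : 0 < al < 1 -> 0 < kap -> kap' < 1 -> 0 < w ->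
 n%:R*E (fun x => cos th-cos (w*Y n x+th)) @[n --> \oo] -->
 c * (w `^ al*osc_int (1 - al) 1 0 0*cos (th - al * (pi/2))).
move=> ha k0 k1 w0; have /andP[a0 a1] := ha; have pi0 := pi_gt0 R.
set G := osc_int _ _ _ _; apply/cvgrPdist_lt => e e0.
(* [q] and [d0] ensure that five times the limit of the error test is at most [e / 4] once
   [de < d0]. *)
pose q := 20 * (`|c| * `|G| + 1); have q0 : 0 < q by apply: mulr_gt0.
pose d0 := (e/q) `^ al^-1; have d00 : 0 < d0 by apply: powR_gt0.
have d0al : d0 `^ al = e/q by rewrite -powRrM mulVf// powRr1.
have e4 : 0 < e/4 by [].
have c1 : (w*cos x + (w-w*sin x)) @[x --> (pi/2 : R)^'-] --> w*cos (pi/2) + (w-w*sin (pi/2)).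
 by apply: cvg_at_left_filter; side.
rewrite cos_pihalf sin_pihalf mulr0 mulr1 subrr addr0 in c1.
have c2 : c * (w `^ al*G*cos (th - al*x)) @[x --> (pi/2 : R)^'-] --> c * (w `^ al*G*cos (th - al * (pi/2))).
 by apply: cvg_at_left_filter; side.
near (pi/2 : R)^'- => phi; have p1 : phi < pi/2 by near: phi; exact: nbhs_left_lt.
have p0 : 0 <= phi by near: phi; apply: nbhs_left_ge; lra.
have : w*cos phi + (w-w*sin phi) < d0 by near: phi; exact: cvgr_lt c1 _ d00.
have hlim : `|c * (w `^ al*G*cos (th - al * (pi/2)))-c * (w `^ al*G*cos (th - al * phi))| < e/4.
 by near: phi; move/cvgrPdist_lt : c2; apply.
set de := _ + _ => hd; have hphi : 0 <= phi < pi/2 by rewrite p0.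
have wc0 : 0 < w*cos phi by rewrite mulr_gt0//; apply: cos_gt0_pihalf; lra.
have sw : w*sin phi <= w by rewrite -[leRHS]mulr1 ler_pM2l// sin_le1.
have de0 : 0 < de by rewrite /de ltr_wpDr// subr_ge0.
have l1 := @damped_limit_lt1 _ _ th ha k0 k1 w0 hphi.
have l2 : n%:R*E (damped de 0 0 \o Y n) @[n --> \oo] --> c * (de `^ al*G).
 have := @damped_limit_lt1 de 0 0 ha k0 k1 de0.
 by rewrite cos0 sin0 !mulr0 mulr1 subrr cos0 mulr1; apply; lra.
have b2 : 5 * (c * (de `^ al*G)) <= e/4.
 have : `|c * (de `^ al*G)| <= (`|c| * `|G| + 1) * (e/q).
 rewrite !normrM (ger0_norm (powR_ge0 _ _)) mulrCA mulrC.
 by apply: ler_pM => //; [rewrite lerDl|rewrite -d0al ge0_ler_powR ?nnegrE// ltW].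
 have -> : (`|c| * `|G| + 1) * (e/q) = e/20 by rewrite /q; field; rewrite gt_eqF.
 by have := ler_norm (c * (de `^ al*G)); lra.
near=> n.
have h1 : `|c * (w `^ al*G*cos (th - al * phi))-n%:R*E (damped (w*cos phi) (w*sin phi) th \o Y n)| < e/4.
 by near: n; move/cvgrPdist_lt : l1; apply.
have h2 : n%:R*E (damped de 0 0 \o Y n) < c * (de `^ al*G)+e/20.
 by near: n; apply: (cvgr_lt _ l2); lra.
have bd := bmf_damped n (w*sin phi) th (ltW wc0); have bd0 := bmf_damped n 0 0 (ltW de0).
have h3 : `|n%:R*E (fun x => cos th-cos (w*Y n x+th))-n%:R*E (damped (w*cos phi) (w*sin phi) th \o Y n)|
 <= 5 * (n%:R*E (damped de 0 0 \o Y n)).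
 have bc : bmf (fun x => cos th-cos (w*Y n x+th)) by apply: bmfB; [|apply: bmf_cos].
 rewrite -mulrBr -exB// normrM normr_nat mulrCA ler_wpM2l// -exZ//.
 apply: ex_abs_le; [exact: bmfB|exact: bmfZ|] => x; apply: undamped_diff => //; exact: ltW.
apply: (abs_three hlim h1 h3); lra.
Unshelve. all: by end_near. Qed.

Lemma undamped_bounded_lt1 U : 0 < al < 1 -> 0 < kap -> kap' < 1 -> 0 < U ->
 exists K : R, 0 <= K /\ \forall n \near \oo, forall w th : R, 0 <= w <= U ->
 `|n%:R*E (fun x => cos th-cos (w*Y n x+th))| <= K.
move=> ha k0 k1 U0.
have hp0 : 0 <= (0 : R) < pi/2 by rewrite lexx; have := pi_gt0 R; lra.
have l2 := @damped_limit_lt1 _ _ 0 ha k0 k1 U0 hp0.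
move: l2; rewrite cos0 sin0 mulr0 mulr1; set l := (X in _ --> X) => l2.
exists (4 * (`|l| + 1)); split; first by rewrite mulr_ge0// addr_ge0.
near=> n => w th /andP[w0 wU].
have h : n%:R*E (damped U 0 0 \o Y n) < `|l| + 1.
 by near: n; apply: (cvgr_lt _ l2); have := ler_norm l; lra.
have bc : bmf (fun x => cos th-cos (w*Y n x+th)).
 apply: bmfB; [exact: bmf_cst|apply: bmf_cos].
 by apply: measurable_funD => //; apply: measurable_funM.
have bd0 := bmf_damped n 0 0 (ltW U0).
rewrite normrM normr_nat.
apply: (@le_trans _ _ (4 * (n%:R*E (damped U 0 0 \o Y n)))); last by rewrite ler_wpM2l// ltW.
rewrite mulrCA ler_wpM2l// -exZ//; apply: ex_abs_le => //.
move=> x; have y0 := Y0 n x; rewrite /= /damped mul0r addr0 cos0 mulr1 mulNr.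
have Uy : 0 <= U*Y n x by rewrite mulr_ge0// ltW.
apply: le_trans (one_minus_exp Uy); apply: (le_trans (cos_diff_min _ _)).
have -> : th - (w*Y n x+th) = - (w*Y n x) by ring.
rewrite normrN (ger0_norm (mulr_ge0 w0 y0)) le_min !ge_min lexx /=.
by apply/orP; right; rewrite ler_wpM2r.
Unshelve. all: by end_near. Qed.
(** For [1 < al] the linear term is subtracted. The derivative is then of order [t] at 0 and
    bounded, hence integrable against [t^(-al)]. *)
Definition comp_test (w th y : R) : R := cos th-cos (w*y+th)-w*sin th*y.
Definition comp_test_p (w th t : R) : R := w * (cos (th+pi/2)-cos (w*t + (th+pi/2))).

Lemma comp_test_test w th : tail_test (comp_test w th) (comp_test_p w th).
split.
- move=> t; have h := der_lin w th t.
 have h1 := @is_derive1_comp _ cos _ t _ w (is_derive_cos (w*t+th)) h.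
 have h2 := is_deriveB (is_deriveB (is_derive_cst (cos th) t (1 : R)) h1) (der_lin (w*sin th) 0 t).
 have -> : comp_test w th = cst (cos th) - (cos \o (fun t => w*t+th)) - (fun t : R => w*sin th*t+0) by apply/funext => y; rewrite /comp_test -[in LHS](addr0 (w*sin th*y)).
 by apply: (is_derive_eq h2); rewrite /comp_test_p addrA !cosDpihalf; ring.
- move=> t; apply: cvgM; [side|apply: cvgB; first exact: cvg_cst].
 apply: continuous_cvg; first exact: continuous_cos.
 by side.
- by rewrite /comp_test !mulr0 add0r subrr subr0.
Qed.
Lemma comp_test_bound U w th t : 0 <= w <= U -> 0 < t -> `|comp_test_p w th t| <= (2*U+U ^+ 2) * pdom 1 0 t.
move=> /andP[w0 wU] t0; rewrite /comp_test_p normrM ger0_norm//.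
have U0 : 0 <= U by lra.
have h := cos_diff_min (th+pi/2) (w*t + (th+pi/2)); move: h.
have -> : th+pi/2 - (w*t + (th+pi/2)) = - (w*t) by ring.
rewrite normrN (ger0_norm (mulr_ge0 w0 (ltW t0))) le_min => /andP[h1 h2].
rewrite /pdom; case: (leP t 1) => t1.
 rewrite powRr1//; apply: (@le_trans _ _ (U * (U*t))).
 by apply: ler_pM => //; apply: (le_trans h2); rewrite ler_wpM2r// ltW.
 by rewrite mulrA -expr2 ler_wpM2r// lerDr.
rewrite oppr0 powRr0 mulr1; apply: (@le_trans _ _ (U*2)); first exact: ler_pM.
by rewrite mulrC lerDl.
Qed.
Lemma damped_dom c0 s th t : 1 < al -> 0 <= c0 -> 0 < t ->
 `|damped c0 s th t*t `^ (- al)| <= (2 + (c0 + `|s|)) * pdom (1 - al) al t.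
move=> a1 c00 t0; rewrite normrM (ger0_norm (powR_ge0 _ _)) /pdom; have s0 := normr_ge0 s.
case: (leP t 1) => t1.
 rewrite powRD ?(gt_eqF t0) ?implybT// powRr1 ?(ltW t0)// mulrA ler_wpM2r//.
 by apply: (le_trans (damped_lin s th c00 (ltW t0))); rewrite ler_wpM2r//; lra.
by rewrite ler_wpM2r//; have := damped_le2 s th c00 (ltW t0); lra.
Qed.
(** Integration by parts raises the exponent from [- al] to [1 - al], where the Euler integral
    converges. *)
Lemma damped_hint_gt1 c0 s th : 1 < al < 2 -> 0 < c0 ->
 (al-1)*hint (fun t => damped c0 s th t*t `^ (- al)) =
 c0*osc_int (2 - al) c0 s th+s*osc_int (2 - al) c0 s (th-pi/2).
move=> /andP[a1 a2] c00; have b0 : 0 < 2 - al by lra.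
have [dP cp P0] := damped_test c0 s th.
have i1 : hints (fun t => damped c0 s th t*t `^ (- al)).
 have ip : hints (pdom (1 - al) al) by apply: hint_pdom; lra.
 apply: (hintable_le _ (hintsZ (2 + (c0 + `|s|)) ip)) => [|t t0]; last exact: damped_dom a1 (ltW c00) t0.
 apply: measurable_funTS; apply: measurable_funM; last exact: measurable_powR.
 exact: (mtail_test (damped_test c0 s th)).2.
have i2 := ok_hint s th b0 c00.
have i3 := ok_hint s (th-pi/2) b0 c00.
have i4 := hintableD (hintsZ c0 i2) (hintsZ s i3).
pose H t := t `^ (1 - al)*damped c0 s th t.
pose h t := (1 - al) * (damped c0 s th t*t `^ (- al)) + (c0*osc_ker (2 - al) c0 s th t+s*osc_ker (2 - al) c0 s (th-pi/2) t).
have cd t : {for t, continuous (damped c0 s th)}.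
 apply: differentiable_continuous; apply/derivable1_diffP.
 by have dt := dP t; exact: (@ex_derive _ _ _ _ _ _ _ dt).
have h0 : hint h = 0.
 apply: (@hint_ftc _ H).
 - move=> t t0; have d1 := @is_derive1_powR R (1 - al) t t0.
 have d3 := is_deriveM d1 (dP t).
 apply: (is_derive_eq d3); rewrite /h /osc_ker /damped_p /GRing.scale /=.
 have -> : 1 - al-1 = - al by ring.
 have -> : 2 - al-1 = 1 - al by ring.
 by ring.
 - move=> t t0; apply: continuousD; last apply: continuousD.
 + apply: continuousM; [exact: cst_continuous|apply: continuousM; [exact: cd|exact: powR_cts]].
 + by apply: continuousM; [exact: cst_continuous|exact: ok_cts].
 + by apply: continuousM; [exact: cst_continuous|exact: ok_cts].
 - exact: (hintableD (hintsZ _ i1) i4).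
 - have cz : (c0 + `|s|) * (n.+2%:R^-1 `^ (2 - al)) @[n --> \oo] --> (0 : R).
 by rewrite -[X in _ --> X](mulr0 (c0 + `|s|)); apply: cvgM; [exact: cvg_cst|exact: cvg_powR0].
 apply: (norm_cvg0 _); apply: (squeeze_cvgr _ (cvg_cst 0) cz).
 apply: nearW => n; have n0 : (0:R) < n.+2%:R^-1 by [].
 rewrite normr_ge0 /= /H normrM (ger0_norm (powR_ge0 _ _)).
 have -> : 2 - al = 1 - al+1 by ring.
 rewrite [in leRHS]powRD ?(gt_eqF n0) ?implybT// powRr1 ?(ltW n0)// mulrCA ler_wpM2l ?powR_ge0//.
 exact: damped_lin (ltW c00) (ltW n0).
 - have a10 : 0 < al-1 by lra.
 have cz : 2 * (n.+2%:R^-1 `^ (al-1)) @[n --> \oo] --> (0 : R).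
 by rewrite -[X in _ --> X](mulr0 2); apply: cvgM; [exact: cvg_cst|exact: cvg_powR0].
 apply: (norm_cvg0 _); apply: (squeeze_cvgr _ (cvg_cst 0) cz).
 apply: nearW => n; have n0 : (0:R) < n.+2%:R by [].
 rewrite normr_ge0 /= /H normrM (ger0_norm (powR_ge0 _ _)) powR_inv ?(ltW n0)// opprB mulrC.
 by rewrite ler_wpM2r ?powR_ge0// damped_le2// ltW.
move: h0; rewrite /h (hintD (hintsZ _ i1) i4) (hintD (hintsZ _ i2) (hintsZ _ i3)) !hintZ//.
rewrite -/(osc_int _ _ _ _) -/(osc_int _ _ _ _) => h0; lra.
Qed.

Ltac noevar tac ::= fail.
(** The limit of [damped_hint_gt1] and [osc_int_polar] as the angle [ph n] tends to [pi / 2]; for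
    [1 < al < 2] the undamped integral converges absolutely, so dominated convergence applies. *)
Lemma comp_hint w th : 1 < al < 2 -> 0 < w ->
 hints (fun t => (cos th-cos (w*t+th))*t `^ (- al)) /\
 (al-1)*hint (fun t => (cos th-cos (w*t+th))*t `^ (- al)) =
 w `^ (al-1)*osc_int (2 - al) 1 0 0*cos (th - (al-1) * (pi/2)).
move=> ha w0; have /andP[a1 a2] := ha; have b0 : 0 < 2 - al by lra.
pose ph (n : nat) : R := pi/2-n.+2%:R^-1.
have i1 n : n.+2%:R^-1 <= 2^-1 :> R by rewrite lef_pV2 ?posrE ?ltr0n// ler_nat.
have i0 n : 0 < n.+2%:R^-1 :> R by rewrite invr_gt0 ltr0n.
have pi2 := pi_ge2 R.
have hph n : 0 <= ph n < pi/2.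
 rewrite /ph; have := i1 n; have := i0 n; move: (n.+2%:R^-1) => x x0 x1.
 by apply/andP; split; lra.
have cph : ph n @[n --> \oo] --> (pi/2 : R).
 have h : n.+2%:R^-1 @[n --> \oo] --> (0 : R).
 have := @cvg_powR0 R 1 ltr01; under eq_fun do rewrite powRr1 ?invr_ge0//.
 by [].
 by rewrite -[X in _ --> X]subr0; apply: cvgB => //; exact: cvg_cst.
have cphc : cos (ph n) @[n --> \oo] --> (0 : R).
 by rewrite -(cos_pihalf R); apply: continuous_cvg cph; exact: continuous_cos.
have cphs : sin (ph n) @[n --> \oo] --> (1 : R).
 by rewrite -(sin_pihalf R); apply: continuous_cvg cph; exact: continuous_sin.
have cpos n : 0 < w*cos (ph n).
 rewrite mulr_gt0//; apply: cos_gt0_pihalf; have /andP[] := hph n.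
 by move=> h1 h2; apply/andP; split=> //; lra.
have ip : hints (pdom (1 - al) al) by apply: hint_pdom; lra.
have [i3 c1] : hints (fun t => (cos th-cos (w*t+th))*t `^ (- al)) /\
 hint (fun t => damped (w*cos (ph n)) (w*sin (ph n)) th t*t `^ (- al)) @[n --> \oo] -->
 hint (fun t => (cos th-cos (w*t+th))*t `^ (- al)).
 apply: (@hint_dominated R _ _ (fun t => (2+2*w) * pdom (1 - al) al t)).
 - move=> n; apply: measurable_funTS; apply: measurable_funM; last exact: measurable_powR.
 exact: (mtail_test (damped_test _ _ th)).2.
 - apply: measurable_funTS; apply: measurable_funM; last exact: measurable_powR.
 apply: measurable_funB => //; apply: measurableT_comp; first by apply: continuous_measurable_fun; exact: continuous_cos.
 by apply: measurable_funD => //; apply: measurable_funM.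
 - exact: hintsZ.
 - move=> n t t0; rewrite normrM (ger0_norm (powR_ge0 _ _)).
 rewrite /pdom; case: (leP t 1) => t1.
 rewrite powRD ?(gt_eqF t0) ?implybT// powRr1 ?(ltW t0)// mulrA ler_wpM2r ?powR_ge0//.
 apply: (le_trans (damped_lin _ th (ltW (cpos n)) (ltW t0))).
 rewrite ler_wpM2r ?(ltW t0)//.
 have h1 : w*cos (ph n) <= w by rewrite -[leRHS]mulr1 ler_pM2l// cos_le1.
 have h2 : `|w*sin (ph n)| <= w.
 by rewrite normrM gtr0_norm// -[leRHS]mulr1 ler_pM2l// ler_norml sin_geN1 sin_le1.
 lra.
 rewrite ler_wpM2r ?powR_ge0//; have := damped_le2 (w*sin (ph n)) th (ltW (cpos n)) (ltW t0); lra.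
 - move=> t t0; apply: cvgM; last exact: cvg_cst.
 apply: cvgB; first exact: cvg_cst.
 rewrite -[X in _ --> X]mul1r; apply: cvgM.
 rewrite -(@expR0 R); apply: continuous_cvg; first exact: continuous_expR.
 rewrite -[X in _ --> X](mul0r t); apply: cvgM; last exact: cvg_cst.
 by rewrite -[X in _ --> X]oppr0 -(mulr0 w); apply: cvgN; apply: cvgM => //; exact: cvg_cst.
 apply: continuous_cvg; first exact: continuous_cos.
 apply: cvgD; last exact: cvg_cst.
 apply: cvgM; last exact: cvg_cst.
 by rewrite -[X in _ --> X]mulr1; apply: cvgM => //; exact: cvg_cst.
have c2 : (al-1)*hint (fun t => damped (w*cos (ph n)) (w*sin (ph n)) th t*t `^ (- al)) @[n --> \oo] -->
 (al-1)*hint (fun t => (cos th-cos (w*t+th))*t `^ (- al)).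
 by apply: cvgM => //; exact: cvg_cst.
have c3 : w `^ (al-1)*osc_int (2 - al) 1 0 0*cos (th - (al-1) * ph n) @[n --> \oo] -->
 w `^ (al-1)*osc_int (2 - al) 1 0 0*cos (th - (al-1) * (pi/2)).
 apply: cvgM; first exact: cvg_cst.
 apply: continuous_cvg; first exact: continuous_cos.
 by apply: cvgB; [exact: cvg_cst|apply: cvgM => //; exact: cvg_cst].
split=> //.
have c4 : (al-1)*hint (fun t => damped (w*cos (ph n)) (w*sin (ph n)) th t*t `^ (- al)) @[n --> \oo] -->
 w `^ (al-1)*osc_int (2 - al) 1 0 0*cos (th - (al-1) * (pi/2)).
 apply: cvg_trans c3; apply: near_eq_cvg; apply: nearW => n.
 rewrite damped_hint_gt1// osc_int_polar//.
 by have -> : 1 - (2 - al) = al-1 by ring.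
exact: (cvg_unique _ c2 c4).
Qed.
Ltac noevar tac ::= noevar0 tac.

Lemma comp_limit_gt1 w th : 1 < al < 2 -> 1 < kap -> kap' < 2 -> 0 < w ->
 n%:R*E (comp_test w th \o Y n) @[n --> \oo] -->
 c * (w `^ al * (- osc_int (2 - al) 1 0 0 / (al-1))*cos (th - al * (pi/2))).
move=> ha k1 k2 w0; have /andP[a1 a2] := ha.
have U0 : 0 <= 2*w+w ^+ 2 by rewrite addr_ge0 ?exprn_ge0 ?mulr_ge0 ?ltW.
have hw : 0 <= w <= w by rewrite lexx ltW.
have ha1 : kap' < 1+1 by lra.
have hb1 : 1 < 0+kap by lra.
have h := @tail_limit _ _ 1 0 (2*w+w ^+ 2) (comp_test_test w th) U0 (fun t t0 => @comp_test_bound w w th t hw t0) ha1 hb1.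
suff <- : hint (fun t => comp_test_p w th t*t `^ (- al)) =
 w `^ al * (- osc_int (2 - al) 1 0 0 / (al-1))*cos (th - al * (pi/2)) by [].
have [i1 e] := comp_hint (th+pi/2) ha w0.
have -> : hint (fun t => comp_test_p w th t*t `^ (- al)) =
 w*hint (fun t => (cos (th+pi/2)-cos (w*t + (th+pi/2)))*t `^ (- al)).
 by rewrite -hintZ//; apply: hint_eq => t _; rewrite /comp_test_p; ring.
have a10 : al-1 != 0 by rewrite gt_eqF// subr_gt0.
apply: (mulfI a10); rewrite mulrCA e.
have -> : th+pi/2 - (al-1) * (pi/2) = th - al * (pi/2)+pi by field.
rewrite cosDpi; have -> : w `^ al = w*w `^ (al-1).
 by rewrite -{2}(powRr1 (ltW w0)) -powRD ?(gt_eqF w0) ?implybT// addrC subrK.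
by field.
Qed.
Lemma comp_integrable : 1 < al < 2 -> 1 < kap -> kap' < 2 ->
 \forall n \near \oo, mu.-integrable setT (EFin \o Y n) /\
 (forall U : R, 0 < U -> exists K : R, 0 <= K /\ forall k w th, (n <= k)%N -> 0 <= w <= U ->
 `|k%:R*E (comp_test w th \o Y k)| <= K).
move=> ha k1 k2; have /andP[a1 a2] := ha.
have ha1 : kap' < 1+1 by lra.
have hb1 : 1 < 0+kap by lra.
have [N hN] := tail_bounded; exists N => // n /= Nn; split.
 have h1 : 0 <= (1 : R) <= 1 by rewrite lexx ler01.
 have U0 : (0 : R) <= 2*1+1 ^+ 2 by rewrite expr1n; lra.
 have [_ i _ _] := hN n Nn _ _ 1 0 _ (comp_test_test 1 (pi/2)) U0 (fun t t0 => @comp_test_bound 1 1 (pi/2) t h1 t0) ha1 hb1.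
 have bc : bmf (fun x => cos (1*Y n x+pi/2)).
 by apply: bmf_cos; apply: measurable_funD => //; exact: measurable_funM.
 have i2 := integrableD measurableT (integrableZl measurableT (-1) i)
 (integrableZl measurableT (-1) (bmf_int mu bc)).
 have := @eq_integrable _ _ R mu setT measurableT _ (EFin \o Y n) _ i2; apply => x _ /=; congr EFin.
 rewrite /comp_test cos_pihalf sin_pihalf; ring.
move=> U U0; pose Cp := 2*U+U ^+ 2.
have Cp0 : 0 <= Cp by rewrite addr_ge0 ?exprn_ge0 ?mulr_ge0 ?ltW.
exists (Cp*C*hint (pdom (1-kap') (0+kap))); split.
 have ip : hints (pdom (1-kap') (0+kap)) by apply: hint_pdom; lra.
 rewrite !mulr_ge0//; apply: Rintegral_ge0 => t _; exact: pdom_ge0.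
move=> k w th nk hw.
have [_ _ _ h] := hN k (leq_trans Nn nk) _ _ 1 0 _ (comp_test_test w th) Cp0 (fun t t0 => @comp_test_bound U w th t hw t0) ha1 hb1.
exact: h.
Qed.

End TailLimit.

(** * Values of the Gamma function as Euler integrals *)

Lemma Gamma_osc {R : realType} (b : R) : Gamma_pos b = osc_int b 1 0 0.
apply: hint_eq => t _; rewrite /osc_ker mul0r add0r cos0 mulr1.
by rewrite mulN1r.
Qed.
Lemma Gamma_fun_lt1 {R : realType} (al : R) : 0 < al < 1 -> Gamma_fun (1 - al) = osc_int (1 - al) 1 0 0.
move=> /andP[a0 a1]; rewrite /Gamma_fun subr_gt0 a1 big_ord0 divr1 addr0; exact: Gamma_osc.
Qed.
Lemma Gamma_fun_gt1 {R : realType} (al : R) : 1 < al < 2 ->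
 Gamma_fun (1 - al) = - osc_int (2 - al) 1 0 0 / (al-1).
move=> /andP[a1 a2]; rewrite /Gamma_fun subr_gt0 ltNge ltW//=.
have -> : Num.truncn (- (1 - al)) = 0%N by apply: truncn_def; apply/andP; split; lra.
rewrite big_ord_recl big_ord0 mulr1 /= addr0 -Gamma_osc.
have -> : 1 - al+1 = 2 - al by ring.
have h : al-1 != 0 by rewrite gt_eqF// subr_gt0.
have h2 : 1 - al != 0 by rewrite lt_eqF// subr_lt0.
by field; rewrite h h2.
Qed.

(** * Independence and products of expectations *)

Section Independence.
Context {d} {W : measurableType d} {R : realType}.
Variables (P : probability W R) (Y : nat -> W -> R).
Hypothesis mY : forall i, mfun W (Y i).
Local Notation E := (ex P).

Lemma bmf_prod (n : nat) (H : nat -> W -> R) (p : pred nat) : (forall i, bmf (H i)) ->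
 bmf (fun w => \prod_(i < n | p i) H i w).
move=> bH; elim: n p => [|n IH] p.
 have -> : (fun w => \prod_(i < 0 | p i) H i w) = (fun=> 1) by apply/funext => w; rewrite big_ord0.
 side.
have -> : (fun w => \prod_(i < n.+1 | p i) H i w) =
 (fun w => (\prod_(i < n | p i) H i w) * (if p n then H n w else 1)) by apply/funext => w; rewrite big_mkcond big_ord_recr -big_mkcond.
by apply: bmfM => //; case: (p n) => //; side.
Qed.
Lemma bmf_compY (h : R -> R) i : bmf h -> bmf (fun w => h (Y i w)).
by move=> [mh [M hM]]; split; [exact: measurableT_comp|exists M]. Qed.
(** In [key], [j] counts the factors that are still general. The last of these is tested on its
    level sets ([level_eq]), until only indicators remain and the definition of independence
    applies. *)
Lemma indep_prod n (H : nat -> R -> R) : independent P n Y -> (forall i, bmf (H i)) ->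
 E (fun w => \prod_(i < n) H i (Y i w)) = \prod_(i < n) E (fun w => H i (Y i w)).
move=> ind; suff key : forall j, (j <= n)%N -> forall H : nat -> R -> R, (forall i, bmf (H i)) ->
 (forall i, (j <= i < n)%N -> exists2 V : set R, measurable V & H i = \1_V) ->
 E (fun w => \prod_(i < n) H i (Y i w)) = \prod_(i < n) E (fun w => H i (Y i w)).
 by move=> bH; apply: (key n) => // i /andP[h1 h2]; move: (leq_ltn_trans h1 h2); rewrite ltnn.
elim=> [|j IH] jn {}H bH hH.
 have /choice[V hV] : forall i, exists V : set R, measurable V /\ ((i < n)%N -> H i = \1_V).
 move=> i; case: (ltnP i n) => h; last by exists setT.
 by have [|V mV e] := hH i; [side|exists V].
 have mV i : measurable (Y i @^-1` V i) by rewrite -[X in measurable X]setTI; apply: mY => //; exact: (hV i).1.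
 have mI k : measurable (\bigcap_(i < k) (Y i @^-1` V i)) by apply: bigcap_measurableType => i _; side.
 have e1 : E (fun w => \prod_(i < n) H i (Y i w)) = pr P (\bigcap_(i < n) (Y i @^-1` V i)).
 rewrite -ex_indic//; apply: ex_eq => w.
 rewrite indicE; case: (boolP (w \in _)) => h.
 by rewrite big1// => i _; rewrite (hV i).2// indicE mem_set//; move: h; rewrite inE => h; exact: (h i (ltn_ord i)).
 have [i [h1 h2]] : exists i, (i < n)%N /\ ~ V i (Y i w).
 apply: contrapT => hn; case/negP: h; rewrite inE => i ilt.
 by apply: contrapT => hi; apply: hn; exists i.
 by rewrite (bigD1 (Ordinal h1))//= (hV i).2// indicE memNset ?mul0r.
 rewrite e1 /pr ind; last by move=> i; exact: (hV i).1.
 rewrite (eq_bigr (fun i : 'I_n => (pr P (Y i @^-1` V i))%:E)); last by move=> i _; rewrite prE.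
 rewrite prodEFin/=; apply: eq_bigr => i _; rewrite -ex_indic//; apply: ex_eq => w.
 by rewrite (hV i).2.
pose jj := Ordinal jn; pose K w := \prod_(i < n | i != jj) H i (Y i w).
have bK : bmf K.
 have := bmf_prod n (fun i => i != j) (fun i => bmf_compY i (bH i)).
 by apply.
pose c := \prod_(i < n | i != jj) E (fun w => H i (Y i w)).
have bj := bmf_compY j (bH j).
rewrite (bigD1 jj)//= -/c -exZr//.
transitivity (E (fun w => H j (Y j w)*K w)).
 by apply: ex_eq => w; rewrite (bigD1 jj).
apply: (level_eq bj bK (bmf_cst c)) => a e.
pose H' i := if i == j then \1_(lvset (H j) a e) else H i.
have mL : measurable (lvset (H j) a e) by apply: mlevel; case: (bH j).
have bH' i : bmf (H' i) by rewrite /H'; case: eqP =>  _; side.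
have h' i : (j <= i < n)%N -> exists2 V : set R, measurable V & H' i = \1_V.
 move=> /andP[ji iltn]; rewrite /H'; case: eqVneq => [_|ne]; first by exists (lvset (H j) a e).
 by apply: hH; rewrite iltn andbT ltn_neqAle eq_sym ne.
have := IH (ltnW jn) H' bH' h'; rewrite [RHS](bigD1 jj)//=.
have -> : \prod_(i < n | i != jj) E (fun w => H' i (Y i w)) = c by apply: eq_bigr => i ne; rewrite /H' ifN.
have bI : bmf (fun w => \1_(lvset (fun w => H j (Y j w)) a e) w : R) by apply: bmf_indic; apply: mlevel; case: bj.
rewrite exZr// => eH; transitivity (E (fun w => \prod_(i < n) H' i (Y i w))); last first.
 rewrite eH /H' eqxx; congr (_ * _); apply: ex_eq => w; rewrite !indicE; congr (nat_of_bool _)%:R.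
apply: ex_eq => w; rewrite (bigD1 jj)//= /H' eqxx; congr (_ * _).
by apply: eq_bigr => i ne; rewrite ifN.
Qed.
Lemma Re_cis_shift s (z : R[i]) : complex.Re (cis (s-pi/2)*z) = complex.Im (cis s*z).
by case: z => a b; rewrite /cis cosBpihalf sinBpihalf /=; ring. Qed.
(** The real part for every phase [s] encodes the complex identity. The induction merges the terms
    into the cosine one by one and carries the others along as bounded factors. *)
Lemma indep_cos n (u : nat -> R) : independent P n Y -> forall s,
 E (fun w => cos (\sum_(i < n) u i*Y i w+s)) =
 complex.Re (cis s * \prod_(i < n) echar P (fun w => u i*Y i w)).
move=> ind; suff key : forall k, (k <= n)%N -> forall (H : nat -> R -> R) s, (forall i, bmf (H i)) ->
 E (fun w => cos (\sum_(i < k) u i*Y i w+s) * \prod_(k <= i < n) H i (Y i w)) =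
 complex.Re (cis s * \prod_(i < k) echar P (fun w => u i*Y i w)) * \prod_(k <= i < n) E (fun w => H i (Y i w)).
 move=> s; have := key n (leqnn n) (fun _ => cst 1) s (fun _ => bmf_cst 1).
 rewrite [X in _ = _*X]big_geq// mulr1 => <-; apply: ex_eq => w.
 by rewrite big_geq// mulr1.
elim=> [|k IH] kn H s bH.
 rewrite big_ord0 mulr1; have -> : complex.Re (cis s) = cos s by [].
 rewrite big_mkord -indep_prod// -exZ; last exact: (bmf_prod n xpredT (fun i => bmf_compY i (bH i))).
 by apply: ex_eq => w; rewrite big_ord0 add0r big_mkord.
pose H1 i := if i == k then (fun y => cos (u k*y)) else H i.
pose H2 i := if i == k then (fun y => sin (u k*y)) else H i.
have b1 i : bmf (H1 i) by rewrite /H1; case: eqP => // _; apply: bmf_cos.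
have b2 i : bmf (H2 i) by rewrite /H2; case: eqP => // _; apply: bmf_sin.
have e1 := IH (ltnW kn) H1 s b1; have e2 := IH (ltnW kn) H2 (s-pi/2) b2.
have mS : mfun W (fun w => \sum_(i < k) u i*Y i w) by [].
have bp (G : nat -> R -> R) : (forall i, bmf (G i)) -> bmf (fun w => \prod_(k <= i < n) G i (Y i w)).
 move=> bG; have := bmf_prod n (fun i => (k <= i)%N) (fun i => bmf_compY i (bG i)).
 congr bmf; apply/funext => w; rewrite big_geq_mkord; by [].
have bc s' : bmf (fun w => cos (\sum_(i < k) u i*Y i w+s')) by [].
have split1 w : cos (\sum_(i < k.+1) u i*Y i w+s) * \prod_(k.+1 <= i < n) H i (Y i w) =
 cos (\sum_(i < k) u i*Y i w+s) * \prod_(k <= i < n) H1 i (Y i w) -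
 cos (\sum_(i < k) u i*Y i w + (s-pi/2)) * \prod_(k <= i < n) H2 i (Y i w).
 rewrite big_ord_recr /= !(big_ltn kn) addrA cosBpihalf {1}/H1 {1}/H2 eqxx.
 have eP (G : nat -> R -> R) : (forall i, i != k -> G i = H i) ->
 \prod_(k.+1 <= i < n) G i (Y i w) = \prod_(k.+1 <= i < n) H i (Y i w).
 by move=> hG; rewrite !big_nat; apply: eq_bigr => i /andP[h1 _]; rewrite hG// gtn_eqF.
 rewrite (eP H1) ?(eP H2); try by move=> i ne; rewrite /H1 /H2 (negPf ne).
 by rewrite addrAC cosD; ring.
rewrite (ex_eq P (fun w => split1 w)) exB; [|by apply: bmfM; [|exact: bp]..].
rewrite e1 e2 big_ord_recr /= !(big_ltn kn) {1}/H1 {1}/H2 eqxx Re_cis_shift.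
have eP (G : nat -> R -> R) : (forall i, i != k -> G i = H i) ->
 \prod_(k.+1 <= i < n) E (fun w => G i (Y i w)) = \prod_(k.+1 <= i < n) E (fun w => H i (Y i w)).
 by move=> hG; rewrite !big_nat; apply: eq_bigr => i /andP[h1 _]; rewrite hG// gtn_eqF.
rewrite (eP H1) ?(eP H2); try by move=> i ne; rewrite /H1 /H2 (negPf ne).
rewrite !mulrA; move: (cis s * _) => z; rewrite /echar.
move: (E _) (E _) (\prod_(_ <= _ < _) _) => p q r; case: z => x y /=; ring.
Qed.

End Independence.

(** * The complex exponential and its Taylor bounds *)

Section ComplexExp.
Context {R : realType}.
Implicit Types z w : R[i].
Local Notation Re := (@complex.Re R).
Local Notation Im := (@complex.Im R).

Lemma cexpE z : cexp z = ((expR (Re z))%:C*cis (Im z))%C.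
by []. Qed.
Lemma cexpD z w : cexp (z+w) = cexp z*cexp w.
case: z => a b; case: w => a' b'; rewrite !cexpE expRD cisD.
by ring.
Qed.
Lemma cexp0 : cexp (0 : R[i]) = 1.
by rewrite cexpE expR0 cis0 mul1r. Qed.
Lemma cn_cexp z : cn (cexp z) = expR (Re z).
by rewrite cexpE cnM cn_cis mulr1 cn_real ger0_norm. Qed.
Lemma cexp_natmul z n : cexp (z *+ n) = cexp z ^+ n.
by elim: n => [|n IH]; rewrite ?cexp0// mulrS exprS cexpD IH. Qed.
Lemma sin_sub_le (b : R) : `|sin b-b| <= b ^+ 2.
wlog b0 : b/0 <= b.
 move=> h; have [b0|b0] := leP 0 b; first exact: h.
 have := h (- b); rewrite sinN sqrrN -opprD normrN; apply; lra.
move: b0; rewrite le_eqVlt => /orP[/eqP<-|b0]; first by rewrite sin0 subrr normr0 expr0n.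
have hd (x : R) : x \in `]0, b[ -> is_derive x (1 : R) (fun x => sin x-x) (cos x-1) by move=> _; apply: is_deriveB.
have [|c] := @MVT R _ _ 0 b b0 hd.
- apply: derivable_within_continuous => x _.
 have dx : is_derive x (1 : R) (fun x => sin x-x) (cos x-1) by apply: is_deriveB.
 exact: @ex_derive _ _ _ _ _ _ _ dx.
rewrite in_itv sin0 !subr0 => /andP[c0 cb] ->.
rewrite normrM (ger0_norm (ltW b0)) expr2 ler_wpM2r//.
have := cos_diff_le c 0; rewrite cos0 subr0 => /le_trans; apply.
by rewrite gtr0_norm// ltW.
Qed.
Lemma cos_sub_le (b : R) : `|cos b-1| <= b ^+ 2.
have := cos_diff_le b 0; rewrite cos0 subr0 => h.
have [b1|b1] := leP 1 `|b|.
 by apply: (le_trans h); rewrite -[leRHS]ger0_norm ?sqr_ge0// normrX expr2 ler_peMl.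
wlog b0 : b h b1/0 <= b.
 move=> w; have [b0|b0] := leP 0 b; first exact: w.
 by have := w (- b); rewrite cosN sqrrN normrN; side.
move: b0; rewrite le_eqVlt => /orP[/eqP<-|b0]; first by rewrite cos0 subrr normr0 expr0n.
have hd (x : R) : x \in `]0, b[ -> is_derive x (1 : R) cos (- sin x) by move=> _; exact: is_derive_cos.
have [|c] := @MVT R _ _ 0 b b0 hd.
- apply: derivable_within_continuous => x _.
 have dx := is_derive_cos x; exact: @ex_derive _ _ _ _ _ _ _ dx.
rewrite in_itv cos0 subr0 => /andP[c0 cb] ->.
rewrite normrM (ger0_norm (ltW b0)) expr2 ler_wpM2r// normrN.
by rewrite (le_trans (abs_sin_le _))// gtr0_norm// ltW.
Qed.
Lemma exp_sub_le (a : R) : a <= 0 -> 0 <= expR a-1 - a <= a ^+ 2.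
move=> a0; have h := expR_ge1Dx a; have h2 := expR_ge1Dx (- a).
apply/andP; split; first lra.
have : expR a <= (1 - a)^-1 by rewrite -[expR a]invrK -expRN lef_pV2 ?posrE; lra.
move=> h3; have : (1 - a)^-1 <= 1 + a + a ^+ 2.
 by rewrite -[leLHS]mul1r ler_pdivrMr; have : a ^+ 3 <= 0 by [rewrite exprS mulr_le0_ge0// sqr_ge0]; nra.
lra.
Qed.
Lemma cexp_taylor z : Re z <= 0 -> cn (cexp z-1-z) <= 4*cn z ^+ 2.
rewrite cn_sqr; case: z => a b /= a0; apply: (le_trans (cn_le _)); rewrite cexpE /=.
have /andP[h1 h2] := exp_sub_le a0; have hs := sin_sub_le b; have hc := cos_sub_le b.
have e1 : expR a <= 1 by rewrite -expR0 ler_expR.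
have e0 := expR_ge0 a.
have e2 : 0 <= 1-expR a by lra.
have e3 : 1-expR a <= - a by lra.
rewrite !mul0r !subr0 addr0.
have -> : expR a*cos b-1 - a = expR a * (cos b-1) + (expR a-1 - a) by ring.
have -> : expR a*sin b-b = expR a * (sin b-b) + (expR a-1)*b by ring.
have k1 : `|expR a * (cos b-1)| <= b ^+ 2 by rewrite normrM (ger0_norm e0) -[leRHS]mul1r ler_pM.
have k2 : `|expR a * (sin b-b)| <= b ^+ 2 by rewrite normrM (ger0_norm e0) -[leRHS]mul1r ler_pM.
have k3 : `|(expR a-1)*b| <= a ^+ 2+b ^+ 2.
 rewrite normrM -normrN opprB (ger0_norm e2).
 apply: (@le_trans _ _ (- a * `|b|)); first by rewrite ler_wpM2r.
 have -> : b ^+ 2 = `|b| ^+ 2 by rewrite -normrX ger0_norm ?sqr_ge0.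
 by have := sqr_ge0 (- a - `|b|); have := sqr_ge0 (- a + `|b|); nra.
have k4 : `|expR a-1 - a| <= a ^+ 2 by rewrite ger0_norm.
have t1 := ler_normD (expR a * (cos b-1)) (expR a-1 - a).
have t2 := ler_normD (expR a * (sin b-b)) ((expR a-1)*b).
have := sqr_ge0 a; have := sqr_ge0 b; lra.
Qed.
Lemma cexp_sub1 z : Re z <= 0 -> cn (cexp z-1) <= 2*cn z.
case: z => a b /= a0; apply: (@le_trans _ _ (cn ((expR a-1)%:C*cis b)%C+cn (cis b-1))).
 have -> : cexp (a +i* b)%C-1 = ((expR a-1)%:C*cis b)%C + (cis b-1) by rewrite cexpE rmorphB; ring.
 exact: cnD.
have ha : `|a| <= cn (a +i* b)%C by exact: (cn_Re (a +i* b)%C).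
have hb : `|b| <= cn (a +i* b)%C by exact: (cn_Im (a +i* b)%C).
rewrite cnM cn_cis mulr1 cn_real.
have h1 : `|expR a-1| <= `|a|.
 have e1 := expR_ge1Dx a; have e2 : expR a <= 1 by rewrite -expR0 ler_expR.
 by rewrite (ler0_norm a0) ler0_norm; lra.
have h2 : cn (cis b-1) <= `|b|.
 rewrite /cn /cis /= subr0 -[leRHS]sqrtr_sqr; apply: ler_wsqrtr.
 have := cos2Dsin2 b => e.
 have e2 : cos b = 1-2*sin (b/2) ^+ 2.
 have := cosD (b/2) (b/2); have := cos2Dsin2 (b/2).
 have -> : b/2+b/2 = b by field.
 by lra.
 have : `|sin (b/2)| <= `|b/2| by exact: abs_sin_le.
 have -> : `|b/2| = `|b| / 2 by rewrite normrM (@ger0_norm _ 2^-1).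
 move=> h3; have h4 : sin (b/2) ^+ 2 <= b ^+ 2/4.
 rewrite -[sin _ ^+ 2]ger0_norm ?sqr_ge0// normrX.
 have -> : b ^+ 2 = `|b| ^+ 2 by rewrite -normrX ger0_norm ?sqr_ge0.
 by have := normr_ge0 (sin (b/2)); have := normr_ge0 b; nra.
 by lra.
lra.
Qed.
Lemma cn_subXX z w k : cn z <= 1 -> cn w <= 1 -> cn (z ^+ k-w ^+ k) <= k%:R*cn (z-w).
move=> z1 w1; elim: k => [|k IH]; first by rewrite !expr0 subrr cn0 mul0r.
have -> : z ^+ k.+1-w ^+ k.+1 = z * (z ^+ k-w ^+ k) + (z-w)*w ^+ k by rewrite !exprS; ring.
apply: (le_trans (cnD _ _)); rewrite !cnM -natr1 mulrDl mul1r; apply: lerD.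
 by rewrite (le_trans _ IH)// -[leRHS]mul1r ler_wpM2r ?cn_ge0.
rewrite -[leRHS]mulr1 ler_wpM2l ?cn_ge0//.
elim: k {IH} => [|k IH]; first by rewrite expr0 cn1.
by rewrite exprS cnM -[leRHS]mulr1 ler_pM ?cn_ge0.
Qed.

End ComplexExp.

(** * The scaled exponents and the contribution of one tail *)

Section LimitData.
Context {d} {X : measurableType d} {R : realType}.
Variables (mu : probability X R) (f : X -> R) (A B : nat -> R).
Local Notation E := (ex mu).

(* [rhoR + i rhoI] is n (phi_n(u)-1) - i u A_n/B_n, phi_n being the characteristic function of f/B_n. *)
Definition rhoR (n : nat) (u : R) : R := n%:R * (E (fun x => cos (u/B n*f x))-1).
Definition rhoI (n : nat) (u : R) : R := n%:R*E (fun x => sin (u/B n*f x))-u * (A n/B n).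

(** The bound [lim_bd], uniform over bounded [u], is what the tail estimates for partial sums rely
    on. *)
Record limit_data (pR pI : R -> R) : Prop := LimitData {
 lim_re : forall u, rhoR n u @[n --> \oo] --> pR u ;
 lim_im : forall u, rhoI n u @[n --> \oo] --> pI u ;
 lim_bd : forall U : R, 0 < U -> exists K : R, \forall n \near \oo, forall u, `|u| <= U ->
 `|rhoR n u| <= K /\ `|rhoI n u| <= K }.

End LimitData.

Section OneSide.
Context {d} {X : measurableType d} {R : realType}.
Variable mu : probability X R.
Local Notation m := (pr mu).
Local Notation E := (ex mu).
Variables (Y : nat -> X -> R) (al c : R).
Hypotheses (mY : forall n, mfun X (Y n)) (Y0 : forall n x, 0 <= Y n x) (hal : 0 < al < 2) (al1 : al != 1)
 (htail : forall t : R, 0 < t -> n%:R * m [set x | t < Y n x] @[n --> \oo] --> c*t `^ (- al)).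
Hypothesis hbound : forall kap kap' : R, 0 < kap < al -> al < kap' -> exists C : R, 0 < C /\
 \forall n \near \oo, forall t : R, 0 < t ->
 n%:R * m [set x | t < Y n x] <= C*Num.max (t `^ (- kap)) (t `^ (- kap')).

(* [de] compensates for the mean when [1 < al] and vanishes otherwise *)
Definition one_test (de w th y : R) : R := cos th-cos (w*y+th)-de * (w*sin th*y).

(** Unites the damped computation for [al < 1] and the compensated one for [1 < al] in a single
    formula, with [Gamma(1 - al)] continued to negative arguments. *)
Lemma one_side (g := Gamma_fun (1 - al)) (de : R := ((1 < al)%R)%:R) : [/\
 forall w th, 0 < w -> n%:R*E (one_test de w th \o Y n) @[n --> \oo] --> c * (w `^ al*g*cos (th - al * (pi/2))),
 forall U : R, 0 < U -> exists K : R, \forall n \near \oo, forall w th, 0 <= w <= U -> `|n%:R*E (one_test de w th \o Y n)| <= K &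
 \forall n \near \oo, mu.-integrable setT (EFin \o (fun x => de*Y n x))].
have [a0 a2] := andP hal; have [al_lt|al_gt|e] := ltgtP al 1; last by move: al1; rewrite e eqxx.
- have ha : 0 < al < 1 by rewrite a0.
 have [||C [C0 hC]] := hbound (kap := al/2) (kap' := (al+1)/2); [lra|lra|].
 have [k1 k2 k3] : [/\ al/2 <= (al+1)/2, 0 < al/2 & (al+1)/2 < 1] by split; lra.
 have d0 : de = 0 by rewrite /de ltNge ltW.
 have e w th n : one_test de w th \o Y n = fun x => cos th-cos (w*Y n x+th) by apply/funext => x; rewrite /one_test /= d0 mul0r subr0.
 split=> [w th w0|U U0|].
 + under eq_fun do rewrite e; rewrite /g Gamma_fun_lt1//; exact: (undamped_limit_lt1 mY Y0 k1 htail hC).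
 + have [K [_ hK]] := undamped_bounded_lt1 mY Y0 k1 htail hC ha k2 k3 U0.
 by exists K; apply: filterS hK => n hK w th hw; rewrite e; exact: hK.
 + apply: nearW => n; rewrite (_ : (fun x => _) = fun=> 0); first exact: bmf_int (bmf_cst 0).
 by apply/funext => x; rewrite d0 mul0r.
- have ha : 1 < al < 2 by lra.
 have [||C [C0 hC]] := hbound (kap := (1 + al)/2) (kap' := (al+2)/2); [lra|lra|].
 have [k1 k2 k3] : [/\ (1 + al)/2 <= (al+2)/2, 1 < (1 + al)/2 & (al+2)/2 < 2] by split; lra.
 have d1 : de = 1 by rewrite /de al_gt.
 have e w th : one_test de w th = comp_test w th by apply/funext => y; rewrite /one_test d1 mul1r.
 have [N _ hN] := comp_integrable mY Y0 k1 (ltW C0) hC ha k2 k3.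
 split=> [w th w0|U U0|].
 + by rewrite e /g Gamma_fun_gt1//; exact: (comp_limit_gt1 mY Y0 k1 htail hC).
 + have [_ /(_ U U0)[K [_ hK]]] := hN N (leqnn N).
 by exists K; exists N => // n Nn w th hw; rewrite e; exact: hK.
 + exists N => // n /hN[i _]; rewrite (_ : (fun x => _) = Y n)//.
 by apply/funext => x; rewrite d1 mul1r.
Qed.

End OneSide.

(** * Modulus of continuity of characteristic functions *)

Section Echar.
Context {d} {W : measurableType d} {R : realType}.
Variable P : probability W R.
Implicit Types Z : W -> R.

Lemma tight_one Z e : mfun W Z -> 0 < e ->
 exists k : nat, pr P [set w | k%:R < `|Z w|] < e.
move=> mZ e0; pose F (k : nat) := [set w | k%:R < `|Z w|].
have mF k : measurable (F k) by [].
have F0 : \bigcap_k F k = set0.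
 apply/seteqP; split=> // w h; have := h (Num.truncn `|Z w|).+1 I.
 by rewrite /F /= ltNge ltW; have /andP[] := truncn_itv (normr_ge0 (Z w)).
have c : (P \o F) k @[k --> \oo] --> P (\bigcap_k F k).
 apply: nonincreasing_cvg_mu => //.
 - by rewrite (le_lt_trans (probability_le1 P (mF 0%N)))// ltry.
 - exact: bigcapT_measurable.
 - move=> a b ab; apply/subsetPset => w; apply: le_lt_trans; by rewrite ler_nat.
rewrite F0 measure0 in c.
have c2 : pr P (F k) @[k --> \oo] --> (0 : R) by apply: fine_cvg.
by have [N _ hN] := cvgr_lt _ c2 _ e0; exists N; apply: (hN N) => /=.
Qed.
Lemma echar_diff Z (u v M : R) : mfun W Z -> 0 <= M ->
 cn (echar P (fun w => u*Z w)-echar P (fun w => v*Z w)) <=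
 2 * (`|u-v| * M+2 * pr P [set w | M < `|Z w|]).
move=> mZ M0.
have mu' : mfun W (fun w => u*Z w) by [].
have mv : mfun W (fun w => v*Z w) by [].
have mS : measurable [set w | M < `|Z w|] by [].
have bI := bmf_indic mS.
have bb : bmf (fun w => `|u-v| * M+2 * \1_[set w | M < `|Z w|] w) by [].
have eb : ex P (fun w => `|u-v| * M+2 * \1_[set w | M < `|Z w|] w) = `|u-v| * M+2 * pr P [set w | M < `|Z w|].
 by rewrite exD ?ex_cst ?exZ ?ex_indic.
have pt w : Num.min 2 `|u*Z w-v*Z w| <= `|u-v| * M+2 * \1_[set w | M < `|Z w|] w.
 rewrite indicE; case: (leP `|Z w| M) => h.
 rewrite memNset /=; last by rewrite ltNge h.
 rewrite mulr0 addr0 ge_min; apply/orP; right.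
 by rewrite -mulrBl normrM ler_wpM2l.
 by rewrite mem_set//= mulr1 ge_min lerDr mulr_ge0.
apply: (le_trans (cn_le _)) => /=; rewrite mulrDl mul1r -eb; apply: lerD.
- rewrite -exB; [apply: ex_abs_le => //|exact: bmf_cos|exact: bmf_cos].
 by move=> w; apply: le_trans (pt w); exact: cos_diff_min.
- rewrite -exB; [apply: ex_abs_le => //|exact: bmf_sin|exact: bmf_sin].
 by move=> w; apply: le_trans (pt w); exact: sin_diff_min.
Qed.
Lemma echar_continuous Z e : mfun W Z -> 0 < e -> exists de : R, 0 < de /\
 forall u v : R, `|u-v| <= de -> cn (echar P (fun w => u*Z w)-echar P (fun w => v*Z w)) <= e.
move=> mZ e0; have e8 : 0 < e/8 by rewrite divr_gt0.
have [k hk] := tight_one mZ e8.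
have kk0 : 0 <= k%:R :> R by [].
exists (e/4/k.+1%:R); split; first by rewrite !divr_gt0.
move=> u v uv; apply: (le_trans (echar_diff u v mZ kk0)).
have : `|u-v| * k%:R <= e/4.
 apply: (@le_trans _ _ (e/4/k.+1%:R*k.+1%:R)); last by rewrite divfK.
 by apply: ler_pM => //; side.
lra.
Qed.

End Echar.

(** * The exponent of the canonical limit and its continuity *)

Definition psiR {R : realType} (al cp cm u : R) : R := - (c_stable al * (cp+cm) * `|u| `^ al).
Definition psiI {R : realType} (al cp cm u : R) : R :=
 c_stable al * (cp+cm) * `|u| `^ al * ((cp-cm) / (cp+cm)*Num.sg u*omega_stable al u).

Lemma canonical_charfun {R : realType} (al cp cm : R) (S : probability (measurableTypeR R) R) t :
 canonical_limit al cp cm S -> charfun S t = cexp (psiR al cp cm t +i* psiI al cp cm t)%C.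
move=> ->; congr cexp; rewrite /psiR /psiI.
apply/eqP; rewrite eq_complex /=; apply/andP; split; apply/eqP; ring.
Qed.

Section PsiContinuity.
Context {R : realType}.
Implicit Types (al cp cm u : R).

Lemma continuous_oppf (g : R -> R) u : {for (- u), continuous g} -> {for u, continuous (fun v => g (- v))}.
move=> h; apply: (@cvg_comp _ _ _ (fun v : R => - v) g _ _ _ _ h).
by side.
Qed.
Lemma continuous_odd (g : R -> R) : (forall u : R, 0 < u -> {for u, continuous g}) ->
 (forall u, g (- u) = - g u) -> g u @[u --> (0 : R)] --> (0 : R) -> continuous g.
move=> gp godd g0 u; have [u0|u0|->] := ltgtP u 0; [|exact: gp|].
- have -> : g = (fun v => - g (- v)) by apply/funext => v; rewrite godd opprK.
 by apply: cvgN; apply: continuous_oppf; apply: gp; side.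
- have e : g 0 = 0 by have := godd 0; rewrite oppr0; move: (g 0) => z h; lra.
 by rewrite /continuous_at e.
Qed.
Lemma continuous_even (g : R -> R) : (forall u : R, 0 < u -> {for u, continuous g}) ->
 (forall u, g (- u) = g u) -> g u @[u --> (0 : R)] --> g 0 -> continuous g.
move=> gp godd g0 u; have [u0|u0|->//] := ltgtP u 0; last exact: gp.
have -> : g = (fun v => g (- v)) by apply/funext => v.
by apply: continuous_oppf; apply: gp; side.
Qed.
Lemma powR_near0 al (K e : R) : 0 < al -> 0 < e -> \forall u \near (0 : R), `|K| * `|u| `^ al < e.
move=> a0 e0; have K1 : 0 < `|K| + 1 by rewrite ltr_wpDl.
pose r := (e / (`|K| + 1)) `^ al^-1.
have r0 : 0 < r by apply: powR_gt0; side.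
exists r => //= u; rewrite /ball /= sub0r normrN => ur.
have h : `|u| `^ al < e / (`|K| + 1).
 have -> : e / (`|K| + 1) = r `^ al by rewrite /r -powRrM mulVf// powRr1.
 by rewrite gt0_ltr_powR.
apply: (@le_lt_trans _ _ ((`|K| + 1) * `|u| `^ al)); last by rewrite mulrC -ltr_pdivlMr.
by rewrite ler_wpM2r// lerDl.
Qed.
Lemma psiR_continuous al cp cm : 0 < al -> continuous (psiR al cp cm).
move=> a0; apply: continuous_even.
- move=> u u0; have c : - (c_stable al * (cp+cm)*v `^ al) @[v --> u] --> - (c_stable al * (cp+cm)*u `^ al).
 by apply: cvgN; apply: cvgM; [side|exact: powR_cts].
 rewrite /continuous_at /prop_for /psiR (gtr0_norm u0).
 apply: cvg_trans c; apply: near_eq_cvg; near=> v.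
 by rewrite gtr0_norm//; near: v; exact: lt_nbhsr.
- by move=> u; rewrite /psiR normrN.
- apply/cvgrPdist_lt => e e0; near=> u.
 rewrite /psiR normr0 powR0// mulr0 oppr0 sub0r opprK normrM (ger0_norm (powR_ge0 _ _)).
 by near: u; exact: powR_near0.
Unshelve. all: by end_near. Qed.
Lemma ln_abs_bound u : `|u| <= 1 -> `|u * ln `|u| | <= 2 * `|u| `^ 2^-1.
have [->|un0] := eqVneq u 0.
 by rewrite mul0r normr0.
have u0 : 0 < `|u| by rewrite normr_gt0.
move=> h; rewrite normrM.
have l0 : ln `|u| <= 0 by rewrite -(@ln1 R) ler_ln.
have sq : `|u| = `|u| `^ 2^-1 * `|u| `^ 2^-1.
 rewrite -powRD ?(gt_eqF u0) ?implybT//.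
 have -> : 2^-1+2^-1 = 1 :> R by field.
 by rewrite powRr1.
rewrite (ler0_norm l0).
have q0 : 0 < `|u| `^ (- 2^-1) by [].
have e : `|u| * `|u| `^ (- 2^-1) = `|u| `^ 2^-1 by rewrite {1}sq -mulrA -powRD ?(gt_eqF u0) ?implybT// subrr powRr0 mulr1.
have b : - ln `|u| <= 2 * `|u| `^ (- 2^-1).
 have := @le_ln1Dx _ (`|u| `^ (- 2^-1)-1); rewrite subrKC => /(_ _).
 rewrite ln_powR; move: (ln _) (`|u| `^ _) q0 => l q q0 h1.
 by lra.
by rewrite -e mulrCA ler_wpM2l// ltW.
Qed.
(** The delicate point is 0 for [al = 1], where the function is a multiple of [u ln |u|], which
    [ln_abs_bound] dominates by a square root. *)
Lemma psiI_continuous al cp cm : 0 < al -> continuous (psiI al cp cm).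
move=> a0; set f := psiI _ _ _; apply: continuous_odd => [u u0|u|].
- pose om v : R := if al == 1 then - (2 / pi) * ln v else tan (al * pi/2).
 have co : om v @[v --> u] --> om u.
 by rewrite /om; case: ifP => _; [apply: cvgM; [exact: cvg_cst|exact: continuous_ln]|exact: cvg_cst].
 have fE v : 0 < v -> f v = c_stable al * (cp+cm)*v `^ al * ((cp-cm) / (cp+cm)*1*om v).
 by move=> v0; rewrite /f /psiI /omega_stable (gtr0_norm v0) (gtr0_sg v0).
 have c : c_stable al * (cp+cm)*v `^ al * ((cp-cm) / (cp+cm)*1*om v) @[v --> u] --> f u.
 rewrite fE//; apply: cvgM; apply: cvgM => //; try exact: cvg_cst.
 exact: powR_cts.
 apply: cvg_trans c; apply: near_eq_cvg; near=> v; rewrite fE//; near: v; exact: lt_nbhsr.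
- by rewrite /f /psiI normrN sgrN /omega_stable normrN; case: ifP => _; ring.
have [K [b [b0 hb]]] : exists K b : R, 0 < b /\ forall u, `|u| <= 1 -> `|f u| <= `|K| * `|u| `^ b.
 pose K := c_stable al * (cp+cm) * ((cp-cm) / (cp+cm)).
 have [al1|al1] := eqVneq al 1; [exists (2 * (K * - (2 / pi))), 2^-1|exists (K*tan (al * pi/2)), al]; split=> // u u1.
 have -> : f u = K * - (2 / pi) * (u * ln `|u|).
 by rewrite [X in X * ln _]numEsg /f /psiI /K /omega_stable al1 eqxx powRr1//; ring.
 move: (K * _) => k; rewrite normrM [2 * _]mulrC [X in _ <= X * _]normrM (ger0_norm (ler0n R 2)) -mulrA ler_wpM2l//.
 exact: ln_abs_bound.
 have -> : f u = K*tan (al * pi/2) * (`|u| `^ al*Num.sg u).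
 by rewrite /f /psiI /K /omega_stable (negPf al1); ring.
 by rewrite normrM ler_wpM2l// normrM (ger0_norm (powR_ge0 _ _)) ler_piMr// normr_sg; case: (u != 0).
apply/cvgrPdist_lt => e e0; near=> u; rewrite sub0r normrN; apply: (le_lt_trans (hb u _)).
 by near: u; exists 1 => //= u; rewrite /ball /= sub0r normrN => /ltW.
by near: u; apply: powR_near0.
Unshelve. all: by end_near. Qed.
Lemma bounded_continuous (g : R -> R) (U : R) : continuous g ->
 exists K, forall u, `|u| <= U -> `|g u| <= K.
move=> cg; have cs : {within `[- U, U], continuous g} by exact: continuous_subspaceT.
have [h|h] := leP (- U) U; last first.
 exists 0 => u /ler_normlP[h1 h2]; lra.
have [c1 _ m1] := EVT_max h cs; have [c2 _ m2] := EVT_min h cs.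
exists (`|g c1| + `|g c2|) => u; rewrite -lerN2 => hu.
have hi : u \in `[- U, U]%R by rewrite in_itv -ler_norml -lerN2.
have := m1 _ hi; have := m2 _ hi; move: (ler_norm (g c1)) (lerNnormlW (lexx `|g c2|)).
have := normr_ge0 (g c1); have := normr_ge0 (g c2).
move=> a1 a2 a3 a4 a5 a6; rewrite ler_norml; lra.
Qed.

End PsiContinuity.

(** * Weak convergence gives locally uniform convergence of characteristic functions *)

Section WeakCharfun.
Context {R : realType}.

Lemma near_forall_lt {T : Type} (F : set_system T) {FF : Filter F} (Q : nat -> T -> Prop) N :
 (forall j, \forall x \near F, Q j x) -> \forall x \near F, forall j, (j < N)%N -> Q j x.
move=> h; elim: N => [|N IH]; first by apply: filterE => x j.
apply: filterS2 (h N) IH => x hN hx j; rewrite ltnS leq_eqVlt => /orP[/eqP->//|].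
exact: hx.
Qed.
Lemma law_ex {E : topologicalType} {d} {W : measurableType d} (P : probability W R)
 (Y : nat -> W -> E) {d'} {W' : measurableType d'} (P' : probability W' R)
 (Y' : W' -> E) (h : E -> R) : cvg_in_law P Y P' Y' -> continuous h -> bounded_fun h ->
 bmf (h \o Y') -> ex P (h \o Y n) @[n --> \oo] --> ex P' (h \o Y').
move=> c ch bh bY; have := c h ch bh; rewrite unlock => c1.
apply: fine_cvg; rewrite /ex /Rintegral fineK //.
by have /integrable_fin_num := bmf_int P' bY; apply.
Qed.

Context {d} {W : measurableType d} (P : probability W R).
Variables (Z : nat -> W -> R) (S : probability (measurableTypeR R) R).
Hypotheses (mZ : forall n, mfun W (Z n)) (hZ : cvg_in_law P Z S (fun x => x : R)).

Let law_id (h : R -> R) M : continuous h -> (forall x, `|h x| <= M) ->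
 ex P (h \o Z n) @[n --> \oo] --> ex S h.
move=> ch hM; apply: (law_ex hZ ch).
 by exists M; split; [exact: num_real|move=> y My x _; exact: le_trans (hM x) (ltW My)].
split; last by exists M => x; side.
exact: continuous_measurable_fun.
Qed.
Lemma cvg_echar u e : 0 < e -> \forall n \near \oo,
 cn (echar P (fun w => u*Z n w)-charfun S u) <= e.
move=> e0; have e2 : 0 < e/2 by rewrite divr_gt0.
have cu : continuous (fun x : R => u*x) by move=> x; apply: cvgM; side.
have c1 : ex P ((fun x => cos (u*x)) \o Z n) @[n --> \oo] --> ex S (fun x : R => cos (u*x)).
 apply: (@law_id _ 1); last by move=> x; rewrite ler_norml cos_geN1 cos_le1.
 by move=> x; apply: continuous_comp; [exact: cu|exact: continuous_cos].
have c2 : ex P ((fun x => sin (u*x)) \o Z n) @[n --> \oo] --> ex S (fun x : R => sin (u*x)).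
 apply: (@law_id _ 1); last by move=> x; rewrite ler_norml sin_geN1 sin_le1.
 by move=> x; apply: continuous_comp; [exact: cu|exact: continuous_sin].
near=> n; apply: (le_trans (cn_le _)) => /=; rewrite [leRHS](splitr e) lerD//.
- by rewrite distrC; near: n; exact: ((iffLR (cvgrPdist_le _ _) c1) _ e2).
- by rewrite distrC; near: n; exact: ((iffLR (cvgrPdist_le _ _) c2) _ e2).
Unshelve. all: by end_near. Qed.
(** The continuous function [h] lies between the indicators of [|x| > k + 1] and of [|x| > k]. *)
Lemma cvg_tight e : 0 < e -> exists M : R, 0 <= M /\ pr S [set x : R | M < `|x|] <= e /\
 \forall n \near \oo, pr P [set w | M < `|Z n w|] <= e.
move=> e0; have e2 : 0 < e/2 by rewrite divr_gt0.
have mid : measurable_fun [set: measurableTypeR R] (fun x => x : R) by [].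
have [k hk] := tight_one S mid e2.
exists k.+1%:R; split=> //; split.
 apply: le_trans (ltW (lt_trans hk _)); last side.
 have mS (t : R) : measurable [set x : measurableTypeR R | t < `|(x : R)|] by apply: (@mset_gt _ (measurableTypeR R) R (fun x : R => `|x|)); side.
 apply: pr_le; [side|side|].
 by move=> x /=; side.
pose h (x : R) := Num.min 1 (Num.max (`|x| - k%:R) 0).
have h0 x : 0 <= h x by rewrite /h.
have h1 x : `|h x| <= 1 by rewrite ger0_norm /h.
have ch : continuous h.
 move=> x; apply: (@continuous_min R _ (fun=> 1) (fun x => Num.max (`|x| - k%:R) 0)); first exact: cvg_cst.
 apply: (@continuous_max R _ (fun x => `|x| - k%:R) (fun=> 0)); last exact: cvg_cst.
 by apply: cvgB; [exact: norm_continuous|side].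
have bh : bmf h by split; [exact: continuous_measurable_fun|exists 1].
have c := law_id ch h1.
have b : ex S h < e/2.
 apply: le_lt_trans hk; have mS : measurable [set x : measurableTypeR R | k%:R < `|(x : R)|].
 by apply: (@mset_gt _ (measurableTypeR R) R (fun x : R => `|x|)); side.
 rewrite -(ex_indic S mS); apply: ex_le => //.
 move=> x; rewrite indicE; case: (ltP k%:R `|x|) => hx.
 by rewrite mem_set// /h ge_min lexx.
 by rewrite memNset; [rewrite /h max_r ?subr_le0// ge_min lexx orbT|apply/negP; rewrite -leNgt].
near=> n; apply: (@le_trans _ _ (ex P (h \o Z n))).
 have mS : measurable [set w | k.+1%:R < `|Z n w|] by [].
 rewrite -(ex_indic P mS); apply: ex_le => //; [exact: bmf_compY|].
 move=> w; rewrite indicE /=; case: (ltP k.+1%:R `|Z n w|) => hx; last by rewrite memNset//=; apply/negP; rewrite -leNgt.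
 rewrite mem_set// /h min_l// le_max; apply/orP; left.
 by lra.
apply: (@le_trans _ _ (e/2)); last side.
by near: n; apply: (cvgr_le _ c).
Unshelve. all: by end_near. Qed.
(** Convergence on a finite grid of mesh [de], extended to all of [[-U, U]] by the equicontinuity
    that tightness provides ([echar_diff]). *)
Lemma cvg_echar_unif U e : 0 < U -> 0 < e -> \forall n \near \oo, forall u, `|u| <= U ->
 cn (echar P (fun w => u*Z n w)-charfun S u) <= e.
move=> U0 e0; have e1 : 0 < e/32 by rewrite divr_gt0.
have [M [M0 [MS MP]]] := cvg_tight e1.
have M1 : 0 < M+1 by rewrite ltr_wpDl.
pose de := e/16 / (M+1).
have de0 : 0 < de by rewrite !divr_gt0.
pose N := (Num.truncn (2*U/de)).+1.
pose v (j : nat) := - U+j%:R*de.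
have e4 : 0 < e/4 by rewrite divr_gt0.
have hv : \forall n \near \oo, forall j, (j < N)%N -> cn (echar P (fun w => v j*Z n w)-charfun S (v j)) <= e/4.
 by apply: near_forall_lt => j; exact: cvg_echar.
near=> n => u uU.
have MPn : pr P [set w | M < `|Z n w|] <= e/32 by near: n.
have hvn : forall j, (j < N)%N -> cn (echar P (fun w => v j*Z n w)-charfun S (v j)) <= e/4 by near: n.
have /andP[u1 u2] : - U <= u <= U by rewrite -ler_norml.
have p0 : 0 <= (u+U)/de by rewrite divr_ge0; lra.
pose j := Num.truncn ((u+U)/de).
have /andP[j1 j2] := truncn_itv p0.
have jN : (j < N)%N.
 rewrite /N ltnS; apply: le_truncn; rewrite ler_pM2r//; lra.
have vj : `|u-v j| <= de.
 move: j1 j2; rewrite ler_pdivlMr// ltr_pdivrMr// -/j -natr1 mulrDl mul1r /v => j1 j2.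
 by rewrite ger0_norm; lra.
have dM : `|u-v j| * M <= e/16.
 apply: (@le_trans _ _ (de * (M+1))); last by rewrite /de divfK.
 by apply: ler_pM => //; rewrite lerDl.
have d1 := echar_diff P u (v j) (mZ n) M0.
have mid : measurable_fun [set: measurableTypeR R] (fun x => x : R) by [].
have d2 := echar_diff S (v j) u mid M0.
rewrite [`|v j-u|]distrC in d2.
have -> : echar P (fun w => u*Z n w)-charfun S u =
 (echar P (fun w => u*Z n w)-echar P (fun w => v j*Z n w)) +
 ((echar P (fun w => v j*Z n w)-charfun S (v j)) + (charfun S (v j)-charfun S u)) by ring.
apply: (le_trans (cnD _ _)); have d3 := cnD (echar P (fun w => v j*Z n w)-charfun S (v j)) (charfun S (v j)-charfun S u).
have d4 := hvn j jN.
have d2' : cn (charfun S (v j)-charfun S u) <= 2 * (`|u-v j| * M+2 * pr S [set w : R | M < `|w|]) by exact: d2.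
move: d1 d2' d3 d4 MS MPn dM e0; clear.
lra.
Unshelve. all: by end_near. Qed.

End WeakCharfun.

(** * From convergence of exponentials to convergence of exponents *)

Section Lift.
Context {R : realType}.
Implicit Types (U del : R) (D r : R -> R).

(** Otherwise [|D|], which vanishes at 0, would take the value [pi / 2] in between, where the cosine
    is zero. This excludes jumps of the argument by multiples of [2 pi]. *)
Lemma lift_small D U : continuous D -> D 0 = 0 -> (forall u, `|u| <= U -> 0 < cos (D u)) ->
 forall u, `|u| <= U -> `|D u| < pi/2.
move=> cD D0 hc u uU; rewrite ltNge; apply/negP => h.
have p2 : 0 <= pi/2 :> R by rewrite divr_ge0// pi_ge0.
have cN : continuous (fun v => `|D v|) by move=> v; apply: continuous_comp; [exact: cD|exact: norm_continuous].
have key : exists2 v, `|v| <= `|u| & `|D v| = pi/2.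
 have b : forall x y, Num.min (`|D x|) (`|D y|) <= pi/2 <= Num.max (`|D x|) (`|D y|) ->
 x <= y -> exists2 v, v \in `[x, y]%R & `|D v| = pi/2 by move=> x y hxy xy; apply: (@IVT _ (fun v => `|D v|)) => //; exact: continuous_subspaceT.
 have [u0|u0] := leP 0 u.
 have [|v] := b 0 u _ u0; first by rewrite D0 normr0 min_l ?max_r// p2.
 by rewrite in_itv => /andP[v0 v1] hv; exists v => //; rewrite !ger0_norm.
 have [|v] := b u 0 _ (ltW u0).
 by rewrite D0 normr0 min_r ?max_l// p2.
 rewrite in_itv => /andP[v0 v1] hv; exists v => //.
 by rewrite !ler0_norm ?lerN2// ltW.
have [v vu e] := key.
have := hc v (le_trans vu uU).
have -> : cos (D v) = cos `|D v| by case: (lerP 0 (D v)) => h0; [rewrite ger0_norm|rewrite ltr0_norm// cosN].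
by rewrite e cos_pihalf ltxx.
Qed.
Lemma cexp_near1 (a b del : R) : cn (cexp (a +i* b)%C-1) <= del -> del <= 2^-1 ->
 [/\ 0 < cos b, `|a| <= 1, `|expR a-1| <= del & `|sin b| <= 2*del].
set z := (a +i* b)%C => h hd.
have ce : cn (cexp z) = expR a by rewrite cn_cexp.
have t1 : expR a <= 1+del by rewrite -ce -[cexp z](subrK 1); apply: (le_trans (cnD _ _)); rewrite cn1 addrC lerD2l.
have t2 : 1-del <= expR a.
 have := cnB (cexp z) (cexp z-1); rewrite subKr cn1 ce => t; lra.
have ea : 2^-1 <= expR a by lra.
have ex0 : 0 < expR a by [].
have hr := cn_Re (cexp z-1); have hi := cn_Im (cexp z-1).
have er : complex.Re (cexp z-1) = expR a*cos b-1 by rewrite /cexp /=; ring.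
have ei : complex.Im (cexp z-1) = expR a*sin b by rewrite /cexp /=; ring.
rewrite er in hr; rewrite ei in hi.
have hr' := le_trans hr h; have hi' := le_trans hi h.
split.
- have : 0 < expR a*cos b by move: hr' => /ler_normlP[x y]; lra.
 by rewrite pmulr_rgt0.
- rewrite ler_norml; apply/andP; split; last first.
 by have := expR_ge1Dx a; lra.
 have := expR_ge1Dx (- a); have := expRxMexpNx_1 a; move: (expR a) (expR (- a)) ex0 ea => p q p0 hp e1 e2.
 nra.
- by rewrite ler_norml; lra.
- move: hi'; rewrite normrM (gtr0_norm ex0); move: (normr_ge0 (sin b)); move: (`|sin b|) => s s0 hs; nra.
Qed.

End Lift.

Lemma near_ge_nat {R : realType} (t : R) : \forall k \near \oo, t <= k.+1%:R.
exists (Num.truncn `|t|) => // k hk; apply: (le_trans (ler_norm t)).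
by have /andP[_ /ltW/le_trans] := truncn_itv (normr_ge0 t); apply; rewrite ler_nat ltnS.
Qed.
Lemma near_dist {R : realType} (u : nat -> R) (l e : R) : u n @[n --> \oo] --> l -> 0 < e ->
 \forall n \near \oo, `|l-u n| <= e.
by move=> /cvgrPdist_le h e0; exact: h. Qed.
Lemma cvg_sum_ord {R : realType} N (u : nat -> nat -> R) (l : nat -> R) :
 (forall i, u i n @[n --> \oo] --> l i) ->
 \sum_(i < N) u i n @[n --> \oo] --> \sum_(i < N) l i.
move=> h; elim: N => [|N IH].
 by rewrite big_ord0; apply: cvg_near_cst; apply: nearW => n; rewrite big_ord0.
by rewrite big_ord_recr; under eq_fun do rewrite big_ord_recr; apply: cvgD.
Qed.

(** * Regular variation of the tails and convergence of the exponents *)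

Section CanonicalData.
Context {d} {X : measurableType d} {R : realType}.
Variables (mu : probability X R) (f : X -> R) (al cp cm : R) (ell : R -> R) (A B : nat -> R).
Hypotheses (mf : mfun X f) (hal : 0 < al < 2) (hcpm : 0 < cp+cm) (hell : slowly_varying ell)
 (htails : stable_tails mu f al cp cm ell) (hB0 : forall n, (1 <= n)%N -> 0 < B n)
 (hBoo : B n @[n --> \oo] --> +oo) (hBell : forall n, (1 <= n)%N -> n%:R*ell (B n) = B n `^ al).
Local Notation m := (pr mu).
Local Notation E := (ex mu).

(** Strict on the right and weak on the left, as in the tail hypotheses; its monotonicity is what
    Potter bounds require. *)
Definition tailV t := m [set x | t < f x]+m [set x | f x <= - t].
Local Notation V := tailV.

Lemma tail_dec s t : s <= t -> V t <= V s.
move=> st; apply: lerD; apply: pr_le.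
- side.
- side.
- by move=> x /=; side.
- exact: mset_le.
- exact: mset_le.
- by move=> x /= h; side.
Qed.
Lemma tail_ge0 t : 0 <= V t.
by rewrite addr_ge0 ?pr_ge0. Qed.
Lemma tail_abs t : m [set x | t < `|f x|] <= V t.
have h := pr_subU mu (mset_gt t mf) (mset_le (- t) mf); apply: le_trans h.
apply: pr_le; [side|by apply: measurableU; [side|exact: mset_le]|].
by move=> x /=; rewrite lter_normr => /orP[h|h]; [left|right; rewrite lerNr ltW].
Qed.
Lemma tail_right_form : exists e : R -> R, e t @[t --> +oo] --> (0 : R) /\
 \forall t \near +oo, m [set x | t < f x] = (cp+e t)*t `^ (- al)*ell t.
have [ep [em [h1 h2 h3 h4]]] := htails; exists ep; split=> //.
by apply: filterS h3 => t ht; rewrite /pr ht.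
Qed.
Lemma tail_left_form : exists e : R -> R, e t @[t --> +oo] --> (0 : R) /\
 \forall t \near +oo, m [set x | f x <= - t] = (cm+e t)*t `^ (- al)*ell t.
have [ep [em [h1 h2 h3 h4]]] := htails; exists em; split=> //.
by apply: filterS h4 => t ht; rewrite /pr ht.
Qed.
Lemma tail_form : exists e : R -> R, e t @[t --> +oo] --> (0 : R) /\
 \forall t \near +oo, V t = (cp+cm+e t)*t `^ (- al)*ell t.
have [ep [h1 h2]] := tail_right_form; have [em [h3 h4]] := tail_left_form.
exists (fun t => ep t+em t); split.
 by rewrite -[X in _ --> X](addr0 0); side.
near=> t; rewrite /tailV (near h2 t)// (near h4 t)//; ring.
Unshelve. all: by end_near. Qed.
Lemma cvg_scale (la : R) : 0 < la -> la*t @[t --> +oo] --> +oo.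
move=> l0; apply/cvgryPge => x; near=> t; by rewrite mulrC -ler_pdivrMr.
Unshelve. all: by end_near. Qed.
Lemma cvg_form_ratio (c : R) (e g : R -> R) (la : R) : 0 < la ->
 e t @[t --> +oo] --> (0 : R) ->
 (\forall t \near +oo, g t = (c+e t)*t `^ (- al)*ell t) ->
 g (la*t) / (t `^ (- al)*ell t) @[t --> +oo] --> c * la `^ (- al).
move=> l0 he hg; have [[a [_ ella]] hla] := hell.
have sc := cvg_scale l0.
have c1 : (c+e (la*t)) * la `^ (- al) * (ell (la*t)/ell t) @[t --> +oo] --> (c+0) * la `^ (- al)*1.
 apply: cvgM; last exact: hla.
 apply: cvgM; last exact: cvg_cst.
 apply: cvgD; first exact: cvg_cst.
 exact: (cvg_comp _ _ sc he).
rewrite addr0 mulr1 in c1; apply: cvg_trans c1; apply: near_eq_cvg.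
have hg' : \forall t \near +oo, g (la*t) = (c+e (la*t)) * (la*t) `^ (- al)*ell (la*t).
 exact: (sc _ hg).
near=> t.
have t0 : 0 < t by near: t; exact: nbhs_pinfty_gt.
have el0 : 0 < ell t by apply: ella.
rewrite (near hg' t)// powRM ?(ltW l0) ?(ltW t0)//.
have : t `^ (- al) != 0 by rewrite gt_eqF// powR_gt0.
have : ell t != 0 by rewrite gt_eqF.
by move=> h1 h2; field; rewrite h1 h2.
Unshelve. all: by end_near. Qed.
(** The relation [n * ell (B n) = B n ^ al] cancels the slowly varying factor. *)
Lemma cvg_tail_seq (c : R) (e g : R -> R) (la : R) : 0 < la ->
 e t @[t --> +oo] --> (0 : R) ->
 (\forall t \near +oo, g t = (c+e t)*t `^ (- al)*ell t) ->
 n%:R*g (la*B n) @[n --> \oo] --> c * la `^ (- al).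
move=> l0 he hg; have c1 := cvg_comp _ _ hBoo (cvg_form_ratio l0 he hg).
apply: cvg_trans c1; apply: near_eq_cvg; near=> n.
have n1 : (1 <= n)%N by near: n.
have b0 := hB0 n1; have be := hBell n1.
have n0 : (n%:R : R) != 0 by [].
have p0 : B n `^ al != 0 by [].
have eb : ell (B n) = B n `^ al/n%:R by rewrite -be mulrAC mulfV// mul1r.
rewrite /= eb powRN; field; rewrite p0 n0.
Unshelve. all: by end_near. Qed.
Lemma cvg_right_tail x : 0 < x -> n%:R * m [set y | x*B n < f y] @[n --> \oo] --> cp*x `^ (- al).
by move=> x0; have [e [h1 h2]] := tail_right_form; exact: cvg_tail_seq x0 h1 h2. Qed.
Lemma cvg_left_tail x : 0 < x -> n%:R * m [set y | f y <= - (x*B n)] @[n --> \oo] --> cm*x `^ (- al).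
by move=> x0; have [e [h1 h2]] := tail_left_form; exact: cvg_tail_seq x0 h1 h2. Qed.
Lemma cvg_tailV x : 0 < x -> n%:R*V (x*B n) @[n --> \oo] --> (cp+cm)*x `^ (- al).
by move=> x0; have [e [h1 h2]] := tail_form; exact: cvg_tail_seq x0 h1 h2. Qed.
Lemma tail_gt0 t : 0 < V t.
have [[a [_ ella]] _] := hell; have [e [h1 h2]] := tail_form.
have h3 : \forall s \near +oo, - (cp+cm) < e s by apply: (cvgr_gt _ h1); have := hcpm; lra.
near (pinfty_nbhs R) => s.
apply: (@lt_le_trans _ _ (V s)); last by apply: tail_dec.
rewrite (near h2 s)// !mulr_gt0//.
- by have : - (cp+cm) < e s; [exact: (near h3 s)|lra].
- by rewrite powR_gt0; side.
- by apply: ella.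
Unshelve. all: by end_near. Qed.
Lemma cvg_tail_double : V (2*t)/V t @[t --> +oo] --> (2 : R) `^ (- al).
have [e [h1 h2]] := tail_form; have [[a [_ ella]] _] := hell.
have c2 : V (2*t) / (t `^ (- al)*ell t) @[t --> +oo] --> (cp+cm)*2 `^ (- al).
 by apply: (cvg_form_ratio _ h1 h2).
have c1 : V (1*t) / (t `^ (- al)*ell t) @[t --> +oo] --> (cp+cm)*1 `^ (- al).
 by apply: (cvg_form_ratio _ h1 h2).
rewrite powR1 mulr1 in c1; have cn0 : cp+cm != 0 by rewrite gt_eqF.
have c3 : V (2*t) / (t `^ (- al)*ell t) * (V (1*t) / (t `^ (- al)*ell t))^-1 @[t --> +oo]
 --> (cp+cm)*2 `^ (- al) * (cp+cm)^-1.
 by apply: cvgM => //; exact: cvgV.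
have -> : (2 : R) `^ (- al) = (cp+cm)*2 `^ (- al) * (cp+cm)^-1 by field.
apply: cvg_trans c3; apply: near_eq_cvg; near=> t.
have v0 := tail_gt0 t; rewrite mul1r.
have p0 : 0 < t `^ (- al) by rewrite powR_gt0//; near: t; exact: nbhs_pinfty_gt.
have e0 : 0 < ell t by apply: ella.
by field; rewrite !gt_eqF.
Unshelve. all: by end_near. Qed.
Lemma two_powR_lt (a b : R) : a < b -> (2 : R) `^ a < 2 `^ b.
by move=> ab; rewrite /powR gt_eqF// ltr_expR ltr_pM2r// ln_gt0; lra. Qed.
(** The limit [2^(-al)] of [V(2t) / V(t)] gives doubling inequalities for any exponents on either
    side of [al]. *)
Lemma potter kap kap' : 0 < kap < al -> al < kap' -> exists C t0 : R, [/\ 0 < C, 0 < t0,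
 (forall t x, t0 <= t -> 1 <= x -> V (x*t) <= C*x `^ (- kap)*V t) &
 (forall t x, t0 <= t -> 1 <= x -> V t <= C*x `^ kap'*V (x*t))].
move=> /andP[k0 k1] k2.
have h1 : \forall t \near +oo, V (2*t)/V t < 2 `^ (- kap).
 by apply: (cvgr_lt _ cvg_tail_double); apply: two_powR_lt; lra.
have h2 : \forall t \near +oo, 2 `^ (- kap') < V (2*t)/V t.
 by apply: (cvgr_gt _ cvg_tail_double); apply: two_powR_lt; lra.
have [t1 [_ g1]] := h1; have [t2 [_ g2]] := h2.
pose t0 := Num.max 1 (Num.max (t1+1) (t2+1)).
have t0p : 0 < t0 by rewrite /t0 !lt_max ltr01.
have t01 t : t0 <= t -> t1 < t /\ t2 < t by rewrite /t0 !ge_max => /and3P[]; lra.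
exists (Num.max (2 `^ kap) (2 `^ kap')), t0; split=> //.
- move=> t x tt x1; apply: (le_trans (potter_upper (V := V) (kap := kap) _ _ t0p _ _ tt x1)).
 + by move=> s s' _; exact: tail_dec.
 + exact: tail_ge0.
 + exact: ltW.
 + move=> s /t01[s1 _]; have := g1 s s1; rewrite ltr_pdivrMr ?tail_gt0//; exact: ltW.
 + by rewrite ler_wpM2r ?tail_ge0// ler_wpM2r ?powR_ge0// le_max lexx.
- move=> t x tt x1; have h : forall t, t0 <= t -> V t <= 2 `^ kap'*V (2*t).
 move=> s /t01[_ s2]; have := g2 s s2; rewrite ltr_pdivlMr ?tail_gt0//= powRN mulrC ltr_pdivrMr ?powR_gt0//.
 by lra.
 have hd : forall s t, 0 < s -> s <= t -> V t <= V s by move=> s s' _; exact: tail_dec.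
 have k'0 : 0 <= kap' by lra.
 have hh := potter_lower hd tail_ge0 t0p k'0 h tt x1; apply: (le_trans hh).
 by rewrite ler_wpM2r ?tail_ge0// ler_wpM2r// le_max lexx orbT.
Qed.
Lemma tail_le1 t : 0 <= t -> V t <= 2.
by move=> _; have -> : 2 = 1+1 :> R by []; rewrite /tailV lerD// pr_le1//; exact: mset_le. Qed.
Lemma tail_power kap : 0 < kap < al -> exists C : R, 0 < C /\ forall t, 0 < t -> V t <= C*t `^ (- kap).
move=> hk; have [C [t0 [C0 t00 h _]]] : exists C t0 : R, [/\ 0 < C, 0 < t0,
 (forall t x, t0 <= t -> 1 <= x -> V (x*t) <= C*x `^ (- kap)*V t) & True].
 have h1 : al < al+1 by lra.
 by have [C [t0 [? ? ? ?]]] := potter hk h1; exists C, t0.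
have k0 : 0 <= kap by lra.
exists (Num.max (2*t0 `^ kap) (C*t0 `^ kap*2)); split; first by rewrite lt_max mulr_gt0.
move=> t tp; have [tt|tt] := leP t0 t.
 have := h t0 (t/t0) (lexx _); rewrite ler_pdivlMr// mul1r => /(_ tt).
 rewrite divfK// => /le_trans; apply.
 apply: (@le_trans _ _ (C*t0 `^ kap*2*t `^ (- kap))).
 rewrite powRM// powR_inv// opprK.
 rewrite (mulrC (t `^ _)) -!mulrA ler_wpM2l// ler_wpM2l// mulrC.
 by rewrite ler_wpM2r// tail_le1// ltW.
 by rewrite ler_wpM2r// le_max lexx orbT.
apply: (le_trans (tail_le1 (ltW tp))).
apply: (@le_trans _ _ (2*t0 `^ kap*t `^ (- kap))).
 by rewrite powRN ler_pdivlMr// ler_wpM2l// ge0_ler_powR ?(ltW tt).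
by rewrite ler_wpM2r// le_max lexx.
Qed.
(** Potter's lower bound at the fixed point [t0] is compared with [n V(B n)], which stays
    bounded. *)
Lemma growth_power kap' : al < kap' -> exists C : R, 0 < C /\
 \forall n \near \oo, n%:R <= C*B n `^ kap'.
move=> hk; have /andP[al0 _] := hal.
have h2 : 0 < al/2 < al by lra.
have [C [t0 [C0 t00 _ h]]] := potter h2 hk.
have v0 := tail_gt0 t0; pose c := cp+cm+1.
have hc : \forall n \near \oo, n%:R*V (1*B n) < c.
 by apply: (cvgr_lt _ (cvg_tailV ltr01)); rewrite powR1 /c; lra.
exists (C*t0 `^ (- kap')*c/V t0); split.
 by rewrite !mulr_gt0 ?invr_gt0 ?powR_gt0// /c; have := hcpm; lra.
have hb : \forall n \near \oo, t0 <= B n by exact: (hBoo (nbhs_pinfty_ge (num_real t0))).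
near=> n.
have b0 : t0 <= B n by exact: (near hb n).
have bp : 0 < B n by lra.
have := h t0 (B n/t0) (lexx _); rewrite ler_pdivlMr// mul1r => /(_ b0).
rewrite divfK// powRM// powR_inv// => hV.
have hn : n%:R*V (B n) < c by have := near hc n; rewrite mul1r; apply.
rewrite mulrAC ler_pdivlMr.
apply: (@le_trans _ _ (n%:R * (C * (B n `^ kap'*t0 `^ (- kap'))*V (B n)))).
 by rewrite ler_wpM2l.
have -> : n%:R * (C * (B n `^ kap'*t0 `^ (- kap'))*V (B n)) =
 C*t0 `^ (- kap')*B n `^ kap' * (n%:R*V (B n)) by ring.
rewrite (mulrAC _ c) ler_wpM2l; side.
Unshelve. all: by end_near. Qed.
(** Three ranges of [x]: Potter bounds for [1 <= x] and for [t0 / B n <= x < 1], and below that the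
    trivial bound on [V] together with [growth_power]. *)
Lemma tail_uniform kap kap' : 0 < kap < al -> al < kap' -> exists C : R, 0 < C /\
 \forall n \near \oo, forall x, 0 < x -> n%:R*V (x*B n) <= C*Num.max (x `^ (- kap)) (x `^ (- kap')).
move=> hk hk'; have [C [t0 [C0 t00 hu hl]]] := potter hk hk'.
have [Cg [Cg0 hg]] := growth_power hk'; pose c := cp+cm+1.
have c0 : 0 < c by rewrite /c; have := hcpm; lra.
have hc : \forall n \near \oo, n%:R*V (1*B n) < c.
 by apply: (cvgr_lt _ (cvg_tailV ltr01)); rewrite powR1 /c; lra.
have hb : \forall n \near \oo, t0 <= B n by exact: (hBoo (nbhs_pinfty_ge (num_real t0))).
have tk : 0 < t0 `^ kap' by rewrite powR_gt0.
have kp0 : 0 <= kap' by have := hal; lra.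
exists (C*c+2*Cg*t0 `^ kap'); split; first by rewrite addr_gt0 ?mulr_gt0.
near=> n.
have b0 : t0 <= B n by exact: (near hb n).
have bp : 0 < B n by exact: lt_le_trans b0.
have hn : n%:R*V (B n) < c by have := near hc n; rewrite mul1r; apply.
have hgn : n%:R <= Cg*B n `^ kap' by exact: (near hg n).
move=> x x0.
have mx0 : 0 <= Num.max (x `^ (- kap)) (x `^ (- kap')) by rewrite le_max powR_ge0.
have Cc0 : 0 <= C*c by rewrite mulr_ge0 ?ltW.
have Cg1 : 0 <= 2*Cg*t0 `^ kap' by rewrite !mulr_ge0 ?ltW.
have key : forall q, 0 <= q -> q <= Num.max (x `^ (- kap)) (x `^ (- kap')) ->
 V (x*B n) <= C*q*V (B n) ->
 n%:R*V (x*B n) <= (C*c+2*Cg*t0 `^ kap')*Num.max (x `^ (- kap)) (x `^ (- kap')).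
 move=> q q0 qm hq; apply: (@le_trans _ _ (C*c*Num.max (x `^ (- kap)) (x `^ (- kap')))).
 apply: (@le_trans _ _ (C*q * (n%:R*V (B n)))).
 by rewrite mulrCA ler_wpM2l.
 rewrite -!mulrA ler_wpM2l ?(ltW C0)// mulrC ler_pM// ?mulr_ge0 ?tail_ge0//.
 exact: ltW.
 by rewrite ler_wpM2r// lerDl.
have [x1|x1] := leP 1 x.
 by apply: (key (x `^ (- kap))); [rewrite powR_ge0|rewrite le_max lexx|exact: hu].
have [tx|tx] := leP t0 (x*B n).
 apply: (key (x `^ (- kap'))); [by rewrite powR_ge0|by rewrite le_max lexx orbT|].
 have := hl (x*B n) x^-1 tx; rewrite mulKf ?gt_eqF// powR_inv ?(ltW x0)//; apply.
 by rewrite invf_ge1// ltW.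
apply: (@le_trans _ _ (2*Cg*t0 `^ kap'*x `^ (- kap'))); last first.
 apply: (@le_trans _ _ (2*Cg*t0 `^ kap'*Num.max (x `^ (- kap)) (x `^ (- kap')))).
 by rewrite ler_wpM2l// le_max lexx orbT.
 by rewrite ler_wpM2r// lerDr.
apply: (@le_trans _ _ (Cg*B n `^ kap'*2)).
 by apply: ler_pM; rewrite ?tail_ge0// tail_le1// mulr_ge0// ltW.
rewrite mulrC -!mulrA ler_wpM2l// ler_wpM2l//.
rewrite powRN ler_pdivlMr// -powRM// mulrC ge0_ler_powR ?(ltW tx).
Unshelve. all: by end_near. Qed.
Lemma cvg_powR_neg (b : R) : 0 < b -> B n `^ (- b) @[n --> \oo] --> (0 : R).
move=> b0; apply/cvgrPdist_lt => e e0; near=> n.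
have bn : e^-1 `^ b^-1 < B n by near: n; exact: (hBoo (nbhs_pinfty_gt (num_real _))).
have bp : 0 < B n by apply: le_lt_trans bn; side.
rewrite sub0r normrN ger0_norm powRN.
rewrite -[ltRHS]invrK ltf_pV2.
have -> : e^-1 = (e^-1 `^ b^-1) `^ b by rewrite -powRrM mulVf// powRr1.
by rewrite gt0_ltr_powR.
Unshelve. all: by end_near. Qed.
(** The gap is of order [ln n / |ln g|]. Since [ln n] is dominated by a small power of [n], and [n]
    by [B n ^ kap'], the inequality [kap' < 2 * kap] leaves a negative power of [B n]. *)
Lemma gap_length (g kap kap' : R) : 0 < g < 1 -> 0 < kap -> al < kap' < 2*kap ->
 exists N : nat -> nat, [/\
 \forall n \near \oo, g ^+ N n <= n%:R^-1 &
 n%:R * (N n).+1%:R*B n `^ (- (2*kap)) @[n --> \oo] --> (0 : R)].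
move=> /andP[g0 g1] k0 /andP[k1 k2]; have /andP[al0 _] := hal.
have lg : 0 < - ln g by rewrite oppr_gt0 ln_lt0// g0.
pose N n := (Num.truncn (ln (n%:R : R) / - ln g)).+1; exists N; split.
 exists 1%N => // n /= n1.
 have n0 : 0 < n%:R :> R by rewrite ltr0n.
 have l0 : 0 <= ln (n%:R : R) / - ln g by rewrite divr_ge0 ?(ltW lg)// ln_ge0// ler1n.
 have /andP[_ h] := truncn_itv l0.
 rewrite -(@ler_ln _ (g ^+ N n)) ?posrE ?invr_gt0 ?exprn_gt0//.
 rewrite lnV ?posrE// lnXn//.
 have h2 : ln (n%:R : R) < (N n)%:R * - ln g by rewrite -ltr_pdivrMr.
 have -> : ln g *+ N n = ln g * (N n)%:R by rewrite mulr_natr.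
 by rewrite ?mul1r lerNr -mulNr mulrC; exact: ltW.
have [C [C0 hC]] := growth_power k1.
(* Chosen so that [kap' * (1 + de)] is still less than [2 * kap]. *)
pose de := (2*kap/kap'-1)/2.
have kp0 : 0 < kap' by lra.
have de0 : 0 < de.
 by rewrite /de divr_gt0// subr_gt0 ltr_pdivlMr ?mul1r.
pose eta := 2*kap-kap' * (1+de).
have eta0 : 0 < eta.
 have -> : eta = (2*kap-kap')/2 by rewrite /eta /de; field; rewrite gt_eqF.
 by lra.
pose C1 := C * ((- ln g)^-1/de*C `^ de+2).
have C10 : 0 <= C1 by rewrite mulr_ge0 ?(ltW C0)// addr_ge0// !mulr_ge0 ?invr_ge0 ?powR_ge0 ?(ltW lg) ?(ltW de0).
have cz : C1*B n `^ (- eta) @[n --> \oo] --> (0 : R).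
 by rewrite -[X in _ --> X](mulr0 C1); apply: cvgM; [exact: cvg_cst|exact: cvg_powR_neg].
apply: (squeeze_cvgr _ (cvg_cst 0) cz); near=> n.
have n1 : (1 <= n)%N by near: n; exists 1%N.
have n0 : 0 < n%:R :> R by rewrite ltr0n.
have bn : 1 <= B n by near: n; exact: (hBoo (nbhs_pinfty_ge (num_real _))).
have bp : 0 < B n by lra.
have hn : n%:R <= C*B n `^ kap' by exact: (near hC n).
apply/andP; split; first by rewrite !mulr_ge0 ?powR_ge0.
have l0 : 0 <= ln (n%:R : R) / - ln g by rewrite divr_ge0 ?(ltW lg)// ln_ge0// ler1n.
have /andP[h _] := truncn_itv l0.
have b1 : 1 <= B n `^ (kap'*de) by rewrite -(powRr0 (B n)) ler_powR.
have hN : (N n).+1%:R <= ((- ln g)^-1/de*C `^ de+2)*B n `^ (kap'*de).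
 have e1 : (N n).+1%:R = (Num.truncn (ln (n%:R : R) / - ln g))%:R+2 :> R.
 by rewrite /N -addn2 natrD.
 rewrite e1 mulrDl; apply: lerD; last side.
 apply: (le_trans h); rewrite mulrC -!mulrA ler_wpM2l//.
 rewrite ler_pdivlMl// -ln_powR.
 apply: (@le_trans _ _ (n%:R `^ de)).
 have := @le_ln1Dx _ (n%:R `^ de-1); rewrite subrKC.
 have := powR_gt0 de n0; set q := _ `^ _ => q0 /(_ _)/le_trans; apply; lra.
 rewrite powRrM -powRM//.
 apply: ge0_ler_powR; side.
have -> : C1*B n `^ (- eta) = C*B n `^ kap' *
 (((- ln g)^-1/de*C `^ de+2)*B n `^ (kap'*de))*B n `^ (- (2*kap)).
 have -> : - eta = kap' + (kap'*de + - (2*kap)) by rewrite /eta; ring.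
 by rewrite !powRD ?(gt_eqF bp) ?implybT /C1; ring.
by rewrite ler_wpM2r// ler_pM.
Unshelve. all: by end_near. Qed.
Lemma moment_of_tail (Y : X -> R) (C t1 kap : R) : mfun X Y ->
 (forall x, 0 <= Y x) -> 0 < kap < 1 -> kap < al -> 0 <= C ->
 (forall t, t1 <= t -> m [set x | t < Y x] <= C * m [set x | t < `|f x|]) ->
 exists M : R, 0 <= M /\ forall t, 0 <= t ->
 ex mu (fun x => Num.min 2 (t*Y x)) <= M*t `^ kap.
move=> mY Y0 hk ka C0 hY; have /andP[k0 k1] := hk.
have hk' : 0 < kap < al by rewrite k0.
have [Cv [Cv0 hv]] := tail_power hk'.
pose D := C*Cv + `|t1| `^ kap.
have D0 : 0 <= D by rewrite addr_ge0.
have r1 : (2^-1 : R) `^ (1-kap) < 1.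
 have := @gt0_ltr_powR _ (1-kap) _ (2^-1 : R) 1; rewrite !nnegrE powR1 ler01; apply; lra.
exists (2*D / (1-2^-1 `^ (1-kap))); split.
 by rewrite !mulr_ge0// invr_ge0; lra.
suff ht : forall y, 0 < y -> m [set x | y < Y x] <= D*y `^ (- kap) by exact: moment_from_tail mY Y0 hk D0 ht.
move=> y y0.
have [ty|ty] := leP t1 y.
 apply: (le_trans (hY _ ty)); apply: (@le_trans _ _ (C * (Cv*y `^ (- kap)))).
 by rewrite ler_wpM2l// (le_trans (tail_abs y))// hv.
 by rewrite mulrA ler_wpM2r// lerDl.
apply: (@le_trans _ _ 1); first by rewrite pr_le1; side.
apply: (@le_trans _ _ (`|t1| `^ kap*y `^ (- kap))).
 rewrite powRN ler_pdivlMr// mul1r ge0_ler_powR//.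
 by rewrite (le_trans (ltW ty))// ler_norm.
by rewrite ler_wpM2r// lerDr.
Qed.

(** The absolute value keeps the variable nonnegative also at [n = 0], where the sign of [B n] is
    not prescribed. *)
Definition posn (g : X -> R) (n : nat) (x : X) : R := Num.max (g x) 0 * `|(B n)^-1|.

Lemma posn_meas g n : mfun X g -> mfun X (posn g n).
by move=> mg; apply: measurable_funM => //; exact: measurable_maxr. Qed.
Lemma posn_ge0 g n x : 0 <= posn g n x.
by rewrite /posn mulr_ge0// le_max lexx orbT. Qed.
Lemma posn_gt g n t : (1 <= n)%N -> 0 < t -> [set x | t < posn g n x] = [set x | t*B n < g x].
move=> n1 t0; have b0 := hB0 n1; apply/seteqP; split=> x /=; rewrite /posn gtr0_norm//.
 by rewrite ltr_pdivlMr// lt_max => /orP[|h]; have := mulr_gt0 t0 b0; lra.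
by move=> h; rewrite ltr_pdivlMr// lt_max h.
Qed.
Lemma pos_tail t : 0 < t -> n%:R * m [set x | t < posn f n x] @[n --> \oo] --> cp*t `^ (- al).
move=> t0; have c := @cvg_right_tail t t0.
by apply: cvg_trans c; apply: near_eq_cvg; exists 1%N => // n n1; rewrite posn_gt.
Qed.
(** The left tail is known for [f <= - t] but needed for [- f > t]. A slightly larger [t'] and
    continuity of [t^(-al)] bridge the difference. *)
Lemma neg_tail t : 0 < t -> n%:R * m [set x | t < posn (fun x => - f x) n x] @[n --> \oo] --> cm*t `^ (- al).
move=> t0; have c t' t'0 := @cvg_left_tail t' t'0.
apply/cvgrPdist_lt => e e0.
have cc : cm*t' `^ (- al) @[t' --> t] --> cm*t `^ (- al) by apply: cvgM; [side|exact: powR_cts].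
have [t' tt' ht'] : exists2 t', t < t' & cm*t `^ (- al)-e/2 < cm*t' `^ (- al).
 have h : \forall t' \near t, cm*t `^ (- al)-e/2 < cm*t' `^ (- al) by apply: (cvgr_gt _ cc); lra.
 have [r /= r0 hr] := h; exists (t+r/2); first lra.
 by apply: hr; rewrite /ball /= opprD addNKr normrN gtr0_norm; lra.
have c1 := c t t0; have c2 := c t' (lt_trans t0 tt').
near=> n.
have n1 : (1 <= n)%N by near: n.
have b0 := hB0 n1; have mNf : mfun X (fun x => - f x) by [].
rewrite posn_gt.
have u1 : n%:R * m [set y | f y <= - (t*B n)] < cm*t `^ (- al)+e by near: n; apply: (cvgr_lt _ c1); lra.
have u2 : cm*t' `^ (- al)-e/2 < n%:R * m [set y | f y <= - (t'*B n)] by near: n; apply: (cvgr_gt _ c2); lra.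
have i1 : m [set x | t*B n < - f x] <= m [set y | f y <= - (t*B n)].
 apply: pr_le; [side|exact: mset_le|].
 by move=> x /= h; rewrite lerNr ltW.
have i2 : m [set y | f y <= - (t'*B n)] <= m [set x | t*B n < - f x].
 apply: pr_le; [exact: mset_le|side|].
 move=> x /=; rewrite lerNr; apply: lt_le_trans; by rewrite ltr_pM2r.
have j1 := ler_wpM2l (ler0n R n) i1; have j2 := ler_wpM2l (ler0n R n) i2.
by rewrite ltr_norml; lra.
Unshelve. all: by end_near. Qed.
Lemma pos_bound kap kap' : 0 < kap < al -> al < kap' -> exists C : R, 0 < C /\
 \forall n \near \oo, forall t : R, 0 < t ->
 n%:R * m [set x | t < posn f n x] <= C*Num.max (t `^ (- kap)) (t `^ (- kap')).
move=> h1 h2; have [C [C0 [N _ hC]]] := @tail_uniform kap kap' h1 h2.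
exists C; split=> //; exists N.+1 => // n Nn t t0; rewrite posn_gt//; last by apply: leq_trans Nn.
apply: le_trans (hC n (ltnW Nn) t t0); rewrite ler_wpM2l//; rewrite /tailV lerDl; exact: pr_ge0.
Qed.
Lemma neg_bound kap kap' : 0 < kap < al -> al < kap' -> exists C : R, 0 < C /\
 \forall n \near \oo, forall t : R, 0 < t ->
 n%:R * m [set x | t < posn (fun x => - f x) n x] <= C*Num.max (t `^ (- kap)) (t `^ (- kap')).
move=> h1 h2; have [C [C0 [N _ hC]]] := @tail_uniform kap kap' h1 h2.
exists C; split=> //; exists N.+1 => // n Nn t t0; rewrite posn_gt//; last by apply: leq_trans Nn.
apply: le_trans (hC n (ltnW Nn) t t0); rewrite ler_wpM2l//; rewrite /tailV.
apply: (@le_trans _ _ (m [set x | f x <= - (t*B n)])); last by rewrite lerDr pr_ge0.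
apply: pr_le; [side|exact: mset_le|].
by move=> x /= h; side.
Qed.
Lemma cos_al_neq0 : al != 1 -> cos (al * (pi/2)) != 0.
move=> al1; have [a0 a2] := andP hal; have p0 := pi_gt0 R.
have [h|h|h] := ltgtP al 1; last by move: al1; rewrite h eqxx.
 by rewrite gt_eqF//; apply: cos_gt0_pihalf; apply/andP; split; nra.
have -> : al * (pi/2) = (al-2) * (pi/2)+pi by field.
by rewrite cosDpi oppr_eq0 gt_eqF//; apply: cos_gt0_pihalf; apply/andP; split; nra.
Qed.
(** [D n w th] treats both parts at once: [th = 0] gives minus the real part and [th = - pi / 2]
    minus the imaginary part of the exponent. Since one of the positive and negative parts of [f]
    vanishes at each point, [D] splits into two one-sided terms; for [1 < al] the compensating
    linear terms add up to the mean of [f], which is [A n / n]. *)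
Lemma limit_data_ne1 : al != 1 -> (al < 1 -> forall n, A n = 0) ->
 (1 < al -> forall n, A n = n%:R * \int[mu]_x f x) ->
 limit_data mu f A B (psiR al cp cm) (psiI al cp cm).
move=> al1 A1 A2; have [a0 a2] := andP hal.
pose Yp := posn f; pose Ym := posn (fun x => - f x).
have mYp n : mfun X (Yp n) by exact: posn_meas.
have mYm n : mfun X (Ym n) by apply: posn_meas; exact: measurable_funN.
have [p1 p2 p3] := @one_side _ _ _ mu Yp al cp mYp (posn_ge0 f) hal al1 pos_tail pos_bound.
have [q1 q2 q3] := @one_side _ _ _ mu Ym al cm mYm (posn_ge0 _) hal al1 neg_tail neg_bound.
move: p1 p2 p3 q1 q2 q3; set g := Gamma_fun (1 - al); set de : R := ((1 < al)%R)%:R => p1 p2 p3 q1 q2 q3.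
have YE n x : (1 <= n)%N -> f x/B n = Yp n x-Ym n x /\ (Yp n x = 0 \/ Ym n x = 0).
 move=> n1; have b0 := hB0 n1; rewrite /Yp /Ym /posn gtr0_norm ?invr_gt0// -mulrBl.
 by case: (leP (f x) 0) => h; [rewrite max_l ?oppr_ge0// sub0r opprK mul0r; split=> //; left
 |rewrite max_r ?oppr_le0 ?(ltW h)// subr0 mul0r; split=> //; right].
have bc (Y : X -> R) w th : mfun X Y -> bmf (fun x => cos th-cos (w*Y x+th)).
 by move=> mY; apply: bmfB; [exact: bmf_cst|apply: bmf_cos; apply: measurable_funD => //; exact: measurable_funM].
have eT (Y : X -> R) w th : mfun X Y -> mu.-integrable setT (EFin \o (fun x => de*Y x)) ->
 E (one_test de w th \o Y) = E (fun x => cos th-cos (w*Y x+th))-w*sin th*E (fun x => de*Y x).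
 move=> mY iY; rewrite /ex -RintegralZl// -RintegralB//; [|exact: bmf_int (bc Y w th mY)|exact: (integrableZl measurableT _ iY)].
 by apply: eq_Rintegral => x _; rewrite /one_test /=; ring.
pose D n w th := n%:R*E (fun x => cos th-cos (w/B n*f x+th))-w*sin th * (A n/B n).
have DE : \forall n \near \oo, forall w th, D n w th = n%:R*E (one_test de w th \o Yp n)+n%:R*E (one_test de w (- th) \o Ym n).
 near=> n => w th; have n1 : (1 <= n)%N by near: n; exists 1%N.
 have b0 := hB0 n1.
 have i1 : mu.-integrable setT (EFin \o (fun x => de*Yp n x)) by exact: (near p3 n).
 have i2 : mu.-integrable setT (EFin \o (fun x => de*Ym n x)) by exact: (near q3 n).
 rewrite /D !eT ?sinN//.
 have -> : A n/B n = n%:R * (E (fun x => de*Yp n x)-E (fun x => de*Ym n x)).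
 have [h|h|h] := ltgtP al 1; last by move: al1; rewrite h eqxx.
 have z Y : E (fun x => de*Y x) = 0 by rewrite -[RHS](ex_cst mu); apply: ex_eq => x; rewrite /de ltNge ltW//= mul0r.
 by rewrite A1// !z subrr mulr0 mul0r.
 rewrite A2// -mulrA; congr (_ * _); have i3 := integrableB measurableT i1 i2.
 apply: (mulIf (lt0r_neq0 b0)); rewrite divfK ?gt_eqF// mulrC /ex -RintegralB// -RintegralZl//.
 by apply: eq_Rintegral => x _; rewrite /de h !mul1r; have [<- _] := YE n x n1; rewrite mulrC divfK ?gt_eqF.
 have -> : E (fun x => cos th-cos (w/B n*f x+th)) =
 E (fun x => cos th-cos (w*Yp n x+th))+E (fun x => cos (- th)-cos (w*Ym n x + - th)).
 rewrite -exD; [|exact: bc|exact: bc]; apply: ex_eq => x; have [e h] := YE n x n1.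
 have -> : w/B n*f x = w * (Yp n x-Ym n x) by rewrite -e; ring.
 rewrite (_ : cos (w*Ym n x + - th) = cos (w * - Ym n x+th)); last by rewrite -cosN; congr cos; ring.
 by case: h => ->; [rewrite sub0r mulr0 add0r cosN|rewrite oppr0 addr0 mulr0 add0r cosN]; ring.
 ring.
have lim w th : 0 < w -> D n w th @[n --> \oo] -->
 w `^ al*g * (cp*cos (th - al * (pi/2))+cm*cos (- th - al * (pi/2))).
 move=> w0; rewrite (_ : _ * _ = cp * (w `^ al*g*cos (th - al * (pi/2)))+cm * (w `^ al*g*cos (- th - al * (pi/2)))); last by ring.
 by apply: cvg_trans (cvgD (p1 w th w0) (q1 w (- th) w0)); apply: near_eq_cvg; near=> n; rewrite (near DE n).
have DN n w th : D n w th = D n (- w) (- th).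
 rewrite /D sinN; congr (_ * _ - _); last by ring.
 by apply: ex_eq => x; rewrite cosN -[cos (_+th)]cosN; congr (_-cos _); ring.
have D0 n th : D n 0 th = 0.
 have z x : cos th-cos (0/B n*f x+th) = 0 by rewrite !mul0r add0r subrr.
 by rewrite /D (ex_eq mu z) ex_cst; ring.
have rR n u : rhoR mu f B n u = - D n u 0.
 rewrite /rhoR /D sin0 mulr0 mul0r subr0 -mulrN cos0 exB ?ex_cst ?opprB; [|exact: bmf_cst|by apply: bmf_cos; apply: measurable_funD => //; exact: measurable_funM].
 by congr (_ * (_ - _)); apply: ex_eq => x; rewrite addr0.
have rI n u : rhoI mu f A B n u = - D n u (- (pi/2)).
 have e : E (fun x => cos (- (pi/2))-cos (u/B n*f x + - (pi/2))) = - E (fun x => sin (u/B n*f x)).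
 rewrite -[RHS]mulN1r -exZ; last by apply: bmf_sin; exact: measurable_funM.
 by apply: ex_eq => x; rewrite cosBpihalf cosN cos_pihalf; ring.
 by rewrite /rhoI /D e sinN sin_pihalf; ring.
have ap : al * pi/2 = al * (pi/2) by rewrite mulrA.
split=> [u|u|U U0].
- under eq_fun do rewrite rR; rewrite -[psiR _ _ _ _]opprK; apply: cvgN.
 have E w : w `^ al*g * (cp*cos (0 - al * (pi/2))+cm*cos (- 0 - al * (pi/2))) =
 c_stable al * (cp+cm)*w `^ al by rewrite /c_stable (negPf al1) ap oppr0 sub0r cosN -/g; ring.
 have [u0|u0|->] := ltgtP u 0; rewrite /psiR opprK.
 + by rewrite ltr0_norm// -E (funext (fun n => DN n u 0)) oppr0; have := lim (- u) 0; rewrite oppr0 oppr_gt0; apply.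
 + by rewrite gtr0_norm// -E; exact: lim.
 + by rewrite normr0 powR0 ?gt_eqF// mulr0; under eq_fun do rewrite D0; exact: cvg_cst.
- under eq_fun do rewrite rI; rewrite -[psiI _ _ _ _]opprK; apply: cvgN; rewrite /psiI /omega_stable (negPf al1) ap.
 have c1 : cos (- (pi/2) - al * (pi/2)) = - sin (al * (pi/2)) by rewrite addrC cosBpihalf sinN.
 have c2 : cos (pi/2 - al * (pi/2)) = sin (al * (pi/2)) by rewrite addrC cosDpihalf sinN opprK.
 have E s w : w `^ al*g * (s * (cp-cm)*sin (al * (pi/2))) =
 c_stable al * (cp+cm)*w `^ al * ((cp-cm) / (cp+cm)*s*tan (al * (pi/2))).
 by rewrite /c_stable (negPf al1) ap -/g /tan; field; rewrite cos_al_neq0// gt_eqF.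
 have [u0|u0|->] := ltgtP u 0.
 + rewrite ltr0_norm// ltr0_sg// -E (funext (fun n => DN n u (- (pi/2)))) opprK.
 have := lim (- u) (pi/2); rewrite c1 c2 oppr_gt0 => /(_ u0).
 by rewrite -mulrN (_ : - (-1 * _ * _) = cp*sin (al * (pi/2))+cm * - sin (al * (pi/2)))//; ring.
 + rewrite gtr0_norm// gtr0_sg// -E; have := lim u (- (pi/2)) u0; rewrite opprK c1 c2.
 by rewrite -[- (_*g * _)]mulrN (_ : - (1 * _ * _) = cp * - sin (al * (pi/2))+cm*sin (al * (pi/2)))//; ring.
 + by rewrite normr0 powR0 ?gt_eqF// mulr0 mul0r oppr0; under eq_fun do rewrite D0; exact: cvg_cst.
- have [K1 h1] := p2 U U0; have [K2 h2] := q2 U U0; exists (K1+K2); near=> n => u uU.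
 have key v th : 0 <= v <= U -> `|D n v th| <= K1+K2.
 by move=> hv; rewrite (near DE n)// (le_trans (ler_normD _ _))// lerD//; [exact: (near h1 n)|exact: (near h2 n)].
 rewrite rR rI !normrN; have [u0|u0] := leP 0 u; first by rewrite !key// u0 (le_trans _ uU)// ler_norm.
 by rewrite !(DN n u) !key// oppr_ge0 (ltW u0) (le_trans _ uU)// ltr0_norm.
Unshelve. all: by end_near. Qed.

Lemma cvg_nB kap : al < 2*kap -> n%:R*B n `^ (- (2*kap)) @[n --> \oo] --> (0 : R).
move=> h; have h1 : al < (al+2*kap)/2 by lra.
have [C [C0 hC]] := @growth_power _ h1.
have h2 : 0 < (2*kap - al)/2 by lra.
have cz : C*B n `^ (- ((2*kap - al)/2)) @[n --> \oo] --> (0 : R) by rewrite -[X in _ --> X](mulr0 C); apply: cvgM; [side|exact: cvg_powR_neg].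
apply: (squeeze_cvgr _ (cvg_cst 0) cz); near=> n.
have n1 : (1 <= n)%N by near: n.
have b0 := hB0 n1; apply/andP; split; first side.
have hn : n%:R <= C*B n `^ ((al+2*kap)/2) by exact: (near hC n).
have -> : - ((2*kap - al)/2) = (al+2*kap)/2 + - (2*kap) by field.
by rewrite powRD ?(gt_eqF b0) ?implybT// mulrA ler_wpM2r.
Unshelve. all: by end_near. Qed.
Definition phin (n : nat) (u : R) : R[i] := echar mu (fun x => u/B n*f x).

Lemma phin_rho n u : (1 <= n)%N -> (n%:R%:C * (phin n u-1) =
 (rhoR mu f B n u +i* (rhoI mu f A B n u+u * (A n/B n))))%C.
move=> n1; rewrite /phin /echar /rhoR /rhoI subrK.
by apply/eqP; rewrite eq_complex /=; apply/andP; split; apply/eqP; ring.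
Qed.
Lemma phin_small kap M : (forall t, 0 <= t -> E (fun x => Num.min 2 (t * `|f x|)) <= M*t `^ kap) ->
 forall n u, (1 <= n)%N -> cn (phin n u-1) <= 2*M * `|u| `^ kap*B n `^ (- kap).
move=> hM n u n1; have b0 := hB0 n1.
have muf : mfun X (fun x => u/B n*f x) by [].
have t0 : 0 <= `|u| / B n by rewrite divr_ge0// ltW.
have -> : 2*M * `|u| `^ kap*B n `^ (- kap) = M * (`|u| / B n) `^ kap+M * (`|u| / B n) `^ kap.
 by rewrite powRM ?invr_ge0 ?(ltW b0)// powR_inv ?(ltW b0)//; ring.
have bm : bmf (fun x => Num.min 2 (`|u| / B n * `|f x|)) by apply: bmf_min.
have ab x : `|u/B n*f x-0| <= `|u| / B n * `|f x|.
 by rewrite subr0 normrM normf_div (gtr0_norm b0).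
apply: (le_trans (cn_le _)) => /=; apply: lerD; apply: le_trans (hM _ t0).
- rewrite -[X in _-X](ex_cst mu) -exB//; apply: ex_abs_le => // x; have := cos_diff_min (u/B n*f x) 0; rewrite cos0 => /le_trans; apply; exact: min2_le.
- rewrite subr0; apply: ex_abs_le => // x; have := sin_diff_min (u/B n*f x) 0; rewrite sin0 subr0 => /le_trans; apply; exact: min2_le.
Qed.
(** [phi] and [exp (phi - 1)] both lie in the unit disc and differ by a Taylor remainder of second
    order, so their [k]-th powers differ by at most [k] times it. *)
Lemma phin_power n u k : cn (phin n u ^+ k-cexp ((phin n u-1) *+ k)) <= k%:R * (4*cn (phin n u-1) ^+ 2).
have p1 : cn (phin n u) <= 1 by exact: echar_le1.
have re0 : complex.Re (phin n u-1) <= 0.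
 have -> : complex.Re (phin n u-1) = complex.Re (phin n u)-1 by [].
 by rewrite subr_le0 (le_trans _ p1)// (le_trans (ler_norm _))// cn_Re.
have e1 : cn (cexp (phin n u-1)) <= 1 by rewrite cn_cexp -expR0 ler_expR.
rewrite cexp_natmul; apply: (le_trans (cn_subXX _ p1 e1)); rewrite ler_wpM2l// cnBC.
have := cexp_taylor re0.
have -> : cexp (phin n u-1)-1 - (phin n u-1) = cexp (phin n u-1)-phin n u by ring.
by [].
Qed.

Local Notation phi := phin.

(** With [al / 2 < kap < min(1, al)], [|phi_n - 1|] is of order [B n ^ (- kap)], and
    [n * B n ^ (- (2 * kap))] tends to 0. *)
Lemma phin_err : exists er : R -> nat -> R, (forall U, er U n @[n --> \oo] --> (0 : R)) /\
 forall n u U, (1 <= n)%N -> `|u| <= U -> n%:R * (4*cn (phi n u-1) ^+ 2) <= er U n.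
have [a0 a2] := andP hal.
pose kap := (al/2+Num.min 1 al)/2.
have hm : al/2 < Num.min 1 al by rewrite lt_min; apply/andP; split; lra.
have k1 : kap < Num.min 1 al by rewrite /kap; move: (Num.min _ _) hm => q; lra.
have k2 : al/2 < kap by rewrite /kap; move: (Num.min _ _) hm => q; lra.
have /andP[k3 k4] : (kap < 1) && (kap < al) by rewrite -lt_min.
have k0 : 0 < kap < 1 by rewrite k3 andbT; lra.
have mY : mfun X (fun x => `|f x|) by exact: measurableT_comp.
have tl (t : R) : 0 <= t -> pr mu [set x | t < `|f x|] <= 1 * pr mu [set x | t < `|f x|] by rewrite mul1r.
have [M [M0 hM]] := @moment_of_tail _ 1 0 _ mY (fun x => normr_ge0 (f x)) k0 k4 ler01 tl.
exists (fun U n => 4 * (2*M * `|U| `^ kap) ^+ 2 * (n%:R*B n `^ (- (2*kap)))); split.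
 move=> U; rewrite -[X in _ --> X](mulr0 (4 * (2*M * `|U| `^ kap) ^+ 2)).
 apply: cvgM; first exact: cvg_cst.
 by apply: cvg_nB => //; lra.
move=> n u U n1 uU; have b0 := hB0 n1.
have h := phin_small hM u n1.
have U0 : 0 <= U by exact: le_trans uU.
have h2 : cn (phi n u-1) <= 2*M * `|U| `^ kap*B n `^ (- kap).
 apply: (le_trans h); rewrite ler_wpM2r ?powR_ge0// ler_wpM2l ?mulr_ge0//.
 by apply: ge0_ler_powR; rewrite ?nnegrE// ?(ltW (andP k0).1)// (le_trans uU)// ler_norm.
have -> : B n `^ (- (2*kap)) = B n `^ (- kap) ^+ 2 by rewrite expr2 -powRD ?(gt_eqF b0) ?implybT//; congr (_ `^ _); ring.
have h3 : cn (phi n u-1) ^+ 2 <= (2*M * `|U| `^ kap*B n `^ (- kap)) ^+ 2 by rewrite ler_sqr ?nnegrE ?cn_ge0.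
apply: (@le_trans _ _ (n%:R * (4 * (2*M * `|U| `^ kap*B n `^ (- kap)) ^+ 2))).
 by rewrite ler_wpM2l// ler_wpM2l.
by rewrite le_eqVlt; apply/orP; left; apply/eqP; ring.
Qed.
Lemma cexp_rho n u : (1 <= n)%N ->
 cexp (rhoR mu f B n u +i* rhoI mu f A B n u)%C = cis (- u * (A n/B n))*cexp ((phi n u-1) *+ n).
move=> n1; rewrite -mulr_natl.
have -> : (n%:R * (phi n u-1) : R[i]) = (n%:R%:C * (phi n u-1))%C by ring.
rewrite phin_rho// !cexpE /= mulrCA; congr (_ * _).
by rewrite -cisD; congr cis; ring.
Qed.

(** * Exponents recovered from the convergence of iid sums *)

Section Iid.
Context {d'} {W : measurableType d'}.
Variables (P : probability W R) (Y : nat -> W -> R).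
Hypotheses (mY : forall k, mfun W (Y k)) (indY : forall n, independent P n Y)
 (lawY : forall k, same_law P (Y k) mu f).
Let Z n w := (B n)^-1 * (\sum_(k < n) Y k w - A n).

Lemma iid_mZ n : mfun W (Z n).
apply: measurable_funM => //; side.
Qed.
Lemma iid_echar n u : (1 <= n)%N -> echar P (fun w => u*Z n w) = cis (- u * (A n/B n)) * phi n u ^+ n.
move=> n1; have b0 := hB0 n1; set s := - u * (A n/B n).
have eZ w : u*Z n w = \sum_(i < n) u/B n*Y i w+s by rewrite -mulr_sumr /Z /s; field; side.
have mU : mfun R (fun y : R => u/B n*y) by [].
have eP : \prod_(i < n) echar P (fun w => u/B n*Y i w) = phi n u ^+ n.
 rewrite (eq_bigr (fun=> phi n u)) ?prodr_const ?card_ord// => i _.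
 rewrite /phin /echar; congr (_ +i* _)%C.
 have bc : bmf (fun y : R => cos (u/B n*y)) by [].
 exact: (ex_same_law (mY i) mf (lawY i) bc).
have bs : bmf (fun y : R => sin (u/B n*y)) by [].
 exact: (ex_same_law (mY i) mf (lawY i) bs).
have h1 := indep_cos mY (fun=> u/B n) (indY n) s.
have h2 := indep_cos mY (fun=> u/B n) (indY n) (s-pi/2).
rewrite Re_cis_shift in h2; rewrite eP in h1 h2.
apply/eqP; rewrite eq_complex -h1 -h2; apply/andP; split; apply/eqP; apply: ex_eq => w.
 by rewrite eZ.
by rewrite eZ addrA -cosBpihalf.
Qed.

Variable S : probability (measurableTypeR R) R.
Hypotheses (hS : canonical_limit al cp cm S) (hZ : cvg_in_law P (Z : nat -> W -> R) S (fun x => x : R)).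
Local Notation pR := (psiR al cp cm).
Local Notation pI := (psiI al cp cm).
Local Notation rR := (rhoR mu f B).
Local Notation rI := (rhoI mu f A B).

(** The characteristic function of the normalised iid sum is close to [exp rho] by [phin_power] and
    converges to [exp psi] uniformly on [[-U, U]]. Dividing by [exp psi] costs at most [expR K]. *)
Lemma rho_psi_near U del : 0 < U -> 0 < del -> \forall n \near \oo, forall u, `|u| <= U ->
 cn (cexp ((rR n u-pR u) +i* (rI n u-pI u))%C-1) <= del.
move=> U0 d0; have [a0 a2] := andP hal.
have [K hK] := bounded_continuous U (@psiR_continuous _ _ cp cm a0).
have [er [er0 her]] := phin_err.
have e0 : 0 < del/2/expR K by rewrite !divr_gt0 ?expR_gt0.
have h1 : \forall n \near \oo, er U n < del/2/expR K by apply: (cvgr_lt _ (er0 U)).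
have h2 := cvg_echar_unif iid_mZ hZ U0 e0.
near=> n => u uU; have n1 : (1 <= n)%N by near: n; exists 1%N.
have g1 : er U n < del/2/expR K by near: n.
have g2 : forall u, `|u| <= U -> cn (echar P (fun w => u*Z n w)-charfun S u) <= del/2/expR K by near: n.
set a := cexp (rR n u +i* rI n u)%C; set b := cexp (pR u +i* pI u)%C.
have eb : charfun S u = b by exact: canonical_charfun.
have ab : cn (a-b) <= del/expR K.
 have -> : a-b = (a-echar P (fun w => u*Z n w)) + (echar P (fun w => u*Z n w)-b) by ring.
 rewrite (le_trans (cnD _ _))// [leRHS](_ : _ = del/2/expR K+del/2/expR K); last first.
 by rewrite -mulrDl -splitr.
 apply: lerD; last by rewrite -eb; exact: g2.
 rewrite iid_echar// /a cexp_rho// -mulrBr cnM cn_cis mul1r cnBC.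
 apply: (le_trans (phin_power _ _ _)); apply: (le_trans (her _ _ _ n1 uU)); side.
set ib := cexp (- (pR u +i* pI u)%C).
have bib : b*ib = 1 by rewrite /b /ib -cexpD subrr cexp0.
have -> : cexp ((rR n u-pR u) +i* (rI n u-pI u))%C = a*ib by rewrite /a /ib -cexpD.
rewrite -bib -mulrBl cnM -[leRHS](divfK (lt0r_neq0 (expR_gt0 K))); apply: ler_pM => //; rewrite ?cn_ge0//.
rewrite /ib cn_cexp ler_expR; exact: le_trans (ler_norm _) (eq_ind_r (fun r => r <= K) (hK u uU) (normrN _)).
Unshelve. all: by end_near. Qed.
Lemma rhoI_continuous n : (1 <= n)%N -> continuous (rI n).
move=> n1 u; rewrite /continuous_at /rhoI; apply: cvgB; last by apply: cvgM; side.
apply: cvgM; first side.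
have mZ : mfun X (fun x => f x/B n) by [].
apply/cvgrPdist_le => e e0; have [de [de0 hde]] := echar_continuous mu mZ e0.
exists de => //= v; rewrite /ball => uv.
apply: le_trans (hde u v (ltW uv)); apply: le_trans (cn_Im _) => /=.
rewrite le_eqVlt; apply/orP; left; apply/eqP; congr `|_ - _|; apply: ex_eq => x.
 by rewrite -mulrA [_^-1 * _]mulrC.
by rewrite -mulrA [_^-1 * _]mulrC.
Qed.
Definition rho_close U del n := forall v, `|v| <= U -> [/\ `|rI n v-pI v| < pi/2, `|rR n v-pR v| <= 1,
 `|expR (rR n v-pR v)-1| <= del & `|sin (rI n v-pI v)| <= 2*del].

(** [exp (rho - psi)] tends to 1 locally uniformly. The logarithm of its modulus gives the real
    part; the imaginary part is recovered by [asin], because [lift_small] confines it to the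
    principal interval. *)
Lemma limit_data_iid : limit_data mu f A B pR pI.
have [a0 a2] := andP hal.
have cI := @psiI_continuous _ _ cp cm a0; have cR := @psiR_continuous _ _ cp cm a0.
have pI0 : pI 0 = 0 by rewrite /psiI sgr0 !(mulr0, mul0r).
have fin U del : 0 < U -> 0 < del -> del <= 2^-1 -> \forall n \near \oo, rho_close U del n.
 move=> U0 d0 d1; near=> n => u uU.
 have n1 : (1 <= n)%N by near: n; exists 1%N.
 have h : forall u, `|u| <= U -> cn (cexp ((rR n u-pR u) +i* (rI n u-pI u))%C-1) <= del.
 by near: n; exact: rho_psi_near.
 have h3 v : `|v| <= U -> _ := fun vU => cexp_near1 (h v vU) d1.
 have [_ p2 p3 p4] := h3 u uU; split=> //.
 apply: (@lift_small _ (fun v => rI n v-pI v) U) => //.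
 - by move=> v; apply: cvgB; [exact: rhoI_continuous|exact: cI].
 - rewrite pI0 /rhoI !mul0r !subr0 (_ : E _ = 0) ?mulr0//.
 by rewrite -[RHS](ex_cst mu); apply: ex_eq => x; rewrite !mul0r sin0.
 - by move=> v /h3[].
have p0 := pi_gt0 R; split=> [u|u|U U0].
- have U0 : 0 < `|u| + 1 by [].
 have c1 : expR (rR n u-pR u) @[n --> \oo] --> (1 : R).
 apply/cvgrPdist_le => e e0; have m0 : 0 < Num.min e 2^-1 by rewrite lt_min e0/=.
 near=> n; have h : rho_close (`|u| + 1) (Num.min e 2^-1) n by near: n; apply: fin => //; rewrite ge_min lexx orbT.
 by have [|_ _ q _] := h u; rewrite ?lerDl// distrC (le_trans q)// ge_min lexx.
 have c2 : ln (expR (rR n u-pR u))+pR u @[n --> \oo] --> ln 1+pR u.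
 by apply: cvgD; [apply: (@cvg_comp _ _ _ _ (@ln R) _ _ _ c1); exact: continuous_ln|exact: cvg_cst].
 rewrite ln1 add0r in c2; have e n : rR n u = ln (expR (rR n u-pR u))+pR u by rewrite expRK subrK.
 by rewrite (funext e).
- have U0 : 0 < `|u| + 1 by [].
 have c1 : sin (rI n u-pI u) @[n --> \oo] --> (0 : R).
 apply/cvgrPdist_le => e e0; have m0 : 0 < Num.min (e/2) 2^-1 by rewrite lt_min; apply/andP.
 near=> n; have h : rho_close (`|u| + 1) (Num.min (e/2) 2^-1) n by near: n; apply: fin => //; rewrite ge_min lexx orbT.
 by have [|_ _ _ q] := h u; rewrite ?lerDl// sub0r normrN (le_trans q)// mulrC -ler_pdivlMr// ge_min lexx.
 have c2 : asin (sin (rI n u-pI u))+pI u @[n --> \oo] --> asin 0+pI u.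
 apply: cvgD; last exact: cvg_cst.
 by apply: (@cvg_comp _ _ _ _ (@asin R) _ _ _ c1); apply: continuous_asin; rewrite ltrN10 ltr01.
 have as0 : asin (0 : R) = 0 by rewrite -[X in asin X](@sin0 R) sinK// in_itv /=; lra.
 rewrite as0 add0r in c2; apply: cvg_trans c2; apply: near_eq_cvg; near=> n.
 have h : rho_close (`|u| + 1) 2^-1 n by near: n; exact: fin.
 have [|/ltr_normlP[q1 q2] _ _ _] := h u; first by rewrite lerDl.
 rewrite sinK ?subrK// in_itv /=; lra.
- have [K1 hK1] := bounded_continuous U cR; have [K2 hK2] := bounded_continuous U cI.
 exists (K1+K2+1+pi/2); near=> n => u uU.
 have h : rho_close U 2^-1 n by near: n; exact: fin.
 have [q1 q2 _ _] := h u uU; have k1 := hK1 u uU; have k2 := hK2 u uU.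
 have K10 := le_trans (normr_ge0 _) k1; have K20 := le_trans (normr_ge0 _) k2.
 have t1 := ler_normD (rR n u-pR u) (pR u); have t2 := ler_normD (rI n u-pI u) (pI u).
 by rewrite !subrK in t1 t2; split; lra.
Unshelve. all: by end_near. Qed.

End Iid.
End CanonicalData.

(** * Dominated convergence and absolutely continuous laws *)

Section DominatedExpectation.
Context {d} {X : measurableType d} {R : realType}.
Variable mu : probability X R.
Local Notation E := (ex mu).

Lemma ex_dominated (H : nat -> X -> R) (G g : X -> R) : (forall n, mfun X (H n)) ->
 mfun X G -> mu.-integrable setT (EFin \o g) -> (forall n x, `|H n x| <= g x) ->
 (forall x, H n x @[n --> \oo] --> G x) -> E (H n) @[n --> \oo] --> E G.
move=> mH mG ig Hg HG.
have [||||iq _ h] := @dominated_convergence _ X R mu setT measurableT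
 (fun n => EFin \o H n) (EFin \o G) (EFin \o g) _ _ _ ig.
- by [].
- exact/measurable_EFinP.
- by apply: aeW => t _; apply: cvg_EFin; [exact: nearW|side].
- by apply: aeW => t n _; rewrite lee_fin Hg.
rewrite /ex /Rintegral; apply: fine_cvg; rewrite fineK//.
by have := integrable_fin_num measurableT iq; apply.
Qed.
Lemma ex_dominated_bound (H : nat -> X -> R) (G : X -> R) M : (forall n, mfun X (H n)) ->
 mfun X G -> (forall n x, `|H n x| <= M) ->
 (forall x, H n x @[n --> \oo] --> G x) -> E (H n) @[n --> \oo] --> E G.
move=> mH mG HM; apply: (@ex_dominated _ _ (fun=> M)) => //.
exact: (bmf_int mu (bmf_cst M)).
Qed.

End DominatedExpectation.

Section AbsoluteContinuity.
Context {d} {X : measurableType d} {R : realType}.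
Variables (mu nu : probability X R).
Hypothesis numu : nu `<< mu.

(** [H] is the Radon-Nikodym derivative set to 0 where it exceeds a level [N] in absolute value; the
    part removed has small integral. *)
Lemma bounded_density e : 0 < e -> exists H : X -> R, bmf H /\
 forall G, bmf G -> (forall x, `|G x| <= 1) -> `|ex nu G-ex mu (fun x => H x*G x)| <= e.
move=> e0; pose g := Radon_Nikodym (charge_of_finite_measure nu) mu.
have gfin x : g x \is a fin_num by exact: Radon_Nikodym_fin_num.
have ig : mu.-integrable setT g by exact: Radon_Nikodym_integrable.
pose p x := fine (g x).
have gp : g = EFin \o p by apply/funext => x; rewrite /p /= fineK.
rewrite gp in ig.
have mp : mfun X p by apply/measurable_EFinP; exact: measurable_int ig.
pose S (N : nat) := [set x | N%:R < `|p x|].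
have mS N : measurable (S N) by apply: mset_gt; exact: measurableT_comp.
have mI N : mfun X (\1_(S N) : X -> R) by have [] := @bmf_indic _ X R _ (mS N).
have iabs := integrable_abse ig.
have iabs' : mu.-integrable setT (EFin \o (fun x => `|p x|)) by [].
have c : ex mu (fun x => `|p x| * \1_(S N) x) @[N --> \oo] --> ex mu (fun=> 0 : R).
 apply: (@ex_dominated _ _ _ _ _ _ (fun x => `|p x|)) => //.
 - move=> N x; rewrite normrM normr_id ler_piMr// indicE.
 by case: (x \in _); rewrite ?normr1 ?normr0.
 - move=> x; apply: cvg_near_cst; exists (Num.truncn `|p x|).+1 => // N /= hN.
 rewrite indicE memNset ?mulr0// /S /=; apply/negP; rewrite -leNgt.
 apply: le_trans (_ : (Num.truncn `|p x|).+1%:R <= N%:R); last by rewrite ler_nat.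
 by have /andP[_ /ltW] := truncn_itv (normr_ge0 (p x)).
rewrite ex_cst in c.
have [N _ hN] := cvgr_lt _ c _ e0.
pose H x := p x * (1 - \1_(S N) x).
have bH : bmf H.
 split; first by apply: measurable_funM => //; apply: measurable_funB.
 exists N%:R => x; rewrite /H indicE; have [h|h] := boolP (x \in S N).
 by rewrite subrr mulr0 normr0.
 by rewrite subr0 mulr1; move: h; rewrite notin_setE /S /= => /negP; rewrite -leNgt.
exists H; split=> // G bG G1.
have iGp : mu.-integrable setT (EFin \o (fun x => G x * p x)).
 have : mu.-integrable setT (EFin \o (fun x => p x*G x)).
 have [mG [M hM]] := bG; have hb : [bounded G x | x in [set: X]].
 by exists M; split; [exact: num_real|move=> y My x _; exact: le_trans (hM x) (ltW My)].
 by have := @integrableMl _ X R mu setT measurableT (EFin \o p) G ig mG hb.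
 by apply: eq_integrable => // x _ /=; rewrite mulrC.
have -> : ex nu G = ex mu (fun x => G x * p x).
 rewrite /ex /Rintegral; congr fine.
 have iG : nu.-integrable setT (EFin \o G) by exact: bmf_int.
 rewrite -(Radon_Nikodym_change_of_variables numu measurableT iG).
 by apply: eq_integral => x _; rewrite -/g gp /= EFinM.
have iHG : mu.-integrable setT (EFin \o (fun x => H x*G x)) by apply: bmf_int; exact: bmfM.
rewrite /ex -RintegralB//; apply: le_trans (ltW (hN N (leqnn N))).
have iD : mu.-integrable setT (EFin \o (fun x => G x * p x-H x*G x)).
 by have := integrableB measurableT iGp iHG.
apply: (le_trans (le_normr_Rintegral measurableT iD)).
apply: le_Rintegral => //.
- by have := integrable_abse iD.
- apply: (@le_integrable _ _ _ mu setT measurableT _ (EFin \o (fun x => `|p x|))) => //.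
 move=> x _; rewrite lee_fin normrM !normr_id ler_piMr// indicE.
 by case: (x \in _); rewrite ?normr1 ?normr0.
- move=> x _; have -> : G x * p x-H x*G x = G x * (p x * \1_(S N) x) by rewrite /H; ring.
 rewrite !normrM -[leRHS]mul1r; apply: ler_pM => //; rewrite//.
 by rewrite ler_wpM2l// indicE; case: (x \in _); rewrite ?normr1 ?normr0.
Qed.
Lemma small_sets e : 0 < e -> exists de : R, 0 < de /\
 forall A, measurable A -> pr mu A <= de -> pr nu A <= e.
move=> e0; have e2 : 0 < e/2 by rewrite divr_gt0.
have [H [bH hH]] := bounded_density e2; have [M hM] := bH.2.
have M0 : 0 <= `|M| by [].
have M1 : 0 < `|M| + 1 by rewrite ltr_wpDl.
exists (e/2 / (`|M| + 1)); split; first by rewrite divr_gt0.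
move=> A mA hA; have bA : bmf (\1_A : X -> R) by exact: bmf_indic.
have I1 x : `|\1_A x| <= 1 :> R by rewrite indicE; case: (x \in A); rewrite ?normr1 ?normr0.
have h := hH _ bA I1; rewrite ex_indic// in h.
have h2 : ex mu (fun x => H x * \1_A x) <= e/2.
 apply: (@le_trans _ _ ((`|M| + 1) * pr mu A)); last by rewrite mulrC -ler_pdivlMr.
 rewrite -ex_indic// -exZ//; apply: ex_le; [side|side|].
 move=> x; rewrite ler_wpM2r//.
 by have := hM x; have := ler_norm (H x); have := ler_norm M; lra.
by move: h => /ler_normlP[]; lra.
Qed.

End AbsoluteContinuity.

(** * Limits of asymptotically invariant functions under absolutely continuous laws *)

Section StrongConvergence.
Context {d} {X : measurableType d} {R : realType}.
Variables (mu : probability X R) (T : X -> X) (c : X -> nat) (K g : R).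
Hypothesis hc : mixing_code mu T c K g.
Hypothesis happ : forall A e, measurable A -> 0 < e ->
 exists k S, [/\ measurable S, saturated T c k S & pr mu (A `+` S) < e].
Local Notation E := (ex mu).
Let mT : mfun X T. Proof. by case: hc. Qed.
Let presT A : measurable A -> pr mu (T @^-1` A) = pr mu A. Proof. by case: hc => _ + _ _ _ _; apply. Qed.

Variables (G : nat -> X -> R) (l : R).
Hypotheses (bG : forall n, bmf (G n)) (G1 : forall n x, `|G n x| <= 1) (Gl : E (G n) @[n --> \oo] --> l)
 (Ginv : E (fun x => `|G n x-G n (T x)|) @[n --> \oo] --> (0 : R)).

Let bmfGT n j : bmf (fun x => G n (iter j T x)).
by apply: bmf_comp => //; exact: iter_measurable. Qed.
Lemma shift_invariant j : E (fun x => `|G n x-G n (iter j T x)|) @[n --> \oo] --> (0 : R).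
elim: j => [|j IH].
 by apply: cvg_near_cst; apply: nearW => n; rewrite -[RHS](ex_cst mu); apply: ex_eq => x; rewrite subrr normr0.
have cs : E (fun x => `|G n x-G n (iter j T x)|)+E (fun x => `|G n x-G n (T x)|) @[n --> \oo] --> 0 + (0 : R) by side.
rewrite addr0 in cs; apply: (squeeze_cvgr _ (cvg_cst 0) cs); apply: nearW => n.
have bD i i' : bmf (fun x => `|G n (iter i T x)-G n (iter i' T x)|) by [].
apply/andP; split; first exact: ex_ge0.
have e : E (fun x => `|G n (iter j T x)-G n (T (iter j T x))|) = E (fun x => `|G n x-G n (T x)|).
 exact: (ex_iter mT presT j (bD 0%N 1%N)).
rewrite -e -exD; [|side|exact: bD j j.+1].
apply: ex_le; [side|by apply: bmfD; [side|exact: bD j j.+1]|].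
by move=> x; rewrite iterS; exact: ler_distD.
Qed.
Lemma indic_word k S : saturated T c k S -> word_fun T c k (\1_S : X -> R).
move=> sS x y sxy; rewrite !indicE; congr (_%:R).
 have [h|h] := boolP (x \in S); apply/esym.
 by rewrite mem_set//; apply: (sS _ _ sxy); exact: set_mem.
 rewrite memNset// => Sy; move: h; rewrite notin_setE; apply; apply: (sS _ _ _ Sy) => i ik; by rewrite sxy.
Qed.
(** Asymptotic invariance moves [G n] past the [k] letters of [S] and a mixing gap [N], after which
    it decorrelates from [S]. *)
Lemma saturated_cvg k S : measurable S -> saturated T c k S ->
 E (fun x => \1_S x*G n x) @[n --> \oo] --> pr mu S * l.
move=> mS sS; have wS := indic_word sS.
have bS := @bmf_indic _ X R _ mS.
have [K0 /andP[g0 g1]] : 0 <= K /\ 0 < g < 1 by case: hc.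
have ES : E (\1_S) = pr mu S by rewrite ex_indic.
apply/cvgrPdist_le => e e0.
have gn : g ^+ n @[n --> \oo] --> (0 : R) by apply: cvg_expr; rewrite ger0_norm ?ltW.
have Kg : K*g ^+ n @[n --> \oo] --> K*0 by apply: cvgM => //; exact: cvg_cst.
rewrite mulr0 in Kg.
have e3 : 0 < e/3 by rewrite divr_gt0.
have [N _ hN] := cvgr_le _ Kg _ e3.
have hinv := shift_invariant (k+N).
have h1 := near_dist Gl e3.
near=> n.
have i1 : E (fun x => `|G n x-G n (iter (k+N) T x)|) <= e/3.
 by near: n; apply: cvgr_le hinv _ e3.
have i2 : `|l-E (G n)| <= e/3 by near: n.
have i3 : `|E (fun x => \1_S x*G n (iter (k+N) T x))-pr mu S*E (G n)| <= e/3.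
 rewrite -ES; apply: (le_trans (mix_bound hc N wS bS (bG n))).
 apply: le_trans (hN N (leqnn N)); rewrite -[leRHS]mulr1 ler_wpM2l//.
 rewrite -[leRHS]mul1r; apply: ler_pM; rewrite ?ex_ge0//.
 by rewrite -[leRHS](ex_cst mu); apply: ex_le; [side|side|move=> x; rewrite indicE; case: (x \in S); rewrite ?normr1 ?normr0].
 by rewrite -[leRHS](ex_cst mu); apply: ex_le.
have i4 : `|E (fun x => \1_S x*G n x)-E (fun x => \1_S x*G n (iter (k+N) T x))| <= e/3.
 apply: le_trans i1; rewrite -exB; [|side|side].
 apply: ex_abs_le; [side|side|].
 move=> x; rewrite -mulrBr normrM ler_piMl// indicE.
 by case: (x \in S); rewrite ?normr1 ?normr0.
have i5 : `|pr mu S*E (G n)-pr mu S * l| <= e/3.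
 rewrite -mulrBr normrM distrC; apply: le_trans i2; rewrite ler_piMl// -ES.
 apply: ex_bound => // x; rewrite indicE; by case: (x \in S); rewrite ?normr1 ?normr0.
move: i3 i4 i5; rewrite !ler_distl => /andP[? ?] /andP[? ?] /andP[? ?]; lra.
Unshelve. all: by end_near. Qed.
Lemma limit_le1 : `|l| <= 1.
have cn : `|E (G n)| @[n --> \oo] --> `|l| by exact: cvg_norm.
rewrite -(cvg_lim (@Rhausdorff R) cn); apply: limr_le; first by apply/cvg_ex; exists `|l|.
by apply: nearW => n; have := @ex_bound _ X R mu (G n) 1 (bG n) (G1 n).
Qed.
Lemma set_cvg A : measurable A -> E (fun x => \1_A x*G n x) @[n --> \oo] --> pr mu A * l.
move=> mA; have bA := @bmf_indic _ X R _ mA.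
have l1 := limit_le1.
apply/cvgrPdist_le => e e0; have e3 : 0 < e/3 by rewrite divr_gt0.
have [k [S [mS sS AS]]] := happ mA e3.
have mAS : measurable (A `+` S) by apply: measurableU; side.
have dI x : `|\1_A x - \1_S x| <= \1_(A `+` S) x :> R.
 rewrite !indicE; have [a|a] := boolP (x \in A); have [s|s] := boolP (x \in S);
 rewrite ?subrr ?normr0// ?subr0 ?sub0r ?normrN ?normr1.
 by rewrite mem_set//; left; split; [exact: set_mem|move/mem_set; rewrite (negPf s)].
 by rewrite mem_set//; right; split; [exact: set_mem|move/mem_set; rewrite (negPf a)].
have cs := near_dist (saturated_cvg mS sS) e3.
near=> n.
have i1 : `|pr mu S * l-E (fun x => \1_S x*G n x)| <= e/3 by near: n.
have i2 : `|E (fun x => \1_A x*G n x)-E (fun x => \1_S x*G n x)| <= e/3.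
 apply: le_trans (ltW AS); rewrite -exB; [|side|side].
 rewrite -ex_indic//; apply: ex_abs_le; [side|side|].
 by move=> x; rewrite -mulrBl normrM; apply: le_trans (dI x); rewrite ler_piMr.
have i3 : `|pr mu A * l-pr mu S * l| <= e/3.
 rewrite -mulrBl normrM; apply: (@le_trans _ _ `|pr mu A-pr mu S|); first by rewrite ler_piMr.
 apply: le_trans (ltW AS); rewrite -!ex_indic// -exB//.
 by apply: ex_abs_le => //.
move: i1 i2 i3; rewrite !ler_distl => /andP[? ?] /andP[? ?] /andP[? ?]; lra.
Unshelve. all: by end_near. Qed.
Lemma weight_cvg H : bmf H -> E (fun x => H x*G n x) @[n --> \oo] --> E H * l.
move=> bH; have [mH [M hM]] := bH.
apply/cvgrPdist_le => e e0.
have m0 : 0 < e / (2 * (`|l| + 2)) by [].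
have hm x : - M <= H x by have := hM x; rewrite ler_norml => /andP[].
have hM' x : H x <= M by apply: le_trans (hM x); exact: ler_norm.
have [N hN] := quant_near m0 hm hM'; set e' := e / _ in m0 hN.
have q1 n := ex_quant_near mu bH (bG n) hN (G1 n).
have b1 := bmf_cst (1 : R) (X := X).
have q2 := ex_quant_near mu bH b1 hN (fun=> eq_ind_r (fun r => r <= 1) (lexx 1) (normr1 R)).
rewrite ex_quant_mul in q2.
have cs : \sum_(i < N) (- M + i%:R*e')*E (fun x => \1_(lvset H (- M + i%:R*e') e') x*G n x)
 @[n --> \oo] --> \sum_(i < N) (- M + i%:R*e') * (pr mu (lvset H (- M + i%:R*e') e') * l).
 apply: (@cvg_sum_ord _ N (fun i n => (- M + i%:R*e')*E (fun x => \1_(lvset H (- M + i%:R*e') e') x*G n x)) (fun i => (- M + i%:R*e') * (pr mu (lvset H (- M + i%:R*e') e') * l))) => i.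
 by apply: cvgM; [exact: cvg_cst|apply: set_cvg; exact: mlevel].
have e2 : 0 < e/2 by [].
have cc := near_dist cs e2.
near=> n.
have i1 := q1 n; rewrite ex_quant_mul in i1.
have i2 : `|\sum_(i < N) (- M + i%:R*e') * (pr mu (lvset H (- M + i%:R*e') e') * l) -
 \sum_(i < N) (- M + i%:R*e')*E (fun x => \1_(lvset H (- M + i%:R*e') e') x*G n x)| <= e/2 by near: n.
have i3 : `|E H * l - \sum_(i < N) (- M + i%:R*e') * (pr mu (lvset H (- M + i%:R*e') e') * l)| <= e' * `|l|.
 under eq_bigr do rewrite mulrA; rewrite -mulr_suml -mulrBl normrM ler_wpM2r//.
 move: q2; rewrite mulr1.
 have -> : E (fun x => H x*1) = E H by apply: ex_eq => x; rewrite mulr1.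
 congr (`|_ - _| <= _); apply: eq_bigr => i _; congr (_ * _); rewrite -ex_indic; last exact: mlevel.
 by apply: ex_eq => x; rewrite mulr1.
have ee : e = 2 * (e' * `|l|)+4*e' by rewrite /e'; field; side.
move: i1 i2 i3; rewrite !ler_distl mulr1.
by lra.
Unshelve. all: by end_near. Qed.

(** The limit is obtained against saturated sets, then against measurable sets by approximation,
    bounded weights by quantisation, and finally against the truncated density of [nu]. *)
Theorem strong_cvg (nu : probability X R) : nu `<< mu -> ex nu (G n) @[n --> \oo] --> l.
move=> numu; apply/cvgrPdist_le => e e0.
have e3 : 0 < e/3 by rewrite divr_gt0.
have l1 := limit_le1.
have [H [bH hH]] := bounded_density numu e3.
have h1 := hH _ (bmf_cst 1) (fun=> eq_ind_r (fun r => r <= 1) (lexx 1) (normr1 R)).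
rewrite ex_cst in h1.
have eH : E (fun x => H x*1) = E H by apply: ex_eq => x; rewrite mulr1.
rewrite eH in h1.
have cc := near_dist (weight_cvg bH) e3.
near=> n.
have i1 : `|E H * l-E (fun x => H x*G n x)| <= e/3 by near: n.
have i2 := hH _ (bG n) (G1 n).
have i3 : `|l-E H * l| <= e/3.
 rewrite -[X in `|X - _|]mul1r -mulrBl normrM; apply: le_trans h1; by rewrite ler_piMr.
move: i1 i2 i3; rewrite !ler_distl => /andP[? ?] /andP[? ?] /andP[? ?]; lra.
Unshelve. all: by end_near. Qed.

End StrongConvergence.

(** * Bernstein smoothing with trigonometric weights *)

Section Bernstein.
Context {R : realType}.
Implicit Types (p : R) (g : nat -> R).

(* The expectation of [g] at [k] plus a binomial variable with parameters [n] and [p]. *)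
Fixpoint bern p n g k : R :=
 if n is n'.+1 then p*bern p n' g k.+1 + (1-p)*bern p n' g k else g k.

Lemma bern_err p n g k (x a b y : R) : 0 <= p <= 1 ->
 (forall j, `|x-g j| <= a+b * (j%:R-y) ^+ 2) ->
 `|x-bern p n g k| <= a+b * ((k%:R+n%:R * p-y) ^+ 2+n%:R * p * (1-p)).
move=> /andP[p0 p1] hg; elim: n k => [|n IH] k.
 by apply: (le_trans (hg k)); rewrite mul0r !mul0r !addr0.
have -> : x-bern p n.+1 g k = p * (x-bern p n g k.+1) + (1-p) * (x-bern p n g k) by rewrite /=; ring.
have q0 : 0 <= 1-p by lra.
have h1 := ler_wpM2l p0 (IH k.+1); have h2 := ler_wpM2l q0 (IH k).
apply: (le_trans (ler_normD _ _)); rewrite !normrM (ger0_norm p0) (ger0_norm q0).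
apply: (le_trans (lerD h1 h2)); rewrite le_eqVlt; apply/orP; left; apply/eqP.
by rewrite -[k.+1%:R]natr1 -[n.+1%:R]natr1; ring.
Qed.
Lemma bern_bound p n g k C : 0 <= p <= 1 -> (forall j, `|g j| <= C) -> `|bern p n g k| <= C.
move=> hp hg; have := @bern_err p n g k 0 C 0 0 hp.
by rewrite !mul0r !addr0 sub0r normrN; apply => j; rewrite mul0r addr0 sub0r normrN.
Qed.
Definition upd (v : nat -> R) (q : nat) (x : R) : nat -> R := fun i => if i == q then x else v i.
Definition lip_in (q : nat) (K : R) (F : (nat -> R) -> R) : Prop :=
 forall v w, `|F v-F w| <= K * \sum_(i < q) `|v i-w i|.
(** With [M = k + 1], success probability [sprob] and [M ^ 4] trials, the random node has mean
    [M sin (x / M)], close to [x], and small variance, while its weights are trigonometric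
    polynomials in [x]. *)
Definition node (k j : nat) : R := k.+1%:R * (2*j%:R / (k.+1 ^ 4)%:R-1).
Definition sprob (k : nat) (x : R) : R := (1+sin (x/k.+1%:R))/2.
Definition smooth (q k : nat) (F : (nat -> R) -> R) (v : nat -> R) : R :=
 bern (sprob k (v q)) (k.+1 ^ 4) (fun j => F (upd v q (node k j))) 0.

Lemma sprob01 k x : 0 <= sprob k x <= 1.
rewrite /sprob; have := sin_geN1 (x/k.+1%:R); have := sin_le1 (x/k.+1%:R).
by lra.
Qed.
Lemma lip_upd q K F x : lip_in q.+1 K F -> lip_in q K (fun v => F (upd v q x)).
move=> h v w; apply: (le_trans (h _ _)); rewrite big_ord_recr /= /upd eqxx subrr normr0 addr0.
rewrite le_eqVlt; apply/orP; left; apply/eqP; congr (_ * _); apply: eq_bigr => i _.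
by rewrite (ltn_eqF (ltn_ord i)).
Qed.
Lemma smooth_err q k K F v : 0 <= K -> lip_in q.+1 K F ->
 `|F v-smooth q k F v| <= K * (2+v q ^+ 4)/k.+1%:R.
move=> K0 hF; have [M Mk] : exists M : R, M = k.+1%:R by exists k.+1%:R.
rewrite -Mk; set x := v q.
have M0 : 0 < M by rewrite Mk ltr0n.
have M4 : (k.+1 ^ 4)%:R = M ^+ 4 by rewrite natrX Mk.
have M40 : M ^+ 4 != 0 by rewrite expf_neq0// gt_eqF.
have Mn0 : M != 0 by rewrite gt_eqF.
(* The number of successes whose node would be exactly [x]. *)
pose y := M ^+ 4 * (x/M+1)/2; pose s := sin (x/M).
have hj j : `|F v-F (upd v q (node k j))| <= K/M+K*4/M ^+ 5 * (j%:R-y) ^+ 2.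
 apply: (le_trans (hF _ _)); rewrite big_ord_recr /= big1 => [|i _]; last first.
 by rewrite /upd (ltn_eqF (ltn_ord i)) subrr normr0.
 rewrite add0r /upd eqxx -/x; set z := `|_|.
 have z2 : z ^+ 2 = 4 * (j%:R-y) ^+ 2/M ^+ 6.
 rewrite /z -normrX ger0_norm ?sqr_ge0// /node M4 -Mk /y; field; exact: Mn0.
 have -> : K/M+K*4/M ^+ 5 * (j%:R-y) ^+ 2 = K * (M^-1+z ^+ 2*M).
 by rewrite z2; field.
 rewrite ler_wpM2l//; have z0 : 0 <= z by exact: normr_ge0.
 have : 0 <= (M^-1+z ^+ 2*M-z)*M.
 have -> : (M^-1+z ^+ 2*M-z)*M = 1-z*M + (z*M) ^+ 2 by field.
 by move: (z*M) => t; nra.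
 by rewrite pmulr_lge0// subr_ge0.
apply: (le_trans (bern_err _ 0 (sprob01 k x) hj)).
have sb : `|s-x/M| <= (x/M) ^+ 2 by exact: sin_sub_le.
have sb2 : (s-x/M) ^+ 2 <= (x/M) ^+ 4.
 rewrite -[leLHS]ger0_norm ?sqr_ge0// normrX (_ : 4 = 2*2)%N// exprM ler_sqr ?nnegrE ?sqr_ge0//.
have pq : sprob k x * (1-sprob k x) <= 4^-1 by move: (sprob k x) => t; rewrite -subr_ge0 (_ : _ - _ = (t-2^-1) ^+ 2) ?sqr_ge0; field.
rewrite M4 add0r.
have e1 : M ^+ 4*sprob k x-y = M ^+ 4/2 * (s-x/M) by rewrite /sprob -Mk -/s /y; field.
rewrite e1 exprMn -[M ^+ 4 * _ * _]mulrA.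
apply: (@le_trans _ _ (K/M+K*4/M ^+ 5 * ((M ^+ 4/2) ^+ 2 * (x/M) ^+ 4+M ^+ 4*4^-1))).
 by rewrite lerD2l ler_wpM2l// lerD// ler_wpM2l.
by rewrite le_eqVlt; apply/orP; left; apply/eqP; field.
Qed.
Lemma smooth_bound q k F v C : (forall w, `|F w| <= C) -> `|smooth q k F v| <= C.
by move=> h; apply: bern_bound => //; exact: sprob01. Qed.

End Bernstein.

Section Smoothing.
Context {d} {W : measurableType d} {R : realType}.
Variable Y : W -> nat -> R.
Hypothesis mY : forall i, mfun W (fun w => Y w i).

Lemma smooth_measurable q k F : (forall x, mfun W (fun w => F (upd (Y w) q x))) ->
 forall n i, mfun W (fun w => bern (sprob k (Y w q)) n (fun j => F (upd (Y w) q (node k j))) i).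
move=> mF; have ms : mfun W (fun w => sprob k (Y w q)).
 apply: measurable_funM => //; side.
elim=> [|n IH] i /=; first side.
by [].
Qed.
(** By [smooth_err] the function is the pointwise limit of its smoothings in the last coordinate,
    which are built from functions of one coordinate less. *)
Lemma lip_measurable q K F : 0 <= K -> lip_in q K F -> mfun W (fun w => F (Y w)).
move=> K0; elim: q F => [|q IH] F hF.
 have -> : (fun w => F (Y w)) = cst (F (fun=> 0)); last side.
 by apply/funext => w; apply/eqP; rewrite -subr_eq0 -normr_le0; apply: (le_trans (hF _ _)); rewrite big_ord0 mulr0.
apply: (@measurable_fun_cvg _ _ _ _ (fun k w => smooth q k F (Y w))).
 move=> k; rewrite /smooth; apply: smooth_measurable => x; apply: (IH (fun v => F (upd v q x))); exact: lip_upd.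
move=> w _; apply/cvgrPdist_le => e e0; near=> k.
apply: (le_trans (smooth_err k (Y w) K0 hF)); rewrite ler_pdivrMr// [e * _]mulrC -ler_pdivrMr.
by near: k; exact: near_ge_nat.
Unshelve. all: by end_near. Qed.

End Smoothing.

(** * Trigonometric sums *)

Section Trigonometric.
Context {R : realType}.
Variable N : nat.

Inductive trig : ((nat -> R) -> R) -> Prop :=
| trig_cos (u : nat -> R) s : trig (fun v => cos (\sum_(i < N) u i*v i+s))
| trig_add F G : trig F -> trig G -> trig (fun v => F v+G v)
| trig_scale a F : trig F -> trig (fun v => a*F v).

Lemma trig_bounded F : trig F -> exists C, forall v, `|F v| <= C.
elim=> [u s|{}F G _ [C hC] _ [D hD]|a {}F _ [C hC]].
- by exists 1 => v; side.
- by exists (C+D) => v; rewrite (le_trans (ler_normD _ _))// lerD.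
- by exists (`|a| * C) => v; rewrite normrM ler_wpM2l.
Qed.
Lemma trig_measurable F {d} {W : measurableType d} (Y : W -> nat -> R) :
 (forall i, mfun W (fun w => Y w i)) -> trig F -> mfun W (fun w => F (Y w)).
move=> mY; elim=> [u s|{}F G _ mF _ mG|a {}F _ mF].
- side.
- side.
- side.
Qed.
(** Product-to-sum formulas: multiplying by the sine shifts the frequency [u q] and the phase. *)
Lemma trig_sprob q k F : (q < N)%N -> trig F ->
 trig (fun v => sprob k (v q)*F v) /\ trig (fun v => (1-sprob k (v q))*F v).
move=> qN tF; suff tS : trig (fun v => sin (v q/k.+1%:R)*F v).
 split.
 have -> : (fun v => sprob k (v q)*F v) = (fun v => 2^-1*F v+2^-1 * (sin (v q/k.+1%:R)*F v)) by apply/funext => v; rewrite /sprob; ring.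
 by apply: trig_add; apply: trig_scale.
 have -> : (fun v => (1-sprob k (v q))*F v) = (fun v => 2^-1*F v + - 2^-1 * (sin (v q/k.+1%:R)*F v)) by apply/funext => v; rewrite /sprob; field.
 by apply: trig_add; apply: trig_scale.
elim: tF => [u s|G H _ IG _ IH|a G _ IG].
- pose w (e : R) i := u i+e * (if i == q then k.+1%:R^-1 else 0).
 have wE e (v : nat -> R) : \sum_(i < N) w e i*v i = \sum_(i < N) u i*v i+e * (v q/k.+1%:R).
 rewrite /w; under eq_bigr do rewrite mulrDl; rewrite big_split; congr (_ + _).
 rewrite (bigD1 (Ordinal qN))//= eqxx big1; first by ring.
 move=> i ik; rewrite (_ : (_ == q) = false) ?mulr0 ?mul0r//.
 by apply/negbTE; side.
 have -> : (fun v => sin (v q/k.+1%:R)*cos (\sum_(i < N) u i*v i+s)) =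
 (fun v => 2^-1*cos (\sum_(i < N) w 1 i*v i + (s-pi/2)) +
 - 2^-1*cos (\sum_(i < N) w (-1) i*v i + (s-pi/2))).
 apply/funext => v; rewrite !wE; move: (\sum_(i < N) _) (v q / _) => a b.
 have -> : a+1*b + (s-pi/2) = (a+s)+b-pi/2 by ring.
 have -> : a + -1*b + (s-pi/2) = (a+s)-b-pi/2 by ring.
 by rewrite !cosBpihalf sinD sinB; field.
 by apply: trig_add; apply: trig_scale; exact: trig_cos.
- have -> : (fun v => sin (v q/k.+1%:R) * (G v+H v)) =
 (fun v => sin (v q/k.+1%:R)*G v+sin (v q/k.+1%:R)*H v) by apply/funext => v; rewrite mulrDr.
 exact: trig_add.
- have -> : (fun v => sin (v q/k.+1%:R) * (a*G v)) = (fun v => a * (sin (v q/k.+1%:R)*G v)) by apply/funext => v; rewrite mulrCA.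
 exact: trig_scale.
Qed.

End Trigonometric.

(** * From convergence of cosines to convergence of Lipschitz functions *)

Section CosConvergence.
Context {dX dW : measure_display} {X : measurableType dX} {W : measurableType dW} {R : realType}.
Variables (nu : probability X R) (P : probability W R) (N : nat).
Variables (D : nat -> X -> nat -> R) (Y : W -> nat -> R).
Hypotheses (mD : forall n i, mfun X (fun x => D n x i)) (mY : forall i, mfun W (fun w => Y w i)).
Hypothesis hcos : forall (u : nat -> R) s, ex nu (fun x => cos (\sum_(i < N) u i*D n x i+s)) @[n --> \oo]
 --> ex P (fun w => cos (\sum_(i < N) u i*Y w i+s)).
Hypothesis htight : forall i e, (i < N)%N -> 0 < e -> exists V : R, \forall n \near \oo, pr nu [set x | V < `|D n x i|] <= e.

Let converges F := ex nu (fun x => F (D n x)) @[n --> \oo] --> ex P (fun w => F (Y w)).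
Let bmf_both (F : (nat -> R) -> R) := (forall n, bmf (fun x => F (D n x))) /\ bmf (fun w => F (Y w)).

Lemma trig_bmf F : trig N F -> bmf_both F.
move=> tF; have [C hC] := trig_bounded tF.
split; first by move=> n; split; [exact: trig_measurable tF|exists C].
by split; [exact: trig_measurable tF|exists C].
Qed.
Lemma convergesD F G : bmf_both F -> bmf_both G -> converges F -> converges G -> converges (fun v => F v+G v).
move=> [bF bF'] [bG bG'] cF cG; rewrite /converges exD//.
by under eq_fun do rewrite exD//; exact: cvgD.
Qed.
Lemma trig_converges F : trig N F -> converges F.
elim=> [u s|{}F G tF cF tG cG|a {}F tF cF]; first exact: hcos.
 by apply: convergesD => //; exact: trig_bmf.
have [b1 b2] := trig_bmf tF; rewrite /converges exZ//.
by under eq_fun do rewrite exZ//; apply: cvgM => //; side.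
Qed.
(** Unfolding the binomial recursion only multiplies the factor [G] by [sprob] or its complement,
    and it remains trigonometric. At the end the coordinate [q] is frozen at a node. *)
Lemma bern_converges q k (F : (nat -> R) -> R) C : (q < N)%N -> (forall v, `|F v| <= C) ->
 (forall x, bmf_both (fun v => F (upd v q x))) ->
 (forall G x, trig N G -> converges (fun v => G v*F (upd v q x))) ->
 forall G, trig N G -> converges (fun v => G v*smooth q k F v).
move=> qN FC bF cF; rewrite /smooth; move: 0%N (k.+1 ^ 4)%N => i n.
elim: n i => [|n IH] i G tG; first exact: cF.
have [t1 t2] := trig_sprob k qN tG.
have e : (fun v => G v*bern (sprob k (v q)) n.+1 (fun j => F (upd v q (node k j))) i) =
 (fun v => sprob k (v q)*G v*bern (sprob k (v q)) n (fun j => F (upd v q (node k j))) i.+1 +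
 (1-sprob k (v q))*G v*bern (sprob k (v q)) n (fun j => F (upd v q (node k j))) i) by apply/funext => v /=; ring.
have bB H j : trig N H -> bmf_both (fun v => H v*bern (sprob k (v q)) n (fun j => F (upd v q (node k j))) j).
 move=> tH; have [b1 b2] := trig_bmf tH.
 split; [move=> m|]; apply: bmfM => //; (split; last by exists C => x; apply: bern_bound => //; exact: sprob01).
 by apply: smooth_measurable => // x; have [+ _] := bF x; move=> /(_ m)[].
 by apply: smooth_measurable => // x; have [_ []] := bF x.
by rewrite e; apply: convergesD; [exact: bB|exact: bB|exact: IH|exact: IH].
Qed.

(* Bernstein smoothing in one coordinate replaces [F] by a trigonometric combination of functions of one coordinate less. *)
Lemma smooth_ex_err {d} {Z : measurableType d} (m : probability Z R) (V : Z -> nat -> R)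
 q k (F G : (nat -> R) -> R) K C C1 a : (forall i, mfun Z (fun z => V z i)) ->
 0 <= K -> 0 <= a -> lip_in q.+1 K F -> (forall v, `|F v| <= C) -> (forall v, `|G v| <= C1) ->
 bmf (fun z => G (V z)) ->
 `|ex m (fun z => G (V z)*F (V z))-ex m (fun z => G (V z)*smooth q k F (V z))| <=
 C1 * (K * (2 + a ^+ 4)/k.+1%:R+2*C * pr m [set z | a < `|V z q|]).
move=> mV K0 a0 hF FC GC bG.
have bF : bmf (fun z => F (V z)) by split; [exact: lip_measurable hF|exists C].
have bS : bmf (fun z => smooth q k F (V z)).
 split; last by exists C => z; exact: smooth_bound.
 by apply: smooth_measurable => // x; apply: lip_measurable (lip_upd x hF).
set b := K * _ / _.
rewrite -exB; [|side|side].
have <- : ex m (fun z => C1 * (b+2*C * \1_[set z | a < `|V z q|] z)) =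
 C1 * (b+2*C * pr m [set z | a < `|V z q|]) by rewrite exZ ?exD ?ex_cst ?exZ ?ex_indic//; side.
apply: ex_abs_le; [side|side|].
move=> z; rewrite -mulrBr normrM ler_pM// indicE; case: (leP `|V z q| a) => h.
 rewrite memNset /=; last by rewrite ltNge h.
 rewrite mulr0 addr0; apply: (le_trans (smooth_err k (V z) K0 hF)); rewrite ler_wpM2r// ler_wpM2l// lerD2l.
 by rewrite -[V z q ^+ 4]ger0_norm ?exprn_even_ge0// normrX lerXn2r.
rewrite mem_set//= mulr1; apply: (@le_trans _ _ (2*C)).
 apply: (le_trans (ler_normB _ _)); rewrite mulrDl mul1r lerD//; exact: smooth_bound.
by rewrite lerDr /b.
Qed.
(** The induction on the number of coordinates closes because a trigonometric factor is carried
    along. The smoothing error grows with the coordinate, and tightness bounds it uniformly in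
    [n]. *)
Lemma lip_trig_converges q K F C : (q <= N)%N -> 0 <= K -> lip_in q K F -> (forall v, `|F v| <= C) ->
 forall G, trig N G -> converges (fun v => G v*F v).
move=> + K0; elim: q F => [|q IH] F qN hF FC G tG.
 have e v : F v = F (fun=> 0).
 by apply/eqP; rewrite -subr_eq0 -normr_le0; apply: (le_trans (hF _ _)); rewrite big_ord0 mulr0.
 have [b1 b2] := trig_bmf tG; have cG := trig_converges tG.
 have eE d (Z : measurableType d) (m : probability Z R) (V : Z -> nat -> R) : bmf (fun z => G (V z)) ->
 ex m (fun z => G (V z)*F (V z)) = F (fun=> 0)*ex m (fun z => G (V z)).
 by move=> bG; rewrite -exZ//; apply: ex_eq => z; rewrite e mulrC.
 rewrite /converges eE//; under eq_fun do rewrite eE//.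
 by apply: cvgM => //; exact: cvg_cst.
have C0 : 0 <= C by exact: le_trans (FC (fun=> 0)).
have [C1 GC] := trig_bounded tG; have C10 : 0 <= C1 by exact: le_trans (GC (fun=> 0)).
have [bG bG'] := trig_bmf tG; apply/cvgrPdist_le => e e0.
(* Makes [(C1 + 1) * (1 + 2 * C) * e1] equal to [e / 3]. *)
pose e1 := e / (3 * (C1+1) * (1+2*C)); have e10 : 0 < e1 by apply: divr_gt0.
have [V1 hV1] := htight qN e10; have [V2 hV2] := tight_one P (mY q) e10.
pose V := Num.max `|V1| V2%:R; have V0 : 0 <= V by rewrite le_max normr_ge0.
have [k hk] : exists k, K * (2+V ^+ 4)/k.+1%:R <= e1.
 have [k _ hk] := near_ge_nat (K * (2+V ^+ 4)/e1); exists k.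
 by rewrite ler_pdivrMr// [e1 * _]mulrC -ler_pdivrMr//; exact: (hk k (leqnn k)).
have bF x : bmf_both (fun v => F (upd v q x)).
 have hx := lip_upd x hF.
 by split; [move=> n|]; (split; [exact: lip_measurable hx|exists C => z; exact: FC]).
have cF H x : trig N H -> converges (fun v => H v*F (upd v q x)).
 by move=> tH; apply: (IH (fun v => F (upd v q x))) => //; [exact: ltnW|exact: lip_upd].
have c : converges (fun v => G v*smooth q k F v) := bern_converges qN FC bF cF tG.
have e3 : 0 < e/3 by []; have cc := near_dist c e3.
have tot r : 0 <= r -> r <= e1 -> C1 * (K * (2+V ^+ 4)/k.+1%:R+2*C*r) <= e/3.
 move=> r0 re; have -> : e/3 = (C1+1) * (e1+2*C*e1).
 by rewrite /e1; field; apply/andP.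
 by apply: ler_pM; rewrite ?lerDl ?lerD// ler_wpM2l.
have i3 : `|ex P (fun w => G (Y w)*F (Y w))-ex P (fun w => G (Y w)*smooth q k F (Y w))| <= e/3.
 apply: (le_trans (smooth_ex_err P k mY K0 V0 hF FC GC bG')); apply: tot; first exact: pr_ge0.
 by apply: le_trans (ltW hV2); apply: pr_le => // w /=; apply: le_lt_trans; rewrite le_max lexx orbT.
near=> n.
have i1 : `|ex P (fun w => G (Y w)*smooth q k F (Y w))-ex nu (fun x => G (D n x)*smooth q k F (D n x))| <= e/3.
 by near: n.
have i2 : `|ex nu (fun x => G (D n x)*F (D n x))-ex nu (fun x => G (D n x)*smooth q k F (D n x))| <= e/3.
 apply: (le_trans (smooth_ex_err nu k (mD n) K0 V0 hF FC GC (bG n))); apply: tot; first exact: pr_ge0.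
 have h : pr nu [set x | V1 < `|D n x q|] <= e1 by near: n.
 by apply: le_trans h; apply: pr_le => // w /=; apply: le_lt_trans; rewrite le_max ler_norm.
by move: i1 i2 i3; rewrite !ler_distl; lra.
Unshelve. all: by end_near. Qed.

Theorem lip_converges K F C : 0 <= K -> lip_in N K F -> (forall v, `|F v| <= C) -> converges F.
move=> K0 hF FC; have := lip_trig_converges (leqnn N) K0 hF FC (trig_cos N (fun=> 0) 0).
have e v : cos (\sum_(i < N) 0*v i+0) = 1 :> R by rewrite big1 ?addr0 ?cos0// => i _; rewrite mul0r.
by rewrite /converges; under eq_fun do under ex_eq do rewrite e mul1r; rewrite (ex_eq P (fun w => f_equal (fun r => r*F (Y w)) (e (Y w)))) (ex_eq P (fun w => mul1r _)).
Qed.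

End CosConvergence.

Lemma ex_ae {d} {W : measurableType d} {R : realType} (P : probability W R) (H H' : W -> R) (Q : W -> Prop) :
 bmf H -> bmf H' -> {ae P, forall w, Q w} -> (forall w, Q w -> H w = H' w) -> ex P H = ex P H'.
move=> [mH _] [mH' _] [N [mN N0 hN]] HH'; rewrite /ex /Rintegral; congr fine.
apply: ae_eq_integral => //.
by exists N; split=> // w /= hw; apply: hN => q; apply: hw => _; rewrite HH'.
Qed.

(** * Tightness from convergence of cosines *)

Section AverageMeasurable.
Context {R : realType}.
Context {d} {X : measurableType d}.
Variables (mu : probability X R) (Z : X -> R).
Hypothesis mZ : mfun X Z.

Lemma mavg h : measurable_fun [set: measurableTypeR R] (fun v : R => ex mu (fun x => 1-cos (v*h*Z x))).
apply: continuous_measurable_fun => u; apply/cvgrPdist_le => e e0.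
have mhZ : mfun X (fun x => h*Z x) by [].
have [de [de0 hde]] := echar_continuous mu mhZ e0.
exists de => //= v; rewrite /ball => uv; have uv' : `|v-u| <= de by rewrite distrC ltW.
apply: le_trans (hde v u uv'); apply: le_trans (cn_Re _) => /=.
rewrite !exB ?ex_cst//; try exact: bmf_cst.
have ea a : ex mu (fun x => cos (a*h*Z x)) = ex mu (fun x => cos (a * (h*Z x))) by apply: ex_eq => x; rewrite mulrA.
rewrite !ea; move: (ex _ _) (ex _ _) => a b.
by have -> : 1-b - (1 - a) = a-b by ring.
Qed.

End AverageMeasurable.

Section Averages.
Context {R : realType}.
Let unif : probability (measurableTypeR R) R := uniform_prob (@ltr01 R).

Lemma unif_avg (z : R) : z != 0 -> ex unif (fun v => 1-cos (v*z)) = 1-sin z/z.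
move=> z0; rewrite /ex /Rintegral /unif integral_uniform; last 2 first.
- apply/measurable_EFinP; side.
- by [].
have -> : (\int[lebesgue_measure]_(x in `[0%R, 1%R]) (1-cos (x*z))%:E =
 ((1-sin (1*z)/z) - (0-sin (0*z)/z))%:E)%E.
 apply: (@FTC_itv R (fun v => v-sin (v*z)/z) (fun v => 1-cos (v*z)) 0 1 ltr01).
 move=> t _.
 have h1 : is_derive (t : R) (1 : R) (fun p : R => p*z) z by apply: (is_derive_eq (is_deriveM (is_derive_id _ _) (is_derive_cst _ _ _))); rewrite /GRing.scale /=; ring.
 have h2 := @is_derive1_comp _ (@sin R) (fun p : R => p*z) t _ _ (is_derive_sin _) h1.
 have h3 := is_deriveM h2 (is_derive_cst (z^-1) t (1 : R)).
 have h4 := is_deriveB (is_derive_id t (1 : R)) h3.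
 by apply: (is_derive_eq h4); rewrite /GRing.scale /=; field.
 move=> t _; apply: cvgB; first side.
 by apply: continuous_comp; [apply: cvgM; side|exact: continuous_cos].
by rewrite subr0 invr1 mul1e mul1r mul0r sin0 mul0r !subr0.
Qed.
Lemma unif_ge (z : R) : 2 <= `|z| -> 1/2 <= ex unif (fun v => 1-cos (v*z)).
move=> z2; have z0 : z != 0 by rewrite -normr_gt0; lra.
rewrite unif_avg//; suff : `|sin z/z| <= 1/2 by move=> /ler_normlP[]; lra.
rewrite normrM normrV ?unitfE//; apply: ler_pM => //.
 by side.
by rewrite lef_pV2 ?posrE; lra.
Qed.

Context {d} {X : measurableType d}.
Variables (mu : probability X R) (Z : X -> R).
Hypothesis mZ : mfun X Z.

(** The truncation inequality: the average of [1 - cos (v z)] over [v] in [[0, 1]] is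
    [1 - sin z / z], at least one half when [|z| >= 2]. Fubini exchanges the two averages. *)
Lemma tail_avg h : 0 < h -> pr mu [set x | 2/h < `|Z x|] <=
 2*ex unif (fun v => ex mu (fun x => 1-cos (v*h*Z x))).
move=> h0; pose F (p : X * measurableTypeR R) : R := 1-cos (p.2*h*Z p.1).
have mF : measurable_fun setT (EFin \o F).
 apply/measurable_EFinP; apply: measurable_funB => //; apply: (bmf_measurable (bmf_cos _)).
 by apply: measurable_funM; [apply: measurable_funM => //; exact: measurable_snd|apply: measurableT_comp].
have F0 p : (0 <= (EFin \o F) p)%E by rewrite lee_fin subr_ge0 cos_le1.
have bcX v : bmf (fun x => 1-cos (v*h*Z x)) by [].
have mid : measurable_fun [set: measurableTypeR R] (fun v : R => v) by exact: measurable_id.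
have bcU x : bmf (fun v : measurableTypeR R => 1-cos (v*h*Z x)) by [].
have c2 (t : R) : `|1-cos t| <= 2 by rewrite ler_norml; have := cos_geN1 t; have := cos_le1 t; lra.
have b2 : bmf (fun x => ex unif (fun v => 1-cos (v*h*Z x))).
 split; last by exists 2 => x; exact: (ex_bound unif (bcU x)).
 have := measurableT_comp (mavg unif mid h) mZ.
 by apply: eq_measurable_fun => // x _ /=; apply: ex_eq => v; congr (1-cos _); ring.
have b3 : bmf (fun v : measurableTypeR R => ex mu (fun x => 1-cos (v*h*Z x))).
 by split; [exact: mavg|exists 2 => v; exact: (ex_bound mu (bcX v))].
have -> : ex unif (fun v => ex mu (fun x => 1-cos (v*h*Z x))) =
 ex mu (fun x => ex unif (fun v => 1-cos (v*h*Z x))).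
 have ft := @fubini_tonelli _ _ _ _ _ mu unif (EFin \o F) mF F0.
 rewrite /ex /Rintegral; congr fine; apply/esym.
 transitivity (\int[mu]_x \int[unif]_y (EFin \o F) (x, y))%E; last rewrite ft.
 by apply: eq_integral => x _; rewrite fineK//; exact: integrable_fin_num (bmf_int unif (bcU x)).
 by apply: eq_integral => y _; rewrite fineK//; exact: integrable_fin_num (bmf_int mu (bcX y)).
rewrite -ex_indic// -exZ//; apply: ex_le => // x.
rewrite indicE; case: (ltP (2/h) `|Z x|) => hz; last first.
 by rewrite memNset; [rewrite mulr_ge0//; apply: ex_ge0 => v; rewrite subr_ge0 cos_le1|rewrite /= ltNge hz].
rewrite mem_set//=; have : 2 <= `|h*Z x| by rewrite normrM (gtr0_norm h0) mulrC -ler_pdivrMr// ltW.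
move=> /unif_ge; rewrite ler_pdivrMr// mulrC => /le_trans; apply.
by rewrite ler_wpM2l// le_eqVlt; apply/orP; left; apply/eqP; apply: ex_eq => v; rewrite mulrA.
Qed.
Lemma unif_le_sup (p : R -> R) b : bmf (p : measurableTypeR R -> R) -> 0 <= b -> (forall v, 0 <= v <= 1 -> p v <= b) ->
 ex unif p <= b.
move=> bp b0 hp; have mI : measurable (`[0, 1]%classic : set (measurableTypeR R)) by exact: measurable_itv.
have z : pr unif (~` (`[0, 1]%classic : set (measurableTypeR R))) = 0 by rewrite /pr /unif /= /uniform_prob integral_uniform_pdf setICl integral_set0.
rewrite (ex_full mI z bp) -[leRHS](ex_cst unif); apply: ex_le; [side|side|].
move=> v; rewrite indicE; have [h|h] := boolP (v \in _); last by rewrite mulr0.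
by rewrite mulr1 hp; move: h; rewrite inE /= in_itv.
Qed.
Lemma tail_sup h b : 0 < h -> 0 <= b -> (forall v, 0 <= v <= h -> ex mu (fun x => 1-cos (v*Z x)) <= b) ->
 pr mu [set x | 2/h < `|Z x|] <= 2*b.
move=> h0 b0 hb; apply: (le_trans (tail_avg h0)); rewrite ler_wpM2l//; apply: unif_le_sup => //.
- split; first exact: mavg.
 exists 2 => v; apply: ex_bound.
 by [].
 move=> x; move: (v*h*Z x) => t; rewrite ler_norml; have := cos_geN1 t; have := cos_le1 t => ? ?; lra.
- by move=> v /andP[v0 v1]; apply: hb; rewrite mulr_ge0//= ler_piMl// ltW.
Qed.

End Averages.

Section TightFromCos.
Context {dX dW : measure_display} {X : measurableType dX} {W : measurableType dW} {R : realType}.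
Variables (nu : probability X R) (P : probability W R) (Z : nat -> X -> R) (Y : W -> R).
Hypotheses (mZ : forall n, mfun X (Z n)) (mY : mfun W Y)
 (hcos : forall u, ex nu (fun x => cos (u*Z n x)) @[n --> \oo] --> ex P (fun w => cos (u*Y w))).

Lemma tight_of_cos e : 0 < e -> exists V : R, \forall n \near \oo, pr nu [set x | V < `|Z n x|] <= e.
move=> e0; have e4 : 0 < e/4 by rewrite divr_gt0.
have [h [h0 hh]] := echar_continuous P mY e4.
pose unif : probability (measurableTypeR R) R := uniform_prob (@ltr01 R).
pose p n (v : R) := ex nu (fun x => 1-cos (v*h*Z n x)).
pose q (v : R) := ex P (fun w => 1-cos (v*h*Y w)).
have c2 (t : R) : `|1-cos t| <= 2 by rewrite ler_norml; have := cos_geN1 t; have := cos_le1 t => ? ?; lra.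
have pE n v : p n v = 1-ex nu (fun x => cos (v*h*Z n x)) by rewrite /p exB ?ex_cst//; side.
have qE v : q v = 1-ex P (fun x => cos (v*h*Y x)) by rewrite /q exB ?ex_cst//; side.
have c : ex unif (p n) @[n --> \oo] --> ex unif q.
 apply: (@ex_dominated_bound _ _ _ unif p q 2).
 - by move=> n; exact: mavg.
 - exact: mavg.
 - by move=> n v; apply: ex_bound => //; side.
 - move=> v; rewrite qE; under eq_fun do rewrite pE.
 by apply: cvgB; side.
have bq : ex unif q <= e/4.
 apply: (unif_le_sup _ (ltW e4)).
 split; first exact: mavg.
 by exists 2 => v; apply: ex_bound => //; side.
 move=> v /andP[v0 v1]; have : `|0-v*h| <= h by rewrite sub0r normrN ger0_norm// ler_piMl// ltW.
 move=> /hh; apply: le_trans; apply: le_trans (cn_Re _) => /=; rewrite qE.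
 have -> : ex P (fun w => cos (0*Y w)) = 1 by rewrite -[RHS](ex_cst P); apply: ex_eq => w; rewrite mul0r cos0.
 exact: ler_norm.
have bq2 : ex unif q < e/2 by lra.
exists (2/h); near=> n; apply: (le_trans (tail_avg nu (mZ n) h0)).
have : ex unif (p n) < e/2 by near: n; exact: cvgr_lt c _ bq2.
by lra.
Unshelve. all: by end_near. Qed.

End TightFromCos.

(** * Continuous roots of unity *)

Section Roots.
Context {R : realType}.
Implicit Types z w : R[i].

(** If [z] differs from 1, its powers [z^i] with [i < m] sum to 0, so [m = |sum of (1 - z^i)| <= m *
    m * |z - 1|]. *)
Lemma root_of_unity_gap z m : (0 < m)%N -> z ^+ m = 1 -> z = 1 \/ m%:R^-1 <= cn (z-1).
move=> m0 zm; have [->|z1] := eqVneq z 1; [by left|right].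
have : (z-1) * \sum_(i < m) z ^+ i = 0 by rewrite -subrX1 zm subrr.
move=> /eqP; rewrite mulf_eq0 subr_eq0 (negPf z1) => /eqP s0.
have cz : cn z <= 1.
 rewrite leNgt; apply/negP => c1; have : cn (z ^+ m) = cn z ^+ m.
 by elim: (m) => [|k IH]; rewrite ?cn1// !exprS cnM IH.
 by rewrite zm cn1 => /esym/eqP; rewrite pexprn_eq1 ?(ltW (lt_trans ltr01 c1))// (gt_eqF c1) orbF => /eqP m00; move: m0; rewrite m00.
have c1 : cn (1 : R[i]) <= 1 by rewrite cn1.
have k1 i : (i < m)%N -> cn (1-z ^+ i) <= m%:R*cn (z-1).
 move=> im; have := cn_subXX i c1 cz; rewrite expr1n [cn (1-z)]cnBC => /le_trans; apply.
 by rewrite ler_wpM2r ?cn_ge0// ler_nat ltnW.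
have cs N (F : nat -> R[i]) b : (forall i, (i < N)%N -> cn (F i) <= b) -> cn (\sum_(i < N) F i) <= N%:R*b.
 elim: N => [|N IH] hF; first by rewrite big_ord0 cn0 mul0r.
 rewrite big_ord_recr (le_trans (cnD _ _))// -natr1 mulrDl mul1r lerD//; last exact: hF.
 by apply: IH => i iN; apply: hF; exact: ltnW.
have := cs m (fun i => 1-z ^+ i) _ k1.
rewrite sumrB s0 subr0 sumr_const card_ord.
have -> : cn (1 *+ m : R[i]) = m%:R.
 have -> : (1 *+ m : R[i]) = (m%:R%:C)%C by ring.
 by rewrite cn_real ger0_norm.
rewrite -[X in X <= _]mulr1 ler_pM2l// => h.
by rewrite -[leLHS]mulr1 ler_pdivrMl.
Qed.
(** Along the segment from 0 to [u] the squared distance of [w] from 1 is continuous and starts at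
    0; it cannot cross the gap of [root_of_unity_gap]. *)
Lemma continuous_root_eq1 (w : R -> R[i]) m : (0 < m)%N -> (forall u, w u ^+ m = 1) -> w 0 = 1 ->
 continuous (fun u => complex.Re (w u)) -> continuous (fun u => complex.Im (w u)) -> forall u, w u = 1.
move=> m0 wm w0 cr ci u.
pose q (t : R) := cn (w (t*u)-1) ^+ 2.
have qE : q = (fun t => (complex.Re (w (t*u))-1) ^+ 2+complex.Im (w (t*u)) ^+ 2) by apply/funext => t; rewrite /q cn_sqr; case: (w (t*u)) => a b /=; rewrite subr0.
have cq : continuous q.
 have cu : continuous (fun t : R => t*u) by move=> t; apply: cvgM; side.
 rewrite qE => t; rewrite /continuous_at; under eq_fun do rewrite !expr2; rewrite !expr2.
 have c1 : complex.Re (w (s*u)) @[s --> t] --> complex.Re (w (t*u)) by apply: (@continuous_comp _ _ _ (fun t : R => t*u) (fun v : R => complex.Re (w v))); [exact: cu|exact: cr].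
 have c2 : complex.Im (w (s*u)) @[s --> t] --> complex.Im (w (t*u)) by apply: (@continuous_comp _ _ _ (fun t : R => t*u) (fun v : R => complex.Im (w v))); [exact: cu|exact: ci].
 by apply: cvgD; side.
have [//|hu] := root_of_unity_gap m0 (wm u).
have q0 : q 0 = 0 by rewrite /q mul0r w0 subrr cn0 expr0n.
have q1 : m%:R^-1 ^+ 2 <= q 1 by rewrite /q mul1r ler_sqr ?nnegrE ?cn_ge0// ltW.
have s0 : 0 < m%:R^-1 ^+ 2 :> R by [].
have [||t _ qt] := @IVT _ q 0 1 (m%:R^-1 ^+ 2/2) ler01.
- exact: continuous_subspaceT.
- have q1' := le_trans (ltW s0) q1; rewrite q0 (min_l q1') (max_r q1').
 by lra.
have [e|h] := root_of_unity_gap m0 (wm (t*u)).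
 have e' : q t = 0 by rewrite /q e subrr cn0 expr0n.
 exfalso; move: qt s0; rewrite e'; clear; move: (_ ^+ 2) => a ? ?; lra.
have h2 : m%:R^-1 ^+ 2 <= q t by rewrite /q ler_sqr ?nnegrE ?cn_ge0// ltW.
exfalso; move: h2 s0; rewrite qt; clear; move: (_ ^+ 2) => a; lra.
Qed.

End Roots.

(** * Characteristic functions of Levy increments *)

Section LevyRoot.
Context {d} {W : measurableType d} {R : realType}.
Variables (P : probability W R) (L : W -> skorohod R) (S : probability (measurableTypeR R) R).
Hypotheses (hL : levy_process P L) (hL1 : same_law P (fun w => L w 1) S (fun x => x)).
Variables (pR pI : R -> R).
Hypothesis hS : forall u, charfun S u = cexp (pR u +i* pI u)%C.
Hypotheses (cR : continuous pR) (cI : continuous pI) (pR0 : pR 0 = 0) (pI0 : pI 0 = 0).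
Variable m : nat.
Hypothesis m0 : (0 < m)%N.

Definition levy_inc (i : nat) (w : W) : R := L w (i.+1%:R / m%:R)-L w (i%:R / m%:R).

Let mR : 0 < m%:R :> R. Proof. by []. Qed.
Lemma mlevy t : 0 <= t -> mfun W (fun w => L w t : R).
by case: hL => h _ _ _; exact: h. Qed.
Lemma mlevy_inc i : mfun W (levy_inc i).
clear mR m0; by apply: measurable_funB; apply: mlevy; side. Qed.
Lemma levy_indep N : independent P N levy_inc.
case: hL => _ _ h _; apply: (h N (fun i => i%:R / m%:R)); first side.
by move=> i _; rewrite ltr_pM2r// ltr_nat.
Qed.
Lemma levy_inc_echar u i : echar P (fun w => u * levy_inc i w) = echar P (fun w => u*L w m%:R^-1).
have mU : mfun R (fun y : R => u*y) by [].
have law : same_law P (levy_inc i) P (fun w => L w m%:R^-1).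
 case: hL => _ _ _ h; have := h (i%:R / m%:R) (i.+1%:R / m%:R).
 have -> : i.+1%:R / m%:R - i%:R / m%:R = m%:R^-1 :> R by lra.
 apply.
 by [].
 by rewrite ler_pM2r// ler_nat.
have mL : mfun W (fun w => L w m%:R^-1 : R) by apply: mlevy; side.
have bc : bmf (fun y : R => cos (u*y)) by [].
have bs : bmf (fun y : R => sin (u*y)) by [].
rewrite /echar; congr (_ +i* _)%C.
 exact: (ex_same_law (mlevy_inc i) mL law bc).
exact: (ex_same_law (mlevy_inc i) mL law bs).
Qed.
Lemma levy_one u : echar P (fun w => u*L w m%:R^-1) ^+ m = cexp (pR u +i* pI u)%C.
have m1 : mfun W (fun w => L w 1 : measurableTypeR R) by exact: mlevy.
have mid : measurable_fun [set: measurableTypeR R] (fun x : R => x) by exact: measurable_id.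
have e1 : echar P (fun w => u*L w 1) = charfun S u.
 by rewrite /echar /charfun; congr (_ +i* _)%C; [apply: (ex_same_law m1 mid hL1 (bmf_cos _))|apply: (ex_same_law m1 mid hL1 (bmf_sin _))] => //.
have pE : \prod_(i < m) echar P (fun w => u * levy_inc i w) = echar P (fun w => u*L w m%:R^-1) ^+ m.
 by rewrite (eq_bigr (fun=> echar P (fun w => u*L w m%:R^-1))) ?prodr_const ?card_ord// => i _; exact: levy_inc_echar.
have tele w : \sum_(i < m) u * levy_inc i w = u * (L w 1-L w 0).
 rewrite -mulr_sumr; congr (_ * _); rewrite /levy_inc -(big_mkord xpredT (fun i => L w (i.+1%:R / m%:R)-L w (i%:R / m%:R))).
 by rewrite (telescope_sumr (fun i => L w (i%:R / m%:R)))// mul0r divff// gt_eqF.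
have ae (h : R -> R) : bmf (fun w => h (u * (L w 1-L w 0))) -> bmf (fun w => h (u*L w 1)) ->
 ex P (fun w => h (u * (L w 1-L w 0))) = ex P (fun w => h (u*L w 1)).
 by move=> b1 b2; apply: (@ex_ae _ _ _ P _ _ (fun w => L w 0 = 0)) => // [|w ->]; [case: hL|rewrite subr0].
have m0' : mfun W (fun w => L w 0 : R) by exact: mlevy.
have h1 := indep_cos mlevy_inc (fun=> u) (levy_indep m) 0.
have h2 := indep_cos mlevy_inc (fun=> u) (levy_indep m) (0-pi/2).
rewrite Re_cis_shift in h2; rewrite pE cis0 mul1r in h1 h2.
rewrite -hS -e1; apply/eqP; rewrite eq_complex /= -h1 -h2; apply/andP; split; apply/eqP.
 rewrite -(ae cos); [|exact: bmf_cos|exact: bmf_cos].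
 by apply: ex_eq => w; rewrite tele addr0.
rewrite -(ae sin); [|exact: bmf_sin|exact: bmf_sin].
by apply: ex_eq => w; rewrite tele sub0r cosBpihalf.
Qed.
Lemma echar_cvg (Z : W -> R) : mfun W Z ->
 continuous (fun u : R => complex.Re (echar P (fun w => u*Z w))) /\ continuous (fun u : R => complex.Im (echar P (fun w => u*Z w))).
move=> mZ; split=> u; apply/cvgrPdist_le => e e0; have [de [de0 hde]] := echar_continuous P mZ e0;
 exists de => //= v; rewrite /ball => uv; apply: le_trans (hde u v (ltW uv)).
 exact: le_trans (cn_Re (_ - _)).
exact: le_trans (cn_Im (_ - _)).
Qed.

(** The [m]-th power is [exp psi] by independence and stationarity, so the quotient by
    [exp (psi / m)] is a continuous [m]-th root of unity equal to 1 at 0. *)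
Theorem levy_inc_charfun u i :
 echar P (fun w => u * levy_inc i w) = cexp ((pR u / m%:R) +i* (pI u / m%:R))%C.
rewrite levy_inc_echar; set g := fun u => echar P (fun w => u*L w m%:R^-1).
have mL : mfun W (fun w => L w m%:R^-1 : R) by apply: mlevy; rewrite invr_ge0.
have [c1 c2] := echar_cvg mL.
pose z v : R[i] := ((pR v / m%:R) +i* (pI v / m%:R))%C.
pose w v := g v*cexp (- z v).
have zm v : z v *+ m = (pR v +i* pI v)%C.
 rewrite -mulr_natl; have -> : (m%:R : R[i]) = (m%:R%:C)%C by rewrite rmorph_nat.
 by apply/eqP; rewrite eq_complex /=; apply/andP; split; apply/eqP; field; rewrite gt_eqF.
have cp (p : R -> R) : continuous p -> continuous (fun v => - (p v / m%:R)).
 by move=> cp' v'; apply: cvgN; apply: cvgM; [exact: cp'|exact: cvg_cst].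
have cE : continuous (fun v => expR (- (pR v / m%:R))) by move=> v'; apply: continuous_comp; [exact: cp|exact: continuous_expR].
have cC : continuous (fun v => cos (- (pI v / m%:R))) by move=> v'; apply: continuous_comp; [exact: cp|exact: continuous_cos].
have cS : continuous (fun v => sin (- (pI v / m%:R))) by move=> v'; apply: continuous_comp; [exact: cp|exact: continuous_sin].
have key : w u = 1.
 apply: (continuous_root_eq1 m0) => [v|||].
 - by rewrite /w exprMn levy_one -cexp_natmul mulNrn zm -cexpD subrr cexp0.
 - rewrite /w /g /z pR0 pI0 !mul0r (_ : - _ = 0) ?cexp0 ?mulr1; last by apply/eqP; rewrite eq_complex /= oppr0 eqxx.
 apply/eqP; rewrite eq_complex /=; apply/andP; split; apply/eqP.
 by rewrite -[RHS](ex_cst P); apply: ex_eq => x; rewrite mul0r cos0.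
 by rewrite -[RHS](ex_cst P); apply: ex_eq => x; rewrite mul0r sin0.
 - move=> v; rewrite /continuous_at.
 have E v' : complex.Re (w v') = complex.Re (g v') * (expR (- (pR v' / m%:R))*cos (- (pI v' / m%:R))) -
 complex.Im (g v') * (expR (- (pR v' / m%:R))*sin (- (pI v' / m%:R))) by rewrite /w /cexp /=; ring.
 rewrite E; under eq_fun do rewrite E.
 by apply: cvgB; apply: cvgM; [exact: c1|apply: cvgM; [exact: cE|exact: cC]|exact: c2|apply: cvgM; [exact: cE|exact: cS]].
 - move=> v; rewrite /continuous_at.
 have E v' : complex.Im (w v') = complex.Re (g v') * (expR (- (pR v' / m%:R))*sin (- (pI v' / m%:R))) +
 complex.Im (g v') * (expR (- (pR v' / m%:R))*cos (- (pI v' / m%:R))) by rewrite /w /cexp /=; ring.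
 rewrite E; under eq_fun do rewrite E.
 by apply: cvgD; apply: cvgM; [exact: c1|apply: cvgM; [exact: cE|exact: cS]|exact: c2|apply: cvgM; [exact: cE|exact: cC]].
have : g u = w u*cexp (z u) by rewrite /w -mulrA -cexpD addNr cexp0 mulr1.
by rewrite key mul1r.
Qed.

End LevyRoot.

(** * Lipschitz bounds for exponentials and products in the unit disc *)

Section ComplexBounds.
Context {R : realType}.
Implicit Types z w : R[i].

Lemma cexp_lip z w : complex.Re z <= 0 -> complex.Re w <= 0 -> cn (cexp z-cexp w) <= 2*cn (z-w).
have key z' w' : complex.Re w' <= 0 -> complex.Re (z'-w') <= 0 -> cn (cexp z'-cexp w') <= 2*cn (z'-w').
 move=> hw h; have -> : cexp z'-cexp w' = cexp w' * (cexp (z'-w')-1).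
 by rewrite mulrBr -cexpD mulr1 subrKC.
 rewrite cnM -[leRHS]mul1r; apply: ler_pM; rewrite ?cn_ge0//; last exact: cexp_sub1.
 by rewrite cn_cexp -expR0 ler_expR.
move=> hz hw; have e : complex.Re (z-w) = - complex.Re (w-z) by case: (z) (w) => [a b] [a' b']; ring.
have [h|h] := leP (complex.Re (z-w)) 0; first exact: key.
rewrite cnBC [cn (z-w)]cnBC; apply: key => //; by rewrite -oppr_ge0 -e ltW.
Qed.
Lemma cn_prod_sub N (z w : nat -> R[i]) : (forall i, cn (z i) <= 1) -> (forall i, cn (w i) <= 1) ->
 cn (\prod_(i < N) z i - \prod_(i < N) w i) <= \sum_(i < N) cn (z i-w i).
move=> hz hw; elim: N => [|N IH]; first by rewrite !big_ord0 subrr cn0.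
rewrite !big_ord_recr /=; set p := \prod_(i < N) z i; set q := \prod_(i < N) w i.
have -> : p*z N-q*w N = p * (z N-w N) + (p-q)*w N by ring.
have p1 : cn p <= 1 by apply: cn_prod => i; side.
rewrite addrC (le_trans (cnD _ _))// !cnM lerD//.
 by rewrite ler_piMl ?cn_ge0.
by apply: le_trans IH; rewrite ler_piMr ?cn_ge0.
Qed.
Lemma cn_pow1 z k : cn z <= 1 -> cn (z ^+ k) <= 1.
move=> h; elim: k => [|k IH]; first by rewrite cn1.
by rewrite exprS cnM -[leRHS]mul1r; apply: ler_pM; rewrite ?cn_ge0.
Qed.

Context {d} {X : measurableType d} (mu : probability X R).

Lemma echar_shift (H : X -> R) s : mfun X H ->
 ex mu (fun x => cos (H x+s)) = complex.Re (cis s*echar mu H).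
move=> mH; have bc := bmf_cos mH; have bs := bmf_sin mH; rewrite /echar /=.
rewrite -exZ// -[X in _-X]exZ// -exB; [|side|side].
by apply: ex_eq => x; rewrite cosD; ring.
Qed.

End ComplexBounds.

(** * First entrance decompositions *)

Section FirstHit.
Context {d} {X : measurableType d} {R : realType}.
Variables (mu : probability X R) (T : X -> X) (c : X -> nat) (K g : R).
Hypothesis hc : mixing_code mu T c K g.
Variable S : nat -> set X.
Hypothesis hS : forall k, saturated T c k (S k).
Local Notation m := (pr mu).

Fixpoint hit n : set X := if n is k.+1 then hit k `|` S k.+1 else S 0.
Definition first k : set X := if k is i.+1 then S k `\` hit i else S 0.

Lemma hitP n x : hit n x <-> exists2 k, (k <= n)%N & S k x.
elim: n => [|n IH]; first by split=> [h|[[|k]]//]; exists 0%N.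
split=> [[/IH[k kn]|h]|[k]]; [by exists k => //; exact: leqW|by exists n.+1|].
by rewrite leq_eqVlt ltnS => /orP[/eqP->|kn h]; [right|left; apply/IH; exists k].
Qed.
Lemma first_hit n x : hit n x -> exists k, [/\ (k <= n)%N, first k x & forall i, (i < k)%N -> ~ S i x].
elim: n => [h|n IH h]; first by exists 0%N.
have [h'|h'] := pselect (hit n x); first by have [k [k1 k2 k3]] := IH h'; exists k; split=> //; exact: leqW.
exists n.+1; split=> //; first by split=> //; case: h.
by move=> i ik Si; apply: h'; apply/hitP; exists i.
Qed.
Lemma hit_saturated n : saturated T c n (hit n).
elim: n => [|n IH]; first exact: hS.
move=> x y sxy [h|h]; [left|right]; last exact: hS sxy h.
by apply: IH h => i ik; apply: sxy; exact: ltnW.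
Qed.
Lemma first_saturated k : saturated T c k (first k).
case: k => [|k]; first exact: hS.
move=> x y sxy [h1 h2]; split; first exact: hS sxy h1.
move=> h; apply: h2; apply: (hit_saturated _ h) => i ik; by rewrite sxy// ltnW.
Qed.

Let mhit n : measurable (hit n). Proof. apply: (msat hc (k := n)); exact: hit_saturated. Qed.
Let mfirst n : measurable (first n). Proof. apply: (msat hc (k := n)); exact: first_saturated. Qed.

(* The sets [W k] are evaluated after the first hit, which decouples them from it. *)
Fixpoint later (W : nat -> set X) n : set X :=
 if n is k.+1 then later W k `|` (first k.+1 `&` iter k.+1 T @^-1` W k.+1) else first 0 `&` W 0.

Lemma later_measurable W n : (forall k, measurable (W k)) -> measurable (later W n).
move=> mW; elim: n => [|n IH]; first exact: (measurableI _ _ (mfirst 0) (mW 0%N)).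
exact: (measurableU _ _ IH (measurableI _ _ (mfirst n.+1) (mpren (code_map hc) n.+1 (mW n.+1)))).
Qed.
Lemma later_hit W k n x : (k <= n)%N -> first k x -> W k (iter k T x) -> later W n x.
move=> + h1 h2; elim: n => [|n IH]; first by rewrite leqn0 => /eqP k0; move: h1 h2; rewrite k0.
by rewrite leq_eqVlt ltnS => /orP[/eqP e|/IH]; [right; rewrite -e|left].
Qed.
(** The first entrance events are disjoint and determined by the past, so each meets its later event
    with probability at most [1 + K] times the product ([mix_ub]). *)
Lemma later_bound W n p : (forall k, measurable (W k)) -> 0 <= p -> (forall k, (k <= n)%N -> m (W k) <= p) ->
 m (later W n) <= (1+K) * p * m (hit n).
move=> mW p0; have K0 := code_K hc.
have one k : m (W k) <= p -> m (first k `&` iter k T @^-1` W k) <= (1+K) * p * m (first k).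
 move=> hp; have mWk : measurable (iter k T @^-1` W k) by exact: (mpren (code_map hc)).
 have bF := @bmf_indic _ X R _ (mfirst k); have bW := @bmf_indic _ X R _ (mW k).
 have wF : word_fun T c k (\1_(first k) : X -> R) by apply: indic_word; exact: first_saturated.
 have := mix_ub hc wF bF bW (fun x => _) (fun x => _); rewrite !ex_indic//.
 have -> : ex mu (fun x => \1_(first k) x * \1_(W k) (iter k T x)) = m (first k `&` iter k T @^-1` W k) by rewrite -ex_indicM//; side.
 move=> h; apply: le_trans (h _ _) _; [side|side|].
 by rewrite -mulrA ler_wpM2l// mulrC ler_wpM2r// pr_ge0.
elim: n => [|n IH] hp; first exact: (one 0%N (hp 0%N isT)).
have -> : m (hit n.+1) = m (hit n)+m (first n.+1).
 rewrite -prU//; first by congr (pr mu _); apply/seteqP; split=> x; [move=> [h|h]; [by left|have [|] := pselect (hit n x); [by left|by right]]|move=> [h|[h _]]; [left|right]].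
 by apply/seteqP; split=> x //= [h [_ h2]].
apply: (le_trans (pr_subU _ _ _)); [exact: later_measurable|by apply: measurableI => //; exact: (mpren (code_map hc))|].
rewrite mulrDr lerD//; last exact: one (hp _ (leqnn _)).
by apply: IH => k kn; apply: hp; exact: leqW.
Qed.

End FirstHit.

(** * Jumps of right-continuous paths with left limits *)

Section JumpSplitting.
Context {R : realType}.
Implicit Types (x y : skorohod R) (p e a b : R).

(** Allows a single jump of any size, at [c], and otherwise only oscillations of size [e] around the
    values at the two ends. *)
Definition split_on e x a b : Prop := exists c, [/\ a < c <= b,
 forall t, a <= t < c -> `|x t-x a| <= e & forall t, c <= t <= b -> `|x t-x b| <= e].

Lemma right_nbhd x p e : 0 <= p -> 0 < e -> exists r, 0 < r /\ forall t, p <= t < p+r -> `|x t-x p| <= e.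
move=> p0 e0; have /cvgrPdist_le/(_ e e0)[r r0 hr] := @cadlag_right_cont R x p p0.
exists r; split=> // t /andP[]; rewrite le_eqVlt => /predU1P[<- _|pt tp]; first by rewrite subrr normr0 ltW.
by rewrite distrC; apply: hr => //=; rewrite ltr_distlC; lra.
Qed.
Lemma left_nbhd x p e : 0 < p -> 0 < e -> exists r l, 0 < r /\ forall t, p-r < t < p -> `|x t-l| <= e.
move=> p0 e0; have /cvg_ex[l /cvgrPdist_le/(_ e e0)[r r0 hr]] := @cadlag_left_lim R x p p0.
exists r, l; split=> // t /andP[pt tp].
by rewrite distrC; apply: hr => //=; rewrite ltr_distlC; lra.
Qed.
Lemma local_split x p e : 0 <= p -> 0 < e -> exists r, 0 < r /\
 forall a b, 0 <= a -> a < b -> p-r < a -> b < p+r -> split_on e x a b.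
move=> p0 e0; have e20 : 0 < e/2 by lra.
have tri (u v l : R) : `|u-l| <= e/2 -> `|v-l| <= e/2 -> `|u-v| <= e.
 by move=> h1 h2; rewrite (le_trans (ler_distD l _ _))// [`|l-v|]distrC; lra.
have [r [r0 hr]] := right_nbhd x p0 e20.
have [r' [l [r'0 hl]]] : exists r' l, 0 < r' /\ forall t, 0 <= t -> p-r' < t < p -> `|x t-l| <= e/2.
 move: p0; rewrite le_eqVlt => /predU1P[<-|p0]; first by exists 1, 0; split=> // t t0; lra.
 by have [r' [l [r'0 hl]]] := left_nbhd x p0 e20; exists r', l; split=> // t _; exact: hl.
exists (Num.min r r'); split=> [|a b a0 ab pa bp]; first by rewrite lt_min r0.
have [mr mr'] : Num.min r r' <= r /\ Num.min r r' <= r' by rewrite !ge_min !lexx orbT.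
have [pa'|ap] := leP p a.
 exists b; split=> [|t /andP[at_ tb]|t]; first side.
 by apply: (tri _ _ (x p)); apply: hr; lra.
 by rewrite -eq_le => /eqP <-; rewrite subrr normr0 ltW.
have [pb|bp'] := leP p b.
 exists p; split=> [|t /andP[at_ tb]|t /andP[at_ tb]]; first side.
 by apply: (tri _ _ l); apply: hl; side.
 by apply: (tri _ _ (x p)); apply: hr; lra.
exists b; split=> [|t /andP[at_ tb]|t]; first side.
 by apply: (tri _ _ l); apply: hl; side.
by rewrite -eq_le => /eqP <-; rewrite subrr normr0 ltW.
Qed.
(** Compactness of [[0, K]] makes the radius of [local_split] uniform. *)
Lemma uniform_split x K e : 0 < e -> exists r, 0 < r /\
 forall a b, 0 <= a <= K -> a < b <= a+r -> split_on e x a b.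
move=> e0; have /compact_near_coveringP h := @segment_compact R 0 K.
have [|r /= r0 hr] := h R (0^'+) (fun r a => forall b, 0 <= a <= K -> a < b <= a+r -> split_on e x a b) _.
 move=> p /=; rewrite in_itv => /andP[p0 _].
 have [r [r0 hr]] := local_split x p0 e0; have r20 : 0 < r/2 by lra.
 exists ([set a | `|a-p| < r/2], [set s | s < r/2]) => /=.
 split; last exact: nbhs_right_lt.
 by apply/nbhs_ballP; exists (r/2) => //= a; rewrite /ball /= distrC.
 move=> [a s] /= [ha hs] b /andP[a0 _] /andP[ab bs].
 by move: ha; rewrite ltr_distlC => /andP[h1 h2]; apply: hr; lra.
exists (r/2); split=> [|a b haK hab]; first by lra.
apply: (hr (r/2) _ _ a haK b haK hab); last by lra.
by rewrite /ball_ /= sub0r normrN gtr0_norm; lra.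
Qed.
(** [ps] collects the ends of short windows and the splitting times inside them. The neighbourhood
    of a point away from [ps] lies on one side of the jump of its window. *)
Lemma jump_points x K e : 0 < e -> exists ps : seq R, forall r s, 0 < s < K ->
 (forall p, p \in ps -> r < `|s-p|) -> r < s /\ forall t, `|t-s| <= r -> `|x t-x s| <= e.
move=> e0; have e20 : 0 < e/2 by lra.
have [r0 [r00 hr0]] := uniform_split x K e20.
have hc i : exists c, i%:R*r0 <= K -> [/\ i%:R*r0 < c <= i.+1%:R*r0,
 forall t, i%:R*r0 <= t < c -> `|x t-x (i%:R*r0)| <= e/2 &
 forall t, c <= t <= i.+1%:R*r0 -> `|x t-x (i.+1%:R*r0)| <= e/2].
 have [iK|iK] := leP (i%:R*r0) K; last by exists 0 => ?; lra.
 have [||c hc] := hr0 (i%:R*r0) (i.+1%:R*r0); last by exists c.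
 by rewrite iK mulr_ge0// ltW.
 by rewrite -natr1; apply/andP; split; lra.
have [c {}hc] := boolp.choice hc.
pose M := (Num.truncn (K/r0)).+1.
exists ([seq i%:R*r0 | i <- iota 0 M.+1] ++ [seq c i | i <- iota 0 M]) => r s /andP[s0 sK] hps.
have KM : K < M%:R*r0 by rewrite -ltr_pdivrMr// truncnS_gt.
have /andP[] : (Num.truncn (s/r0))%:R <= s/r0 < (Num.truncn (s/r0)).+1%:R.
 by apply: truncn_itv; rewrite divr_ge0// ltW.
rewrite ler_pdivlMr// ltr_pdivrMr//; move: (Num.truncn _) => i h1 h2.
have iM : (i < M)%N by rewrite -(ltr_nat R) -(ltr_pM2r r00); lra.
have n1 j : (j <= M)%N -> r < `|s-j%:R*r0|.
 by move=> jM; apply: hps; rewrite mem_cat; apply/orP; left; apply/mapP; exists j; rewrite ?mem_iota.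
have n2 : r < `|s-c i| by apply: hps; rewrite mem_cat; apply/orP; right; apply/mapP; exists i; rewrite ?mem_iota.
have := n1 0%N isT; rewrite mul0r subr0 gtr0_norm// => rs; split=> // t.
have {hc}[|/andP[c1 c2] hl hu] := hc i; first by lra.
have := n1 _ (ltnW iM); have := n1 _ iM; rewrite ler_distl => m1 m2 /andP[t1 t2].
have [sc|cs] := ltP s (c i).
 have h t' : i%:R*r0 <= t' < c i -> `|x t'-x (i%:R*r0)| <= e/2 by exact: hl.
 rewrite (le_trans (ler_distD (x (i%:R*r0)) _ _))// [`|_-x s|]distrC.
 have := h t; have := h s; move: m2 n2; rewrite ger0_norm ?subr_ge0// ltr0_norm; lra.
rewrite (le_trans (ler_distD (x (i.+1%:R*r0)) _ _))// [`|_-x s|]distrC.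
have := hu t; have := hu s; move: m1 n2; rewrite ltr0_norm ?subr_lt0// ger0_norm; lra.
Qed.

End JumpSplitting.

(** * An upper bound for the J1 distance *)

Section J1Bound.
Context {R : realType}.
Implicit Types x y : skorohod R.
Local Notation leb := (@lebesgue_measure R).

(* no measurability is assumed: [J1_dist] integrates a function that is not known to be measurable *)
Lemma integral_mono (F g : R -> \bar R) : (forall s, 0 <= F s)%E -> (forall s, F s <= g s)%E ->
 (\int[leb]_s F s <= \int[leb]_s g s)%E.
move=> F0 Fg; rewrite !ge0_integralTE//; last by move=> s; exact: le_trans (Fg s).
by apply: le_ereal_sup => _ [h hF <-]; exists h => // s; exact: le_trans (Fg s).
Qed.
(** The integrand is dominated by [2 * c] times the exponential density of rate 1/2, plus the
    indicators of the intervals of half-width [r] around the points of [ps]. *)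
Lemma J1_dist_bound x y (c r : R) (ps : seq R) : 0 <= c -> 0 <= r ->
 (forall s, 0 < s -> (forall p, p \in ps -> r < `|s-p|) ->
 ((expR (- s))%:E * mine 1 (J1_dist_on s x y) <= (c*expR (- (s/2)))%:E)%E) ->
 (J1_dist x y <= (2*c + (size ps)%:R * (2*r))%:E)%E.
move=> c0 r0 hs.
pose I p := `[p-r, p+r]%classic.
have mI p : measurable (I p : set (measurableTypeR R)) by exact: measurable_itv.
pose g (s : R) : \bar R := ((2*c)%:E * (exponential_pdf (1/2) s)%:E + \sum_(p <- ps) (\1_(I p) s)%:E)%E.
have g10 s : (0 <= (2*c)%:E * (exponential_pdf (1/2) s)%:E)%E.
 by rewrite -EFinM lee_fin mulr_ge0// exponential_pdf_ge0.
have g20 s : (0 <= \sum_(p <- ps) (\1_(I p) s)%:E)%E by apply: sume_ge0 => p _; rewrite lee_fin.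
have J0 s : 0 < s -> (0 <= J1_dist_on s x y)%E.
 move=> s0; apply: le_ereal_inf_tmp => _ [lam _ <-]; rewrite le_max; apply/orP; right.
 apply: (@le_trans _ _ (`|lam 0-0|)%:E); first by rewrite lee_fin.
 by apply: ereal_sup_ubound; exists 0 => //=; rewrite in_itv /= lexx ltW.
rewrite /J1_dist integral_mkcond.
apply: (@le_trans _ _ (\int[leb]_s g s)%E); first apply: integral_mono => s.
- rewrite patchE; case: ifPn => //; rewrite inE /= in_itv /= andbT => s0.
 by rewrite mule_ge0 ?lee_fin ?expR_ge0// le_min lee01 J0.
- rewrite patchE; case: ifPn => [|_]; last by rewrite adde_ge0.
 rewrite inE /= in_itv /= andbT => s0.
 have [/hasP[p pps hp]|/hasPn h] := boolP (has (fun p => `|s-p| <= r) ps).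
 apply: (@le_trans _ _ 1%E).
 rewrite -[leRHS]mul1e lee_pmul ?lee_fin ?expR_ge0//; [by rewrite le_min lee01 J0| |by rewrite ge_min lexx].
 by rewrite expR_le1 oppr_le0 ltW.
 rewrite /g (big_rem p)//= indicE mem_set; last by rewrite /I /= in_itv /= -ler_distl.
 by rewrite -[leLHS]add0e leeD// -[leLHS]adde0 leeD// sume_ge0// => q _; rewrite lee_fin.
 have {}h p : p \in ps -> r < `|s-p| by move=> /h; rewrite -ltNge.
 apply: (le_trans (hs _ s0 h)); rewrite -[leLHS]adde0 leeD// -EFinM lee_fin exponential_pdfE ?(ltW s0)//.
 by rewrite (_ : - (1/2)*s = - (s/2)); [move: (expR _) => E; lra|lra].
rewrite ge0_integralD//=; last 2 first.
- by apply: emeasurable_funM => //; apply/measurable_EFinP; exact: measurable_exponential_pdf.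
- by apply: emeasurable_sum => p; apply/measurable_EFinP; exact: measurable_indic.
rewrite ge0_integralZl_EFin//; last 2 first.
- by move=> s _; rewrite lee_fin exponential_pdf_ge0.
- by apply/measurable_EFinP; exact: measurable_exponential_pdf.
rewrite integral_exponential_pdf// mule1 EFinD leeD//.
rewrite ge0_integral_sum//.
elim: (ps) => [|p qs IH]; first by rewrite big_nil /= mul0r.
rewrite big_cons /= -natr1 mulrDl mul1r [_+2*r]addrC EFinD leeD//.
rewrite integral_indic// setIT; have := lebesgue_measure_itv `[p-r, p+r]; rewrite /I /= => ->; case: ifP => _; rewrite ?lee_fin//; lra.
Qed.

End J1Bound.

(** * Closeness of paths up to time changes *)

Section TimeChange.
Context {R : realType}.
Implicit Types x y z : skorohod R.

(* a time change is given by its graph, so that inverses and composites are immediate *)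
Definition time_change (G : R -> R -> Prop) : Prop :=
 [/\ forall a, 0 <= a -> exists b, G a b, forall b, 0 <= b -> exists a, G a b,
 forall a b, G a b -> 0 <= a /\ 0 <= b &
 forall a b a' b', G a b -> G a' b' -> (a < a') = (b < b')].

(** A form of J1-closeness on the half line without integrals: the values are compared as long as
    one of the two times is at most [e^-1]. *)
Definition close (e : R) x y : Prop := exists2 G, time_change G &
 forall a b, G a b -> `|a-b| <= e /\ (a <= e^-1 \/ b <= e^-1 -> `|x a-y b| <= e).

Lemma close_sym e x y : close e x y -> close e y x.
move=> [G [h1 h2 h3 h4] hG]; exists (fun a b => G b a).
 by split=> // [a b /h3[]|a b a' b' g g'] //; rewrite (h4 _ _ _ _ g g').
by move=> a b /hG[h5 h6]; rewrite distrC; split=> // h; rewrite distrC; side.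
Qed.
Lemma close_mono e e' x y : 0 < e -> e <= e' -> close e x y -> close e' x y.
move=> e0 ee' [G tG hG]; exists G => // a b /hG[h1 h2]; split=> [|h]; first side.
have i : e'^-1 <= e^-1 by rewrite lef_pV2// posrE; side.
by lra.
Qed.
Lemma close_trans e e' x y z : 0 < e -> 0 < e' -> e+e' <= 1 -> close e x y -> close e' y z -> close (e+e') x z.
move=> e0 e'0 ee' [G [g1 g2 g3 g4] hG] [G' [g1' g2' g3' g4'] hG'].
exists (fun a c => exists2 b, G a b & G' b c); first split.
- by move=> a /g1[b Gab]; have [_ /g1'[c G'bc]] := g3 _ _ Gab; exists c, b.
- by move=> c /g2'[b G'bc]; have [/g2[a Gab] _] := g3' _ _ G'bc; exists a, b.
- by move=> a c [b /g3[? _] /g3'[_ ?]].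
- by move=> a c a' c' [b h1 h2] [b' h1' h2']; rewrite (g4 _ _ _ _ h1 h1') (g4' _ _ _ _ h2 h2').
move=> a c [b /hG[h1 h2] /hG'[h1' h2']]; split; first by rewrite (le_trans (ler_distD b _ _))// lerD.
(* The horizons fit together: a time up to [(e + e')^-1], displaced by at most [e], stays below
   [e'^-1]. *)
have inv (u v : R) : 0 < u -> 0 < v -> u+v <= 1 -> (u+v)^-1+u <= v^-1.
 move=> u0 v0 uv; have w0 : 0 < u+v by rewrite addr_gt0.
 have -> : v^-1 = (u+v)^-1+u / (v * (u+v)) by field; side.
 by rewrite lerD2l ler_pdivlMr// ler_piMr//; nra.
have i1 := inv _ _ e0 e'0 ee'; have i2 := inv _ _ e'0 e0; rewrite addrC in i2; have {}i2 := i2 ee'.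
move=> h; rewrite (le_trans (ler_distD (y b) _ _))//; move: h1 h1'; rewrite !ler_distl => /andP[? ?] /andP[? ?].
apply: lerD.
 by lra.
by lra.
Qed.
(** Making the relation trivial from scale 1 on gives a triangle inequality without any restriction
    on the scales. *)
Definition near_path e x y : Prop := 1 <= e \/ close e x y.

Lemma near_path_sym e x y : near_path e x y -> near_path e y x.
by case=> [|/close_sym]; [left|right]. Qed.
Lemma near_path_trans e e' x y z : 0 < e -> 0 < e' -> near_path e x y -> near_path e' y z -> near_path (e+e') x z.
move=> e0 e'0 h h'; have [|ee'] := leP 1 (e+e'); [by left|right].
case: h => [|h]; first lra; case: h' => [|h']; first lra.
by apply: close_trans h h' => //; side.
Qed.

(* The time change is modified on [s-2 d, s] so as to end at [s]; this costs little when [x] is nearly constant there. *)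
Lemma close_J1_on (d e s : R) x y : 0 < d -> close d x y -> 4*d < s -> s <= d^-1 ->
 (forall t, `|t-s| <= 4*d -> `|x t-x s| <= e) -> (J1_dist_on s x y <= (2*e+3*d)%:E)%E.
move=> d0 [G [g1 g2 g3 g4] hG] ds sd hx.
have /boolp.choice[ph hph] : forall b, exists a, 0 <= b -> G a b.
 by move=> b; have [/g2[a Ga]|b0] := leP 0 b; [exists a|exists 0 => b0'; lra].
have phi b : 0 <= b -> 0 <= ph b /\ b-d <= ph b <= b+d.
 by move=> b0; have /hG[] := hph _ b0; rewrite ler_distl; have [] := g3 _ _ (hph _ b0).
have phm b b' : 0 <= b -> 0 <= b' -> (ph b < ph b') = (b < b') by move=> b0 b0'; apply: g4; exact: hph.
have phs a : 0 <= a -> exists2 b, 0 <= b & ph b = a.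
 move=> a0; have [b Gab] := g1 _ a0; have [_ b0] := g3 _ _ Gab; exists b => //.
 by have := g4 _ _ _ _ (hph _ b0) Gab; have := g4 _ _ _ _ Gab (hph _ b0); rewrite ltxx; case: ltgtP.
pose s' := s-2*d; have s'0 : 0 <= s' by rewrite /s'; lra.
have [ps0 /andP[ps1 ps2]] := phi _ s'0.
pose m := (s-ph s') / (2*d).
have m0 : 0 < m by apply: divr_gt0 => //; rewrite /s' in ps2; lra.
have md : m * (2*d) = s-ph s' by rewrite /m divfK.
pose lam b := if b <= s' then ph b else ph s' + (b-s') * m.
have lam_le b : b <= s' -> lam b = ph b by rewrite /lam => ->.
have lam_gt b : s' < b -> lam b = ph s' + (b-s') * m by rewrite /lam leNgt => ->.
have incr b b' : 0 <= b -> b < b' -> lam b < lam b'.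
 move=> b0 bb'; have [b's|sb'] := leP b' s'.
 by rewrite !lam_le// ?phm// ?(le_trans _ b's) ?ltW//; lra.
 have [bs|sb] := leP b s'; last by rewrite !lam_gt// ltrD2l ltr_pM2r// ltrD2r.
 rewrite lam_le// lam_gt//; apply: (@le_lt_trans _ _ (ph s')); first by rewrite leNgt phm// -leNgt.
 by rewrite ltrDl mulr_gt0// subr_gt0.
have ph0 : ph 0 = 0.
 have [b b0 pb] := phs 0 (lexx _); have := phm b 0 b0 (lexx _); have [p0 _] := phi 0 (lexx _).
 by rewrite pb [b < 0]ltNge b0 /= => /negbT; rewrite -leNgt => p1; apply/le_anti; rewrite p0 p1.
have lam0 : lam 0 = 0 by rewrite lam_le.
have lams : lam s = s by rewrite lam_gt; [have -> : s-s' = 2*d by rewrite /s'; lra|rewrite /s'; lra]; rewrite mulrC md addrC subrK.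
have incre b b' : 0 <= b -> b <= b' -> lam b <= lam b'.
 by move=> b0; rewrite le_eqVlt => /predU1P[->//|/(incr _ _ b0)/ltW].
have onto a : 0 <= a <= s -> exists2 b, 0 <= b <= s & lam b = a.
 move=> /andP[a0 as_]; have [as'|sa] := leP a (ph s').
 have [b b0 pb] := phs _ a0; have bs : b <= s' by move: as'; rewrite -pb leNgt phm// -leNgt.
 by exists b; [rewrite b0 (le_trans bs)// /s'; lra|rewrite lam_le].
 have p : 0 < (a-ph s') / m by apply: divr_gt0; rewrite ?subr_gt0.
 exists (s' + (a-ph s') / m); last by rewrite lam_gt ?ltrDl// [s' + _]addrC addrK divfK ?gt_eqF// addrC subrK.
 apply/andP; split; first by rewrite addr_ge0// ltW.
 by rewrite -lerBrDl ler_pdivrMr// mulrC /s' opprB addrCA subrr addr0 md lerD2r.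
have hom : increasing_homeo s lam.
 split.
 - split=> [b|b b'|a] /=; rewrite ?in_itv /=.
 + by move=> /andP[b0 bs]; apply/andP; split; [rewrite -lam0 incre|rewrite -[leRHS]lams incre].
 + rewrite !inE /= !in_itv /= => /andP[b0 _] /andP[b'0 _] E.
 by case: (ltgtP b b') => // h; [have := incr _ _ b0 h|have := incr _ _ b'0 h]; rewrite E ltxx.
 + by move=> /onto[b hb <-]; exists b => //=; rewrite in_itv.
 - by move=> b b'; rewrite !in_itv /= => /andP[b0 _] _; exact: incr.
 - apply: segment_inc_surj_continuous.
 by apply: le_mono_in => b b'; rewrite !in_itv /= => /andP[b0 _] _; exact: incr.
 by rewrite lam0 lams => a /=; rewrite in_itv /= => /onto[b hb <-]; exists b => //=; rewrite in_itv.
have fin b : 0 <= b -> b <= s -> `|x (lam b)-y b| <= 2*e+3*d /\ `|lam b-b| <= 2*e+3*d.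
 move=> b0 bs; have e0 : 0 <= e by rewrite (le_trans _ (hx s _)) ?subrr ?normr0; lra.
 have [_ /andP[p1 p2]] := phi _ b0; have [_ hb] := hG _ _ (hph _ b0).
 have {hb} hb : `|x (ph b)-y b| <= d by apply: hb; right; exact: le_trans sd.
 have [bs'|sb] := leP b s'; first by rewrite lam_le//; split; [lra|rewrite ler_distl; lra].
 have l1 := incre _ _ s'0 (ltW sb); rewrite lam_le// in l1.
 have l2 := incre _ _ b0 bs; rewrite lams in l2; rewrite /s' in ps1 sb.
 split; last by rewrite ler_distl; lra.
 have xl : `|x (lam b)-x s| <= e by apply: hx; rewrite ler_distl; lra.
 have xp : `|x (ph b)-x s| <= e by apply: hx; rewrite ler_distl; lra.
 rewrite (le_trans (ler_distD (x s) _ _))// (_ : 2*e+3*d = e + (e+3*d)); last lra.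
 rewrite lerD// (le_trans (ler_distD (x (ph b)) _ _))// [`|x s - _|]distrC; lra.
apply: ge_ereal_inf; exists (maxe (dist_on s (x \o lam) y) (dist_on s lam id)); first by exists lam.
by rewrite ge_max; apply/andP; split; apply: ge_ereal_sup => _ [b hb <-]; move: hb; rewrite /= in_itv /= lee_fin => /andP[b0 bs]; have [] := fin b b0 bs.
Qed.
(** Cut-off times [s] near a jump of [x] fill short intervals, large [s] are damped by the
    exponential weight, and at the other [s] the bound [close_J1_on] applies. *)
Lemma close_continuous (h : skorohod R -> R) x e : continuous h -> 0 < e ->
 exists d, 0 < d /\ forall y, close d x y -> `|h x-h y| < e.
move=> hc e0; have : nbhs x (h @^-1` [set v | `|h x-v| < e]).
 by apply: hc; apply/nbhs_ballP; exists e.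
rewrite nbhsE => -[U [oU Ux] hU]; have [r [r0 hr]] := oU x Ux.
have [c c0 rc] : exists2 c, 0 < c & r = 6*c by exists (r/6); lra.
have e'0 : 0 < c/4 by lra.
have [ps hps] := jump_points x (2/c) e'0.
pose k := (size ps).+1%:R : R; have k0 : 0 < k by rewrite ltr0n.
(* [d] is small against the number of jump points, so that the excluded intervals, of half-width
   [4 * d], have small total length. *)
have [d [d0 d1 d3]] : exists d, [/\ 0 < d, d <= c/6 & d * (8*k) <= c].
 exists (Num.min (c/6) (c / (8*k))); rewrite lt_min !divr_gt0// ?mulr_gt0//.
 by rewrite -ler_pdivlMr ?mulr_gt0// !ge_min !lexx ?orbT.
exists d; split=> // y xy; apply: hU; apply: hr.
apply: (@le_lt_trans _ _ (2*c + (size ps)%:R * (2 * (4*d)))%:E); last first.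
 have {}d3 : (size ps)%:R * (2 * (4*d))+8*d <= c.
 by rewrite (le_trans _ d3)// /k -natr1 le_eqVlt; apply/orP; left; apply/eqP; ring.
 by rewrite lte_fin rc; move: (_ * (2 * _)) d3 => u d3; lra.
apply: J1_dist_bound; [exact: ltW|lra|move=> s s0 hs].
have expc : expR (- s) = expR (- (s/2))*expR (- (s/2)) by rewrite -expRD; congr expR; lra.
have E0 := expR_gt0 (- (s/2)).
have E1 : expR (- (s/2)) <= 1 by rewrite expR_le1; lra.
have [|sK] := ltP s (2/c); last first.
 apply: (@le_trans _ _ ((expR (- s))%:E*1)%E); first by rewrite lee_pmul2l// ?lte_fin ?expR_gt0// ge_min lexx.
 rewrite mule1 lee_fin expc ler_pM2r// expRN invf_ple ?posrE ?expR_gt0//.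
 apply: le_trans (expR_ge1Dx _); move: sK; rewrite ler_pdivrMr// => sK.
 by rewrite -[c^-1]mul1r ler_pdivrMr//; lra.
move=> sK; have [|ds hx] := hps _ s _ hs; first side.
have sd : s <= d^-1 by rewrite ltW// (lt_le_trans sK)// ler_pdivrMr// ler_pdivlMl; lra.
apply: (@le_trans _ _ ((expR (- s))%:E * (2 * (c/4)+3*d)%:E)%E).
 by rewrite lee_pmul2l ?lte_fin// ge_min (close_J1_on d0 xy ds sd hx) orbT.
rewrite -EFinM lee_fin expc -mulrA mulrC [leRHS](mulrC c) -mulrA ler_wpM2l//.
have w0 : 0 <= 2 * (c/4)+3*d by lra.
have w1 : 2 * (c/4)+3*d <= c by lra.
by have := ler_wpM2l w0 E1; rewrite mulr1 mulrC => /le_trans; apply.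
Qed.

End TimeChange.

(** * Piecewise linear time changes and discretised paths *)

Section Interpolation.
Context {R : realType}.
Implicit Types c : nat -> R.

Definition interp c (k : nat) (t : R) : R := c k+t * (c k.+1-c k).

Variables (c : nat -> R).
Hypothesis c_incr : forall k, c k < c k.+1.

Lemma interp_itv k (t : R) : 0 <= t < 1 -> c k <= interp c k t < c k.+1.
by move=> /andP[t0 t1]; have := c_incr k; rewrite /interp => h; apply/andP; split; nra. Qed.
Lemma interp_lt k k' (t t' : R) : 0 <= t < 1 -> 0 <= t' < 1 ->
 (interp c k t < interp c k' t') = (k < k')%N || (k == k') && (t < t').
have mono : {homo c : i j / (i <= j)%N >-> i <= j} by apply: homo_leq => // [? ? ?|i]; [side|exact: ltW].
move=> t01 t01'; have /andP[h1 h2] := interp_itv k t01; have /andP[h1' h2'] := interp_itv k' t01'.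
case: ltngtP => [kk'|k'k|<-].
- by apply: lt_le_trans h2 _; apply: le_trans h1'; exact: mono.
- by apply/negbTE; rewrite -leNgt; apply: le_trans (ltW h2') _; apply: le_trans h1; exact: mono.
- by rewrite /interp ltrD2l ltr_pM2r// subr_gt0.
Qed.
Lemma interp_onto (a : R) : c 0%N <= a -> (exists n, a < c n) -> exists k, exists2 t, 0 <= t < 1 & interp c k t = a.
move=> ca ex; have := ex_minnP ex; case=> -[|k] h hmin; first lra.
have ka : c k <= a by rewrite leNgt; apply/negP => /hmin; rewrite ltnn.
have d0 : 0 < c k.+1-c k by lra.
exists k, ((a-c k) / (c k.+1-c k)); last by rewrite /interp divfK// addrC subrK.
by rewrite ltr_pdivrMr// mul1r ltrD2r h andbT divr_ge0 ?subr_ge0// ltW.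
Qed.

End Interpolation.

Section Discretization.
Context {R : realType}.
Implicit Types x y z : skorohod R.

(** Constant from index [N] on, so that the path depends on finitely many values. *)
Definition disc (q N : nat) (v : nat -> R) : skorohod R := step_path (fun i => v (minn i N)) q.

Lemma disc_near q N v w e : 0 < e -> (forall i, (i <= N)%N -> `|v i-w i| <= e) -> near_path e (disc q N v) (disc q N w).
move=> e0 h; right; exists (fun a b => 0 <= a /\ a = b); first split.
- by move=> a a0; exists a.
- by move=> a a0; exists a.
- by move=> a _ [a0 <-].
- by move=> a _ a' _ [_ <-] [_ <-].
by move=> a _ [a0 <-]; rewrite subrr normr0 ltW//; split=> // _; apply: h; exact: geq_minr.
Qed.
(** The time change moves the splitting time of each window to its right end, where the sampled path
    jumps. Between two consecutive splitting times the path stays near its value at the grid point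
    in between. *)
Lemma window_close x q H N e : (0 < q)%N -> 2/q%:R <= e -> e^-1+2 < H%:R -> (H*q <= N)%N ->
 (forall i, (i < H*q)%N -> split_on e x (i%:R/q%:R) (i.+1%:R/q%:R)) ->
 near_path e x (disc q N (fun i => x (i%:R/q%:R))).
move=> q0 qe He HN hs; right; have q0' : 0 < q%:R :> R by rewrite ltr0n.
have /boolp.choice[ta hta] : forall i, exists c, (i < H*q)%N -> [/\ i%:R/q%:R < c <= i.+1%:R/q%:R,
 forall t, i%:R/q%:R <= t < c -> `|x t-x (i%:R/q%:R)| <= e &
 forall t, c <= t <= i.+1%:R/q%:R -> `|x t-x (i.+1%:R/q%:R)| <= e] by move=> i; case: (ltnP i (H*q)) => [/hs[c hc]|_]; [exists c|exists 0].
(* Entry [k.+1] is the splitting time of window [k]; from the [H * q]-th window on the grid points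
   are kept. *)
pose c i := if i is k.+1 then if (k < H*q)%N then ta k else k.+1%:R/q%:R else 0.
pose u i : R := i%:R/q%:R.
have u1 i : u i.+1 = u i+q%:R^-1 by rewrite /u -natr1 mulrDl mul1r.
have u_incr i : u i < u i.+1 by rewrite u1 ltrDl.
have cu i : u i <= c i.+1 <= u i.+1 /\ u i < c i.+1 by rewrite /c; case: ifP => [/hta[/andP[h1 h2] _ _]|_]; [rewrite h1 (ltW h1) h2|rewrite -/(u _) lexx ltW u_incr].
have c_incr i : c i < c i.+1.
 have [_ h] := cu i; apply: le_lt_trans h; case: i => [|i]; first by rewrite /u mul0r.
 by have [/andP[]] := cu i.
have unb (f : nat -> R) a : (forall i, u i <= f i.+1) -> exists n, a < f n.
 move=> hf; exists (Num.truncn (a*q%:R)).+2; apply: lt_le_trans (hf _).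
 by rewrite /u ltr_pdivlMr// truncnS_gt.
exists (fun a b => exists k, exists2 t, 0 <= t < 1 & a = interp c k t /\ b = interp u k t); first split.
- move=> a a0; have [|k [t t01 <-]] := interp_onto c_incr a0; last by exists (interp u k t), k, t.
 by apply: unb => i; have [/andP[]] := cu i.
- move=> b b0; have [||k [t t01 <-]] := @interp_onto _ u u_incr b; last by exists (interp c k t), k, t.
 by rewrite /u mul0r.
 by apply: unb => i; exact: ltW.
- move=> a b [k [t t01 [-> ->]]]; have /andP[h _] := interp_itv c_incr k t01; have /andP[h' _] := interp_itv u_incr k t01.
 split; last by apply: le_trans h'; rewrite divr_ge0.
 by apply: le_trans h; case: k {h'} => // k; have [/andP[h' _] _] := cu k; apply: le_trans h'; rewrite divr_ge0.
- by move=> a b a' b' [k [t h [-> ->]]] [k' [t' h' [-> ->]]]; rewrite !interp_lt.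
move=> a b [k [t t01 [-> ->]]]; have /andP[a1 a2] := interp_itv c_incr k t01; have /andP[b1 b2] := interp_itv u_incr k t01.
move: (interp c k t) (interp u k t) a1 a2 b1 b2 => {}a {}b a1 a2 b1 b2.
have [/andP[_ a3] _] := cu k; have a4 : u k-q%:R^-1 <= c k.
 case: k {a1 a2 b1 b2 a3} => [|k]; first by rewrite /u mul0r /c sub0r oppr_le0 ltW.
 by rewrite u1 addrK; have [/andP[]] := cu k.
have u1k := u1 k; split; first by rewrite ler_distl; lra.
move=> hab; have {hab} ub : u k <= e^-1+2*q%:R^-1 by case: hab; lra.
have kH : (k < H*q)%N.
 rewrite -(ltr_nat R) natrM -ltr_pdivrMr//; apply: le_lt_trans ub _; apply: le_lt_trans He.
 by rewrite lerD2l ler_piMr// invf_le1// ler1n.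
have -> : disc q N (fun i => x (i%:R/q%:R)) b = x (u k).
 rewrite /disc /= /step_fun (@truncn_def _ _ k); last by rewrite -ler_pdivrMr// b1 -ltr_pdivlMr.
 by rewrite (minn_idPl _)// (leq_trans (ltnW kH)).
have [_ h1 _] := hta k kH; have [ak|ka] := ltP a (u k); last first.
 by apply: h1; rewrite ka/=; move: a2; rewrite /c kH.
case: k ak a1 kH {h1 a2 b1 b2 a3 a4 u1k ub} => [|k] ak a1 kH; first by move: ak a1; rewrite /u mul0r /c; lra.
by have [_ _] := hta k (ltnW kH); apply; rewrite (ltW ak) andbT; move: a1; rewrite /c (ltnW kH).
Qed.

End Discretization.

(** * Lipschitz minorants of path functionals *)

Section LowerApproximation.
Context {R : realType}.
Implicit Types (x y z : skorohod R) (k e : R).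
Variables (h : skorohod R -> R) (C : R).
Hypothesis hC : forall x, `|h x| <= C.

(* A Lipschitz minorant of [h], for the closeness of paths. *)
Definition low k x : R := inf [set r | exists y e, [/\ 0 < e, near_path e x y & r = h y+k*e]].

Lemma low_le k x y e : 0 <= k -> 0 < e -> near_path e x y -> low k x <= h y+k*e.
move=> k0 e0 xy; apply: ge_inf; last by exists y, e.
exists (- C) => _ [z [d [d0 _ ->]]]; have := hC z; rewrite ler_norml => /andP[h1 _].
by apply: (le_trans h1); rewrite lerDl mulr_ge0// ltW.
Qed.
Lemma low_ge k x b : (forall y e, 0 < e -> near_path e x y -> b <= h y+k*e) -> b <= low k x.
move=> hb; apply: lb_le_inf; last by move=> _ [y [e [e0 xy ->]]]; exact: hb.
by exists (h x+k*1), x, 1; split=> //; left.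
Qed.
Lemma near_path_refl x e : 0 < e -> near_path e x x.
move=> e0; right; exists (fun a b => 0 <= a /\ a = b); first split.
- by move=> a a0; exists a.
- by move=> a a0; exists a.
- by move=> a _ [a0 <-].
- by move=> a _ a' _ [_ <-] [_ <-].
by move=> a _ [a0 <-]; rewrite !subrr normr0 ltW.
Qed.
Lemma low_near k x x' e : 0 <= k -> 0 < e -> near_path e x x' -> low k x <= low k x'+k*e.
move=> k0 e0 xx'; rewrite -lerBlDr; apply: low_ge => y d d0 x'y; rewrite lerBlDr -addrA -mulrDr [d+e]addrC.
by apply: low_le => //; exact: near_path_trans x'y.
Qed.
Lemma low_le_h k x : 0 <= k -> low k x <= h x.
move=> k0; apply/ler_addgt0Pr => e e0; have k1 : 0 < k+1 by lra.
apply: (le_trans (low_le k0 (divr_gt0 e0 k1) (near_path_refl _ (divr_gt0 e0 k1)))).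
by rewrite lerD2l mulrA ler_pdivrMr; nra.
Qed.
Lemma low_bound k x : 0 <= k -> `|low k x| <= C.
move=> k0; rewrite ler_norml; apply/andP; split; last first.
 by apply: (le_trans (low_le_h x k0)); have := hC x; rewrite ler_norml => /andP[].
apply: low_ge => y e e0 _; have := hC y; rewrite ler_norml => /andP[h1 _].
by apply: (le_trans h1); rewrite lerDl mulr_ge0// ltW.
Qed.
(** Paths [y] at scale at least [r] are ruled out by the penalty, which exceeds [2 * C]; for the
    others continuity of [h] applies, the scale being below 1. *)
Lemma low_cvg x : continuous h -> low i%:R x @[i --> \oo] --> h x.
move=> hc; apply/cvgrPdist_le => e e0; have [d [d0 hd]] := close_continuous x hc e0.
pose r := Num.min d (1/2); have r0 : 0 < r by rewrite lt_min d0; lra.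
near=> i; have i0 : 0 <= i%:R :> R by [].
have ir : 2*C <= i%:R*r.
 rewrite -ler_pdivrMr//; near: i; exact: nbhs_infty_ger.
have l1 := low_le_h x i0.
rewrite ger0_norm ?subr_ge0// lerBlDr -lerBlDl; apply: low_ge => y a a0 xy.
have := hC x; have := hC y; rewrite !ler_norml => /andP[y1 _] /andP[_ x1].
have [ra|ar] := leP r a; first by have := ler_wpM2l i0 ra; lra.
have [ad a2] : a <= d /\ a <= 1/2 by move: ar; rewrite lt_min => /andP[/ltW ? /ltW].
case: xy => [a1|/(close_mono a0 ad)/hd]; first lra.
by rewrite ltr_norml => /andP[_ ?]; have := mulr_ge0 i0 (ltW a0); lra.
Unshelve. all: by end_near. Qed.
(** Brings path functionals within reach of [lip_measurable] and [lip_converges]. The map [V] allows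
    the coordinates to be sampled values or increments. *)
Lemma low_lip k q N K (V : (nat -> R) -> nat -> R) : 0 <= k ->
 (forall v w i, (i <= N)%N -> `|V v i-V w i| <= \sum_(j < K) `|v j-w j|) ->
 lip_in K k (fun v => low k (disc q N (V v))).
move=> k0 hV.
have le v w : low k (disc q N (V v)) <= low k (disc q N (V w))+k * \sum_(j < K) `|v j-w j|.
 set s := \sum_(j < K) _; have s0 : 0 <= s by apply: sumr_ge0.
 apply/ler_addgt0Pr => e e0; have k1 : 0 < k+1 by lra.
 have se : 0 < s+e / (k+1) by [].
 apply: (le_trans (@low_near k _ (disc q N (V w)) _ k0 se _)).
 apply: disc_near => // i iN; apply: (le_trans (hV _ _ _ iN)); rewrite lerDl; exact/ltW/divr_gt0.
 rewrite -addrA lerD2l mulrDr lerD2l mulrA ler_pdivrMr; nra.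
move=> v w; rewrite ler_norml lerBlDl lerNl opprB lerBlDl le andbT (le_trans (le w v))//.
by under eq_bigr do rewrite distrC.
Qed.

End LowerApproximation.

(** * Measurability of continuous functionals of a process *)

Section Measurability.
Context {R : realType} {d} {W : measurableType d}.
Implicit Types x : skorohod R.

Lemma disc_approx x e : 0 < e -> exists q0, forall q, (q0 <= q)%N -> (0 < q)%N ->
 near_path e x (disc q (q*q) (fun i => x (i%:R/q%:R))).
move=> e0; pose H := (Num.truncn (e^-1+2)).+1.
have [r [r0 hr]] := uniform_split x H%:R e0.
exists (maxn H (Num.truncn (2/e+r^-1)).+1) => q; rewrite geq_max => /andP[Hq hq] q0.
have b : 2/e+r^-1 <= q%:R by rewrite ltW// (lt_le_trans (truncnS_gt _))// ler_nat.
have [i1 i2] : 0 < 2/e /\ 0 < r^-1 by [].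
have rq : q%:R^-1 <= r by rewrite invf_ple//; lra.
apply: (@window_close _ _ _ H) => //; first by rewrite ler_pdivrMr// mulrC -ler_pdivrMr; lra.
- exact: truncnS_gt.
- by rewrite leq_mul2r Hq orbT.
move=> i iH; apply: hr; first by rewrite divr_ge0//= ler_pdivrMr// -natrM ler_nat ltnW.
have q1 : 0 < q%:R^-1 :> R by [].
by lra.
Qed.

Variables (Y : W -> skorohod R) (h : skorohod R -> R) (C : R).
Hypotheses (mY : forall t, 0 <= t -> mfun W (fun w => Y w t : R)) (hC : forall x, `|h x| <= C).

Lemma low_disc_cvg k x : 0 <= k ->
 low h k (disc q.+1 (q.+1*q.+1) (fun i => x (i%:R/q.+1%:R))) @[q --> \oo] --> low h k x.
move=> k0; apply/cvgrPdist_le => e e0; have k1 : 0 < k+1 by lra.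
have [q0 hq] := disc_approx x (divr_gt0 e0 k1).
near=> q; have n1 : near_path (e / (k+1)) x (disc q.+1 (q.+1*q.+1) (fun i => x (i%:R/q.+1%:R))).
 by apply: hq => //; apply: leqW; near: q; exists q0.
have n2 := near_path_sym n1; have d0 := divr_gt0 e0 k1.
have := low_near hC k0 d0 n1; have := low_near hC k0 d0 n2.
have : k * (e / (k+1)) <= e by rewrite mulrA ler_pdivrMr; nra.
by rewrite ler_norml; side.
Unshelve. all: by end_near. Qed.
Lemma mlow_disc q N k : 0 <= k ->
 mfun W (fun w => low h k (disc q N (fun i => Y w (i%:R/q%:R)))).
move=> k0; apply: (lip_measurable (Y := fun w i => Y w (i%:R/q%:R)) (q := N.+1) (F := fun v => low h k (disc q N v)) _ k0).
 by move=> i; apply: mY; side.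
apply: (low_lip hC) => // v w i iN.
by rewrite (bigD1 (Ordinal (iN : (i < N.+1)%N)))//= lerDl.
Qed.
Lemma low_measurable k : 0 <= k -> mfun W (fun w => low h k (Y w)).
move=> k0; apply: (@measurable_fun_cvg _ _ _ _ (fun q w => low h k (disc q.+1 (q.+1*q.+1) (fun i => Y w (i%:R/q.+1%:R))))).
 by move=> q; exact: mlow_disc.
by move=> w _; exact: low_disc_cvg.
Qed.
(** [h] is the limit of its minorants, and each of these is the limit, along discretisations, of
    Lipschitz functions of finitely many coordinates. *)
Lemma path_fun_measurable : continuous h -> mfun W (h \o Y).
move=> hc; apply: (@measurable_fun_cvg _ _ _ _ (fun i w => low h i%:R (Y w))) => [i|w _].
 exact: low_measurable.
exact: (low_cvg hC).
Qed.

End Measurability.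

(** * Asymptotic independence of the increments of the partial sums *)

Section Process.
Context {d} {X : measurableType d} {R : realType}.
Variables (mu : probability X R) (T : X -> X) (c : X -> nat) (K g : R).
Variables (f : X -> R) (G : set X) (osc : nat -> R) (theta kap M : R).
Variables (al cp cm : R) (ell : R -> R) (A B : nat -> R) (pR pI : R -> R).
Hypotheses (hc : mixing_code mu T c K g) (hf : tame_obs mu T c f G osc theta kap M) (hal : 0 < al < 2)
 (hkap : al < 2*kap) (hcpm : 0 < cp+cm) (hell : slowly_varying ell)
 (htails : stable_tails mu f al cp cm ell) (hB0 : forall n, (1 <= n)%N -> 0 < B n)
 (hBoo : B n @[n --> \oo] --> +oo) (hBell : forall n, (1 <= n)%N -> n%:R*ell (B n) = B n `^ al)
 (hlim : limit_data mu f A B pR pI).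
Local Notation m := (pr mu).
Local Notation E := (ex mu).
Local Notation phi := (phin mu f B).
Local Notation erg := (ergodic_sum T f).
Let mf := obs_meas hf.
Let mT := code_map hc.
Let presT := code_pres hc.

Definition csum n k x : R := erg k x-k%:R/n%:R*A n.

Lemma erg_measurable k : mfun X (erg k).
by apply: measurable_sum => j; apply: measurableT_comp => //; exact: iter_measurable. Qed.
Lemma csum_measurable n k : mfun X (csum n k).
by apply: measurable_funB => //; exact: erg_measurable. Qed.
Lemma csumD n j k x : csum n (j+k) x = csum n j x+csum n k (iter j T x).
rewrite /csum /ergodic_sum big_split_ord /= natrD mulrDl mulrDl opprD addrACA; congr (_ + (_ - _)).
by apply: eq_bigr => i _; rewrite addnC iterD.
Qed.
(** [char_product] with [t = U / B n] and a gap from [gap_length]; the error per step is [er n / n]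
    with [er] tending to 0. *)
Lemma char_near U : 0 < U -> exists er : nat -> R, er n @[n --> \oo] --> (0 : R) /\
 \forall n \near \oo, forall k a, (forall j, `|a j| <= U/B n) ->
 cn (echar mu (psum T f a k) - \prod_(j < k) echar mu (fun x => a j*f x)) <= k%:R/n%:R*er n.
move=> U0; have [k0 k1] := andP (obs_kap hf); have M0 := obs_M hf.
have [N [hN1 hN2]] : exists N : nat -> nat, (\forall n \near \oo, g ^+ N n <= n%:R^-1) /\
 n%:R * (N n).+1%:R*B n `^ (- (2*kap)) @[n --> \oo] --> (0 : R).
 apply: (gap_length mf hal hcpm hell htails hB0 hBoo hBell (code_g hc) k0 (kap' := (al+2*kap)/2)).
 by have := hkap => ?; lra.
set dc := dconst K theta kap M; have dc0 : 0 <= dc by exact: dconst_ge0 hc hf.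
pose er n := 4*dc*M * (U `^ kap ^+ 2 * (n%:R * (N n).+1%:R*B n `^ (- (2*kap)))+U `^ kap*B n `^ (- kap)).
exists er; split.
 rewrite (_ : (0 : R) = 4*dc*M * (U `^ kap ^+ 2*0+U `^ kap*0)); last by rewrite !mulr0 addr0 mulr0.
 apply: cvgM; [side|apply: cvgD; apply: cvgM; try exact: cvg_cst]; [side|exact: cvg_powR_neg].
near=> n => k a ha; have n1 : (1 <= n)%N by near: n; exists 1%N.
have b0 := hB0 n1; have nR : 0 < n%:R :> R by [].
have t0 : 0 <= U/B n by [].
apply: (le_trans (char_product hc hf t0 ha k (N n))); rewrite -[leRHS]mulrA ler_wpM2l// -ler_pdivrMl// invrK.
rewrite -/dc powRM// powR_inv// natr1.
have gN : g ^+ N n <= n%:R^-1 by near: n.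
rewrite /er (_ : B n `^ (- (2*kap)) = B n `^ (- kap) ^+ 2); last by rewrite expr2 -powRD ?(gt_eqF b0) ?implybT//; congr (_ `^ _); ring.
have : 4*dc*M * (U `^ kap*B n `^ (- kap) * (n%:R*g ^+ N n)) <= 4*dc*M * (U `^ kap*B n `^ (- kap)*1).
 rewrite ler_wpM2l// ler_wpM2l//.
 by rewrite -ler_pdivlMl// mulr1.
move: (U `^ kap) (B n `^ (- kap)) (g ^+ N n) ((N n).+1%:R) => p q r s; lra.
Unshelve. all: by end_near. Qed.
Lemma phi_le1 n u : cn (phi n u) <= 1.
by apply: echar_le1; side. Qed.
Lemma rhoR_le0 n u : rhoR mu f B n u <= 0.
rewrite /rhoR mulr_ge0_le0// subr_le0 (le_trans _ (phi_le1 n u))//.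
by rewrite (le_trans (ler_norm _))// (cn_Re (phi n u)).
Qed.
Lemma pR_le0 u : pR u <= 0.
have h := lim_re hlim (u := u).
rewrite -(cvg_lim (@Rhausdorff R) h); apply: limr_le; first by apply/cvg_ex; exists (pR u).
by apply: nearW => n; exact: rhoR_le0.
Qed.
Definition rho n u : R[i] := (rhoR mu f B n u +i* rhoI mu f A B n u)%C.

Lemma phi_window n u k : (1 <= n)%N ->
 cn (cis (- u * (k%:R/n%:R * (A n/B n))) * phi n u ^+ k-cexp ((k%:R/n%:R)%:C%C*rho n u)) <=
 k%:R/n%:R * (n%:R * (4*cn (phi n u-1) ^+ 2)).
move=> n1; have nR : n%:R != 0 :> R by rewrite pnatr_eq0 -lt0n.
rewrite [leRHS]mulrA divfK//; apply: le_trans (phin_power mu B mf n u k).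
suff -> : cexp ((k%:R/n%:R)%:C%C*rho n u) = cis (- u * (k%:R/n%:R * (A n/B n)))*cexp ((phi n u-1) *+ k).
 by rewrite -mulrBr cnM cn_cis mul1r.
have -> : (phi n u-1) *+ k = ((k%:R/n%:R)%:C * ((n%:R%:C) * (phi n u-1)))%C by rewrite mulrA -rmorphM divfK// rmorph_nat mulr_natl.
rewrite (phin_rho mu f A B u n1) !cexpE /= [RHS]mulrCA; congr (_ * _).
 by congr ((expR _)%:C)%C; rewrite !mul0r.
by rewrite -cisD; congr cis; ring.
Qed.
(** Three replacements, each costing a multiple of [k / n]: the characteristic function by a power
    of [phi], the power by the exponential of [(k / n) * rho], and this by 1. *)
Lemma window_charfun U : 0 < U -> exists C : R, 0 <= C /\ \forall n \near \oo, forall k u, `|u| <= U ->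
 E (fun x => 1-cos (u * ((B n)^-1*csum n k x))) <= C * (k%:R/n%:R).
move=> U0; have [er [er0 her]] := char_near U0.
have [er2 [er20 her2]] := phin_err mf hal hcpm hell htails hB0 hBoo hBell.
have [K1 hK1] := lim_bd hlim U0.
have l1 : (0 : R) < 1 by [].
exists (2+2 * (2 * `|K1|)); split; first side.
near=> n => k u uU; have n1 : (1 <= n)%N by near: n; exists 1%N.
have b0 := hB0 n1; have nR : 0 < n%:R :> R by [].
have e1 : er n < 1 by near: n; exact: cvgr_lt er0 _ l1.
have e2 : er2 U n < 1 by near: n; exact: cvgr_lt (er20 U) _ l1.
have h1 : forall k a, (forall j, `|a j| <= U/B n) ->
 cn (echar mu (psum T f a k) - \prod_(j < k) echar mu (fun x => a j*f x)) <= k%:R/n%:R*er n by near: n.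
have h2 : forall u, `|u| <= U -> `|rhoR mu f B n u| <= K1 /\ `|rhoI mu f A B n u| <= K1 by near: n.
set s := - u * (k%:R/n%:R * (A n/B n)); pose a (_ : nat) := u/B n.
have mp : mfun X (psum T f a k) by exact: psum_measurable hc hf _ _.
have ->: E (fun x => 1-cos (u * ((B n)^-1*csum n k x))) = 1-complex.Re (cis s*echar mu (psum T f a k)).
 rewrite -echar_shift// exB ?ex_cst//; [|by apply: bmf_cos; apply: measurable_funM => //; apply: measurable_funM => //; exact: csum_measurable].
 congr (_ - _); apply: ex_eq => x; congr cos; rewrite /psum -mulr_sumr /csum /ergodic_sum /s /a; ring.
set z := cis s * _; have k0 : 0 <= k%:R/n%:R :> R by rewrite divr_ge0.
have -> : 1-complex.Re z = complex.Re (1-z) by case: (z).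
apply: (le_trans (ler_norm _)); apply: (le_trans (cn_Re _)).
set w := cis s * phi n u ^+ k; set v := cexp ((k%:R/n%:R)%:C%C*rho n u).
have -> : 1-z = - (z-w) + (- (w-v) + - (v-1)) by ring.
have q1 : cn (z-w) <= k%:R/n%:R*1.
 rewrite /z /w -mulrBr cnM cn_cis mul1r.
 have ha j : `|a j| <= U/B n by rewrite normrM normfV (gtr0_norm b0) ler_wpM2r.
 have := h1 k a ha; rewrite (eq_bigr (fun=> phi n u))// prodr_const card_ord => /le_trans; apply.
 by rewrite ler_wpM2l// ltW.
have q2 : cn (w-v) <= k%:R/n%:R*1.
 apply: (le_trans (phi_window u k n1)); rewrite ler_wpM2l//.
 exact: le_trans (her2 n u U n1 uU) (ltW e2).
have q3 : cn (v-1) <= k%:R/n%:R * (2 * (2 * `|K1|)).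
 have re0 : complex.Re ((k%:R/n%:R)%:C%C*rho n u) <= 0 by rewrite /= mul0r subr0 mulr_ge0_le0// rhoR_le0.
 apply: (le_trans (cexp_sub1 re0)); rewrite cnM cn_real ger0_norm// mulrCA ler_wpM2l// ler_wpM2l//.
 have [r1 r2] := h2 u uU; apply: (le_trans (cn_le _)); rewrite mulrDl mul1r.
 by apply: lerD; [apply: le_trans r1 _|apply: le_trans r2 _]; exact: ler_norm.
apply: (le_trans (cnD _ _)); rewrite cnN; apply: (le_trans (lerD q1 (cnD _ _))); rewrite !cnN.
move: q2 q3; move: (cn _) (cn _) (k%:R/n%:R) => x y t; lra.
Unshelve. all: by end_near. Qed.

Section Increments.
Variable q : nat.
Hypothesis q0 : (0 < q)%N.
Let qR : 0 < q%:R :> R. Proof. by []. Qed.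
Definition grid n i : nat := Num.truncn ((i%:R/q%:R : R)*n%:R).
Definition inc n x i : R := (B n)^-1 * (csum n (grid n i.+1) x-csum n (grid n i) x).

Lemma gridP n i : (grid n i)%:R <= (i%:R/q%:R : R)*n%:R < (grid n i).+1%:R.
clear qR q0; by apply: truncn_itv; side. Qed.
Lemma grid_le n i j : (i <= j)%N -> (grid n i <= grid n j)%N.
clear qR q0; by move=> ij; apply: le_truncn; rewrite ler_wpM2r// ler_wpM2r// ler_nat. Qed.
Lemma grid_cvg i : ((grid n i.+1)%:R - (grid n i)%:R)/n%:R @[n --> \oo] --> (q%:R^-1 : R).
apply/cvgrPdist_le => e e0; near=> n; have n1 : (1 <= n)%N by near: n; exists 1%N.
have nR : 0 < n%:R :> R by [].
have ne : e^-1 < n%:R by near: n; exact: nbhs_infty_gtr.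
have /andP[a1 a2] := gridP n i; have /andP[a3 a4] := gridP n i.+1.
have -> : q%:R^-1 - ((grid n i.+1)%:R - (grid n i)%:R)/n%:R =
 ((i.+1%:R/q%:R*n%:R - (grid n i.+1)%:R) - (i%:R/q%:R*n%:R - (grid n i)%:R))/n%:R :> R by rewrite -[i.+1%:R]natr1; field; rewrite !gt_eqF.
rewrite normrM normfV (gtr0_norm nR) ler_pdivrMr.
have : 1 <= e*n%:R by rewrite -ler_pdivrMl// mulr1 ltW.
apply: le_trans; rewrite -[(grid n i).+1%:R]natr1 in a2; rewrite -[(grid n i.+1).+1%:R]natr1 in a4; move: a1 a2 a3 a4.
move: (i%:R / _ * _) (i.+1%:R / _ * _) (grid n i)%:R (grid n i.+1)%:R => x y a b *; rewrite ler_norml; lra.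
Unshelve. all: by end_near. Qed.
Lemma inc_measurable n i : mfun X (fun x => inc n x i).
by apply: measurable_funM => //; apply: measurable_funB; exact: csum_measurable. Qed.

Section Frequency.
Variables (N : nat) (u : nat -> R).

(** Equals [u i / B n] during the [i]-th window and 0 after the last one. It presents a linear form
    in the increments as one weighted orbit sum. *)
Definition freq n (j : nat) : R := \sum_(i < N) u i/B n * (grid n i <= j < grid n i.+1)%N%:R.

Lemma freq_window n i j : (i < N)%N -> (grid n i <= j < grid n i.+1)%N -> freq n j = u i/B n.
move=> iN hj; rewrite /freq (bigD1 (Ordinal iN))//= hj mulr1 big1 ?addr0// => k ki.
rewrite (_ : (_ <= _ < _)%N = false) ?mulr0//; apply/negbTE; rewrite negb_and -ltnNge -leqNgt.
have {ki} : (val k != i) by [].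
have /andP[j1 j2] := hj; rewrite neq_ltn => /orP[h|h]; apply/orP; [right|left].
 exact: leq_trans (grid_le n h) j1.
exact: leq_trans j2 (grid_le n h).
Qed.
Lemma freq_psum n x : psum T f (freq n) (grid n N) x = \sum_(i < N) u i/B n * (erg (grid n i.+1) x-erg (grid n i) x).
have g0 : grid n 0 = 0%N by rewrite /grid !mul0r truncn0.
suff h p : (p <= N)%N -> psum T f (freq n) (grid n p) x = \sum_(i < p) u i/B n * (erg (grid n i.+1) x-erg (grid n i) x) by exact: h.
elim: p => [|p IH] pN; first by rewrite g0 /psum !big_ord0.
rewrite big_ord_recr -IH; last exact: ltnW.
rewrite /psum /ergodic_sum -!(big_mkord xpredT (fun j => freq n j*f (iter j T x))) -!(big_mkord xpredT (fun j => f (iter j T x))).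
rewrite (big_cat_nat (leq0n _) (grid_le n (leqnSn p))) [X in _ = _ + _ * (X - _)](big_cat_nat (leq0n _) (grid_le n (leqnSn p))).
congr (_ + _); rewrite [X in _*X]addrAC subrr add0r mulr_sumr !big_nat; apply: eq_bigr => j hj.
by rewrite (freq_window pN).
Qed.
Lemma freq_prod n : \prod_(j < grid n N) echar mu (fun x => freq n j*f x) =
 \prod_(i < N) phi n (u i) ^+ (grid n i.+1-grid n i).
have g0 : grid n 0 = 0%N by rewrite /grid !mul0r truncn0.
suff h p : (p <= N)%N -> \prod_(j < grid n p) echar mu (fun x => freq n j*f x) =
 \prod_(i < p) phi n (u i) ^+ (grid n i.+1-grid n i) by exact: h.
elim: p => [|p IH] pN; first by rewrite g0 !big_ord0.
rewrite big_ord_recr -IH; last exact: ltnW.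
rewrite -!(big_mkord xpredT (fun j => echar mu (fun x => freq n j*f x))).
rewrite (big_cat_nat (leq0n _) (grid_le n (leqnSn p))); congr (_ * _).
by rewrite -prodr_const_nat !big_nat; apply: eq_bigr => j hj; rewrite (freq_window pN).
Qed.
Lemma window_cvg v i : cn (cis (- v * (((grid n i.+1) - (grid n i))%N%:R/n%:R * (A n/B n))) * phi n v ^+ (grid n i.+1-grid n i)
 - cexp ((pR v/q%:R) +i* (pI v/q%:R))%C) @[n --> \oo] --> (0 : R).
have [er2 [er20 her2]] := phin_err mf hal hcpm hell htails hB0 hBoo hBell.
pose t n : R := ((grid n i.+1) - (grid n i))%N%:R/n%:R.
have ct : t n @[n --> \oo] --> (q%:R^-1 : R).
 apply: cvg_trans (grid_cvg i); apply: near_eq_cvg; apply: nearW => n.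
 by rewrite /t natrB// grid_le.
pose bd n := t n*er2 `|v| n+2 * (`|t n*rhoR mu f B n v-pR v/q%:R| + `|t n*rhoI mu f A B n v-pI v/q%:R|).
have cb : bd n @[n --> \oo] --> q%:R^-1*0+2 * (`|q%:R^-1 * pR v-pR v/q%:R| + `|q%:R^-1 * pI v-pI v/q%:R| : R).
 apply: cvgD; first side.
 apply: cvgM; [side|apply: cvgD; apply: cvg_norm; apply: cvgB; try exact: cvg_cst; apply: cvgM => //].
 exact: (lim_re hlim (u := v)).
 exact: (lim_im hlim (u := v)).
rewrite !(mulrC q%:R^-1) !subrr normr0 mul0r addr0 mulr0 addr0 in cb.
apply: (squeeze_cvgr _ (cvg_cst 0) cb); near=> n.
have n1 : (1 <= n)%N by near: n.
have t0 : 0 <= t n by rewrite divr_ge0.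
rewrite cn_ge0 -[X in cn X](subrKA (cexp ((t n)%:C%C*rho n v))) (le_trans (cnD _ _))//; apply: lerD.
 by apply: (le_trans (phi_window v _ n1)); rewrite ler_wpM2l// her2.
have h1 : complex.Re ((t n)%:C%C*rho n v) <= 0 by rewrite /= mul0r subr0 mulr_ge0_le0// rhoR_le0.
have h2 : complex.Re ((pR v/q%:R) +i* (pI v/q%:R))%C <= 0 by rewrite mulr_le0_ge0 ?pR_le0.
apply: (le_trans (cexp_lip h1 h2)); rewrite ler_wpM2l//; apply: (le_trans (cn_le _)) => /=.
by rewrite !mul0r subr0 addr0.
Unshelve. all: by end_near. Qed.
(** [char_near] for the weights [freq] turns the expectation into a product of powers of [phi] over
    the windows, whose factors converge by [window_cvg]. *)
Lemma inc_cos s : E (fun x => cos (\sum_(i < N) u i*inc n x i+s)) @[n --> \oo] -->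
 complex.Re (cis s * \prod_(i < N) cexp ((pR (u i)/q%:R) +i* (pI (u i)/q%:R))%C).
pose U := \sum_(i < N) `|u i| + 1.
have U0 : 0 < U by rewrite ltr_wpDl// sumr_ge0.
have [er [er0 her]] := char_near U0.
pose t n i : R := ((grid n i.+1) - (grid n i))%N%:R/n%:R.
pose z n i := cis (- u i * (t n i * (A n/B n))) * phi n (u i) ^+ (grid n i.+1-grid n i).
pose w i := cexp ((pR (u i)/q%:R) +i* (pI (u i)/q%:R))%C.
have cb : N%:R/q%:R*er n + \sum_(i < N) cn (z n i-w i) @[n --> \oo] --> N%:R/q%:R*0 + \sum_(i < N) (0 : R).
 apply: cvgD; first by apply: cvgM => //; exact: cvg_cst.
 by apply: (@cvg_sum_ord _ N (fun i n => cn (z n i-w i)) (fun=> 0)) => i; exact: window_cvg.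
rewrite mulr0 add0r big1// in cb.
apply/cvgrPdist_le => e e0; near=> n.
have n1 : (1 <= n)%N by near: n; exists 1%N.
have b0 := hB0 n1.
have be : N%:R/q%:R*er n + \sum_(i < N) cn (z n i-w i) < e by near: n; exact: cvgr_lt cb _ e0.
have h1 : forall k a, (forall j, `|a j| <= U/B n) ->
 cn (echar mu (psum T f a k) - \prod_(j < k) echar mu (fun x => a j*f x)) <= k%:R/n%:R*er n by near: n.
have ha j : `|freq n j| <= U/B n.
 apply: (le_trans (ler_norm_sum _ _ _)); rewrite /U mulrDl mulr_suml.
 apply: (@le_trans _ _ (\sum_(i < N) `|u i| / B n)); last by rewrite lerDl divr_ge0// ltW.
 apply: ler_sum => i _; rewrite normrM normrM normfV (gtr0_norm b0) ler_piMr//.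
 by rewrite normr_nat; case: (_ && _).
have mp : mfun X (psum T f (freq n) (grid n N)) by exact: psum_measurable hc hf _ _.
pose s' := s - \sum_(i < N) u i * (t n i * (A n/B n)).
have -> : E (fun x => cos (\sum_(i < N) u i*inc n x i+s)) = complex.Re (cis s'*echar mu (psum T f (freq n) (grid n N))).
 rewrite -echar_shift//; apply: ex_eq => x; congr cos.
 rewrite /s' addrA addrAC freq_psum -sumrB; congr (_ + _); apply: eq_bigr => i _.
 by rewrite /inc /csum /t natrB ?grid_le//; field; rewrite !gt_eqF.
have e1 : cis s' * \prod_(i < N) phi n (u i) ^+ (grid n i.+1-grid n i) = cis s * \prod_(i < N) z n i.
 rewrite /z big_split mulrA; congr (_ * _); rewrite /s' -sumrN cisD; congr (_ * _).
 elim: (N) => [|k IH]; first by rewrite !big_ord0 cis0.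
 by rewrite !big_ord_recr cisD IH mulNr.
have -> : complex.Re (cis s * \prod_(i < N) w i)-complex.Re (cis s'*echar mu (psum T f (freq n) (grid n N))) =
 complex.Re (cis s * \prod_(i < N) w i-cis s'*echar mu (psum T f (freq n) (grid n N))) by ring.
apply: (le_trans (cn_Re _)); rewrite cnBC; apply: le_trans (ltW be).
rewrite -[X in cn X](subrKA (cis s * \prod_(i < N) z n i)) (le_trans (cnD _ _))//; apply: lerD.
 rewrite -e1 -mulrBr cnM cn_cis mul1r -freq_prod; apply: (le_trans (h1 _ _ ha)).
 (* Nonnegative because it bounds a modulus, for zero frequencies and [n] steps. *)
 have er00 : 0 <= er n.
 have := h1 n (fun=> 0) (fun=> _); rewrite divff// mul1r => h; apply: le_trans (h _); rewrite ?cn_ge0//.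
 by rewrite normr0.
 rewrite ler_wpM2r// ler_pdivrMr; by have /andP[] := gridP n N.
rewrite -mulrBr cnM cn_cis mul1r; apply: cn_prod_sub => i.
 by rewrite /z cnM cn_cis mul1r cn_pow1// phi_le1.
by rewrite /w cn_cexp -expR0 ler_expR mulr_le0_ge0 ?pR_le0.
Unshelve. all: by end_near. Qed.

(* The increments of [x] and [T x] differ by terms of the orbit at the ends of the windows only. *)
Lemma inc_invariant s : E (fun x => `|cos (\sum_(i < N) u i*inc n x i+s)-cos (\sum_(i < N) u i*inc n (T x) i+s)|)
 @[n --> \oo] --> (0 : R).
have [k0 k1] := andP (obs_kap hf); have M0 := obs_M hf.
pose bd n := \sum_(i < N) 2 * (M * (`|u i| `^ kap*B n `^ (- kap))).
have cb : bd n @[n --> \oo] --> \sum_(i < N) (0 : R).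
 apply: (@cvg_sum_ord _ N (fun i n => 2 * (M * (`|u i| `^ kap*B n `^ (- kap)))) (fun=> 0)) => i.
 rewrite -[X in _ --> X](mulr0 2); apply: cvgM; first side.
 rewrite -[X in _ --> X](mulr0 M); apply: cvgM; first side.
 by rewrite -[X in _ --> X](mulr0 (`|u i| `^ kap)); apply: cvgM; [side|exact: cvg_powR_neg].
rewrite big1// in cb; apply: (squeeze_cvgr _ (cvg_cst 0) cb); near=> n.
have n1 : (1 <= n)%N by near: n.
have b0 := hB0 n1; rewrite ex_ge0//=.
pose F i k x := Num.min 2 (`|u i| / B n * `|f (iter k T x)|).
have u0 i : 0 <= `|u i| / B n by [].
have bF0 i : bmf (fun x => Num.min 2 (`|u i| / B n * `|f x|)) by apply: bmf_min => //.
have bF i k : bmf (F i k) by exact: (bmf_iter mT k (bF0 i)).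
have EF i k : E (F i k) <= M * (`|u i| `^ kap*B n `^ (- kap)).
 rewrite (ex_iter mT presT k (bF0 i)); apply: (le_trans (obs_mom hf (u0 i))).
 by rewrite powRM// powR_inv.
have bS : bmf (fun x => cos (\sum_(i < N) u i*inc n x i+s)).
 apply: bmf_cos; apply: measurable_funD => //; apply: measurable_sum => i.
 by apply: measurable_funM => //; exact: inc_measurable.
apply: (@le_trans _ _ (E (fun x => \sum_(i < N) (F i (grid n i.+1) x+F i (grid n i) x)))); last first.
 rewrite (ex_sum mu _ (H := fun i : 'I_N => fun x => F i (grid n i.+1) x+F i (grid n i) x)); last by move=> i; side.
 by apply: ler_sum => i _; rewrite exD// mulrDl mul1r lerD.
apply: ex_le; [by apply: bmf_norm; apply: bmfB => //; exact: (bmf_comp mT bS)|side|].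
move=> x; apply: (le_trans (cos_diff_min _ _)).
have -> : \sum_(i < N) u i*inc n x i+s - (\sum_(i < N) u i*inc n (T x) i+s) =
 \sum_(i < N) (u i/B n*f (iter (grid n i) T x)-u i/B n*f (iter (grid n i.+1) T x)).
 rewrite opprD addrACA subrr addr0 -sumrB; apply: eq_bigr => i _.
 have sh k : erg k (T x) = erg k x+f (iter k T x)-f x.
 elim: k => [|k IHk]; first by rewrite /ergodic_sum !big_ord0 add0r subrr.
 have ES y : erg k.+1 y = erg k y+f (iter k T y) by rewrite /ergodic_sum big_ord_recr.
 by rewrite !ES IHk -iterSr; ring.
 by rewrite /inc /csum !sh; ring.
elim: (N) => [|k IH]; first by rewrite !big_ord0 normr0 ge_min lexx orbT.
rewrite !big_ord_recr; apply: le_trans (lerD IH (lexx _)).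
have d0 : `|u k| / B n * `|f (iter (grid n k) T x)| = `|u k/B n*f (iter (grid n k) T x)| by rewrite !normrM normfV (gtr0_norm b0).
have d1 : `|u k| / B n * `|f (iter (grid n k.+1) T x)| = `|u k/B n*f (iter (grid n k.+1) T x)| by rewrite !normrM normfV (gtr0_norm b0).
rewrite /F d0 d1; apply: le_trans (lerD (lexx _) (min2D (normr_ge0 _) (normr_ge0 _))).
apply: le_trans (min2D (normr_ge0 _) (addr_ge0 (normr_ge0 _) (normr_ge0 _))).
by apply: min2_le; rewrite (le_trans (ler_normD _ _))// lerD2l [leRHS]addrC ler_normB.
Unshelve. all: by end_near. Qed.

End Frequency.
End Increments.

(** * Maximal inequality and the jumps within a window *)

Section Tightness.
Hypothesis hosc : exists C t0 : R, 0 <= C /\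
 forall t, t0 <= t -> m [set x | t < osc (c x)] <= C * m [set x | t < `|f x|].

(** Bounds the oscillation of the sum up to [k] among good points with the same [k]-word. *)
Definition accum k x : R := \sum_(i < k) osc (c (iter i T x))*theta ^+ (k - i).
(** On good points a majorant of the centred sum that is a function of the first [k] letters, so
    that first exceedances are saturated events. *)
Definition major n k x : R := `|repv T c G k (csum n k) x| + accum k x.

Lemma accum_ge0 k x : 0 <= accum k x.
have /andP[th0 _] := obs_theta hf.
by apply: sumr_ge0 => i _; rewrite mulr_ge0 ?(obs_osc0 hf)// exprn_ge0 ltW.
Qed.
Lemma major_word n k : word_fun T c k (major n k).
move=> x y sxy; rewrite /major (repv_word _ _ sxy); congr (_ + _).
by apply: eq_bigr => i _; rewrite sxy.
Qed.
Lemma repv_csum n k x : G x -> `|repv T c G k (csum n k) x-csum n k x| <= accum k x.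
move=> Gx; have [y [Gy sxy ->]] := repvP T c k (csum n k) Gx.
rewrite /csum opprB addrA subrK -sumrB; apply: (le_trans (ler_norm_sum _ _ _)); apply: ler_sum => i _.
rewrite distrC; apply: (obs_osc hf); rewrite ?subn_gt0//; [exact: (good_iter hf)|exact: (good_iter hf)|].
by move=> j jk; rewrite -!iterD; apply: sxy; rewrite addnC -ltn_subRL.
Qed.
Lemma csum_major n k x : G x -> `|csum n k x| <= major n k x.
move=> Gx; have := repv_csum n k Gx; move=> /ler_normlP[h1 h2].
by rewrite /major ler_norml; apply/andP; split; have := ler_norm (repv T c G k (csum n k) x);
 have := lerNnormlW (lexx `|repv T c G k (csum n k) x|); lra.
Qed.
Lemma accum_le k x b : 0 <= b -> (forall i, (i < k)%N -> osc (c (iter i T x)) <= b * (1-theta)) -> accum k x <= b.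
move=> b0 h; have /andP[th0 th1] := obs_theta hf; have q0 : 0 < 1-theta by lra.
apply: (@le_trans _ _ (\sum_(i < k) b * (1-theta)*theta ^+ (k - i))).
 by apply: ler_sum => i _; rewrite ler_wpM2r// h.
have geo : \sum_(i < k) theta ^+ (k - i) <= (1-theta)^-1 by apply: geom_bound; side.
rewrite -mulr_sumr -[leRHS](mulfK (lt0r_neq0 q0)); apply: ler_wpM2l => //; side.
Qed.
Lemma major_saturated n r k : saturated T c k [set x | r < major n k x].
by move=> x y sxy /=; rewrite (major_word n sxy). Qed.
Definition exceed n r L : set X := hit (fun k => [set x | r < major n k x]) L.

Lemma exceed_measurable n r L : measurable (exceed n r L).
by apply: (msat hc (k := L)); apply: hit_saturated => k; exact: major_saturated. Qed.
(** The truncation inequality [tail_sup] applied to the bound of [window_charfun]. *)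
Lemma csum_tail eta : 0 < eta -> exists C : R, 0 <= C /\ \forall n \near \oo, forall k,
 m [set x | eta*B n < `|csum n k x|] <= C * (k%:R/n%:R).
move=> e0; have h0 : 0 < 2/eta by rewrite divr_gt0.
have [C [C0 hC]] := window_charfun h0.
exists (2*C); split; first side.
near=> n => k; have n1 : (1 <= n)%N by near: n; exists 1%N.
have b0 := hB0 n1.
have h : forall k u, `|u| <= 2/eta -> E (fun x => 1-cos (u * ((B n)^-1*csum n k x))) <= C * (k%:R/n%:R) by near: n.
have mZ : mfun X (fun x => (B n)^-1*csum n k x) by apply: measurable_funM => //; exact: csum_measurable.
have hv v : 0 <= v <= 2/eta -> E (fun x => 1-cos (v * ((B n)^-1*csum n k x))) <= C * (k%:R/n%:R) by case/andP => v0 v1; apply: h; rewrite ger0_norm.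
have := @tail_sup R _ X mu _ mZ (2/eta) (C * (k%:R/n%:R)) h0 _ hv.
rewrite -mulrA; have -> : [set x | 2 / (2/eta) < `|(B n)^-1*csum n k x|] = [set x | eta*B n < `|csum n k x|].
 have e2 : 2 / (2/eta) = eta by field; side.
 by apply/seteqP; split=> x /=; rewrite e2 normrM gtr0_norm// [_^-1 * _]mulrC ltr_pdivlMr.
by apply; side.
Unshelve. all: by end_near. Qed.
Lemma osc_exceed eta : 0 < eta -> exists C : R, 0 <= C /\ \forall n \near \oo,
 m [set x | eta*B n < osc (c x)] <= C/n%:R.
move=> e0; have [Co [t1 [Co0 ht1]]] := hosc; have /andP[al0 al2] := hal.
have h1 : 0 < al/2 < al by lra.
have h2 : al < al+1 by lra.
have [C [C0 hC]] := tail_uniform mf hal hcpm hell htails hB0 hBoo hBell h1 h2.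
pose b1 := Num.max (eta `^ (- (al/2))) (eta `^ (- (al+1))).
have b10 : 0 <= b1 by rewrite le_max powR_ge0.
exists (Co * (C*b1)); split; first side.
near=> n; have n1 : (1 <= n)%N by near: n; exists 1%N.
have Bt : t1/eta <= B n by near: n; exact: (hBoo (nbhs_pinfty_ge (num_real _))).
have tl : forall x, 0 < x -> n%:R*tailV mu f (x*B n) <= C*Num.max (x `^ (- (al/2))) (x `^ (- (al+1))) by near: n.
apply: (le_trans (ht1 _ _)); first by rewrite mulrC -ler_pdivrMr.
rewrite -mulrA ler_wpM2l//; apply: (le_trans (tail_abs mu mf _)); rewrite ler_pdivlMr// mulrC; exact: tl.
Unshelve. all: by end_near. Qed.
Lemma osc_orbit_bound b L : exists Q : set X, [/\ measurable Q, m Q <= L%:R * m [set x | b < osc (c x)] &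
 forall x, ~ Q x -> forall i, (i < L)%N -> osc (c (iter i T x)) <= b].
have mO : measurable [set x | b < osc (c x)] by apply: (@mset_gt _ _ _ (fun x => osc (c x))); exact: osc_measurable osc hc.
elim: L => [|L [Q [mQ mQb hQ]]]; first by exists set0; split=> //; rewrite pr_set0 mul0r.
have mT' := mpren mT L mO.
exists (Q `|` iter L T @^-1` [set x | b < osc (c x)]); split; first side.
 apply: (le_trans (pr_subU mu mQ mT')); rewrite -natr1 mulrDl mul1r lerD//.
 by rewrite (presTn mT presT).
move=> x h i; rewrite ltnS leq_eqVlt => /orP[/eqP->|iL]; last by apply: hQ => // Qx; apply: h; left.
by rewrite leNgt; apply/negP => hh; apply: h; right.
Qed.

(* Ottaviani's inequality: after the first large value the remaining sum must compensate it. *)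
Lemma exceed_bound eta : 0 < eta -> exists C c0 : R, [/\ 0 <= C, 0 < c0 & \forall n \near \oo, forall L,
 L%:R/n%:R <= c0 -> m (exceed n (eta*B n) L) <= C * (L%:R/n%:R)].
move=> e0; have e4 : 0 < eta/4 by [].
have /andP[th0 th1] := obs_theta hf; have q0 : 0 < 1-theta by lra.
have K0 := code_K hc; have [C1 [C10 hC1]] := csum_tail e4.
have [C2 [C20 hC2]] := osc_exceed (mulr_gt0 e4 q0).
(* For [t] up to [c0] the factor [(1 + K) * (C1 * t)] is at most one half, so the probability on the
   right can be absorbed. *)
exists (2 * (C1+C2)), (2 * (1+K) * (C1+1))^-1; split=> //.
near=> n => L hL; have n1 : (1 <= n)%N by near: n; exists 1%N.
have b0 := hB0 n1; have nR : 0 < n%:R :> R by rewrite ltr0n.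
have g1 : forall k, m [set x | eta/4*B n < `|csum n k x|] <= C1 * (k%:R/n%:R) by near: n.
have g2 : m [set x | eta/4 * (1-theta)*B n < osc (c x)] <= C2/n%:R by near: n.
set r := eta*B n; have er : eta/4*B n = r/4 by rewrite /r mulrAC.
have r0 : 0 < r by apply: mulr_gt0.
have [Q [mQ mQb hQ]] := osc_orbit_bound (eta/4 * (1-theta)*B n) L.
set St := fun k => [set x | r < major n k x]; pose Wk k := [set x | r/4 < `|csum n (L-k) x|].
have mC k : measurable [set x | r/4 < `|csum n k x|].
 by apply: mset_gt; apply: measurableT_comp => //; exact: csum_measurable.
have mW k : measurable (Wk k) by exact: mC.
have hSt k : saturated T c k (St k) by exact: major_saturated.
set t := L%:R/n%:R in hL *; have t0 : 0 <= t by apply: divr_ge0.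
have lb : m (later T St Wk L) <= (1+K) * (C1*t) * m (exceed n r L).
 apply: (later_bound hc hSt mW) => [|k kL]; first by [].
 by rewrite /Wk -er (le_trans (g1 _))// ler_wpM2l// ler_wpM2r// ler_nat leq_subr.
have mG := obs_mgood hf; have ml := later_measurable hc hSt L mW.
have sub : exceed n r L `<=` (~` G `|` Q) `|` ([set x | r/4 < `|csum n L x|] `|` later T St Wk L).
 move=> x hx; have [Gx|] := pselect (G x); last by left; left.
 have [|nQ] := pselect (Q x); first by left; right.
 right; have [k [kL fk _]] := first_hit hx.
 have Sk : r < major n k x by case: (k) fk => [//|k' []].
 have ak : accum k x <= r/4.
 apply: accum_le => [|i ik]; first by [].
 by rewrite -er mulrAC; apply: (hQ x nQ i (leq_trans ik kL)).
 have [h|h] := ltP (r/4) `|csum n L x|; [by left|right].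
 apply: (@later_hit _ _ T St Wk k) => //; rewrite /Wk /=.
 have e : csum n L x = csum n k x+csum n (L-k) (iter k T x) by rewrite -csumD subnKC.
 have t1 := ler_normB (csum n L x) (csum n (L-k) (iter k T x)); rewrite {1}e addrK in t1.
 have t2 := ler_normD (repv T c G k (csum n k) x-csum n k x) (csum n k x); rewrite subrK in t2.
 have := repv_csum n k Gx; move: Sk t1 t2 h ak; rewrite /major.
 move: (`|_|) (`|_|) (`|_|) (`|_|) (`|_|) (accum k x) => a1 a2 a3 a4 a5 a6; lra.
have hb : m (exceed n r L) <= C2*t + (C1*t + (1+K) * (C1*t) * m (exceed n r L)).
 apply: (le_trans (pr_le mu (exceed_measurable n r L) _ sub)); first by [].
 rewrite (le_trans (pr_subU mu _ _))//; apply: lerD.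
 rewrite (le_trans (pr_subU mu _ mQ))// (obs_good0 hf) add0r (le_trans mQb)// mulrC.
 by apply: le_trans (ler_wpM2r (ler0n R L) g2) _; rewrite /t; lra.
 by rewrite (le_trans (pr_subU mu (mC L) ml))// lerD// -er.
have half : (1+K) * (C1*t) <= 2^-1.
 have h3 : 2 * (1+K) * (C1+1)*t <= 1 by rewrite mulrC -ler_pdivlMr// mul1r.
 have : 0 <= (1+K)*t by []; lra.
have := ler_wpM2r (pr_ge0 mu (exceed n r L)) half.
rewrite -/r; move: (m _) hb => y hb; move: ((1+K) * (C1*t)*y) hb => w hb h'; lra.
Unshelve. all: by end_near. Qed.
(** The discrete counterpart of [split_on], with [j] as the time of the jump. *)
Definition splits (s : nat -> R) (L : nat) (e : R) : Prop := exists j, [/\ (0 < j <= L)%N,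
 forall l, (l < j)%N -> `|s l| <= e & forall l, (j <= l <= L)%N -> `|s L-s l| <= e].

(** The splitting time is the first exceedance of half the level. A second exceedance, counted from
    that time, has probability of order [(L / n)^2] by [later_bound]; without it the sum varies by
    at most the level from then on. *)
Lemma split_bound e : 0 < e -> exists C c0 : R, [/\ 0 <= C, 0 < c0 & \forall n \near \oo, forall L, (0 < L)%N ->
 L%:R/n%:R <= c0 -> exists Q, [/\ measurable Q, m Q <= C * (L%:R/n%:R) ^+ 2 &
 forall x, ~ Q x -> splits (fun l => csum n l x) L (e*B n)]].
move=> e0; have e2 : 0 < e/2 by [].
have [C [c0 [C0 c00 hC]]] := exceed_bound e2; have K0 := code_K hc.
exists ((1+K)*C ^+ 2), c0; split=> //.
near=> n => L L0 hL; have n1 : (1 <= n)%N by near: n; exists 1%N.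
have b0 := hB0 n1; set r := e/2*B n; have r0 : 0 < r by apply: mulr_gt0.
have : forall L, L%:R/n%:R <= c0 -> m (exceed n (e/2*B n) L) <= C * (L%:R/n%:R) by near: n.
move/(_ L hL); rewrite -/r; set t := L%:R/n%:R => hbL; have t0 : 0 <= t by apply: divr_ge0.
set St := fun k => [set x | r < major n k x].
have hSt k : saturated T c k (St k) by exact: major_saturated.
have mW (k : nat) := exceed_measurable n r L.
have mG := obs_mgood hf; have ml := later_measurable hc hSt L mW.
exists (~` G `|` later T St (fun=> exceed n r L) L); split=> //.
 rewrite (le_trans (pr_subU mu _ ml))// (obs_good0 hf) add0r.
 apply: (le_trans (later_bound hc hSt mW _ (fun k _ => hbL))); first by [].
 rewrite (_ : _*t ^+ 2 = (1+K) * (C*t) * (C*t)); last by ring.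
 by apply: ler_wpM2l.
have er : e*B n = r+r by rewrite /r; field.
move=> x nQ; have Gx : G x by apply: contrapT => h; apply: nQ; left.
have nl : ~ later T St (fun=> exceed n r L) L x by move=> h; apply: nQ; right.
have small y l : G y -> ~ exceed n r L y -> (l <= L)%N -> `|csum n l y| <= r.
 move=> Gy ny lL; apply: (le_trans (csum_major n l Gy)); rewrite leNgt; apply/negP => hh.
 by apply: ny; apply/hitP; exists l.
have [h|h] := pselect (exceed n r L x); last first.
 (* Without an exceedance the jump may be placed at the end of the window. *)
 exists L; split; first by rewrite L0 leqnn.
 by move=> l lL; rewrite er (le_trans (small x l Gx h (ltnW lL)))// lerDl ltW.
 by move=> l; rewrite -eqn_leq => /eqP<-; rewrite subrr normr0.
have [k [kL fk hk]] := first_hit h.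
have k0 : (0 < k)%N.
 rewrite lt0n; apply/negP => /eqP k0; have : St k x by case: (k) fk => [//|k' []].
 rewrite k0 /St /= /major /accum big_ord0 addr0.
 have [y [_ _ ->]] := repvP T c 0 (csum n 0) Gx.
 by rewrite /csum /ergodic_sum big_ord0 !mul0r subr0 normr0 ltNge ltW.
have Gk : G (iter k T x) by exact: (good_iter hf).
have nh : ~ exceed n r L (iter k T x) by move=> hh; apply: nl; exact: (@later_hit _ _ T St _ k).
exists k; split; first by rewrite k0.
 move=> l lk; rewrite er (le_trans (csum_major n l Gx))// (@le_trans _ _ r) ?lerDl ?(ltW r0)//.
 by rewrite leNgt; apply/negP => hh; exact: hk hh.
move=> l /andP[kl lL]; rewrite er -{1}(subnKC kL) -{1}(subnKC kl) !csumD.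
rewrite opprD addrACA subrr add0r (le_trans (ler_normB _ _))// lerD//.
 by apply: small => //; exact: leq_subr.
by apply: small => //; exact: leq_trans (leq_subr _ _) lL.
Unshelve. all: by end_near. Qed.

(** A window lasts about [n / q] steps, so each of the [H * q] windows fails with probability of
    order [q^-2]; the bad sets are pulled back by invariance and added. *)
Theorem path_splits e e1 (H : nat) : 0 < e -> 0 < e1 -> exists q0 : nat, forall q, (q0 <= q)%N -> (0 < q)%N ->
 \forall n \near \oo, exists Q, [/\ measurable Q, m Q <= e1 &
 forall x, ~ Q x -> forall i, (i < H*q)%N ->
 splits (fun l => csum n (grid q n i+l) x-csum n (grid q n i) x) (grid q n i.+1-grid q n i) (e*B n)].
move=> e0 e10; have [C [c0 [C0 c00 hC]]] := split_bound e0.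
pose z := 2/c0+4*H%:R*C/e1.
exists (Num.truncn z).+1 => q qz q0.
have qR : 0 < q%:R :> R by rewrite ltr0n.
have z0 : 0 <= z by rewrite addr_ge0// divr_ge0 ?mulr_ge0// ltW.
have zq : z <= q%:R by have /andP[_ /ltW h] := truncn_itv z0; apply: (le_trans h); rewrite ler_nat.
have zq1 : 2/q%:R <= c0.
 rewrite ler_pdivrMr// mulrC -ler_pdivrMr//; apply: le_trans zq; by rewrite lerDl divr_ge0 ?(ltW e10)// !mulr_ge0.
have zq2 : 4*H%:R*C/q%:R <= e1.
 by rewrite ler_pdivrMr// [e1 * _]mulrC -ler_pdivrMr//; apply: le_trans zq; rewrite lerDr divr_ge0// ltW.
near=> n; have n1 : (1 <= n)%N by near: n; exists 1%N.
have nR : 0 < n%:R :> R by rewrite ltr0n.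
(* Windows then contain at least one step and at most [2 * n / q]. *)
have nq : (2*q <= n)%N by near: n; exists (2*q)%N.
have nq' : 2 <= n%:R/q%:R :> R by rewrite ler_pdivlMr// -natrM ler_nat.
have h : forall L, (0 < L)%N -> L%:R/n%:R <= c0 -> exists Q, [/\ measurable Q, m Q <= C * (L%:R/n%:R) ^+ 2 &
 forall x, ~ Q x -> splits (fun l => csum n l x) L (e*B n)] by near: n.
pose len i := (grid q n i.+1-grid q n i)%N.
have lenP i : (0 < len i)%N /\ (len i)%:R/n%:R <= 2/q%:R :> R.
 have /andP[a1 a2] := gridP q n i; have /andP[a3 a4] := gridP q n i.+1.
 have eg : (len i)%:R = (grid q n i.+1)%:R - (grid q n i)%:R :> R by rewrite natrB// grid_le.
 have ei : i.+1%:R/q%:R*n%:R = i%:R/q%:R*n%:R+n%:R/q%:R :> R by rewrite -[i.+1%:R]natr1; ring.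
 rewrite ei in a3 a4; rewrite -[(grid q n i).+1%:R]natr1 in a2; rewrite -[(grid q n i.+1).+1%:R]natr1 in a4.
 split; first by rewrite -(ltr_nat R) eg; move: a1 a2 a3 a4 nq'; move: (n%:R/q%:R) (i%:R / _ * _) (grid _ _ _)%:R (grid _ _ _)%:R => *; lra.
 rewrite ler_pdivrMr// mulrAC -mulrA eg; move: a1 a2 a3 a4 nq'.
 move: (n%:R/q%:R) (i%:R / _ * _) (grid _ _ _)%:R (grid _ _ _)%:R => *; lra.
suff key N : exists Q, [/\ measurable Q, m Q <= N%:R * (C * (2/q%:R) ^+ 2) & forall x, ~ Q x -> forall i, (i < N)%N ->
 splits (fun l => csum n (grid q n i+l) x-csum n (grid q n i) x) (len i) (e*B n)].
 have [Q [mQ mQb hQ]] := key (H*q)%N; exists Q; split=> //; apply: (le_trans mQb); apply: le_trans zq2.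
 by rewrite natrM le_eqVlt; apply/orP; left; apply/eqP; field; rewrite gt_eqF.
elim: N => [|N [Q [mQ mQb hQ]]]; first by exists set0; split=> //; rewrite pr_set0 mul0r.
have [l0 l1] := lenP N.
have [Q' [mQ' mQb' hQ']] := h (len N) l0 (le_trans l1 zq1).
have mP := mpren mT (grid q n N) mQ'.
exists (Q `|` iter (grid q n N) T @^-1` Q'); split; first exact: measurableU.
 apply: (le_trans (pr_subU mu mQ mP)); rewrite -natr1 mulrDl mul1r lerD// (presTn mT presT)//.
 apply: (le_trans mQb'); rewrite ler_wpM2l// ler_sqr ?nnegrE ?divr_ge0//.
move=> x nQ i; rewrite ltnS leq_eqVlt => /orP[/eqP->|iN]; last by apply: hQ => // Qx; apply: nQ; left.
have [j [j1 j2 j3]] := hQ' _ (fun Qx => nQ (or_intror Qx)).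
have sE l : csum n (grid q n N+l) x-csum n (grid q n N) x = csum n l (iter (grid q n N) T x) by rewrite csumD addrAC subrr add0r.
by exists j; split=> // l hl; rewrite ?sE; [exact: j2|exact: j3].
Unshelve. all: by end_near. Qed.

(** * Convergence to the Levy process *)

Context {d'} {W : measurableType d'}.
Variables (P : probability W R) (L : W -> skorohod R) (S : probability (measurableTypeR R) R).
Hypotheses (hL : levy_process P L) (hL1 : same_law P (fun w => L w 1) S (fun x => x))
 (hS : forall u, charfun S u = cexp (pR u +i* pI u)%C).
Hypotheses (cR : continuous pR) (cI : continuous pI) (pR0 : pR 0 = 0) (pI0 : pI 0 = 0).
Variable nu : probability X R.
Hypothesis numu : nu `<< mu.
Local Notation Y := (partial_sum_process T f A B).
Local Notation step q n := (inc q n).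

Hypothesis happ : forall A e, measurable A -> 0 < e ->
 exists k S, [/\ measurable S, saturated T c k S & m (A `+` S) < e].

(** The limit under [mu] comes from [inc_cos] and is identified by [levy_inc_charfun]; [strong_cvg]
    transfers it to [nu], by [inc_invariant]. *)
Lemma increment_cos q N (u : nat -> R) s : (0 < q)%N ->
 ex nu (fun x => cos (\sum_(i < N) u i*step q n x i+s)) @[n --> \oo] -->
 ex P (fun w => cos (\sum_(i < N) u i * levy_inc L q i w+s)).
move=> q0; have mi n : mfun X (fun x => \sum_(i < N) u i*step q n x i+s).
 by apply: measurable_funD => //; apply: measurable_sum => i; apply: measurable_funM => //; exact: inc_measurable.
rewrite (indep_cos (mlevy_inc hL q) u (levy_indep hL q0 N) s).
under [X in _*X]eq_bigr do rewrite (levy_inc_charfun hL hL1 hS cR cI pR0 pI0 q0).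
apply: (@strong_cvg _ _ _ mu T c K g hc happ (fun n x => cos (\sum_(i < N) u i*step q n x i+s))) => //.
- by move=> n; exact: bmf_cos.
- by side.
- have := inc_cos q0 (N := N) (u := u) (s := s); apply.
- exact: inc_invariant.
Qed.
Lemma increment_tight q i e : (0 < q)%N -> 0 < e ->
 exists V : R, \forall n \near \oo, pr nu [set x | V < `|step q n x i|] <= e.
move=> q0; apply: (@tight_of_cos _ _ _ _ _ nu P (fun n x => step q n x i) (levy_inc L q i)) => [n||u].
- exact: inc_measurable.
- exact: (mlevy_inc hL).
have := @increment_cos q i.+1 (fun j => if j == i then u else 0) 0 q0.
have E1 (v : nat -> R) : \sum_(j < i.+1) (if j == i :> nat then u else 0)*v j+0 = u*v i.
 rewrite big_ord_recr /= eqxx big1 ?add0r ?addr0// => j _.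
 by rewrite (ltn_eqF (ltn_ord j)) mul0r.
by under eq_fun do under ex_eq do rewrite E1; rewrite (ex_eq P (fun w => f_equal cos (E1 (fun j => levy_inc L q j w)))).
Qed.
Lemma path_sample n x q i : Y n x (i%:R/q%:R) = (B n)^-1*csum n (grid q n i) x.
by []. Qed.
Lemma path_measurable n t : mfun X (fun x => Y n x t : R).
by apply: measurable_funM => //; exact: csum_measurable. Qed.
Lemma split_path (q n i : nat) e x : (0 < q)%N -> (0 < n)%N ->
 splits (fun l => csum n (grid q n i+l) x-csum n (grid q n i) x)
 (grid q n i.+1-grid q n i) (e*B n) ->
 split_on e (Y n x) (i%:R/q%:R) (i.+1%:R/q%:R).
move=> q0 n0 [j [/andP[j0 jL] h1 h2]]; have nR : 0 < n%:R :> R by rewrite ltr0n.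
have gle := @grid_le q n _ _ (leqnSn i).
have b0 : 0 < (B n)^-1 by rewrite invr_gt0 hB0.
have val t k l : Y n x t = (B n)^-1*csum n k x -> `|csum n k x-csum n l x| <= e*B n ->
 `|Y n x t - (B n)^-1*csum n l x| <= e by move=> -> h; rewrite -mulrBr normrM gtr0_norm// mulrC ler_pdivrMr// hB0.
have Yt t : Y n x t = (B n)^-1*csum n (Num.truncn (t*n%:R)) x by [].
have /andP[g1 g2] := @gridP q n i; have /andP[g3 g4] := @gridP q n i.+1.
exists ((grid q n i+j)%:R/n%:R); split.
- rewrite ltr_pdivlMr// ler_pdivrMr//; apply/andP; split.
 by apply: lt_le_trans g2 _; rewrite ler_nat; lia.
 by apply: le_trans g3; rewrite ler_nat; lia.
- move=> t /andP[t1]; rewrite ltr_pdivlMr// => t2; rewrite path_sample; apply: (val _ _ _ (Yt t)).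
 have k1 : (grid q n i <= Num.truncn (t*n%:R))%N by apply: le_truncn; rewrite ler_pM2r.
 have k2 : (Num.truncn (t*n%:R) < grid q n i+j)%N by rewrite truncn_lt_nat// mulr_ge0// (le_trans _ t1).
 have := h1 (Num.truncn (t*n%:R)-grid q n i)%N; rewrite subnKC//; apply; rewrite ltn_subLR//.
- move=> t /andP[]; rewrite ler_pdivrMr// => t1 t2; rewrite path_sample; apply: (val _ _ _ (Yt t)).
 have k1 : (grid q n i+j <= Num.truncn (t*n%:R))%N by rewrite truncn_ge_nat (le_trans _ t1).
 have k2 : (Num.truncn (t*n%:R) <= grid q n i.+1)%N by apply: le_truncn; rewrite ler_pM2r.
 have := h2 (Num.truncn (t*n%:R)-grid q n i)%N; rewrite !subnKC ?(leq_trans _ k1) ?leq_addr//.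
 have -> (a b c' : R) : a-b - (c'-b) = a-c' by ring.
 by rewrite distrC; apply; rewrite leq_sub2r// andbT leq_subRL (leq_trans _ k1)// leq_addr.
Qed.

Section LowerBound.
Variables (h : skorohod R -> R) (C : R).
Hypotheses (ch : continuous h) (hC : forall x, `|h x| <= C).

Lemma bmf_path : bmf (fun w => h (L w)) /\ forall n, bmf (fun x => h (Y n x)).
split=> [|n]; (split; last by exists C => ?; exact: hC).
 by apply: (path_fun_measurable _ hC ch) => t t0; exact: mlevy hL _ t0.
by apply: (path_fun_measurable _ hC ch) => t _; exact: path_measurable.
Qed.
(** The sampled path is rebuilt from its increments by [V], which makes the functional Lipschitz in
    the increments. The Levy process starts at 0 only almost surely, hence the use of [ex_ae]. *)
Lemma low_disc_law q N k : (0 < q)%N -> 0 <= k ->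
 ex nu (fun x => low h k (disc q N (fun i => Y n x (i%:R/q%:R)))) @[n --> \oo] -->
 ex P (fun w => low h k (disc q N (fun i => L w (i%:R/q%:R)))).
move=> q0 k0; have qR : 0 < q%:R :> R by rewrite ltr0n.
pose V (v : nat -> R) (i : nat) := \sum_(j < i) v j; pose F v := low h k (disc q N (V v)).
have lipF : lip_in N k F.
 apply: (low_lip hC) => // v w i iN; rewrite /V -sumrB (le_trans (ler_norm_sum _ _ _))//.
 rewrite -!(big_mkord xpredT (fun j => `|v j-w j|)) (big_cat_nat (leq0n i) iN) lerDl.
 by [].
have mi n i : mfun X (fun x => step q n x i) by exact: inc_measurable.
have := @lip_converges _ _ _ _ _ nu P N (fun n x => step q n x) (fun w i => levy_inc L q i w) mi
 (mlevy_inc hL q) (fun u s => @increment_cos q N u s q0) (fun i e _ => increment_tight i q0) k F C k0 lipF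
 (fun v => low_bound hC _ k0).
have eY n x : V (step q n x) = fun i => Y n x (i%:R/q%:R).
 apply/funext => i; rewrite /V /inc -mulr_sumr path_sample; congr (_ * _).
 rewrite -(big_mkord xpredT (fun j => csum n (grid q n j.+1) x-csum n (grid q n j) x)).
 rewrite telescope_sumr// /grid mul0r mul0r truncn0 /csum /ergodic_sum big_ord0 mul0r mul0r subr0 subr0 //.
have eL w : L w 0 = 0 -> V (fun i => levy_inc L q i w) = fun i => L w (i%:R/q%:R).
 move=> L0; apply/funext => i; rewrite /V /levy_inc.
 rewrite -(big_mkord xpredT (fun j => L w (j.+1%:R/q%:R)-L w (j%:R/q%:R))).
 by rewrite (telescope_sumr (fun j => L w (j%:R/q%:R)))// mul0r L0 subr0.
under eq_fun do under ex_eq do rewrite /F eY.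
rewrite (@ex_ae _ _ _ P _ (fun w => low h k (disc q N (fun i => L w (i%:R/q%:R)))) (fun w => L w 0 = 0))//.
- split; last by exists C => w; exact: low_bound.
 exact: (lip_measurable (mlevy_inc hL q) k0 lipF).
- split; last by exists C => w; exact: low_bound.
 by apply: (mlow_disc _ hC) => // t t0; exact: mlevy hL _ t0.
- by case: hL.
- by move=> w L0; rewrite /F eL.
Qed.
(** Five errors of [e / 5]: passing to the minorant, discretising the Levy path, convergence of the
    increments, the closeness [de] of path and sample, and the exceptional set [Q]. *)
Lemma path_lower_bound e : 0 < e ->
 \forall n \near \oo, ex P (fun w => h (L w))-e <= ex nu (fun x => h (Y n x)).
move=> e0; have e5 : 0 < e/5 by rewrite divr_gt0.
have C0 : 0 <= C := le_trans (normr_ge0 _) (hC (Y 0%N point)).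
have [bL bY] := bmf_path.
have mL t : 0 <= t -> mfun W (fun w => L w t : R) by exact: mlevy hL _.
have lowm k : 0 <= k -> mfun W (fun w => low h k (L w)) by move=> k0; exact: (low_measurable mL hC).
have [k hk] : exists k : nat, ex P (fun w => h (L w))-e/5 <= ex P (fun w => low h k%:R (L w)).
 have cv : ex P (fun w => low h k%:R (L w)) @[k --> \oo] --> ex P (fun w => h (L w)).
 apply: (@ex_dominated_bound _ _ _ _ _ _ C) => [k|||w].
 - exact: lowm.
 - by case: bL.
 - by move=> k w; exact: low_bound.
 - exact: (low_cvg hC).
 have [N _ hN] := near_dist cv e5; exists N; have := hN N (leqnn N); rewrite ler_distl => /andP[]; lra.
have k0 : 0 <= k%:R :> R by [].
have k1 : 0 < k%:R+1 :> R by lra.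
pose de := e/5 / (k%:R+1).
have de0 : 0 < de by exact: divr_gt0.
have kde : k%:R*de <= e/5 by rewrite /de mulrA ler_pdivrMr//; nra.
have C1 : 0 < 2*C+1 by lra.
(* Splitting fails on a set of small [mu]-measure; absolute continuity makes its [nu]-measure
   small. *)
have [b [b0 hb]] := small_sets numu (divr_gt0 e5 C1).
pose H := (Num.truncn (de^-1+2)).+1.
have [q0 hq0] := path_splits H de0 b0.
have cv : ex P (fun w => low h k%:R (disc q.+1 (q.+1*q.+1) (fun i => L w (i%:R/q.+1%:R)))) @[q --> \oo] -->
 ex P (fun w => low h k%:R (L w)).
 apply: (@ex_dominated_bound _ _ _ _ _ _ C) => [q|||w].
 - exact: (mlow_disc mL hC).
 - exact: lowm.
 - by move=> k' w; exact: low_bound.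
 - exact: (low_disc_cvg hC).
have [q [q1 q2 q3 q4]] : exists q, [/\ (q0 <= q.+1)%N, (H <= q.+1)%N, 2/de <= q.+1%:R &
 ex P (fun w => low h k%:R (L w))-e/5 <= ex P (fun w => low h k%:R (disc q.+1 (q.+1*q.+1) (fun i => L w (i%:R/q.+1%:R))))].
 have [N _ hN] := near_dist cv e5; pose r := (Num.truncn (2/de)).+1.
 exists (N + (q0 + (H+r)))%N; split.
 - by rewrite leqW// addnCA leq_addr.
 - by rewrite leqW// addnA addnCA leq_addr.
 - by rewrite ltW// (lt_le_trans (truncnS_gt _))// ler_nat leqW// !addnA leq_addl.
 - by have := hN (N + (q0 + (H+r)))%N (leq_addr _ _); rewrite /= ler_distl => /andP[]; lra.
have qR : 0 < q.+1%:R :> R by rewrite ltr0n.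
have cvd := @low_disc_law q.+1 (q.+1*q.+1)%N _ (ltn0Sn q) k0.
near=> n; have n0 : (0 < n)%N by near: n; exists 1%N.
have hd : `|ex P (fun w => low h k%:R (disc q.+1 (q.+1*q.+1) (fun i => L w (i%:R/q.+1%:R)))) -
 ex nu (fun x => low h k%:R (disc q.+1 (q.+1*q.+1) (fun i => Y n x (i%:R/q.+1%:R))))| <= e/5.
 by near: n; exact: (near_dist cvd e5).
have [Q [mQ Qb hQ]] : exists Q, [/\ measurable Q, pr mu Q <= b &
 forall x, ~ Q x -> forall i, (i < H*q.+1)%N ->
 splits (fun l => csum n (grid q.+1 n i+l) x-csum n (grid q.+1 n i) x)
 (grid q.+1 n i.+1-grid q.+1 n i) (de*B n)] by near: n; exact: hq0.
have nuQ := hb Q mQ Qb.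
set D := fun x => low h k%:R (disc q.+1 (q.+1*q.+1) (fun i => Y n x (i%:R/q.+1%:R))).
have bD : bmf D.
 split; last by exists C => x; exact: low_bound.
 by apply: (mlow_disc _ hC) => // t _; exact: path_measurable.
have key x : D x - (k%:R*de+2*C * \1_Q x) <= h (Y n x).
 have [Qx|nQx] := pselect (Q x).
 have := low_bound hC (disc q.+1 (q.+1*q.+1) (fun i => Y n x (i%:R/q.+1%:R))) k0; have := hC (Y n x).
 rewrite indicE mem_set// mulr1 -/(D x) !ler_norml => /andP[? _] /andP[_ ?].
 by have := mulr_ge0 k0 (ltW de0); lra.
 rewrite indicE memNset// mulr0 addr0.
 apply: (le_trans _ (low_le_h hC (Y n x) k0)); rewrite lerBlDr; apply: (low_near hC) => //; apply: near_path_sym.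
 apply: (@window_close _ _ _ H) => //.
 - by rewrite ler_pdivrMr// mulrC -ler_pdivrMr.
 - exact: truncnS_gt.
 - by rewrite leq_mul2r q2 orbT.
 - by move=> i iH; apply: split_path => //; exact: hQ.
have bI : bmf (fun x => k%:R*de+2*C * \1_Q x).
 by apply: bmfD; [side|apply: bmfZ; exact: (@bmf_indic _ X R _ mQ)].
have := ex_le nu (bmfB bD bI) (bY n) key; rewrite exB// exD ?ex_cst ?exZ ?ex_indic ; last 3 first.
- side.
- side.
- by [].
have : 2*C * pr nu Q <= e/5.
 have := nuQ; rewrite ler_pdivlMr// => h'; have := pr_ge0 nu Q; nra.
move: hd; rewrite -/D ler_distl => /andP[]; lra.
Unshelve. all: by end_near. Qed.

End LowerBound.

(** The lower bound, used for [h] and for [- h], encloses the expectations from both sides. *)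
Theorem functional_limit : cvg_in_law nu Y P L.
move=> h ch [M0 [_ hM0]]; pose C := M0+1.
have hC x : `|h x| <= C by apply: (hM0 C) => //; rewrite /C ltrDl.
have chN : continuous (fun x => - h x) by move=> x; exact: (cvgN (ch x)).
have hCN x : `|- h x| <= C by rewrite normrN.
have [bL bY] := bmf_path ch hC.
rewrite unlock.
have E n : (\int[nu]_x (h (Y n x))%:E = (ex nu (fun x => h (Y n x)))%:E)%E by rewrite /ex /Rintegral fineK//; have /integrable_fin_num := bmf_int nu (bY n); apply.
have E' : (\int[P]_x (h (L x))%:E = (ex P (fun x => h (L x)))%:E)%E by rewrite /ex /Rintegral fineK//; have /integrable_fin_num := bmf_int P bL; apply.
rewrite E'; under eq_fun do rewrite E; apply: cvg_EFin; first by near=> n.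
apply/cvgrPdist_le => e e0; near=> n.
have h1 : ex P (fun w => h (L w))-e <= ex nu (fun x => h (Y n x)) by near: n; exact: (path_lower_bound ch hC).
have h2 : ex P (fun w => - h (L w))-e <= ex nu (fun x => - h (Y n x)) by near: n; exact: (path_lower_bound chN hCN).
have eN (m : probability X R) n' : ex m (fun x => - h (Y n' x)) = - ex m (fun x => h (Y n' x)) by rewrite -[RHS]mulN1r -exZ//; apply: ex_eq => x; rewrite mulN1r.
have eN' : ex P (fun x => - h (L x)) = - ex P (fun x => h (L x)) by rewrite -[RHS]mulN1r -exZ//; apply: ex_eq => x; rewrite mulN1r.
move: h2; rewrite eN eN' /= ler_distl => h2; lra.
Unshelve. all: by end_near. Qed.

End Tightness.
End Process.

(** * Deduction of the limit theorem for Gibbs-Markov systems *)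

Theorem theorem2p2 (R : realType) (d : measure_display) (X : measurableType d)
  (mu : probability X R) (T : X -> X) (xi : set (set X)) (theta : R)
  (htheta : 0 < theta < 1)
  (hGM : gibbs_markov mu T xi theta) (hmix : mixing mu T)
  (f : X -> R) (hf : measurable_fun [set: X] f)
  (alpha cp cm : R) (ell : R -> R)
  (halpha : 0 < alpha < 2) (hcp : 0 <= cp) (hcm : 0 <= cm)
  (hcpm : 0 < cp + cm) (hell : slowly_varying ell)
  (htails : stable_tails mu f alpha cp cm ell)
  (hvartheta : exists C : R, \forall t \near +oo,
    (mu [set x | t%:E < vartheta T xi theta f x] <=
       C%:E * mu [set x | (t < `|f x|)%R])%E)
  (S : probability (measurableTypeR R) R)
  (hS : canonical_limit alpha cp cm S)
  (A B : nat -> R) (hAB : canonical_normalizing mu f alpha ell S A B)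
  (d' : measure_display) (W : measurableType d') (P : probability W R)
  (L : W -> skorohod R) (hL : levy_process P L)
  (hL1 : same_law P (fun w => L w 1) S (fun x => x)) :
  forall nu : probability X R, nu `<< mu ->
    cvg_in_law nu (partial_sum_process T f A B) P L.
Proof.
have [[a0 a2] [th0 th1]] := (andP halpha, andP htheta).
have [[[mT prT] _ _ _ _] _ _ _] := hGM.
have presT A' : measurable A' -> pr mu (T @^-1` A') = pr mu A' by move=> mA; rewrite /pr prT.
have [D [D0 hg]] := code_gibbs htheta hGM; have [K1 [K10 hb]] := code_big htheta hGM.
have mix A' B' : measurable A' -> measurable B' ->
 pr mu (A' `&` (iter n T @^-1` B')) @[n --> \oo] --> pr mu A' * pr mu B'.
 move=> mA mB; apply: fine_cvg; rewrite EFinM -!prE//; exact: hmix.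
have [K [g [K0 g01 hmx]]] := cyl_mixing mT presT (mcode hGM) htheta D0 K10 hg hb mix.
have hc : mixing_code mu T (code hGM) K g by split=> //; exact: mcode.
have [mA mB mBell [A1 A2 A3]] := hAB.
(* Below 1 and [alpha] for the truncated moments to be of order [t^kap], above [alpha / 2] for the
   accumulated correlation errors to vanish. *)
have [kap [k1 k2 k3]] : exists kap, [/\ 0 < kap < 1, kap < alpha & alpha < 2*kap].
 have [m1 [m1l m1a m10]] : exists m1, [/\ m1 <= 1, m1 <= alpha & alpha/2 < m1].
 by exists (Num.min 1 alpha); rewrite !ge_min !lexx orbT lt_min; split=> //; apply/andP; split; lra.
 by exists ((alpha/2+m1)/2); split; [apply/andP; split| |]; lra.
have [C [t0 [C0 ht]]] := osc_tail htheta hGM hf hvartheta.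
have mo : measurable_fun [set: X] (fun x => osc hGM f (code hGM x)) by exact: osc_measurable _ hc.
have [M1 [M10 hM1]] := moment_of_tail hf hcpm hell htails mo (fun x => osc_ge0 hGM f _) k1 k2 C0 ht.
have mnf : measurable_fun [set: X] (fun x => `|f x|) by exact: measurableT_comp.
have [M2 [M20 hM2]] : exists M2 : R, 0 <= M2 /\ forall t, 0 <= t -> ex mu (fun x => Num.min 2 (t * `|f x|)) <= M2*t `^ kap.
 have tl t : 0 <= t -> pr mu [set x | t < `|f x|] <= 1 * pr mu [set x | t < `|f x|] by rewrite mul1r.
 exact: (moment_of_tail hf hcpm hell htails mnf (fun x => normr_ge0 (f x)) k1 k2 ler01 tl).
have ho : tame_obs mu T (code hGM) f (good hGM) (osc hGM f) theta kap (M1+M2).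
 split=> //; first exact: mgood.
 - exact: good0.
 - by move=> x gx; exact: (@goodT _ _ _ _ _ _ _ _ 1).
 - exact: osc_ge0.
 - by move=> k x y; exact: (osc_lip htheta hf hvartheta).
 - by have [-> /ltW] := andP k1.
 - by move=> t t0'; rewrite (le_trans (hM2 t t0'))// ler_wpM2r ?powR_ge0// lerDr.
 - by move=> t t0'; rewrite (le_trans (hM1 t t0'))// ler_wpM2r ?powR_ge0// lerDl.
(* For [alpha = 1] the centring is known only through the iid convergence, from which the exponents
   are recovered; otherwise they are computed. *)
have hlim : limit_data mu f A B (psiR alpha cp cm) (psiI alpha cp cm).
 have [al1|al1] := eqVneq alpha 1; last exact: limit_data_ne1 hf halpha hcpm hell htails mA mB mBell al1 A1 A2.
 have [d1 [W1 [P1 [Z [mZ iZ lZ hZ]]]]] := A3 al1.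
 exact: (limit_data_iid hf halpha hcpm hell htails mA mB mBell mZ iZ lZ hS hZ).
move=> nu numu; apply: (functional_limit hc ho halpha k3 hcpm hell htails mA mB mBell hlim _ hL hL1) => //.
- by exists C, t0.
- by move=> u; exact: canonical_charfun.
- exact: psiR_continuous.
- exact: psiI_continuous.
- by rewrite /psiR normr0 powR0 ?gt_eqF// mulr0 oppr0.
- by rewrite /psiI sgr0 !(mulr0, mul0r).
- move=> A' e mA' e0; have [_ h] := measurable_approximable hGM mA'; exact: h.
Qed.
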